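(* Let $T>0$, $H\in(0,1)$, $p\ge2$, and let $b:\mathbb{R}\to\mathbb{R}$ be globally Lipschitz. Assume: (a) in the case of the wave equation, $u_0$ and $v_0$ are $H$-Hölder continuous and bounded; (b) in the case of the heat equation, $u_0$ is $H$-Hölder continuous and bounded. Then, for each of the two equations, the mild equation $$u^H(t,x)=I_0(t,x)+\int_0^t\!\int_{\mathbb{R}}G_{t-s}(x-y)\,W^H(ds,dy)+\int_0^t\!\int_{\mathbb{R}}b(u^H(s,y))\,G_{t-s}(x-y)\,dy\,ds,\qquad (t,x)\in[0,T]\times\mathbb{R},$$ has a unique solution $u^H$ in the space of $L^2(\Omega)$-continuous and adapted stochastic processes satisfying $$\sup_{(t,x)\in[0,T]\times\mathbb{R}}\mathrm{E}\big[|u^H(t,x)|^p\big]<\infty.$$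
   Context: Noise. On a complete probability space, $W^H=\{W^H(\varphi)\}$ is a centered Gaussian family indexed by $\varphi\in C_0^\infty([0,\infty)\times\mathbb{R})$ with covariance $\mathrm{E}[W^H(\varphi)W^H(\psi)]=\int_0^\infty\int_{\mathbb{R}}\mathcal{F}\varphi(t,\cdot)(\xi)\,\overline{\mathcal{F}\psi(t,\cdot)(\xi)}\,c_H|\xi|^{1-2H}\,d\xi\,dt$, where $c_H=\frac{\Gamma(2H+1)\sin(\pi H)}{2\pi}$ and $\mathcal{F}f(\xi)=\int_{\mathbb{R}}e^{-i\xi x}f(x)\,dx$ is the Fourier transform in space. $W^H$ extends isometrically to the completion $\mathcal{H}^H$ of $C_0^\infty([0,\infty)\times\mathbb{R})$ for this inner product; $\mathcal{H}^H$ contains all functions $g$ with $\int_0^\infty\int_{\mathbb{R}}|\mathcal{F}g(t,\cdot)(\xi)|^2|\xi|^{1-2H}d\xi\,dt<\infty$, and one writes $\int_0^\infty\int_{\mathbb{R}}g\,dW^H:=W^H(g)$ (Wiener integral), and $\int_0^t\int_{\mathbb{R}}g\,dW^H:=W^H(1_{[0,t]}g)$. Filtration: $\mathcal{F}^H_t$ is generated by $W^H(1_{[0,s]}\varphi)$, $s\in[0,t]$, $\varphi\in C_0^\infty(\mathbb{R})$, and the null sets; ''adapted'' means $u^H(t,x)$ is $\mathcal{F}^H_t$-measurable. Kernels and initial terms ($u_0,v_0:\mathbb{R}\to\mathbb{R}$ deterministic). Wave: $G_t(x)=\frac12 1_{\{|x|<t\}}$ and $I_0(t,x)=\frac12\int_{x-t}^{x+t}v_0(y)\,dy+\frac12\big(u_0(x+t)+u_0(x-t)\big)$.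 Heat: $G_t(x)=(2\pi t)^{-1/2}e^{-|x|^2/(2t)}$ and $I_0(t,x)=\int_{\mathbb{R}}G_t(x-y)u_0(y)\,dy$ for $t>0$, $I_0(0,x)=u_0(x)$. A solution is an adapted, jointly measurable process satisfying the mild equation almost surely for every $(t,x)\in[0,T]\times\mathbb{R}$. An $L^2(\Omega)$-continuous process is one for which $(t,x)\mapsto u^H(t,x)\in L^2(\Omega)$ is continuous; such a process has a jointly measurable modification, which is the one used in the drift integral. Uniqueness is up to modification. *)

(* Defs.v *)
From HB Require Import structures.
From mathcomp Require Import all_boot all_order all_algebra.
From mathcomp Require Import all_classical all_reals all_analysis.
From mathcomp Require Import complex.
Set Implicit Arguments.
Unset Strict Implicit.
Unset Printing Implicit Defensive.
Import Order.TTheory GRing.Theory Num.Theory.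
Import numFieldNormedType.Exports.
Local Open Scope classical_set_scope.
Local Open Scope ring_scope.
Local Open Scope complex_scope.

(* Functions of time and space are curried: [g t x]. *)

Definition smooth (R : realType) (V : normedModType R) (f : V -> R) : Prop :=
  forall vs : seq V,
    let D := foldr (fun (v : V) (h : V -> R) => 'D_v h) f vs in
    continuous D /\ forall z v, derivable D z v.

Definition compactly_supported (V : topologicalType) (R : realType)
    (f : V -> R) : Prop := compact (closure [set z | f z != 0]).

(* C_0^oo([0,oo) x R): smooth up to the boundary {0} x R, i.e. restrictions of
   smooth functions on the plane, with no vanishing condition at t = 0.
   A function on [0,oo) x R is represented by its extension by 0 to t < 0. *)
Definition test_functions (R : realType) : set (R -> R -> R) :=
  [set phi | exists Phi : R * R -> R,
     [/\ smooth Phi, compactly_supported Phi &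
         forall t x, phi t x = if 0 <= t then Phi (t, x) else 0]].
Arguments test_functions : clear implicits.

Definition hoelder_continuous (R : realType) (H : R) (f : R -> R) : Prop :=
  exists C : R, forall x y, `|f x - f y| <= C * `|x - y| `^ H.

Section fourier.
Context (R : realType).
Local Notation mu := (@lebesgue_measure R).

Definition cintegral (D : set R) (f : R -> R[i]) : R[i] :=
  (\int[mu]_(x in D) complex.Re (f x)) +i* (\int[mu]_(x in D) complex.Im (f x)).

Definition fourier (f : R -> R) (xi : R) : R[i] :=
  cintegral setT (fun x => (cos (xi * x) -i* sin (xi * x)) * (f x)%:C).

Definition Gamma (z : R) : R :=
  \int[mu]_(x in `]0, +oo[) (x `^ (z - 1) * expR (- x)).

Definition c_ (H : R) : R := Gamma (2 * H + 1) * sin (pi * H) / (2 * pi).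

Definition noise_inner (H : R) (phi psi : R -> R -> R) : R[i] :=
  cintegral `[0, +oo[ (fun t => cintegral setT (fun xi =>
    fourier (phi t) xi * (fourier (psi t) xi)^* *
    (c_ H * `|xi| `^ (1 - 2 * H))%:C)).

(* [noise_inner H g g], as an extended real. *)
Definition noise_sqnorm (H : R) (g : R -> R -> R) : \bar R :=
  (\int[mu]_(t in `[0%R, +oo[) \int[mu]_xi
    (ComplexField.Normc.normc (fourier (g t) xi) ^+ 2 *
     (c_ H * `|xi| `^ (1 - 2 * H)))%:E)%E.

End fourier.

Section noise.
Context (R : realType) (d : measure_display) (Omega : measurableType d).
Variable P : probability Omega R.

(* The library's [normal_prob 0 s] is the Gaussian law only for [s != 0];
   variance 0 is the Dirac mass. *)
Definition centered_gaussian (X : Omega -> R) : Prop :=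
  (exists2 s : R, s != 0 & forall B, measurable B ->
     pushforward P X B = normal_prob 0 s B) \/
  (forall B, measurable B -> pushforward P X B = \d_(0 : R) B).

Definition centered_gaussian_family (I : Type) (W : I -> {RV P >-> R}) : Prop :=
  forall (n : nat) (a : 'I_n -> R) (i : 'I_n -> I),
    centered_gaussian (fun w => \sum_(k < n) a k * W (i k) w).

(* The covariance is real because the test functions are: the imaginary part of
   the integrand of [noise_inner] is odd in the frequency. *)
Definition fractional_noise (H : R) (W : test_functions R -> {RV P >-> R}) :
    Prop :=
  centered_gaussian_family W /\
  forall phi psi : test_functions R,
    ('E_P[fun w => (W phi w * W psi w)%R] =
     (complex.Re (noise_inner H (val phi) (val psi)))%:E)%E.

(* [X] is a version of W(g), for the isometric extension of W to the completion
   of the test functions: X is the mean-square limit of W(phi n) for test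
   functions phi n converging to g.  Integrands are restricted to functions
   which are integrable in space, so that their spatial Fourier transform is
   given by the integral. *)
Definition wiener_integral (H : R) (W : test_functions R -> {RV P >-> R})
    (g : R -> R -> R) (X : {RV P >-> R}) : Prop :=
  [/\ measurable_fun setT (fun z : R * R => g z.1 z.2),
      forall t, 0 <= t ->
        (@lebesgue_measure R).-integrable setT (EFin \o g t),
      (noise_sqnorm H g < +oo)%E &
      exists phi : nat -> test_functions R,
        (noise_sqnorm H (fun t x => val (phi n) t x - g t x)%R
           @[n --> \oo] --> 0%E) /\
        ('N[P]_2%:E[EFin \o (W (phi n) \- X)%R] @[n --> \oo] --> 0)%E].

(* Sigma-algebra generated by W(1_[0,s] phi), s in [0,t], phi in C_0^oo(R),
   and the null sets. *)
Definition noise_filtration (H : R) (W : test_functions R -> {RV P >-> R})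
    (t : R) : set (set Omega) :=
  <<s [set A | exists (s : R) (phi : R -> R) (X : {RV P >-> R}),
         [/\ 0 <= s <= t, smooth phi, compactly_supported phi,
             wiener_integral H W (fun r x => \1_(`[0, s]) r * phi x) X &
             exists2 B : set R, measurable B & A = X @^-1` B]]
      `|` P.-negligible >>.

Definition adapted (H : R) (W : test_functions R -> {RV P >-> R}) (T : R)
    (u : R -> R -> Omega -> R) : Prop :=
  forall t x, 0 <= t <= T -> forall B : set R, measurable B ->
    noise_filtration H W t (u t x @^-1` B).

Definition jointly_measurable (T : R) (u : R -> R -> Omega -> R) : Prop :=
  measurable_fun ((`[0, T] `*` setT) `*` setT)
    (fun z : (R * R) * Omega => u z.1.1 z.1.2 z.2).

Definition L2_continuous (T : R) (u : R -> R -> Omega -> R) : Prop :=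
  let D : set (R * R) := `[0, T] `*` setT in
  (forall z, D z -> u z.1 z.2 \in Lfun P 2%:E) /\
  (forall z0, D z0 ->
    ('N[P]_2%:E[EFin \o (u z.1 z.2 \- u z0.1 z0.2)%R]
       @[z --> within D (nbhs z0)] --> 0)%E).

(* The integrand of the drift, as a function of (s,y), for fixed (t,x). *)
Definition drift (G : R -> R -> R) (b : R -> R) (u : R -> R -> Omega -> R)
    (t x : R) (w : Omega) (s y : R) : R := b (u s y w) * G (t - s) (x - y).

Definition mild_equation (H : R) (W : test_functions R -> {RV P >-> R}) (T : R)
    (b : R -> R) (G I0 : R -> R -> R) (u : R -> R -> Omega -> R) : Prop :=
  forall t x, 0 <= t <= T ->
  exists2 X : {RV P >-> R},
    wiener_integral H W (fun s y => \1_(`[0, t]) s * G (t - s) (x - y)) X &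
    {ae P, forall w,
      (@lebesgue_measure R \x @lebesgue_measure R)%E.-integrable
        (`[0, t] `*` setT) (fun z => (drift G b u t x w z.1 z.2)%:E) /\
      u t x w = I0 t x + X w +
        \int[@lebesgue_measure R]_(s in `[0, t])
          \int[@lebesgue_measure R]_y drift G b u t x w s y}.

Definition bounded_moment (T p : R) (u : R -> R -> Omega -> R) : Prop :=
  (ereal_sup [set 'E_P[fun w => (`|u z.1 z.2 w| `^ p)%R] |
              z in (`[0%R, T] `*` setT : set (R * R))] < +oo)%E.

Definition solution (H : R) (W : test_functions R -> {RV P >-> R}) (T p : R)
    (b : R -> R) (G I0 : R -> R -> R) (u : R -> R -> Omega -> R) : Prop :=
  [/\ adapted H W T u, jointly_measurable T u, L2_continuous T u,
      bounded_moment T p u & mild_equation H W T b G I0 u].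

Definition modification (T : R) (u v : R -> R -> Omega -> R) : Prop :=
  forall t x, 0 <= t <= T -> {ae P, forall w, u t x w = v t x w}.

Definition has_unique_solution (H : R) (W : test_functions R -> {RV P >-> R})
    (T p : R) (b : R -> R) (G I0 : R -> R -> R) : Prop :=
  (exists u, solution H W T p b G I0 u) /\
  (forall u v, solution H W T p b G I0 u -> solution H W T p b G I0 v ->
     modification T u v).

End noise.

Section equations.
Context (R : realType).
Local Notation mu := (@lebesgue_measure R).
Variables u0 v0 : R -> R.

Definition wave_kernel (t x : R) : R := if `|x| < t then 2^-1 else 0.

Definition wave_initial (t x : R) : R :=
  2^-1 * (\int[mu]_(y in `[x - t, x + t]) v0 y) +
  2^-1 * (u0 (x + t) + u0 (x - t)).

(* Extended by 0 to t <= 0. *)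
Definition heat_kernel (t x : R) : R :=
  if 0 < t then (Num.sqrt (2 * pi * t))^-1 * expR (- (`|x| ^+ 2 / (2 * t)))
  else 0.

Definition heat_initial (t x : R) : R :=
  if 0 < t then \int[mu]_y (heat_kernel t (x - y) * u0 y) else u0 x.

End equations.

(* Main.v *)
(* A function whose slice at each time t has L1 norm at most al(t) and moves by
   at most be(t)|h| in L1 under translation by h, with al <= be, has a noise
   norm of order the integral of al^H be^(2-H) dt: the L1 norm controls low
   frequencies, translation by half a period the high ones.  The Green
   functions of both equations, and their increments in time and space, satisfy
   such bounds, so the stochastic convolution V is a mean-square limit of the noise at
   test functions, is Hoelder continuous in L2, and has Gaussian moments
   uniformly bounded on the strip.  Rounding the argument to finer and finer
   grids, with times rounded down, gives a version of V which is progressively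
   measurable.

   The noise being additive, u = V + I_0 + drift(u) is solved by Picard
   iteration: since the kernel has bounded mass, the iterates converge
   geometrically in L1(Omega) with weight e^(Bt), Jensen's inequality for the
   kernel bounds their moments, and the contraction estimate applied to the
   difference of two solutions gives uniqueness. *)

From HB Require Import structures.
Require Import Defs.
From mathcomp Require Import all_boot all_order all_algebra.
From mathcomp Require Import all_classical all_reals all_analysis.
From mathcomp Require Import measurable_realfun complex.
From mathcomp Require Import ring lra.
Set Implicit Arguments.
Unset Strict Implicit.
Unset Printing Implicit Defensive.
Import Order.TTheory GRing.Theory Num.Theory.
Import numFieldNormedType.Exports.
Local Open Scope classical_set_scope.
Local Open Scope ring_scope.

(** The weight |xi|^(1-2H) is singular at frequency 0 when H > 1/2 and grows at infinity when H <
    1/2. Splitting the squared transform as |u|^H |u|^(2-H) treats both cases at once: only the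
    second factor is traded for decay, which leaves |xi|^(-1-H) at infinity and |xi|^(1-2H) near 0,
    both integrable exactly for 0 < H < 1. The exponents 1/4 and 1/2 in [power_slices] come from the
    heat kernel: moving by e^2 in space or by e^4 in time costs e t^(-1/4) in L1, while the
    translation modulus is of order t^(-1/2). Raised to the powers H and 2-H these give e^H
    t^(H/4-1), integrable in time and small with e. The wave kernel obeys the same bounds on [0, T],
    so one abstract [regular_kernel] serves both equations. The hypothesis on the noise gives
    Gaussianity and covariances; linearity of W up to null sets is derived from them. Squared norms
    are compared through (x+y)^2 <= 2x^2 + 2y^2, whence explicit constants such as 32. *)

(** * Integration tools: invariance, measurability in a parameter, power means *)

Section lebesgue_shift.
Context {R : realType}.
Local Notation mu := (@lebesgue_measure R).

(** Lebesgue measure is determined by its values on half-open intervals, so the pushforward has to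
    be computed only there. *)
Lemma lebesgue_measure_shift (a : R) (A : set R) : measurable A ->
  pushforward mu (fun x : R => x + a) A = mu A.
Proof.
move=> mA.
have mphi : @measurable_fun _ _ (measurableTypeR R) (measurableTypeR R) setT
    (fun x : R => x + a) by exact: (@measurable_funD _ R R).
pose mp := isMeasurableFun.Build _ _ _ _ _ mphi.
pose phi : {mfun measurableTypeR R >-> measurableTypeR R} := HB.pack (fun x : R => x + a) mp.
apply/esym; apply: (@lebesgue_measure_unique R (pushforward mu phi)) => // X.
move=> [[x y] _ <-].
transitivity (mu `]x - a, y - a]); last first.
  rewrite /pushforward; congr (mu _).
  by apply/seteqP; split => z /=; rewrite !in_itv /= ltrBlDr lerBrDr.
rewrite !lebesgue_measure_itv /= !lte_fin ltrD2r; case: ifP => // _.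
by rewrite -!EFinB; congr (_%:E); lra.
Qed.

Lemma lebesgue_measure_opp (A : set R) : measurable A ->
  pushforward mu (-%R : R -> R) A = mu A.
Proof.
move=> mA.
have mphi : @measurable_fun _ _ (measurableTypeR R) (measurableTypeR R) setT
    (-%R : R -> R) by exact: oppr_measurable.
pose mp := isMeasurableFun.Build _ _ _ _ _ mphi.
pose phi : {mfun measurableTypeR R >-> measurableTypeR R} := HB.pack (-%R : R -> R) mp.
apply/esym; apply: (@lebesgue_measure_unique R (pushforward mu phi)) => // X.
move=> [[x y] _ <-].
(* Reflection moves the closed end from right to left; the length does not see it. *)
transitivity (mu `[- y, - x[); last first.
  rewrite /pushforward; congr (mu _).
  by apply/seteqP; split => z /=; rewrite !in_itv /= ltrNr lerNl andbC.
rewrite !lebesgue_measure_itv /= !lte_fin ltrN2; case: ifP => // _.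
by rewrite -!EFinB; congr (_%:E); lra.
Qed.

Lemma ge0_integral_shift (a : R) (f : R -> \bar R) : measurable_fun [set: measurableTypeR R] f ->
  (forall x, 0 <= f x)%E -> (\int[mu]_x f (x + a)%R = \int[mu]_x f x)%E.
Proof.
move=> mf f0.
have mphi : @measurable_fun _ _ (measurableTypeR R) (measurableTypeR R) setT
    (fun x : R => x + a) by exact: (@measurable_funD _ R R).
pose phi : measurableTypeR R -> measurableTypeR R := fun x => x + a.
transitivity (\int[pushforward mu phi]_x f x)%E.
  by symmetry; apply: (@ge0_integral_pushforward _ _ _ _ R phi mphi mu setT f) => // y _; exact: f0.
by apply: eq_measure_integral => A mA _; exact: lebesgue_measure_shift.
Qed.

Lemma ge0_integral_opp (f : R -> \bar R) : measurable_fun [set: measurableTypeR R] f ->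
  (forall x, 0 <= f x)%E -> (\int[mu]_x f (- x)%R = \int[mu]_x f x)%E.
Proof.
move=> mf f0.
have mphi : @measurable_fun _ _ (measurableTypeR R) (measurableTypeR R) setT
    (-%R : R -> R) by exact: oppr_measurable.
pose phi : measurableTypeR R -> measurableTypeR R := fun x => - x.
transitivity (\int[pushforward mu phi]_x f x)%E.
  by symmetry; apply: (@ge0_integral_pushforward _ _ _ _ R phi mphi mu setT f) => // y _; exact: f0.
by apply: eq_measure_integral => A mA _; exact: lebesgue_measure_opp.
Qed.

Lemma ge0_integral_reflect (a : R) (f : R -> \bar R) : measurable_fun [set: measurableTypeR R] f ->
  (forall x, 0 <= f x)%E -> (\int[mu]_x f (a - x)%R = \int[mu]_x f x)%E.
Proof.
move=> mf f0; rewrite -[RHS]ge0_integral_opp// -[RHS](ge0_integral_shift (- a)).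
- by apply: eq_integral => x _; rewrite opprD opprK addrC.
- by apply: measurableT_comp => //; exact: oppr_measurable.
- by move=> x; exact: f0.
Qed.

Lemma Rintegral_shift (a : R) (f : R -> R) : measurable_fun [set: measurableTypeR R] f ->
  \int[mu]_x f (x + a) = \int[mu]_x f x.
Proof.
move=> mf; have mEf : measurable_fun [set: measurableTypeR R] (EFin \o f) by exact/measurable_EFinP.
rewrite /Rintegral; congr fine.
rewrite integralE [RHS]integralE; congr (_ - _)%E.
- rewrite -(ge0_integral_shift a (measurable_funepos mEf)); last first.
    by move=> x; exact: funepos_ge0.
  by apply: eq_integral => x _; rewrite !funeposE.
- rewrite -(ge0_integral_shift a (measurable_funeneg mEf)); last first.
    by move=> x; exact: funeneg_ge0.
  by apply: eq_integral => x _; rewrite !funenegE.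
Qed.

End lebesgue_shift.

Section integral_tools.
Local Open Scope ereal_scope.

(** Tonelli's theorem gives measurability for nonnegative integrands, so the positive and negative
    parts are treated separately. *)
Lemma measurable_integral_param (R : realType) d1 d2 (X : measurableType d1)
    (Y : measurableType d2) (m : {sigma_finite_measure set Y -> \bar R})
    (f : X * Y -> \bar R) :
  measurable_fun setT f -> measurable_fun setT (fun x => \int[m]_y f (x, y)).
Proof.
move=> mf.
have -> : (fun x => \int[m]_y f (x, y)) =
    (fun x => \int[m]_y f^\+ (x, y)) \- (fun x => \int[m]_y f^\- (x, y)).
  apply/funext => x; rewrite integralE.
  under eq_integral do rewrite funepos_comp/=.
  by under [X in _ - X = _]eq_integral do rewrite funeneg_comp/=.
apply: emeasurable_funB.
- by apply: measurable_fun_fubini_tonelli_F => //; exact: measurable_funepos.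
- by apply: measurable_fun_fubini_tonelli_F => //; exact: measurable_funeneg.
Qed.

Lemma measurable_Rintegral_param (R : realType) d1 d2 (X : measurableType d1)
    (Y : measurableType d2) (m : {sigma_finite_measure set Y -> \bar R})
    (f : X * Y -> R) :
  measurable_fun setT f ->
  measurable_fun setT (fun x => (\int[m]_y f (x, y))%R).
Proof.
move=> mf; rewrite /Rintegral; apply: measurableT_comp => //.
by apply: (measurable_integral_param m (f := EFin \o f)); exact/measurable_EFinP.
Qed.

(* [Rintegral] is 0 when the integral is infinite or undefined, so integrability is not needed. *)
Lemma le_abs_Rintegral (R : realType) d (X : measurableType d)
    (m : {measure set X -> \bar R}) (D : set X) (f : X -> R) :
  measurable D -> measurable_fun D f ->
  (`|\int[m]_(x in D) f x|%R)%:E <= \int[m]_(x in D) `|f x|%:E.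
Proof.
move=> mD mf; rewrite /Rintegral.
have mEf : measurable_fun D (EFin \o f) by exact/measurable_EFinP.
have := le_abse_integral m mD mEf; rewrite /=.
case: (\int[m]_(x in D) (f x)%:E) => [r| |] //= _.
- by rewrite normr0; apply: integral_ge0 => x _; rewrite lee_fin.
- by rewrite normr0; apply: integral_ge0 => x _; rewrite lee_fin.
Qed.

(** Moves the domain of integration into the integrand, so that the tools below need only be stated
    on the whole space. *)
Lemma integral_indicr (R : realType) d (X : measurableType d)
    (m : {measure set X -> \bar R}) (D : set X) (f : X -> R) :
  \int[m]_(x in D) (f x)%:E = \int[m]_x (f x * \1_D x)%:E.
Proof.
rewrite integral_mkcond; apply: eq_integral => x _.
by rewrite patchE indicE; case: ifPn => xD; rewrite ?mulr1 ?mulr0.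
Qed.

Lemma integral_scale (R : realType) d (X : measurableType d)
    (m : {measure set X -> \bar R}) (c : R) (f : X -> R) :
  measurable_fun setT f -> (forall x, 0 <= f x)%R -> (0 <= c)%R ->
  \int[m]_x (c * f x)%:E = c%:E * \int[m]_x (f x)%:E.
Proof.
move=> mf f0 c0; under eq_integral do rewrite EFinM.
rewrite ge0_integralZl_EFin; [by []|by []| | |by []].
- by move=> x _; rewrite lee_fin.
- exact/measurable_EFinP.
Qed.

Lemma integral_add (R : realType) d (X : measurableType d)
    (m : {measure set X -> \bar R}) (f g : X -> R) :
  measurable_fun setT f -> measurable_fun setT g ->
  (forall x, 0 <= f x)%R -> (forall x, 0 <= g x)%R ->
  \int[m]_x (f x + g x)%:E = \int[m]_x (f x)%:E + \int[m]_x (g x)%:E.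
Proof.
move=> mf mg f0 g0; under eq_integral do rewrite EFinD.
rewrite ge0_integralD; [by []|by []| | | |].
- by move=> x _; rewrite lee_fin.
- exact/measurable_EFinP.
- by move=> x _; rewrite lee_fin.
- exact/measurable_EFinP.
Qed.

Lemma integral_mono (R : realType) d (X : measurableType d)
    (m : {measure set X -> \bar R}) (f g : X -> R) :
  measurable_fun setT f -> measurable_fun setT g ->
  (forall x, 0 <= f x)%R -> (forall x, f x <= g x)%R ->
  \int[m]_x (f x)%:E <= \int[m]_x (g x)%:E.
Proof.
move=> mf mg f0 fg; apply: ge0_le_integral; [by []| | | |].
- by move=> x _; rewrite lee_fin.
- exact/measurable_EFinP.
- exact/measurable_EFinP.
- by move=> x _; rewrite lee_fin.
Qed.

Lemma ge0_integral_lty_ae (R : realType) d (X : measurableType d)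
    (m : {measure set X -> \bar R}) (f : X -> \bar R) :
  measurable_fun setT f -> (forall x, 0 <= f x) -> \int[m]_x f x < +oo ->
  {ae m, forall x, f x < +oo}.
Proof.
move=> mf f0 foo.
have : m.-integrable setT f.
  apply/integrableP; split => //.
  by under eq_integral do rewrite gee0_abs//.
move/integrable_ae => /(_ measurableT); apply: filterS => x /= /(_ I).
by rewrite ge0_fin_numE.
Qed.

End integral_tools.

Section power_mean.
Context (R : realType) d (X : measurableType d).
Variable m : {measure set X -> \bar R}.
Local Open Scope ereal_scope.

(** Either x is at most l, or (x / l)^n is at least 1. Integrated against a weight and optimized in
    l, this replaces Jensen's inequality. *)
Lemma le_powS_split (n : nat) (x l : R) : (0 <= x)%R -> (0 < l)%R ->
  (x <= l ^- n * x ^+ n.+1 + l)%R.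
Proof.
move=> x0 l0; have ln0 : (0 < l ^+ n)%R by exact: exprn_gt0.
have [xl|lx] := leP x l.
  by rewrite (le_trans xl)// lerDr mulr_ge0 ?exprn_ge0// invr_ge0 ltW.
rewrite -[leLHS]addr0 lerD//; last exact: ltW.
rewrite exprSr mulrA ler_peMl//.
by rewrite mulrC ler_pdivlMr// mul1r lerXn2r// ?nnegrE// ltW.
Qed.

(** Jensen's inequality for a weight of mass at most M, up to the factor 2^(n+1). The number r is
    any lower bound of the integral, typically the absolute value of a real-valued one, so the case
    of an infinite integral needs no separate statement. *)
Lemma integral_power_le (n : nat) (M : R) (F K : X -> R) (r : R) :
  measurable_fun setT F -> measurable_fun setT K ->
  (forall x, 0 <= F x)%R -> (forall x, 0 <= K x)%R -> (0 < M)%R ->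
  \int[m]_x (K x)%:E <= M%:E -> (0 <= r)%R ->
  r%:E <= \int[m]_x (F x * K x)%:E ->
  (r ^+ n.+1)%:E <=
    (2 ^+ n.+1 * M ^+ n)%:E * \int[m]_x (F x ^+ n.+1 * K x)%:E.
Proof.
move=> mF mK F0 K0 M0 KM r0 rFK.
have FK0 : 0 <= \int[m]_x (F x ^+ n.+1 * K x)%:E.
  by apply: integral_ge0 => x _; rewrite lee_fin mulr_ge0// exprn_ge0.
have c0 : (0 < 2 ^+ n.+1 * M ^+ n :> R)%R by rewrite mulr_gt0// exprn_gt0.
move: r0; rewrite le_eqVlt => /predU1P[<-|r0].
  by rewrite expr0n/= mule_ge0// lee_fin ltW.
have mFn : measurable_fun setT (fun x => F x ^+ n.+1)%R by exact: measurable_funX.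
have l0 : (0 < r / (2 * M))%R by rewrite divr_gt0// mulr_gt0.
(* With this l the constant term of [le_powS_split] contributes at most r / 2, which is absorbed in
   the left-hand side. *)
set l := (r / (2 * M))%R in l0.
have ln0 : (0 < l ^- n)%R by rewrite invr_gt0 exprn_gt0.
have key : r%:E <= (l ^- n)%:E * \int[m]_x (F x ^+ n.+1 * K x)%:E + (l * M)%:E.
  apply: (le_trans rFK).
  apply: (@le_trans _ _ (\int[m]_x (((l ^- n)%:E * (F x ^+ n.+1 * K x)%:E) + (l%:E * (K x)%:E)))).
    apply: ge0_le_integral => //.
    - by move=> x _; rewrite lee_fin mulr_ge0.
    - by apply/measurable_EFinP; exact: measurable_funM.
    - apply: emeasurable_funD; apply/measurable_EFinP; apply: measurable_funM => //.
      exact: measurable_funM.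
    - move=> x _; rewrite -!EFinM -EFinD lee_fin mulrA -mulrDl ler_wpM2r//.
      exact: le_powS_split.
  rewrite ge0_integralD//; last 4 first.
  - by move=> x _; rewrite mule_ge0// lee_fin ?mulr_ge0 ?exprn_ge0// ltW.
  - by apply/measurable_EFinP; apply: measurable_funM => //; exact: measurable_funM.
  - by move=> x _; rewrite mule_ge0// lee_fin// ltW.
  - by apply/measurable_EFinP; apply: measurable_funM.
  rewrite ge0_integralZl_EFin//; last 3 first.
  - by move=> x _; rewrite lee_fin mulr_ge0// exprn_ge0.
  - by apply/measurable_EFinP; exact: measurable_funM.
  - exact: ltW.
  rewrite leeD2l// ge0_integralZl_EFin//; last 3 first.
  - by move=> x _; rewrite lee_fin.
  - exact/measurable_EFinP.
  - exact: ltW.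
  by rewrite (EFinM l) lee_wpmul2l// lee_fin ltW.
move: FK0 key; case: (\int[m]_x (F x ^+ n.+1 * K x)%:E) => [q||]; last 2 first.
- by move=> _ _; rewrite gt0_muley ?lte_fin// leey.
- by [].
rewrite lee_fin => q0.
rewrite -!EFinM -EFinD !lee_fin.
have -> : (l * M = r / 2)%R by rewrite /l; field; rewrite gt_eqF.
have -> : (l ^- n = (2 * M) ^+ n / r ^+ n)%R.
  by rewrite /l exprMn exprVn invfM invrK mulrC.
move=> h.
have rn0 : (0 < r ^+ n)%R by exact: exprn_gt0.
have -> : (2 ^+ n.+1 * M ^+ n * q = 2 * ((2 * M) ^+ n / r ^+ n * q * r ^+ n))%R.
  by rewrite exprMn exprS; field; rewrite gt_eqF.
rewrite exprS.
have h3 : (r / 2 * r ^+ n <= (2 * M) ^+ n / r ^+ n * q * r ^+ n)%R.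
  by rewrite ler_pM2r//; lra.
set z := ((2 * M) ^+ n / r ^+ n * q * r ^+ n)%R in h3 *; lra.
Qed.

End power_mean.

(** * Almost sure limits and the comparison of L1 with L2 *)

Section limits.
Context (R : realType).

(* A total, measurable stand-in for the pointwise limit. *)
Definition limit_fun (T : Type) (X : nat -> T -> R) (w : T) : R :=
  fine (limn_esup (fun n => (X n w)%:E)).

Lemma limit_funE (T : Type) (X : nat -> T -> R) (w : T) (l : R) :
  X n w @[n --> \oo] --> l -> limit_fun X w = l.
Proof.
move=> Xl; rewrite /limit_fun.
have h : (X n w)%:E @[n --> \oo] --> l%:E by apply/cvg_EFin => //; exact: nearW.
by have [_ ->] := cvg_limn_einf_sup h.
Qed.

(** The sigma-algebra is arbitrary: this is how adaptedness and progressive measurability survive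
    limits. *)
Lemma measurable_limit_fun d (T : measurableType d) (X : nat -> T -> R) (D : set T) :
  (forall n, measurable_fun D (X n)) -> measurable_fun D (limit_fun X).
Proof.
move=> mX; apply: measurableT_comp => //.
by apply: measurable_fun_limn_esup => n; exact/measurable_EFinP.
Qed.

Context d (T : measurableType d).
Variable m : {measure set T -> \bar R}.
Local Open Scope ereal_scope.

(** The form of Fatou's lemma by which moment and integral bounds pass to limits: almost sure
    convergence and an eventual bound suffice. *)
Lemma fatou_ae (Y : nat -> T -> R) (Z : T -> R) (c : \bar R) :
  (forall n, measurable_fun setT (Y n)) -> measurable_fun setT Z ->
  (forall n x, 0 <= Y n x)%R -> (forall x, 0 <= Z x)%R ->
  {ae m, forall x, Y n x @[n --> \oo] --> Z x} ->
  (\forall n \near \oo, \int[m]_x (Y n x)%:E <= c) -> \int[m]_x (Z x)%:E <= c.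
Proof.
move=> mY mZ Y0 Z0 YZ [N _ Yc].
(* Starting the sequence at N makes the eventual bound available at every index. *)
have -> : \int[m]_x (Z x)%:E = \int[m]_x limn_einf (fun n => (Y (n + N)%N x)%:E).
  apply: ae_eq_integral => //.
  - exact/measurable_EFinP.
  - apply: (eq_measurable_fun (fun x => - limn_esup (fun n => - (Y (n + N)%N x)%:E))).
      by move=> x _; rewrite /limn_einf; congr (- limn_esup _); apply/funext => n.
    apply: measurableT_comp => //; apply: measurable_fun_limn_esup => n.
    by apply/measurable_EFinP; exact: measurable_funN.
  - move: YZ; apply: filterS => x YZ _ /=.
    have h : (Y (n + N)%N x)%:E @[n --> \oo] --> (Z x)%:E.
      apply/cvg_EFin; first exact: nearW.
      by have := YZ; rewrite -(cvg_shiftn N).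
    by have [-> _] := cvg_limn_einf_sup h.
apply: le_trans.
  apply: (fatou m measurableT (f := fun n x => (Y (n + N)%N x)%:E)).
  - by move=> n; exact/measurable_EFinP.
  - by move=> n x _; rewrite lee_fin.
rewrite limn_einf_lim; apply: lime_le.
  by apply: is_cvg_einfs.
apply: nearW => n.
apply: (@le_trans _ _ (\int[m]_x (Y (n + N)%N x)%:E)).
  by apply: ereal_inf_lbound; exists n => //=.
by apply: Yc; rewrite /= leq_addl.
Qed.

(** The integral of the series is the series of the integrals, at most 2C; hence the series is
    finite almost everywhere. *)
Lemma ae_summable (Y : nat -> T -> R) (C : R) :
  (forall n, measurable_fun setT (Y n)) -> (forall n x, 0 <= Y n x)%R ->
  (forall n, \int[m]_x (Y n x)%:E <= (C / 2 ^+ n)%:E) ->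
  {ae m, forall x, cvgn (series (Y ^~ x))}.
Proof.
move=> mY Y0 YC.
have h : \int[m]_x (\sum_(0 <= n <oo) (Y n x)%:E) < +oo.
  rewrite integral_nneseries//; last 2 first.
    by move=> n; exact/measurable_EFinP.
    by move=> n x _; rewrite lee_fin.
  apply: (@le_lt_trans _ _ (\sum_(0 <= n <oo) (C / 2 ^+ n)%:E)).
    apply: lee_nneseries => [n _ _|n _]; last exact: YC.
    by apply: integral_ge0 => x _; rewrite lee_fin.
  have C0 : (0 <= C)%R.
    rewrite -lee_fin -[C]divr1 -[1%R](expr0 2); apply: le_trans (YC 0%N).
    by apply: integral_ge0 => x _; rewrite lee_fin.
  apply: (@le_lt_trans _ _ (C * 2)%:E); last exact: ltry.
  apply: lime_le; first by apply: is_cvg_nneseries => n _ _; rewrite lee_fin divr_ge0.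
  apply: nearW => n; rewrite sumEFin lee_fin -mulr_sumr ler_wpM2l//.
  elim: n => [|n IH]; first by rewrite big_nil.
  suff -> : (\sum_(0 <= i < n.+1) (2 ^+ i)^-1 = 2 - (2 ^+ n)^-1 :> R)%R.
    by rewrite gerBl invr_ge0 exprn_ge0.
  elim: n {IH} => [|n IH]; first by rewrite big_nat1 expr0 invr1; lra.
  by rewrite big_nat_recr//= IH exprS; field; rewrite expf_neq0.
have := ge0_integral_lty_ae _ _ h.
move=> /(_ _ _)/wrap[].
  apply: ge0_emeasurable_sum => [n x _ _|n _]; first by rewrite lee_fin.
  exact/measurable_EFinP.
  by move=> x; apply: nneseries_ge0 => n _ _; rewrite lee_fin.
apply: filterS => x hx.
apply: nondecreasing_is_cvgn; first exact: nondecreasing_series.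
exists (fine (\sum_(0 <= n <oo) (Y n x)%:E)) => _ [n _ <-].
rewrite -lee_fin fineK; last first.
  by rewrite ge0_fin_numE//; apply: nneseries_ge0 => k _ _; rewrite lee_fin.
rewrite /series/= -sumEFin.
by apply: nneseries_lim_ge => k _; rewrite lee_fin.
Qed.

(** A geometric rate makes the errors summable almost everywhere, so the whole sequence converges
    and no subsequence has to be extracted. *)
Lemma ae_cvg_fast (X : nat -> T -> R) (Z : T -> R) (C : R) :
  (forall n, measurable_fun setT (X n)) -> measurable_fun setT Z ->
  (forall n, \int[m]_x (`|X n x - Z x|)%:E <= (C / 2 ^+ n)%:E) ->
  {ae m, forall x, X n x @[n --> \oo] --> Z x}.
Proof.
move=> mX mZ XC.
have := @ae_summable (fun n x => `|X n x - Z x|)%R C _ _ XC.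
move=> /(_ _ _)/wrap[] => [n|//|].
  by apply: measurableT_comp => //; exact: measurable_funB.
apply: filterS => x /cvg_series_cvg_0 h.
by apply: (@cvg_zero R R^o); apply: norm_cvg0; exact: h.
Qed.

Lemma ae_cauchy_fast (X : nat -> T -> R) (C : R) :
  (forall n, measurable_fun setT (X n)) ->
  (forall n, \int[m]_x (`|X n.+1 x - X n x|)%:E <= (C / 2 ^+ n)%:E) ->
  {ae m, forall x, X n x @[n --> \oo] --> limit_fun X x}.
Proof.
move=> mX XC.
have := @ae_summable (fun n x => `|X n.+1 x - X n x|)%R C _ _ XC.
move=> /(_ _ _)/wrap[] => [n|//|].
  by apply: measurableT_comp => //; exact: measurable_funB.
apply: filterS => x h.
have : cvgn (series (fun n => X n.+1 x - X n x)%R).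
  by apply: normed_cvg.
move=> h2.
have : cvgn (X ^~ x).
  have -> : X ^~ x = (fun n => X 0%N x + series (fun n => X n.+1 x - X n x) n)%R.
    apply/funext => n; rewrite /series/= telescope_sumr//; lra.
  by apply: is_cvgD => //; exact: is_cvg_cst.
move=> h3; rewrite (@limit_funE _ X x (limn (X ^~ x)))//.
Qed.

End limits.

Section L1_L2.
Context (R : realType) d (T : measurableType d) (P : probability T R).
Local Open Scope ereal_scope.

(** From |Y| <= Y^2 / (2e) + e / 2, since P has mass 1. *)
Lemma L1_le_L2 (Y : T -> R) (e : R) : measurable_fun setT Y -> (0 < e)%R ->
  \int[P]_x (Y x ^+ 2)%:E <= (e ^+ 2)%:E -> \int[P]_x `|Y x|%:E <= e%:E.
Proof.
move=> mY e0 h.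
apply: (@le_trans _ _ (\int[P]_x ((2 * e)^-1%:E * (Y x ^+ 2)%:E + (e / 2)%:E))).
  apply: ge0_le_integral => //.
  - by apply/measurable_EFinP; exact: measurableT_comp.
  - apply: emeasurable_funD => //; apply/measurable_EFinP; apply: measurable_funM => //.
    exact: measurable_funX.
  - move=> x _; rewrite -EFinM -EFinD lee_fin -real_normK ?num_real//.
    set a := (`|Y x|)%R.
    rewrite -subr_ge0; have -> : ((2 * e)^-1 * a ^+ 2 + e / 2 - a = (2 * e)^-1 * (a - e) ^+ 2)%R.
      by field; rewrite gt_eqF.
    by rewrite mulr_ge0 ?sqr_ge0// invr_ge0 mulr_ge0// ltW.
rewrite ge0_integralD//; last 3 first.
- by move=> x _; rewrite mule_ge0// lee_fin ?sqr_ge0// invr_ge0 mulr_ge0// ltW.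
- by apply/measurable_EFinP; apply: measurable_funM => //; exact: measurable_funX.
- by move=> x _; rewrite lee_fin divr_ge0// ltW.
rewrite ge0_integralZl_EFin//; last 3 first.
- by move=> x _; rewrite lee_fin sqr_ge0.
- by apply/measurable_EFinP; exact: measurable_funX.
- by rewrite invr_ge0 mulr_ge0// ltW.
rewrite integral_cst//= probability_setT mule1.
apply: (@le_trans _ _ ((2 * e)^-1%:E * (e ^+ 2)%:E + (e / 2)%:E)).
  by rewrite leeD2r// lee_wpmul2l// lee_fin invr_ge0 mulr_ge0// ltW.
rewrite -EFinM -EFinD lee_fin le_eqVlt; apply/orP; left; apply/eqP.
by field; rewrite gt_eqF.
Qed.

End L1_L2.

(** * Integrals of powers, and translates of monotone functions *)

Section powR_integrals.
Context {R : realType}.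
Local Notation mu := (@lebesgue_measure R).

Lemma continuous_powR_gt0 (r x : R) : 0 < x -> {for x, continuous (@powR R ^~ r)}.
Proof.
move=> x0; apply/differentiable_continuous/derivable1_diffP.
by have := is_derive1_powR r x0; case.
Qed.

Lemma integral_powR_segment (r a b : R) : 0 < a -> a < b -> r + 1 != 0 ->
  (\int[mu]_(x in `[a, b]) (x `^ r)%:E =
   ((b `^ (r + 1) - a `^ (r + 1)) / (r + 1))%:E)%E.
Proof.
move=> a0 ab r1.
pose F (x : R) := (r + 1)^-1 * x `^ (r + 1).
have dF (x : R) : 0 < x -> is_derive x 1 F (x `^ r).
  move=> x0.
  have -> : x `^ r = (r + 1)^-1 *: ((r + 1) * x `^ (r + 1 - 1)).
    by rewrite addrK scalerA mulVf// scale1r.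
  by apply: is_deriveZ; exact: is_derive1_powR.
have cF (x : R) : 0 < x -> {for x, continuous F}.
  by move=> x0; apply/differentiable_continuous/derivable1_diffP; case: (dF x x0).
rewrite (@continuous_FTC2 _ (fun x => x `^ r) F a b ab).
- by rewrite -EFinB /F; congr (_%:E); rewrite mulrBl ![_ / (r + 1)]mulrC.
- apply: continuous_in_subspaceT => x; rewrite inE/= in_itv/= => /andP[ax _].
  by apply: continuous_powR_gt0; exact: lt_le_trans ax.
- split.
  + move=> x; rewrite in_itv/= => /andP[ax _].
    by case: (dF x (lt_trans a0 ax)).
  + by apply: cvg_at_right_filter; apply: cF.
  + by apply: cvg_at_left_filter; apply: cF; exact: lt_trans ab.
- move=> x; rewrite in_itv/= => /andP[ax _].
  by rewrite derive1E; case: (dF x (lt_trans a0 ax)).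
Qed.

(** The antiderivative is available on segments inside the positive half-line; Fatou's lemma passes
    from an exhaustion by such segments to a domain touching 0 or infinity. *)
Lemma integral_powR_exhaust (r c : R) (D : set R) (a b : nat -> R) :
  measurable D -> r + 1 != 0 -> (forall n, 0 < a n) -> (forall n, a n < b n) ->
  (forall n x, a n <= x <= b n -> D x) ->
  (forall x, D x -> \forall n \near \oo, a n <= x <= b n) ->
  (forall n, (b n `^ (r + 1) - a n `^ (r + 1)) / (r + 1) <= c) ->
  (\int[mu]_(x in D) (x `^ r)%:E <= c%:E)%E.
Proof.
move=> mD r1 a0 ab aD Da bc.
rewrite integral_indicr.
have mpow : measurable_fun [set: measurableTypeR R] (fun x : R => x `^ r) by exact: measurable_powR.
apply: (@fatou_ae R _ _ mu (fun n x => x `^ r * \1_(`[a n, b n]) x)).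
- move=> n; apply: measurable_funM => //; exact: measurable_indic.
- apply: measurable_funM => //; exact: measurable_indic.
- by move=> n x; rewrite mulr_ge0// powR_ge0.
- by move=> x; rewrite mulr_ge0// powR_ge0.
- apply: aeW => x.
  have [xD|xD] := pselect (D x).
    apply: cvg_near_cst; apply: filterS (Da x xD) => n anx.
    by rewrite !indicE mem_set//= (mem_set xD).
  apply: cvg_near_cst; apply: nearW => n.
  rewrite !indicE (memNset xD) memNset// => /=; rewrite in_itv/= => /aD.
  exact: xD.
- apply: nearW => n.
  by rewrite -integral_indicr integral_powR_segment// lee_fin.
Qed.

Lemma integral_powR_0T (e T : R) : 0 < e -> 0 < T ->
  (\int[mu]_(x in `]0%R, T]) (x `^ (e - 1))%:E <= (T `^ e / e)%:E)%E.
Proof.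
(* The index [n.+2] keeps the left end strictly below T already for n = 0. *)
move=> e0 T0; apply: (@integral_powR_exhaust _ _ _ (fun n => T / n.+2%:R) (fun=> T)).
- exact: measurable_itv.
- by rewrite subrK gt_eqF.
- by move=> n; rewrite divr_gt0.
- by move=> n; rewrite ltr_pdivrMr// ltr_pMr// ltr1n.
- move=> n x /andP[ax xT]; rewrite /= in_itv/= xT andbT.
  by apply: lt_le_trans ax; rewrite divr_gt0.
- move=> x; rewrite /= in_itv/= => /andP[x0 xT].
  have h : (T / n.+2%:R) @[n --> \oo] --> 0.
    rewrite -(mulr0 T); apply: cvgMr.
    have := @cvg_harmonic R; rewrite -(cvg_shiftS (@harmonic R)); exact.
  near=> n; rewrite xT andbT; near: n.
  exact: (cvgr_le _ h).
- move=> n; rewrite subrK ler_pM2r ?invr_gt0//.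
  by rewrite gerBl powR_ge0.
Unshelve. all: by end_near. Qed.

Lemma integral_powR_1y (e : R) : 0 < e ->
  (\int[mu]_(x in `[1%R, +oo[) (x `^ (- e - 1))%:E <= (e^-1)%:E)%E.
Proof.
move=> e0; apply: (@integral_powR_exhaust _ _ _ (fun n => 1) (fun n => n.+2%:R)).
- exact: measurable_itv.
- by rewrite subrK oppr_eq0 gt_eqF.
- by [].
- by move=> n; rewrite ltr1n.
- by move=> n x /andP[x1 _]; rewrite /= in_itv/= x1.
- move=> x; rewrite /= in_itv/= andbT => x1.
  near=> n; rewrite x1/=.
  have : x <= n%:R by near: n; exact: nbhs_infty_ger.
  by move=> /le_trans; apply; rewrite ler_nat -addn2 leq_addr.
- move=> n; rewrite subrK powR1 invrN mulrN -mulNr opprB ler_pdivrMr// mulVf ?gt_eqF//.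
Unshelve. all: by end_near. Qed.

End powR_integrals.

Section monotone_shift.
Context {R : realType}.
Local Notation mu := (@lebesgue_measure R).

Lemma lebesgue_measure_segment (a b : R) : a <= b ->
  mu `[a, b]%classic = (b - a)%:E.
Proof.
rewrite le_eqVlt => /predU1P[->|ab]; rewrite lebesgue_measure_itv/= lte_fin.
  by rewrite ltxx subrr.
by rewrite ab -EFinB.
Qed.

(** For a nondecreasing f the absolute value disappears and the integral over [-n, n] telescopes:
    what remains is an integral of f over a segment of length h minus one over another such segment,
    at most h (M - m). *)
Let monotone_shift_pos (f : R -> R) (m M h : R) : {homo f : x y / x <= y} ->
  (forall x, m <= f x <= M) -> 0 < h ->
  (\int[mu]_x `|f (x + h)%R - f x|%:E <= (h * (M - m))%:E)%E.
Proof.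
move=> ndf fmM h0.
have mf : measurable_fun [set: measurableTypeR R] f by apply: nondecreasing_measurable => // x y _ _; exact: ndf.
have msh : measurable_fun [set: measurableTypeR R] (fun x : R => x + h) by exact: (@measurable_funD _ R R).
have mfh : measurable_fun [set: measurableTypeR R] (fun x : R => f (x + h)).
  exact: (measurableT_comp mf msh).
pose I (n : nat) : set R := `[- n%:R, n%:R]%classic.
have mI n : measurable_fun [set: measurableTypeR R] (\1_(I n) : R -> R).
  by apply: measurable_indic; exact: measurable_itv.
apply: (@fatou_ae R _ _ mu (fun n x => `|f (x + h) - f x| * \1_(I n) x)).
- move=> n; apply: measurable_funM; last exact: mI.
  by apply: measurableT_comp => //; exact: measurable_funB.
- by apply: measurableT_comp => //; exact: measurable_funB.
- by move=> n x; rewrite mulr_ge0.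
- by move=> x.
- apply: aeW => x; apply: cvg_near_cst; near=> n.
  rewrite indicE mem_set ?mulr1// /I /= in_itv/= -ler_norml.
  by near: n; exact: nbhs_infty_ger.
apply: nearW => n.
(* Subtracting the lower bound makes all integrands nonnegative. *)
pose g x := f x - m.
have g0 x : 0 <= g x by rewrite subr_ge0; case/andP: (fmM x).
have gM x : g x <= M - m by rewrite lerB//; case/andP: (fmM x).
have mM : 0 <= M - m by exact: le_trans (g0 0) (gM 0).
have mg : measurable_fun [set: measurableTypeR R] g by exact: measurable_funB.
have mgh : measurable_fun [set: measurableTypeR R] (fun x : R => g (x + h)) by exact: measurable_funB.
have mgI k : measurable_fun [set: measurableTypeR R] (fun x : R => (g x * \1_(I k) x)%:E).
  by apply/measurable_EFinP; exact: measurable_funM.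
have mIE k : measurable_fun [set: measurableTypeR R] (fun x : R => (\1_(I k) x : R)%:E).
  by apply/measurable_EFinP; exact: mI.
have mgIs k : measurable_fun [set: measurableTypeR R] (fun x : R => (g x * \1_(I k) (x - h))%:E).
  apply/measurable_EFinP; apply: measurable_funM => //.
  by apply: measurableT_comp; [exact: mI|exact: (@measurable_funB _ R R)].
have fing : (\int[mu]_x (g x * \1_(I n) x)%:E \is a fin_num)%E.
  rewrite ge0_fin_numE; last first.
    by apply: integral_ge0 => x _; rewrite lee_fin mulr_ge0.
  apply: (@le_lt_trans _ _ (\int[mu]_x ((M - m) * \1_(I n) x)%:E)%E).
    by apply: integral_mono => [||x|x]; [exact: measurable_funM|exact: measurable_funM|exact: mulr_ge0|rewrite ler_wpM2r].
  rewrite (integral_scale mu (mI n)) => [|x|]; [|by []|by []].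
  rewrite integral_indic//; last exact: measurable_itv.
  rewrite [X in (_ * X)%E](_ : _ = (n%:R - - n%:R)%:E); last first.
    by rewrite setIT; apply: lebesgue_measure_segment; rewrite ge0_cp// ler0n.
  by rewrite -EFinM ltry.
(* The finite integral of g over the window is added on both sides, which avoids a difference of
   extended reals. *)
rewrite -(leeD2rE _ _ fing) -integral_add => [|||x|x]; last 4 first.
- apply: measurable_funM; last exact: mI.
  by apply: measurableT_comp => //; exact: (measurable_funB mfh mf).
- exact: measurable_funM.
- exact: mulr_ge0.
- exact: mulr_ge0.
pose J : set R := `[n%:R, n%:R + h]%classic.
have mJ : measurable_fun [set: measurableTypeR R] (\1_J : R -> R).
  by apply: measurable_indic; exact: measurable_itv.
have mJE : measurable_fun [set: measurableTypeR R] (fun x : R => (\1_J x : R)%:E).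
  by apply/measurable_EFinP; exact: mJ.
have -> : (\int[mu]_x (`|f (x + h) - f x| * \1_(I n) x + g x * \1_(I n) x)%:E =
    \int[mu]_x (g x * \1_(I n) (x - h)%R)%:E)%E.
  rewrite -[RHS](ge0_integral_shift h); last 2 first.
  - exact: mgIs.
  - by move=> x; rewrite lee_fin mulr_ge0.
  apply: eq_integral => x _; rewrite addrK -mulrDl; congr (_ * _)%:E.
  rewrite ger0_norm; first by rewrite /g; lra.
  by rewrite subr_ge0 ndf// lerDl ltW.
(* The shifted window lies in the union of the original one and J, and g <= M - m on J. *)
apply: (@le_trans _ _ (\int[mu]_x ((M - m) * \1_J x + g x * \1_(I n) x)%:E)%E).
  apply: integral_mono => [||x|x].
  - by apply: measurable_funM => //; apply: measurableT_comp; [exact: mI|exact: (@measurable_funB _ R R)].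
  - by apply: measurable_funD; apply: measurable_funM.
  - exact: mulr_ge0.
  - rewrite !indicE /I /J.
    have [xI|xI] := boolP (x \in [set` `[- n%:R, n%:R]]).
      rewrite mulr1 -[leLHS]add0r lerD ?mulr_ge0 ?ler0n//.
      by rewrite ler_piMr// lern1 leq_b1.
    rewrite mulr0 addr0.
    have [xJ|xJ] := boolP (x \in [set` `[n%:R, n%:R + h]]).
      by rewrite mulr1 (le_trans _ (gM x))// ler_piMr// lern1 leq_b1.
    rewrite mulr0 memNset ?mulr0//= in_itv/= => /andP[h1 h2].
    move: xI xJ; rewrite !notin_setE/= !in_itv/= => xI xJ.
    have [hx|hx] := leP x n%:R; first by apply: xI; rewrite hx andbT; lra.
    by apply: xJ; rewrite (ltW hx)/=; lra.
rewrite integral_add => [|||x|x]; [|exact: measurable_funM|exact: measurable_funM|exact: mulr_ge0|exact: mulr_ge0].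
rewrite leeD2r// (integral_scale mu mJ) => [|x|]; [|by []|by []].
rewrite integral_indic//; last exact: measurable_itv.
rewrite [X in (_ * X)%E](_ : _ = (n%:R + h - n%:R)%:E); last first.
  by rewrite setIT; apply: lebesgue_measure_segment; rewrite lerDl ltW.
by rewrite -EFinM lee_fin [n%:R + h]addrC addrK mulrC.
Unshelve. all: by end_near. Qed.

Lemma monotone_shift (f : R -> R) (m M h : R) : {homo f : x y / x <= y} ->
  (forall x, m <= f x <= M) ->
  (\int[mu]_x `|f (x + h)%R - f x|%:E <= (`|h| * (M - m))%:E)%E.
Proof.
move=> ndf fmM.
have mf : measurable_fun [set: measurableTypeR R] f by apply: nondecreasing_measurable => // x y _ _; exact: ndf.
have [h0|h0|h0] := ltgtP 0 h.
- by rewrite gtr0_norm//; exact: monotone_shift_pos.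
- rewrite ltr0_norm//.
  apply: le_trans (@monotone_shift_pos f m M (- h) _ _ _) => //; last by rewrite oppr_gt0.
  rewrite -[leRHS](ge0_integral_shift h)//.
  + rewrite le_eqVlt; apply/orP; left; apply/eqP; apply: eq_integral => x _.
    by rewrite addrK distrC.
  + apply/measurable_EFinP; apply: measurableT_comp => //; apply: measurable_funB => //.
    by apply: measurableT_comp => //; exact: (@measurable_funB _ R R).
- rewrite -h0 normr0 mul0r.
  rewrite (eq_integral (cst 0%E)) ?integral0// => x _.
  by rewrite addr0 subrr normr0.
Qed.

Lemma monotone_shift_dec (f : R -> R) (m M h : R) : {homo f : x y /~ x <= y} ->
  (forall x, m <= f x <= M) ->
  (\int[mu]_x `|f (x + h)%R - f x|%:E <= (`|h| * (M - m))%:E)%E.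
Proof.
move=> nif fmM.
have := @monotone_shift (fun x => - f x) (- M) (- m) h.
rewrite opprK [- m + M]addrC => /(_ _ _)/wrap[|x|].
- by move=> x y xy; rewrite lerN2; exact: nif.
- by rewrite !lerN2 andbC.
- by apply: le_trans; rewrite le_eqVlt; apply/orP; left; apply/eqP; apply: eq_integral => x _;
    rewrite -opprD normrN.
Qed.

End monotone_shift.

(** * Fourier estimates and the noise norm *)

Section trig_transform.
Context {R : realType}.
Local Notation mu := (@lebesgue_measure R).
Local Notation mR := (measurable_fun [set: measurableTypeR R]).
Local Notation intR := (mu.-integrable [set: measurableTypeR R]).

Definition trig_transform (c : R -> R) (f : R -> R) (xi : R) : R :=
  \int[mu]_x (c (xi * x) * f x).

(* The properties shared by [cos] and [- sin] on which all Fourier estimates rest. *)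
Definition trig_wave (c : R -> R) : Prop :=
  [/\ continuous c, forall x, `|c x| <= 1 & forall x, c (x + pi) = - c x].

Lemma trig_wave_cos : trig_wave cos.
Proof. by split; [exact: continuous_cos|exact: cos_max|move=> x; rewrite cosDpi]. Qed.

Lemma trig_wave_Nsin : trig_wave (fun x => - sin x).
Proof.
split.
- by move=> x; apply: cvgN; exact: continuous_sin.
- by move=> x; rewrite normrN; exact: sin_max.
- by move=> x; rewrite sinDpi.
Qed.

Lemma fourier_Re (f : R -> R) (xi : R) :
  complex.Re (fourier f xi) = trig_transform cos f xi.
Proof. by rewrite /=; apply: eq_Rintegral => x _; rewrite mulr0 subr0. Qed.

Lemma fourier_Im (f : R -> R) (xi : R) :
  complex.Im (fourier f xi) = trig_transform (fun x => - sin x) f xi.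
Proof. by rewrite /=; apply: eq_Rintegral => x _; rewrite mulr0 add0r. Qed.

Definition fourier_sq (f : R -> R) (xi : R) : R :=
  trig_transform cos f xi ^+ 2 + trig_transform (fun x => - sin x) f xi ^+ 2.

Lemma fourier_sqE (f : R -> R) (xi : R) :
  ComplexField.Normc.normc (fourier f xi) ^+ 2 = fourier_sq f xi.
Proof.
rewrite /fourier_sq -fourier_Re -fourier_Im.
case: (fourier f xi) => a b /=.
by rewrite sqr_sqrtr// addr_ge0// sqr_ge0.
Qed.

Lemma fourier_sq_ge0 (f : R -> R) (xi : R) : 0 <= fourier_sq f xi.
Proof. by rewrite addr_ge0// sqr_ge0. Qed.

Context (c : R -> R) (wc : trig_wave c).

Let mc : measurable_fun [set: R] c.
Proof. by apply: continuous_measurable_fun; case: wc. Qed.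

Lemma measurable_trig_mul (xi : R) (f : R -> R) : mR f ->
  mR (fun x => c (xi * x) * f x).
Proof.
move=> mf; apply: measurable_funM => //.
by apply: (measurableT_comp mc); exact: mulrl_measurable.
Qed.

Lemma integrable_trig_mul (xi : R) (f : R -> R) : intR (EFin \o f) ->
  intR (EFin \o (fun x => c (xi * x) * f x)).
Proof.
move=> intf; have mf : mR f by apply/measurable_EFinP; case/integrableP: intf.
apply: le_integrable intf => //.
  by apply/measurable_EFinP; exact: measurable_trig_mul.
move=> x _ /=; rewrite lee_fin normrM ler_piMl//.
by case: wc.
Qed.

Lemma trig_transform_le_L1 (f : R -> R) (xi a : R) : mR f ->
  (\int[mu]_x `|f x|%:E <= a%:E)%E -> `|trig_transform c f xi| <= a.
Proof.
move=> mf fa; rewrite -lee_fin; apply: le_trans fa.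
apply: le_trans; first exact: (le_abs_Rintegral mu measurableT (measurable_trig_mul xi mf)).
apply: integral_mono => [||x|x].
- by apply: measurableT_comp => //; exact: measurable_trig_mul.
- by apply: measurableT_comp.
- by [].
- by rewrite normrM ler_piMl//; case: wc.
Qed.

Lemma trig_transformD (f g : R -> R) (xi : R) :
  intR (EFin \o f) -> intR (EFin \o g) ->
  trig_transform c (fun x => f x + g x) xi =
  trig_transform c f xi + trig_transform c g xi.
Proof.
move=> fi gi; rewrite /trig_transform -RintegralD//; try exact: integrable_trig_mul.
by apply: eq_Rintegral => x _; rewrite mulrDr.
Qed.

Lemma trig_transformZ (k : R) (f : R -> R) (xi : R) : intR (EFin \o f) ->
  trig_transform c (fun x => k * f x) xi = k * trig_transform c f xi.
Proof.
move=> fi; rewrite /trig_transform -RintegralZl//; last exact: integrable_trig_mul.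
by apply: eq_Rintegral => x _; rewrite mulrCA.
Qed.

Lemma integrable_shift (f : R -> R) (h : R) : intR (EFin \o f) ->
  intR (EFin \o (fun x => f (x + h))).
Proof.
move=> fi; have mf : mR f by apply/measurable_EFinP; case/integrableP: fi.
have msh : measurable_fun [set: measurableTypeR R] (fun x : R => x + h).
  exact: (@measurable_funD _ (measurableTypeR R) R).
apply/integrableP; split.
  by apply/measurable_EFinP; apply: (measurableT_comp mf).
have /integrableP[_] := fi; apply: le_lt_trans.
rewrite -[leRHS](ge0_integral_shift h)//.
by apply: measurableT_comp => //; exact/measurable_EFinP.
Qed.

(* Translating by half a period flips the sign of the oscillating factor. *)
Lemma trig_transform_le_shift (f : R -> R) (xi b : R) : intR (EFin \o f) -> 0 <= b ->
  (forall h, (\int[mu]_x `|f (x + h)%R - f x|%:E <= (b * `|h|)%:E)%E) ->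
  `|trig_transform c f xi| * `|xi| <= 2 * b.
Proof.
move=> fi b0 fb; have [->|xi0] := eqVneq xi 0.
  by rewrite normr0 mulr0 mulr_ge0.
have mf : mR f by apply/measurable_EFinP; case/integrableP: fi.
set h := pi / xi.
have e1 : trig_transform c f xi = - trig_transform c (fun x => f (x + h)) xi.
  rewrite {1}/trig_transform -(Rintegral_shift h)//; last exact: measurable_trig_mul.
  rewrite -[RHS]mulN1r -trig_transformZ//; last exact: integrable_shift.
  apply: eq_Rintegral => x _; rewrite mulrDr /h mulrCA divff// mulr1.
  by case: wc => _ _ ->; rewrite mulN1r mulrN mulNr.
have e2 : 2 * trig_transform c f xi = - trig_transform c (fun x => f (x + h) - f x) xi.
  rewrite (_ : (fun x => f (x + h) - f x) = (fun x => f (x + h) + (-1) * f x)).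
    rewrite trig_transformD//; last 2 first.
    - exact: integrable_shift.
    - by have := integrableZl measurableT (-1) fi.
    by rewrite trig_transformZ//; lra.
  by apply/funext => x; lra.
have : `|trig_transform c (fun x => f (x + h) - f x) xi| <= b * `|h|.
  apply: trig_transform_le_L1; last exact: fb.
  apply: measurable_funB => //.
  apply: (measurableT_comp mf).
  exact: (@measurable_funD _ (measurableTypeR R) R).
rewrite -normrN -e2 normrM (ger0_norm (ler0n R 2)) /h normrM normfV (ger0_norm (pi_ge0 R)) => le1.
have x0 : 0 < `|xi| by rewrite normr_gt0.
have : 2 * `|trig_transform c f xi| * `|xi| <= b * pi.
  by have := le1; rewrite mulrA ler_pdivlMr.
(* The half-period argument gives 2 |c(f)| |xi| <= pi b; rounding pi up to 4 yields the stated
   2b. *)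
have pi4 : pi <= 4 :> R by have := pihalf_lt2 R; lra.
move=> le2; have : b * pi <= b * 4 by rewrite ler_wpM2l.
lra.
Qed.

Lemma measurable_trig_transform (g : R -> R -> R) :
  measurable_fun [set: measurableTypeR R * measurableTypeR R] (fun z => g z.1 z.2) ->
  measurable_fun [set: measurableTypeR R * measurableTypeR R]
    (fun z => trig_transform c (g z.1) z.2).
Proof.
move=> mg.
apply: (measurable_Rintegral_param mu (f := fun w : (measurableTypeR R * measurableTypeR R) * measurableTypeR R =>
  c (w.1.2 * w.2) * g w.1.1 w.2)).
apply: measurable_funM.
  apply: (measurableT_comp mc); apply: measurable_funM => //.
  by apply: measurableT_comp.
apply: (measurableT_comp mg (g := fun w : (measurableTypeR R * measurableTypeR R) * measurableTypeR R => (w.1.1, w.2))).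
apply: measurable_fun_pair => //.
by apply: measurableT_comp.
Qed.

End trig_transform.

Lemma measurable_powR_comp (R : realType) d (T : measurableType d) (f : T -> R) (r : R) :
  measurable_fun setT f -> measurable_fun setT (fun x => f x `^ r).
Proof. by move=> mf; apply: (measurableT_comp (@measurable_powR R r) mf). Qed.

(** Integrated form of (x+y)^2 <= 2x^2 + 2y^2, shared by the noise norm and the mean square. *)
Lemma integral_le_combination (R : realType) d (T : measurableType d)
    (m : {measure set T -> \bar R}) (D : set T) (n n1 n2 : T -> \bar R) :
  measurable D -> measurable_fun setT n -> measurable_fun setT n1 ->
  measurable_fun setT n2 -> (forall t, 0 <= n t)%E -> (forall t, 0 <= n1 t)%E ->
  (forall t, 0 <= n2 t)%E ->
  (forall t, D t -> n t <= 2%:E * n1 t + 2%:E * n2 t)%E ->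
  (\int[m]_(t in D) n t <=
   2%:E * \int[m]_(t in D) n1 t + 2%:E * \int[m]_(t in D) n2 t)%E.
Proof.
move=> mD mn mn1 mn2 n0 n10 n20 h.
rewrite -!ge0_integralZl_EFin//; try exact: measurable_funTS.
rewrite -ge0_integralD//; last 4 first.
- by move=> t _; rewrite mule_ge0.
- by apply: measurable_funTS; exact: measurable_funeM.
- by move=> t _; rewrite mule_ge0.
- by apply: measurable_funTS; exact: measurable_funeM.
apply: ge0_le_integral => //.
- exact: measurable_funTS.
- by apply: measurable_funTS; apply: emeasurable_funD; exact: measurable_funeM.
Qed.

Section noise_norm.
Context {R : realType}.
Local Notation mu := (@lebesgue_measure R).
Local Notation mR := (measurable_fun [set: measurableTypeR R]).
Local Notation intR := (mu.-integrable [set: measurableTypeR R]).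
Local Notation mRR := (measurable_fun [set: measurableTypeR R * measurableTypeR R]).
Variable H : R.
Hypothesis H0 : 0 < H.
Hypothesis H1 : H < 1.

Lemma c_ge0 : 0 <= c_ H.
Proof.
rewrite /c_ divr_ge0 ?mulr_ge0 ?pi_ge0//.
- by apply: Rintegral_ge0 => x _; rewrite mulr_ge0 ?powR_ge0 ?expR_ge0.
- apply: sin_ge0_pi; rewrite mulr_ge0 ?pi_ge0 ?(ltW H0)//=.
  by rewrite -[leRHS]mulr1 ler_wpM2l ?pi_ge0// ltW.
Qed.

Definition noise_weight (xi : R) : R := c_ H * `|xi| `^ (1 - 2 * H).

Lemma noise_weight_ge0 xi : 0 <= noise_weight xi.
Proof. by rewrite mulr_ge0 ?c_ge0// powR_ge0. Qed.

Lemma measurable_noise_weight : mR noise_weight.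
Proof.
apply: measurable_funM => //.
apply: measurable_powR_comp; exact: (@normr_measurable R setT).
Qed.

Lemma noise_sqnormE (g : R -> R -> R) : (noise_sqnorm H g =
  \int[mu]_(t in `[0%R, +oo[) \int[mu]_xi (fourier_sq (g t) xi * noise_weight xi)%:E)%E.
Proof.
apply: eq_integral => t _; apply: eq_integral => xi _.
by rewrite fourier_sqE.
Qed.

Lemma measurable_fourier_sq_weight (g : R -> R -> R) : mRR (fun z => g z.1 z.2) ->
  mRR (fun z => fourier_sq (g z.1) z.2 * noise_weight z.2).
Proof.
move=> mg; apply: measurable_funM; last first.
  exact: (measurableT_comp measurable_noise_weight).
apply: measurable_funD; apply: measurable_funX; apply: measurable_trig_transform => //.
  exact: trig_wave_cos.
exact: trig_wave_Nsin.
Qed.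

Lemma measurable_fourier_sq_weight2 (g : R -> R -> R) (t : R) : mRR (fun z => g z.1 z.2) ->
  mR (fun xi => fourier_sq (g t) xi * noise_weight xi).
Proof. by move=> /measurable_fourier_sq_weight/(measurable_fun_pair2 t). Qed.

Lemma measurable_slice_norm (g : R -> R -> R) : mRR (fun z => g z.1 z.2) ->
  mR (fun t => \int[mu]_xi (fourier_sq (g t) xi * noise_weight xi)%:E)%E.
Proof.
move=> mg.
apply: (measurable_integral_param mu
  (f := fun z : measurableTypeR R * measurableTypeR R =>
    (fourier_sq (g z.1) z.2 * noise_weight z.2)%:E)).
by apply/measurable_EFinP; exact: measurable_fourier_sq_weight.
Qed.

(** Frequency dependence left by the interpolation of [sqr_le_interp], times the noise weight
    without its constant: |xi|^(1-2H) up to 1, then |xi|^(-1-H). *)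
Definition freq_density (xi : R) : R :=
  (if `|xi| <= 1 then 1 else `|xi| `^ (H - 2)) * `|xi| `^ (1 - 2 * H).

Lemma freq_density_ge0 xi : 0 <= freq_density xi.
Proof. by rewrite mulr_ge0 ?powR_ge0//; case: ifP => // _; exact: powR_ge0. Qed.

Lemma measurable_freq_density : mR freq_density.
Proof.
have mn : mR (fun x : R => `|x|) by exact: (@normr_measurable R setT).
apply: measurable_funM; last exact: (measurable_powR_comp _ mn).
apply: measurable_fun_ifT => //; last exact: (measurable_powR_comp _ mn).
exact: measurable_fun_ler.
Qed.

(** Twice the sum of the integrals of x^(1-2H) over [0, 1] and of x^(-1-H) over [1, +oo[. *)
Definition freq_mass : R := 2 * ((2 - 2 * H)^-1 + H^-1).

Lemma freq_mass_ge0 : 0 <= freq_mass.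
Proof.
have h1 : 0 <= (2 - 2 * H)^-1 by rewrite invr_ge0; have := H1; lra.
have h2 : 0 <= H^-1 by rewrite invr_ge0 ltW.
by apply: mulr_ge0 => //; apply: addr_ge0.
Qed.

Lemma integral_freq_density : (\int[mu]_xi (freq_density xi)%:E <= freq_mass%:E)%E.
Proof.
pose d1 (x : R) := x `^ (1 - 2 * H) * \1_(`[0, 1]) x.
pose d2 (x : R) := x `^ (- H - 1) * \1_(`[1, +oo[) x.
have md1 : mR d1.
  apply: measurable_funM; first exact: measurable_powR.
  by apply: measurable_indic; exact: measurable_itv.
have md2 : mR d2.
  apply: measurable_funM; first exact: measurable_powR.
  by apply: measurable_indic; exact: measurable_itv.
have d10 x : 0 <= d1 x by rewrite mulr_ge0// powR_ge0.
have d20 x : 0 <= d2 x by rewrite mulr_ge0// powR_ge0.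
pose d x := d1 x + d2 x.
have d0 x : 0 <= d x by rewrite addr_ge0.
have md : mR d by exact: measurable_funD.
have mN : mR (-%R : R -> R) by exact: oppr_measurable.
have mdN : mR (fun x => d (- x)) by exact: (measurableT_comp md mN).
have h x : 0 <= x -> freq_density x <= d x.
  move=> x0; rewrite /freq_density ger0_norm// /d /d1 /d2.
  case: ifPn => [x1|].
    rewrite mul1r indicE mem_set ?mulr1; last by rewrite /= in_itv/= x0 x1.
    by rewrite lerDl mulr_ge0// powR_ge0.
  rewrite -ltNge => x1; rewrite [X in _ <= _ + _ * X]indicE mem_set ?mulr1; last first.
    by rewrite /= in_itv/= ltW.
  rewrite -powRD; last by rewrite (gt_eqF (lt_trans ltr01 x1)) implybT.
  have -> : H - 2 + (1 - 2 * H) = - H - 1 by lra.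
  by rewrite lerDr mulr_ge0// powR_ge0.
(* The density is even, so it is dominated by a half-line profile plus its reflection. *)
apply: (@le_trans _ _ (\int[mu]_x (d x + d (- x))%:E)%E).
  apply: integral_mono => [||x|x].
  - exact: measurable_freq_density.
  - exact: measurable_funD.
  - exact: freq_density_ge0.
  - have [x0|x0] := leP 0 x.
      by rewrite (le_trans (h _ x0))// lerDl.
    have -> : freq_density x = freq_density (- x) by rewrite /freq_density normrN.
    by rewrite (le_trans (h (- x) _)) ?lerDr// oppr_ge0 ltW.
rewrite integral_add// (@ge0_integral_opp R (fun x => (d x)%:E)) => [||x]; last 2 first.
- by apply/measurable_EFinP.
- by rewrite lee_fin.
have -> : (\int[mu]_x (d x)%:E = \int[mu]_x (d1 x)%:E + \int[mu]_x (d2 x)%:E)%E.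
  by rewrite -integral_add.
rewrite -!integral_indicr.
rewrite -integral_itv_obnd_cbnd; last first.
  by apply/measurable_EFinP; apply: measurable_funTS; exact: measurable_powR.
have := @integral_powR_0T R (2 - 2 * H) 1 _ ltr01.
have -> : 2 - 2 * H - 1 = 1 - 2 * H by lra.
rewrite powR1 mul1r => h1'; have h1 := h1' ltac:(have := H1; lra).
have h2 := integral_powR_1y H0.
rewrite (_ : freq_mass = (2 - 2 * H)^-1 + H^-1 + ((2 - 2 * H)^-1 + H^-1)) ?EFinD; last first.
  by rewrite /freq_mass; ring.
by rewrite leeD// leeD.
Qed.

(** Write u^2 = |u|^H |u|^(2-H). The first factor is at most a^H; the second is at most b^(2-H) for
    small |xi| and (2b/|xi|)^(2-H) for large |xi|. The factor 4 dominates 2^(2-H). *)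
Lemma sqr_le_interp (u a b xi : R) : 0 <= a -> a <= b -> `|u| <= a ->
  `|u| * `|xi| <= 2 * b ->
  u ^+ 2 <= 4 * (a `^ H * b `^ (2 - H)) *
    (if `|xi| <= 1 then 1 else `|xi| `^ (H - 2)).
Proof.
move=> a0 ab ua ub; have b0 : 0 <= b by exact: le_trans ab.
have u2 (v : R) : 0 <= v -> v ^+ 2 = v `^ H * v `^ (2 - H).
  move=> v0; rewrite -powRD ?subrKC; first by rewrite powR_mulrn.
  by apply/implyP => /eqP; have := H1; lra.
have u0 : 0 <= `|u| by [].
rewrite -real_normK ?num_real// u2//.
have uaH : `|u| `^ H <= a `^ H by rewrite ge0_ler_powR ?nnegrE// ltW.
case: ifPn => [x1|].
  have h1 : `|u| `^ (2 - H) <= b `^ (2 - H).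
    apply: ge0_ler_powR; rewrite ?nnegrE//; first by have := H1; lra.
    exact: le_trans ab.
  have h2 : `|u| `^ H * `|u| `^ (2 - H) <= a `^ H * b `^ (2 - H).
    by rewrite ler_pM ?powR_ge0.
  have h3 : 0 <= a `^ H * b `^ (2 - H) by rewrite mulr_ge0 ?powR_ge0.
  by rewrite mulr1; lra.
rewrite -ltNge => x1; have x0 : 0 < `|xi| by exact: lt_trans x1.
have : `|u| `^ (2 - H) <= 4 * b `^ (2 - H) * `|xi| `^ (H - 2).
  have ub' : `|u| <= 2 * b / `|xi| by rewrite ler_pdivlMr.
  apply: (@le_trans _ _ ((2 * b / `|xi|) `^ (2 - H))).
    apply: ge0_ler_powR; rewrite ?nnegrE ?divr_ge0 ?mulr_ge0//; have := H1; lra.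
  rewrite powRM ?mulr_ge0 ?invr_ge0// powRM//.
  have -> : `|xi|^-1 `^ (2 - H) = `|xi| `^ (H - 2).
    by rewrite -powR_inv1// -powRrM; congr (_ `^ _); lra.
  rewrite !ler_wpM2r ?powR_ge0//.
  have -> : 4 = 2 `^ 2 :> R by rewrite powR_mulrn//; lra.
  by rewrite ler_powR//; have := H0; lra.
move=> h; rewrite [leRHS](_ : _ = a `^ H * (4 * b `^ (2 - H) * `|xi| `^ (H - 2))); last by ring.
by rewrite ler_pM ?powR_ge0.
Qed.

(** The 8 collects a 4 from [sqr_le_interp] for the cosine part and a 4 for the sine part. *)
Definition slice_const : R := 8 * c_ H * freq_mass.

Lemma slice_const_ge0 : 0 <= slice_const.
Proof. by apply: mulr_ge0; [apply: mulr_ge0 => //; exact: c_ge0|exact: freq_mass_ge0]. Qed.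

Lemma slice_norm_le (f : R -> R) (a b : R) : intR (EFin \o f) -> 0 <= a -> a <= b ->
  (\int[mu]_x `|f x|%:E <= a%:E)%E ->
  (forall h, (\int[mu]_x `|f (x + h)%R - f x|%:E <= (b * `|h|)%:E)%E) ->
  (\int[mu]_xi (fourier_sq f xi * noise_weight xi)%:E <=
   (slice_const * (a `^ H * b `^ (2 - H)))%:E)%E.
Proof.
move=> fi a0 ab fa fb; have b0 : 0 <= b by exact: le_trans ab.
have mf : mR f by apply/measurable_EFinP; case/integrableP: fi.
have mff : mRR (fun z => f z.2) by exact: (measurableT_comp mf).
set A := a `^ H * b `^ (2 - H).
have A0 : 0 <= A by rewrite mulr_ge0 ?powR_ge0.
apply: (@le_trans _ _ (\int[mu]_xi (8 * c_ H * A * freq_density xi)%:E)%E).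
  apply: integral_mono => [||xi|xi].
  - exact: (measurable_fourier_sq_weight2 0 mff).
  - by apply: measurable_funM => //; exact: measurable_freq_density.
  - by rewrite mulr_ge0 ?fourier_sq_ge0 ?noise_weight_ge0.
  - rewrite /noise_weight /freq_density.
    set p := `|xi| `^ (1 - 2 * H); set q := (if _ then _ else _).
    have -> : 8 * c_ H * A * (q * p) = (4 * A * q + 4 * A * q) * (c_ H * p) by ring.
    apply: ler_wpM2r; first by apply: mulr_ge0; [exact: c_ge0|exact: powR_ge0].
    rewrite /fourier_sq; apply: lerD; apply: sqr_le_interp => //.
    + by apply: trig_transform_le_L1 => //; exact: trig_wave_cos.
    + by apply: trig_transform_le_shift => //; exact: trig_wave_cos.
    + by apply: trig_transform_le_L1 => //; exact: trig_wave_Nsin.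
    + by apply: trig_transform_le_shift => //; exact: trig_wave_Nsin.
rewrite (integral_scale mu measurable_freq_density); last 2 first.
- exact: freq_density_ge0.
- by apply: mulr_ge0 => //; apply: mulr_ge0 => //; exact: c_ge0.
apply: (@le_trans _ _ ((8 * c_ H * A)%:E * freq_mass%:E)%E).
  rewrite lee_wpmul2l ?integral_freq_density// lee_fin.
  by apply: mulr_ge0 => //; apply: mulr_ge0 => //; exact: c_ge0.
by rewrite -EFinM lee_fin /slice_const le_eqVlt; apply/orP; left; apply/eqP; ring.
Qed.

(* Square-integrability in frequency needs decay, which the translation modulus [be] provides; time enters only through [al] and [be]. *)
Lemma noise_sqnorm_le (g : R -> R -> R) (al be : R -> R) :
  mRR (fun z => g z.1 z.2) -> (forall t, 0 <= t -> intR (EFin \o g t)) ->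
  mR al -> mR be ->
  (forall t, 0 < t -> 0 <= al t <= be t) ->
  (forall t, 0 < t -> (\int[mu]_x `|g t x|%:E <= (al t)%:E)%E) ->
  (forall t h, 0 < t ->
     (\int[mu]_x `|g t (x + h)%R - g t x|%:E <= (be t * `|h|)%:E)%E) ->
  (noise_sqnorm H g <= slice_const%:E *
    \int[mu]_(t in `]0%R, +oo[) (al t `^ H * be t `^ (2 - H))%:E)%E.
Proof.
move=> mg gi mal mbe ab ga gb; rewrite noise_sqnormE.
(* The slice bounds are assumed for t > 0 only; the single time 0 is negligible. *)
rewrite -integral_itv_obnd_cbnd; last first.
  by apply: measurable_funTS; exact: measurable_slice_norm.
have mp : mR (fun t => al t `^ H * be t `^ (2 - H)).
  by apply: measurable_funM; exact: measurable_powR_comp.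
rewrite -ge0_integralZl_EFin//; last 3 first.
- by move=> x _; rewrite lee_fin mulr_ge0 ?powR_ge0.
- by apply: measurable_funTS; exact/measurable_EFinP.
- exact: slice_const_ge0.
apply: ge0_le_integral => //.
- by move=> t _; apply: integral_ge0 => xi _; rewrite lee_fin mulr_ge0 ?fourier_sq_ge0 ?noise_weight_ge0.
- by apply: measurable_funTS; exact: measurable_slice_norm.
- apply: measurable_funTS; apply/measurable_EFinP.
  exact: (measurable_funM (measurable_cst slice_const) mp).
- move=> t /=; rewrite in_itv/= andbT => t0; rewrite -EFinM.
  by have /andP[? ?] := ab t t0; apply: slice_norm_le => //; [exact: gi (ltW t0)|exact: ga|
     move=> h; exact: gb].
Qed.

(** Under these conditions [fourier] is an absolutely convergent integral, hence linear on slices,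
    and the slice norm is measurable in time. *)
Definition admissible (g : R -> R -> R) : Prop :=
  mRR (fun z => g z.1 z.2) /\ forall t, 0 <= t -> intR (EFin \o g t).

Lemma admissibleD g1 g2 : admissible g1 -> admissible g2 ->
  admissible (fun t x => g1 t x + g2 t x).
Proof.
move=> [m1 i1] [m2 i2]; split; first exact: measurable_funD.
by move=> t t0; have := integrableD measurableT (i1 t t0) (i2 t t0).
Qed.

Lemma admissibleZ a g : admissible g -> admissible (fun t x => a * g t x).
Proof.
move=> [m1 i1]; split; first exact: measurable_funM.
by move=> t t0; have := integrableZl measurableT a (i1 t t0).
Qed.

Lemma admissibleB g1 g2 : admissible g1 -> admissible g2 ->
  admissible (fun t x => g1 t x - g2 t x).
Proof.
move=> [m1 i1] [m2 i2]; split; first exact: measurable_funB.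
by move=> t t0; have := integrableB measurableT (i1 t t0) (i2 t t0).
Qed.

Lemma eq_noise_sqnorm (g1 g2 : R -> R -> R) :
  (forall t x, 0 <= t -> g1 t x = g2 t x) -> noise_sqnorm H g1 = noise_sqnorm H g2.
Proof.
move=> g12; rewrite !noise_sqnormE; apply: eq_integral => t; rewrite inE/= in_itv/= andbT => t0.
by have -> : g1 t = g2 t by apply/funext => x; exact: g12.
Qed.

Lemma noise_sqnormZ (a : R) (g : R -> R -> R) : admissible g ->
  (noise_sqnorm H (fun t x => (a * g t x)%R) = (a ^+ 2)%:E * noise_sqnorm H g)%E.
Proof.
move=> [mg ig]; rewrite !noise_sqnormE -ge0_integralZl_EFin//; last 3 first.
- by move=> t _; apply: integral_ge0 => xi _; rewrite lee_fin mulr_ge0 ?fourier_sq_ge0 ?noise_weight_ge0.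
- by apply: measurable_funTS; exact: measurable_slice_norm.
- exact: sqr_ge0.
apply: eq_integral => t; rewrite inE/= in_itv/= andbT => t0.
rewrite -integral_scale; last 3 first.
- exact: measurable_fourier_sq_weight2.
- by move=> xi; rewrite mulr_ge0 ?fourier_sq_ge0 ?noise_weight_ge0.
- exact: sqr_ge0.
apply: eq_integral => xi _; congr (_%:E).
rewrite /fourier_sq !trig_transformZ; [by ring| | | |].
- exact: trig_wave_Nsin.
- exact: ig.
- exact: trig_wave_cos.
- exact: ig.
Qed.

(** Weaker than Minkowski's inequality, but free of square roots of possibly infinite norms. *)
Lemma noise_sqnormD_le (g1 g2 : R -> R -> R) : admissible g1 -> admissible g2 ->
  (noise_sqnorm H (fun t x => (g1 t x + g2 t x)%R) <=
   2%:E * noise_sqnorm H g1 + 2%:E * noise_sqnorm H g2)%E.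
Proof.
move=> a1 a2; have [m12 i12] := admissibleD a1 a2; move: a1 a2 => [m1 i1] [m2 i2].
have pos (g : R -> R -> R) t : (0 <= \int[mu]_xi (fourier_sq (g t) xi * noise_weight xi)%:E)%E.
  by apply: integral_ge0 => xi _; rewrite lee_fin mulr_ge0 ?fourier_sq_ge0 ?noise_weight_ge0.
have posr (g : R -> R) xi : 0 <= fourier_sq g xi * noise_weight xi.
  by rewrite mulr_ge0 ?fourier_sq_ge0 ?noise_weight_ge0.
rewrite !noise_sqnormE.
have mN12 := @measurable_slice_norm (fun t x => g1 t x + g2 t x) m12.
apply: (integral_le_combination mu _ mN12 (measurable_slice_norm m1)
  (measurable_slice_norm m2)); [exact: measurable_itv| |exact: (pos g1)|exact: (pos g2)|].
  by move=> t; exact: (pos (fun t x => g1 t x + g2 t x)).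
move=> t; rewrite /= in_itv/= andbT => t0.
have sc2 (g : R -> R -> R) : mRR (fun z => g z.1 z.2) ->
    (2%:E * \int[mu]_xi (fourier_sq (g t) xi * noise_weight xi)%:E =
     \int[mu]_xi (2 * (fourier_sq (g t) xi * noise_weight xi))%:E)%E.
  move=> mg; rewrite integral_scale//.
  exact: measurable_fourier_sq_weight2.
rewrite (sc2 _ m1) (sc2 _ m2).
rewrite -integral_add; last 4 first.
- by apply: measurable_funM => //; exact: measurable_fourier_sq_weight2.
- by apply: measurable_funM => //; exact: measurable_fourier_sq_weight2.
- by move=> xi; rewrite mulr_ge0.
- by move=> xi; rewrite mulr_ge0.
apply: integral_mono => [||xi|xi].
- exact: (@measurable_fourier_sq_weight2 (fun t x => g1 t x + g2 t x) t m12).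
- by apply: measurable_funD; apply: measurable_funM => //; exact: measurable_fourier_sq_weight2.
- exact: posr.
have := noise_weight_ge0 xi; move: (noise_weight xi) => w w0.
rewrite !mulrA -mulrDl; apply: ler_wpM2r => //; rewrite /fourier_sq.
have /= := trig_transformD trig_wave_cos xi (i1 t t0) (i2 t t0) => ->.
have /= := trig_transformD trig_wave_Nsin xi (i1 t t0) (i2 t t0) => ->.
set p := trig_transform _ _ _; set q := trig_transform _ _ _.
set r := trig_transform _ _ _; set s := trig_transform _ _ _.
rewrite -subr_ge0.
rewrite [leRHS](_ : _ = (p - q) ^+ 2 + (r - s) ^+ 2); last by ring.
by rewrite addr_ge0 ?sqr_ge0.
Qed.

Lemma noise_sqnorm_ge0 g : (0 <= noise_sqnorm H g)%E.
Proof.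
rewrite noise_sqnormE; apply: integral_ge0 => t _; apply: integral_ge0 => xi _.
by rewrite lee_fin mulr_ge0 ?fourier_sq_ge0 ?noise_weight_ge0.
Qed.

Lemma noise_sqnormB_le (g1 g2 g3 : R -> R -> R) :
  admissible g1 -> admissible g2 -> admissible g3 ->
  (noise_sqnorm H (fun t x => (g1 t x - g3 t x)%R) <=
   2%:E * noise_sqnorm H (fun t x => (g1 t x - g2 t x)%R) +
   2%:E * noise_sqnorm H (fun t x => (g2 t x - g3 t x)%R))%E.
Proof.
move=> a1 a2 a3; apply: le_trans (noise_sqnormD_le (admissibleB a1 a2) (admissibleB a2 a3)).
by rewrite le_eqVlt; apply/orP; left; apply/eqP; apply: eq_noise_sqnorm => t x _; lra.
Qed.

Lemma noise_sqnormBC (g1 g2 : R -> R -> R) : admissible g1 -> admissible g2 ->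
  noise_sqnorm H (fun t x => g1 t x - g2 t x) = noise_sqnorm H (fun t x => g2 t x - g1 t x).
Proof.
move=> a1 a2.
rewrite (@eq_noise_sqnorm _ (fun t x => (-1) * (g2 t x - g1 t x))) => [|t x _]; last lra.
by rewrite noise_sqnormZ ?sqrrN ?expr1n ?mul1e//; exact: admissibleB.
Qed.

End noise_norm.

(** * Smooth test functions *)

Section smooth_functions.
Context {R : realType}.

(** The functions p(1/x) exp(-1/x), extended by 0 to x <= 0: the family that contains all
    derivatives of the classical flat function exp(-1/x). *)
Definition flat (p : {poly R}) (x : R) : R :=
  if 0 < x then p.[x^-1] * expR (- x^-1) else 0.

(* Each constructor is stable under differentiation, so smoothness follows by induction. *)
Inductive elem_smooth : (R -> R) -> Prop :=
| es_cst c : elem_smooth (fun=> c)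
| es_id : elem_smooth id
| es_add f g : elem_smooth f -> elem_smooth g -> elem_smooth (fun x => f x + g x)
| es_mul f g : elem_smooth f -> elem_smooth g -> elem_smooth (fun x => f x * g x)
| es_inv f : (forall x, f x != 0) -> elem_smooth f -> elem_smooth (fun x => (f x)^-1)
| es_exp f : elem_smooth f -> elem_smooth (fun x => expR (f x))
| es_affine a b f : elem_smooth f -> elem_smooth (fun x => f (a * x + b))
| es_flat p : elem_smooth (flat p).

Lemma exprn_le_expR (n : nat) (u : R) : 0 <= u -> u ^+ n <= n`!%:R * expR u.
Proof.
move=> u0; case: n => [|n].
  by rewrite expr0 fact0 mul1r (le_trans _ (expR_ge1Dx u))// lerDl.
have := expR_ge1Dxn n u0; rewrite -lerBrDl => h.
have f0 : 0 < (n.+1)`!%:R :> R by rewrite ltr0n fact_gt0.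
rewrite -ler_pdivrMl//.
have : expR u - 1 <= expR u by rewrite gerBl.
by move=> /(le_trans h); rewrite mulrC.
Qed.

Lemma poly_expR_bounded (p : {poly R}) :
  exists2 C, 0 <= C & forall u, 0 <= u -> `|p.[u] * expR (- u)| <= C.
Proof.
exists (\sum_(i < size p) `|p`_i| * i`!%:R).
  by apply: sumr_ge0 => i _; rewrite mulr_ge0.
move=> u u0; rewrite horner_coef mulr_suml.
apply: le_trans (ler_norm_sum _ _ _) _; apply: ler_sum => i _.
rewrite -mulrA normrM ler_wpM2l// ger0_norm; last first.
  by rewrite mulr_ge0 ?exprn_ge0 ?expR_ge0.
by rewrite expRN ler_pdivrMr ?expR_gt0//; exact: exprn_le_expR.
Qed.

(** Boundedness of u^2 p(u) exp(-u) at u = 1/x. A quadratic bound makes the derivative at 0 exist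
    and vanish. *)
Lemma flat_le_sq (p : {poly R}) :
  exists2 C, 0 <= C & forall x, `|flat p x| <= C * x ^+ 2.
Proof.
have [C C0 hC] := poly_expR_bounded (p * 'X^2).
exists C => // x; rewrite /flat; case: ifPn => x0; last first.
  by rewrite normr0 mulr_ge0// sqr_ge0.
have x10 : 0 <= x^-1 by rewrite invr_ge0 ltW.
have := hC _ x10; rewrite hornerM hornerXn mulrAC normrM.
rewrite (ger0_norm (exprn_ge0 2 x10)) exprVn ler_pdivrMr//.
by rewrite exprn_gt0.
Qed.

(** For x > 0 the product and chain rules give (1/x^2) (p - p')(1/x) exp(-1/x), again in the family;
    0 is covered by [flat_le_sq]. *)
Lemma is_derive_flat (p : {poly R}) (x : R) :
  is_derive x 1 (flat p) (flat ('X^2 * (p - p^`())) x).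
Proof.
have [x0|x0|x0] := ltgtP x 0.
- have -> : flat ('X^2 * (p - p^`())) x = 0 by rewrite /flat ltNge (ltW x0).
  apply: (@near_eq_is_derive _ _ _ (cst 0)).
    near=> y; rewrite /flat; suff -> : (0 < y) = false by [].
    by apply/negbTE; rewrite -leNgt ltW//; near: y; exact: lt_nbhsl.
- have xV : is_derive x 1 (fun y : R => y^-1) (- x ^- 2 *: 1).
    by apply: is_deriveV; rewrite gt_eqF.
  have -> : flat ('X^2 * (p - p^`())) x =
    p.[x^-1] *: (expR (- x^-1) * - (- x ^- 2 *: 1)) + expR (- x^-1) *: (p^`().[x^-1] * (- x ^- 2 *: 1)).
    rewrite /flat x0 hornerM hornerXn hornerD hornerN exprVn /GRing.scale/=.
    by ring.
  apply: (@near_eq_is_derive R R R (fun y : R => p.[y^-1] * expR (- y^-1))).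
    near=> y; rewrite /flat; suff -> : 0 < y by [].
    by near: y; exact: lt_nbhsr.
  exact: is_deriveM.
- rewrite x0.
  have [C C0 hC] := flat_le_sq p.
  have f0 q : flat q 0 = 0 by rewrite /flat ltxx.
  rewrite f0.
  have h : h^-1 *: ((flat p \o shift 0) (h *: 1) - flat p 0) @[h --> 0^'] --> (0 : R).
    apply/cvgr0Pnorm_le => e e0; near=> h.
    rewrite /= f0 subr0 addr0 [h *: 1]mulr1 /GRing.scale/= normrM normfV.
    have h0 : h != 0 by near: h; exact: nbhs_dnbhs_neq.
    rewrite ler_pdivrMl ?normr_gt0//; apply: le_trans (hC h) _.
    rewrite -[h ^+ 2]ger0_norm ?sqr_ge0// normrX expr2 mulrCA ler_wpM2l//.
    have : `|h| < e / (C + 1).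
      near: h; apply: dnbhs0_lt; rewrite divr_gt0//; lra.
    rewrite ltr_pdivlMr; last lra.
    rewrite mulrDr mulr1 mulrC => /ltW; apply: le_trans.
    by rewrite lerDl.
  apply: DeriveDef.
    by apply/cvg_ex; exists 0.
  exact: cvg_lim h.
Unshelve. all: by end_near. Qed.

Lemma elem_smooth_derive (f : R -> R) : elem_smooth f ->
  exists2 g, elem_smooth g & forall x : R, is_derive x (1 : R) f (g x).
Proof.
elim=> {f}.
- by move=> c; exists (fun=> 0); [exact: es_cst|move=> x; exact: is_derive_cst].
- by exists (fun=> 1); [exact: es_cst|move=> x; exact: is_derive_id].
- move=> f g _ [f' sf' df] _ [g' sg' dg]; exists (fun x => f' x + g' x).
    exact: es_add.
  by move=> x; exact: is_deriveD.
- move=> f g sf [f' sf' df] sg [g' sg' dg].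
  exists (fun x => f x * g' x + g x * f' x).
    by apply: es_add; apply: es_mul.
  by move=> x; exact: is_deriveM.
- move=> f f0 sf [f' sf' df].
  exists (fun x => (-1) * ((f x)^-1 * (f x)^-1) * f' x).
    apply: es_mul => //; apply: es_mul; first exact: es_cst.
    by apply: es_mul; exact: es_inv.
  move=> x; have := is_deriveV (f0 x) (df x).
  by rewrite /GRing.scale/= expr2 invfM mulN1r.
- move=> f sf [f' sf' df]; exists (fun x => expR (f x) * f' x).
    by apply: es_mul => //; exact: es_exp.
  by move=> x; exact: (is_derive1_comp (f := expR)).
- move=> a b f sf [f' sf' df]; exists (fun x => f' (a * x + b) * a).
    by apply: es_mul; [exact: es_affine|exact: es_cst].
  move=> x; apply: (is_derive1_comp (f := f) (g := fun x => a * x + b)).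
  have h := is_deriveD (is_deriveZ a (is_derive_id x (1:R))) (is_derive_cst b x 1).
  by rewrite addr0 /GRing.scale/= mulr1 in h.
- by move=> p; exists (flat ('X^2 * (p - p^`()))); [exact: es_flat|exact: is_derive_flat].
Qed.

Lemma elem_smooth_continuous f : elem_smooth f -> continuous f.
Proof.
move=> /elem_smooth_derive[g _ df] x.
by apply/differentiable_continuous/derivable1_diffP; case: (df x).
Qed.

Lemma is_derive_line (V : normedModType R) (F : V -> R) (z v : V) (d : R) :
  is_derive (0 : R) (1 : R) (fun h : R => F (h *: v + z)) d -> is_derive z v F d.
Proof.
case=> dF e; apply: DeriveDef; first exact/derivable1P.
rewrite -e /derive; set g1 := fun h => _; set g2 := fun h => _.
suff -> : g1 = g2 by [].
by rewrite funeqE /g1 /g2 => h /=; rewrite addr0 scale0r add0r [_%:A]mulr1.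
Qed.

Lemma elem_smooth_line f : elem_smooth f ->
  exists2 g, elem_smooth g & forall x v : R, is_derive x v f (v * g x).
Proof.
move=> /elem_smooth_derive[g sg df]; exists g => // x v.
apply: is_derive_line; rewrite mulrC.
apply: (is_derive1_comp (f := f) (g := fun h : R => h *: v + x)).
  by rewrite scale0r add0r; exact: df.
have h := is_deriveD (is_deriveZ v (is_derive_id (0:R) (1:R))) (is_derive_cst x (0:R) 1).
rewrite addr0 /GRing.scale/= mulr1 in h.
rewrite (_ : (fun h : R => h *: v + x) = (v \*: id + cst x)) //.
by apply/funext => k /=; rewrite !fctE /GRing.scale/= mulrC.
Qed.

Lemma smooth_of_elem f : elem_smooth f -> smooth (f : R -> R).
Proof.
move=> sf vs /=; suff [g sg ->] : exists2 g, elem_smooth g &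
    foldr (fun (v : R) (h : R -> R) => 'D_v h) f vs = g.
  split; first exact: elem_smooth_continuous.
  by move=> z v; have [g' _ dg] := elem_smooth_line sg; case: (dg z v).
elim: vs => [|v vs [g sg /= ->]]; first by exists f.
have [g' sg' dg] := elem_smooth_line sg; exists (fun x => v * g' x).
  by apply: es_mul => //; exact: es_cst.
by apply/funext => x; case: (dg x v).
Qed.

(** Finite sums of products of one-variable functions: a directional derivative turns a product into
    a sum of two products, so this class too is stable. *)
Inductive elem_smooth2 : (R * R -> R) -> Prop :=
| es2_prod f g : elem_smooth f -> elem_smooth g -> elem_smooth2 (fun z => f z.1 * g z.2)
| es2_add F G : elem_smooth2 F -> elem_smooth2 G -> elem_smooth2 (fun z => F z + G z).

Lemma elem_smooth2_continuous F : elem_smooth2 F -> continuous F.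
Proof.
elim=> {F} [f g sf sg|F G _ cF _ cG] z; last by apply: cvgD; [exact: cF|exact: cG].
apply: cvgM.
  apply: (cvg_comp fst f); first exact: cvg_fst.
  exact: (elem_smooth_continuous sf).
apply: (cvg_comp snd g); first exact: cvg_snd.
exact: (elem_smooth_continuous sg).
Qed.

Lemma elem_smooth2_line F (v : R * R) : elem_smooth2 F ->
  exists2 G, elem_smooth2 G & forall z, is_derive z v F (G z).
Proof.
elim=> {F} [f g sf sg|F G _ [F' sF' dF] _ [G' sG' dG]]; last first.
  exists (fun z => F' z + G' z); first exact: es2_add.
  by move=> z; exact: is_deriveD.
have [f' sf' df] := elem_smooth_derive sf.
have [g' sg' dg] := elem_smooth_derive sg.
exists (fun z => f z.1 * (g' z.2 * v.2) + (f' z.1 * v.1) * g z.2).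
  apply: es2_add.
    apply: (es2_prod sf (g := fun x => g' x * v.2)).
    by apply: es_mul => //; exact: es_cst.
  apply: (es2_prod (f := fun x => f' x * v.1) _ sg).
  by apply: es_mul => //; exact: es_cst.
move=> z; apply: is_derive_line.
have lin (a c : R) : is_derive (0 : R) 1 (fun h : R => h * a + c) a.
  have h := is_deriveD (is_deriveZ a (is_derive_id (0:R) (1:R))) (is_derive_cst c (0:R) 1).
  rewrite addr0 /GRing.scale/= mulr1 in h.
  rewrite (_ : (fun h : R => h * a + c) = (a \*: id + cst c)) //.
  by apply/funext => k /=; rewrite !fctE /GRing.scale/= mulrC.
have d1 : is_derive (0 : R) 1 (fun h : R => f (h * v.1 + z.1)) (f' z.1 * v.1).
  apply: (is_derive1_comp (f := f) (g := fun h : R => h * v.1 + z.1)).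
  by rewrite mul0r add0r.
have d2 : is_derive (0 : R) 1 (fun h : R => g (h * v.2 + z.2)) (g' z.2 * v.2).
  apply: (is_derive1_comp (f := g) (g := fun h : R => h * v.2 + z.2)).
  by rewrite mul0r add0r.
have := is_deriveM d1 d2.
by rewrite /= !mul0r !add0r /GRing.scale/= [g z.2 * _]mulrC.
Qed.

Lemma smooth_of_elem2 F : elem_smooth2 F -> smooth F.
Proof.
move=> sF vs /=; suff [G sG ->] : exists2 G, elem_smooth2 G &
    foldr (fun (v : R * R) (h : R * R -> R) => 'D_v h) F vs = G.
  split; first exact: elem_smooth2_continuous.
  by move=> z v; have [G' _ dG] := elem_smooth2_line v sG; case: (dG z).
elim: vs => [|v vs [G sG /= ->]]; first by exists F.
have [G' sG' dG] := elem_smooth2_line v sG; exists G' => //.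
by apply/funext => z; case: (dG z).
Qed.

Lemma smoothD (V : normedModType R) (F G : V -> R) : smooth F -> smooth G ->
  smooth (fun z => F z + G z).
Proof.
move=> sF sG.
have e vs : foldr (fun (v : V) (h : V -> R) => 'D_v h) (fun z => F z + G z) vs =
   (fun z => foldr (fun (v : V) (h : V -> R) => 'D_v h) F vs z +
             foldr (fun (v : V) (h : V -> R) => 'D_v h) G vs z).
  elim: vs => [//|v vs /= ->]; apply/funext => z.
  by rewrite deriveD//; [case: (sF vs) => _; apply|case: (sG vs) => _; apply].
move=> vs /=; rewrite e; case: (sF vs) => cF dF; case: (sG vs) => cG dG; split.
  by move=> z; apply: cvgD; [exact: cF|exact: cG].
by move=> z v; apply: derivableD; [exact: dF|exact: dG].
Qed.

Lemma smoothZ (V : normedModType R) (a : R) (F : V -> R) : smooth F ->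
  smooth (fun z => a * F z).
Proof.
move=> sF.
have e vs : foldr (fun (v : V) (h : V -> R) => 'D_v h) (fun z => a * F z) vs =
   (fun z => a * foldr (fun (v : V) (h : V -> R) => 'D_v h) F vs z).
  elim: vs => [//|v vs /= ->]; apply/funext => z.
  by rewrite (deriveZ a)//; case: (sF vs) => _; apply.
move=> vs /=; rewrite e; case: (sF vs) => cF dF; split.
  by move=> z; apply: cvgM; [exact: cvg_cst|exact: cF].
by move=> z v; apply: derivableZ; exact: dF.
Qed.

Definition smooth_step (x : R) : R := flat 1 x * (flat 1 x + flat 1 (1 - x))^-1.

Lemma flat1_ge0 x : 0 <= flat 1 x.
Proof. by rewrite /flat; case: ifP => // _; rewrite hornerC mul1r expR_ge0. Qed.

Lemma flat1_gt0 x : 0 < x -> 0 < flat 1 x.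
Proof. by move=> x0; rewrite /flat x0 hornerC mul1r expR_gt0. Qed.

Lemma flat1_nd : {homo flat 1 : x y / x <= y}.
Proof.
move=> x y xy; rewrite {1}/flat; case: ifPn => x0; last exact: flat1_ge0.
have y0 : 0 < y by exact: lt_le_trans xy.
rewrite /flat y0 !hornerC !mul1r ler_expR lerN2.
by rewrite lef_pV2// posrE.
Qed.

Lemma smooth_step_den_gt0 x : 0 < flat 1 x + flat 1 (1 - x).
Proof.
have [x0|x0] := ltP 0 x.
  by rewrite ltr_wpDr ?flat1_ge0 ?flat1_gt0.
by rewrite ltr_wpDl ?flat1_ge0 ?flat1_gt0//; lra.
Qed.

Lemma smooth_step_ge0 x : 0 <= smooth_step x.
Proof. by rewrite mulr_ge0 ?flat1_ge0// invr_ge0 ltW// smooth_step_den_gt0. Qed.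

Lemma smooth_step_le1 x : smooth_step x <= 1.
Proof. by rewrite ler_pdivrMr ?smooth_step_den_gt0// mul1r lerDl flat1_ge0. Qed.

Lemma smooth_step0 x : x <= 0 -> smooth_step x = 0.
Proof. by move=> x0; rewrite /smooth_step {1}/flat ltNge x0/= mul0r. Qed.

Lemma smooth_step1 x : 1 <= x -> smooth_step x = 1.
Proof.
move=> x1; have := smooth_step_den_gt0 x; rewrite /smooth_step.
have -> : flat 1 (1 - x) = 0 by rewrite /flat ltNge subr_le0 x1.
by rewrite addr0 => x0; rewrite divff// gt_eqF.
Qed.

Lemma smooth_step_nd : {homo smooth_step : x y / x <= y}.
Proof.
move=> x y xy; rewrite /smooth_step.
rewrite ler_pdivrMr ?smooth_step_den_gt0// mulrAC ler_pdivlMr ?smooth_step_den_gt0//.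
have h1 := flat1_nd xy.
have h2 : flat 1 (1 - y) <= flat 1 (1 - x) by apply: flat1_nd; lra.
rewrite !mulrDr [flat 1 y * flat 1 x]mulrC lerD2l.
by apply: ler_pM => //; exact: flat1_ge0.
Qed.

Lemma elem_smooth_step : elem_smooth smooth_step.
Proof.
have h : elem_smooth (fun x => flat 1 (1 - x)).
  have := es_affine (-1) 1 (es_flat 1).
  by congr elem_smooth; apply/funext => x; rewrite mulN1r addrC.
apply: es_mul; first exact: es_flat.
apply: es_inv => [x|]; first by rewrite gt_eqF ?smooth_step_den_gt0.
by apply: es_add => //; exact: es_flat.
Qed.

End smooth_functions.

(** * Rounding to grids and joint measurability *)

Section grid_measurability.
Context {R : realType}.

(** Rounds down to the grid of mesh 1/k, so that a rounded time never looks into the future. *)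
Definition grid_point (k : R) (x : R) : R := (Num.floor (x * k))%:~R / k.

Lemma grid_point_le (k x : R) : 0 < k -> grid_point k x <= x.
Proof. by move=> k0; rewrite ler_pdivrMr// floor_le. Qed.

Lemma grid_point_ge0 (k x : R) : 0 < k -> 0 <= x -> 0 <= grid_point k x.
Proof.
by move=> k0 x0; rewrite divr_ge0 ?(ltW k0)// ler0z floor_ge0 mulr_ge0// ltW.
Qed.

Lemma grid_point_dist (k x : R) : 0 < k -> `|x - grid_point k x| <= k^-1.
Proof.
move=> k0; rewrite ger0_norm ?subr_ge0 ?grid_point_le//.
have /andP[_] := floor_itv (x * k); rewrite intrD => /ltW h.
have -> : x - grid_point k x = (x * k - (Num.floor (x * k))%:~R) / k.
  by rewrite /grid_point; field; rewrite gt_eqF.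
rewrite -[leRHS]mul1r ler_pM2r ?invr_gt0//; move: h; set j : R := _%:~R; lra.
Qed.

Lemma measurable_floor_fiber (k : R) (j : int) :
  measurable [set x : measurableTypeR R | Num.floor (x * k) = j].
Proof.
rewrite (_ : [set _ | _] = (fun x : R => x * k) @^-1` `[j%:~R, (j + 1)%:~R[).
  rewrite -[X in measurable X]setTI.
  apply: (mulrr_measurable k) => //; exact: measurable_itv.
apply/seteqP; split => x /=; rewrite in_itv/=; first by move=> <-; exact: floor_itv.
exact: floor_def.
Qed.

(** The fibres of q cut D into countably many measurable pieces, and each F i is needed only on its
    own piece. *)
Lemma measurable_fun_glue d d' (T : measurableType d) (T' : measurableType d')
    (I : countType) (D : set T) (q : T -> I) (F : I -> T -> T') :
  (forall i, measurable (D `&` q @^-1` [set i])) ->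
  (forall i, measurable_fun (D `&` q @^-1` [set i]) (F i)) ->
  measurable_fun D (fun t => F (q t) t).
Proof.
move=> mq mF mD B mB.
have -> : D `&` (fun t => F (q t) t) @^-1` B =
    \bigcup_i ((D `&` q @^-1` [set i]) `&` F i @^-1` B).
  apply/seteqP; split => t /=.
    by move=> [Dt FB]; exists (q t).
  by move=> [i _ [[Dt /= <-]] FB].
by apply: countable_bigcupT_measurable => // i; exact: mF.
Qed.

(** With the first coordinate rounded to a grid, F is countably many one-variable continuous
    functions glued together; refining the grid gives F as a pointwise limit, measurable for the
    product sigma-algebra. *)
Lemma continuous2_measurable (F : R * R -> R) : continuous F ->
  measurable_fun [set: measurableTypeR R * measurableTypeR R] F.
Proof.
move=> cF.
apply: (measurable_fun_cvg (h := fun n (z : measurableTypeR R * measurableTypeR R) =>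
   F (grid_point n.+1%:R z.1, z.2))).
- move=> n.
  apply: (measurable_fun_glue (q := fun z : measurableTypeR R * measurableTypeR R => Num.floor (z.1 * n.+1%:R))
   (F := fun (j : int) (z : measurableTypeR R * measurableTypeR R) => F (j%:~R / n.+1%:R, z.2))).
  + move=> j; rewrite setTI.
    rewrite (_ : _ @^-1` _ = [set x : measurableTypeR R | Num.floor (x * n.+1%:R) = j] `*` setT); last first.
      by apply/seteqP; split => -[x y] /=; [split|case].
    by apply: measurableX => //; exact: measurable_floor_fiber.
  + move=> j; apply: measurable_funTS.
    have h : measurable_fun [set: R] (fun x : R => F (j%:~R / n.+1%:R, x)).
      apply: continuous_measurable_fun => x.
      apply: (cvg_comp (fun x : R => (j%:~R / n.+1%:R, x)) F); last exact: cF.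
      by apply/cvg_ballP => e e0; exists e => //= y xy; split => //=; exact: ballxx.
    exact: (measurableT_comp h (@measurable_snd _ _ (measurableTypeR R) (measurableTypeR R))).
- move=> [t x] _ /=.
  apply: (cvg_comp (fun n : nat => (grid_point n.+1%:R t, x)) F); last exact: cF.
  apply/cvg_ballP => e e0; near=> n; split => /=; last exact: ballxx.
  apply: le_lt_trans (grid_point_dist _ _) _ => //.
  rewrite invf_plt ?posrE//.
  have : e^-1 < n%:R by near: n; exact: nbhs_infty_gtr.
  by move=> /lt_trans; apply; rewrite ltr_nat.
Unshelve. all: by end_near. Qed.

End grid_measurability.

Section compact_support.
Context {R : realType}.
Local Notation mu := (@lebesgue_measure R).
Local Notation mR := (measurable_fun [set: measurableTypeR R]).
Local Notation intR := (mu.-integrable [set: measurableTypeR R]).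

Lemma integral_shift_le2 (f : R -> R) (h : R) : mR f ->
  (\int[mu]_x `|f (x + h)%R - f x|%:E <= 2%:E * \int[mu]_x `|f x|%:E)%E.
Proof.
move=> mf.
have mfh : mR (fun x => f (x + h)).
  by apply: (measurableT_comp mf); exact: (@measurable_funD _ (measurableTypeR R) R).
have mn (g : R -> R) : mR g -> mR (fun x => `|g x|) by move=> mg; exact: measurableT_comp.
apply: (@le_trans _ _ (\int[mu]_x (`|f (x + h)%R| + `|f x|)%:E)%E).
  apply: integral_mono => [||x|x].
  - by apply: (mn (fun x => f (x + h) - f x)); exact: measurable_funB.
  - by apply: measurable_funD; exact: mn.
  - by [].
  - exact: ler_normB.
rewrite integral_add//; [|exact: mn|exact: mn].
rewrite (@ge0_integral_shift R h (fun x => `|f x|%:E)) => [||x].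
- by rewrite -[X in (X + X)%E]mul1e -ge0_muleDl ?lee_fin.
- by apply/measurable_EFinP; exact: mn.
- by rewrite lee_fin.
Qed.

Lemma integral_bounded_segment (f : R -> R) (M a b : R) : mR f -> a <= b ->
  (forall x, `|f x| <= M) -> (forall x, ~ (a <= x <= b) -> f x = 0) ->
  (\int[mu]_x `|f x|%:E <= (M * (b - a))%:E)%E.
Proof.
move=> mf ab fM f0.
have M0 : 0 <= M by exact: le_trans (fM 0).
have mI : mR (\1_(`[a, b]%classic : set R) : R -> R).
  by apply: measurable_indic; exact: measurable_itv.
apply: (@le_trans _ _ (\int[mu]_x (M * \1_(`[a, b]%classic : set R) x)%:E)%E).
  apply: integral_mono => [||x|x].
  - exact: measurableT_comp.
  - exact: measurable_funM.
  - by [].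
  - rewrite indicE; have [xab|xab] := boolP (x \in _).
      by rewrite mulr1.
    rewrite mulr0 f0 ?normr0//.
    by move: xab; rewrite notin_setE /= in_itv.
rewrite (integral_scale mu mI)//.
rewrite [X in (_ * X)%E](_ : _ = (b - a)%:E) ?EFinM//.
by rewrite integral_indic//= setIT; exact: lebesgue_measure_segment.
Qed.

(* For a Lipschitz function supported in [[-N, N]], the three terms bound the L1 norm, and the L1 effect of a translation by [h] divided by [|h|], for [|h| <= 1] and for [|h| >= 1]. *)
Definition support_const (N M L : R) : R := M * (2 * N) + L * (2 * N + 2) + 2 * (M * (2 * N)).

Lemma support_const_ge (N M L : R) : 0 <= N -> 0 <= M -> 0 <= L ->
  [/\ 0 <= support_const N M L, M * (2 * N) <= support_const N M L,
      L * (2 * N + 2) <= support_const N M L &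
      2 * (M * (2 * N)) <= support_const N M L].
Proof.
move=> N0 M0 L0.
have h1 : 0 <= M * (2 * N) by rewrite !mulr_ge0.
have h2 : 0 <= L * (2 * N + 2) by rewrite mulr_ge0// addr_ge0// mulr_ge0.
by split; rewrite /support_const; lra.
Qed.

Lemma compact_support_bounds (f : R -> R) (N M L : R) : mR f ->
  0 <= N -> 0 <= L -> (forall x, `|f x| <= M) -> (forall x, N < `|x| -> f x = 0) ->
  (forall x h, `|f (x + h) - f x| <= L * `|h|) ->
  (\int[mu]_x `|f x|%:E <= (support_const N M L)%:E)%E /\
  (forall h, (\int[mu]_x `|f (x + h)%R - f x|%:E <= (support_const N M L * `|h|)%:E)%E).
Proof.
move=> mf N0 L0 fM fN fL.
have M0 : 0 <= M by exact: le_trans (fM 0).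
have [C0 C1 C2 C3] := support_const_ge N0 M0 L0.
have f1 : (\int[mu]_x `|f x|%:E <= (M * (2 * N))%:E)%E.
  have -> : 2 * N = N - - N by lra.
  apply: integral_bounded_segment => //; first lra.
  by move=> x xN; apply: fN; rewrite ltNge ler_norml; apply/negP.
split; first by apply: le_trans f1 _; rewrite lee_fin.
move=> h; have [h1|h1] := leP `|h| 1.
  apply: (@le_trans _ _ (L * `|h| * (2 * N + 2))%:E); last first.
    by rewrite lee_fin mulrAC ler_wpM2r.
  have -> : 2 * N + 2 = (N + 1) - (- N - 1) by lra.
  apply: (@integral_bounded_segment (fun x => f (x + h) - f x)).
  - apply: measurable_funB => //.
    by apply: (measurableT_comp mf); exact: (@measurable_funD _ (measurableTypeR R) R).
  - by lra.
  - by move=> x; exact: fL.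
  - move=> x xN; move: h1; rewrite ler_norml => /andP[h1 h2].
    rewrite !fN ?subrr// ltNge ler_norml; apply/negP => /andP[h3 h4]; apply: xN; lra.
apply: le_trans (integral_shift_le2 h mf) _.
apply: (@le_trans _ _ (2%:E * (M * (2 * N))%:E)%E).
  by rewrite lee_wpmul2l// lee_fin.
rewrite -EFinM lee_fin; apply: le_trans C3 _.
by rewrite ler_peMr// ltW.
Qed.

Lemma bounded_of_compact_support (V : normedModType R) (G : V -> R) (K : set V) :
  continuous G -> compact K -> (forall z, ~ K z -> G z = 0) ->
  exists2 M, 0 <= M & forall z, `|G z| <= M.
Proof.
move=> cG cK G0.
have cGK : compact (G @` K).
  by apply: continuous_compact => //; exact: continuous_subspaceT.
have [M [_ hM]] := compact_bounded cGK.
exists (`|M| + 1); first by rewrite addr_ge0.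
move=> z; have [Kz|nKz] := pselect (K z); last by rewrite G0// normr0 addr_ge0.
apply: (hM (`|M| + 1)); last by exists z.
by rewrite (le_lt_trans (ler_norm M))// ltrDl.
Qed.

(** N and M come from compactness of the support. L bounds the space derivative, itself continuous
    with compact support, and the mean value theorem makes it a Lipschitz constant. *)
Lemma test_function_bounds (Phi : R * R -> R) : smooth Phi -> compactly_supported Phi ->
  exists N M L : R, [/\ 0 <= N, 0 <= L, forall z, `|Phi z| <= M,
    (forall t x, N < `|t| \/ N < `|x| -> Phi (t, x) = 0) &
    forall t x h, `|Phi (t, x + h) - Phi (t, x)| <= L * `|h|].
Proof.
move=> sPhi cPhi; set K := closure [set z | Phi z != 0] in cPhi.
have Phi0 z : ~ K z -> Phi z = 0.
  move=> nKz; apply/eqP; apply/negP => /negP Phiz; apply: nKz.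
  by apply: subset_closure.
have [_ dPhi] := sPhi [::].
have [cPhi0 _] := sPhi [::].
have [cD _] := sPhi [:: (0, 1)].
have [M M0 hM] := bounded_of_compact_support cPhi0 cPhi Phi0.
have D0 z : ~ K z -> 'D_(0, 1) Phi z = 0.
  move=> nKz.
  (* On the open complement of K the function is locally 0, hence so is its derivative. *)
  have oK : open (~` K) by apply: closed_openC; exact: closed_closure.
  have nz : \near z, cst 0 z = Phi z.
    have := open_nbhs_nbhs (conj oK nKz); apply: filterS => y /Phi0 ->//.
  have d0 : is_derive z (0, 1) Phi 0.
    by apply: (near_eq_is_derive (f := cst 0)) nz _; exact: is_derive_cst.
  by case: d0.
have [L L0 hL] := bounded_of_compact_support cD cPhi D0.
have [N0 [_ hN0]] := compact_bounded cPhi.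
pose N := `|N0| + 1.
have hN z : K z -> `|z| <= N.
  by move=> Kz; apply: (hN0 N) => //; rewrite /N (le_lt_trans (ler_norm N0))// ltrDl.
exists N, M, L; split => //; first by rewrite /N addr_ge0.
  move=> t x tx; apply: Phi0 => /hN; rewrite prod_normE ge_max => /andP[h1 h2].
  by case: tx; rewrite ltNge ?h1 ?h2.
have key t x y : x <= y -> `|Phi (t, y) - Phi (t, x)| <= L * `|y - x|.
  move=> xy.
  have dline s : is_derive s (1 : R) (fun r : R => Phi (t, r)) ('D_(0, 1) Phi (t, s)).
    have h := derivableP (dPhi (t, s) (0, 1)).
    case: h => h1 _.
    have e : (fun h : R => h^-1 *: (((fun r : R => Phi (t, r)) \o shift s) (h *: 1) - Phi (t, s))) =
             (fun h : R => h^-1 *: ((Phi \o shift (t, s)) (h *: (0, 1)) - Phi (t, s))).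
      apply/funext => k /=; congr (_ *: (Phi _ - _)).
      apply: injective_projections => //=.
      by rewrite -[LHS]add0r; congr (_ + t); exact/esym/mulr0.
    by apply: DeriveDef; rewrite /derivable /derive ?e.
  have cline : {within `[x, y], continuous (fun r : R => Phi (t, r))}.
    apply: continuous_subspaceT => s.
    by apply/differentiable_continuous/derivable1_diffP; case: (dline s).
  have [c _ ->] := MVT_segment xy (fun s _ => dline s) cline.
  by rewrite normrM; apply: ler_wpM2r => //; exact: hL.
move=> t x h; have [h0|h0] := leP 0 h.
  by have := key t x (x + h); rewrite lerDl => /(_ h0); rewrite [x + h - x]addrAC subrr add0r.
have := key t (x + h) x; rewrite gerDl => /(_ (ltW h0)).
by rewrite opprD addNKr normrN distrC.
Qed.

End compact_support.

(** * Test functions and the noise inner product *)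

Section test_functions.
Context {R : realType}.
Local Notation mu := (@lebesgue_measure R).
Local Notation mR := (measurable_fun [set: measurableTypeR R]).
Local Notation intR := (mu.-integrable [set: measurableTypeR R]).
Local Notation mRR := (measurable_fun [set: measurableTypeR R * measurableTypeR R]).
Variable H : R.
Hypothesis H0 : 0 < H.
Hypothesis H1 : H < 1.

(** Both slice bounds are taken equal to C on the window, so the exponents H and 2-H add up to 2.
    The bound is linear in the length of the window: short windows are negligible. *)
Lemma noise_sqnorm_window (g : R -> R -> R) (C a b : R) : admissible g ->
  0 <= C -> 0 <= a -> a <= b ->
  (forall t x, ~ (a < t <= b) -> 0 < t -> g t x = 0) ->
  (forall t, a < t <= b -> (\int[mu]_x `|g t x|%:E <= C%:E)%E) ->
  (forall t h, a < t <= b ->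
     (\int[mu]_x `|g t (x + h)%R - g t x|%:E <= (C * `|h|)%:E)%E) ->
  (noise_sqnorm H g <= (slice_const H * (C ^+ 2 * (b - a)))%:E)%E.
Proof.
move=> [mg ig] C0 a0 ab g0 gC gh.
pose al (t : R) := C * \1_(`]a, b]%classic : set R) t.
have mI : mR (\1_(`]a, b]%classic : set R) : R -> R).
  by apply: measurable_indic; exact: measurable_itv.
have mal : mR al by exact: measurable_funM.
have alE t : al t = if (a < t <= b) then C else 0.
  rewrite /al indicE; case: ifPn => tab.
    by rewrite mem_set ?mulr1//= in_itv.
  by rewrite memNset ?mulr0//= in_itv/=; exact/negP.
have al0 t : 0 <= al t by rewrite alE; case: ifP.
have i0 : (\int[mu]__ (0:R)%:E = 0)%E by rewrite integral0.
have h : (noise_sqnorm H g <= (slice_const H)%:E *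
    \int[mu]_(t in `]0%R, +oo[) (al t `^ H * al t `^ (2 - H))%:E)%E.
  apply: noise_sqnorm_le => //.
  - by move=> t _; rewrite al0 lexx.
  - move=> t t0; rewrite alE; case: ifPn => [|tab]; first exact: gC.
    rewrite (eq_integral (cst 0%E)) ?integral0// => x _.
    by rewrite g0 ?normr0//; exact/negP.
  - move=> t k t0; rewrite alE; case: ifPn => [|tab]; first exact: gh.
    rewrite mul0r (eq_integral (cst 0%E)) ?integral0// => x _.
    by rewrite !g0 ?subrr ?normr0//; exact/negP.
apply: le_trans h _; rewrite (EFinM (slice_const H)) lee_wpmul2l ?lee_fin ?slice_const_ge0//.
apply: (@le_trans _ _ (\int[mu]_t (C ^+ 2 * \1_(`]a, b]%classic : set R) t)%:E)%E).
  rewrite integral_indicr; apply: integral_mono => [||t|t].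
  - apply: measurable_funM; last by apply: measurable_indic; exact: measurable_itv.
    by apply: measurable_funM; exact: measurable_powR_comp.
  - exact: measurable_funM.
  - by rewrite !mulr_ge0 ?powR_ge0.
  - apply: (@le_trans _ _ (al t `^ H * al t `^ (2 - H))).
      by rewrite ler_piMr ?mulr_ge0 ?powR_ge0// indicE lern1 leq_b1.
    rewrite -powRD ?subrKC; last by apply/implyP => /eqP; lra.
    rewrite powR_mulrn// exprMn ler_wpM2l ?sqr_ge0// indicE.
    by case: (_ \in _); rewrite ?expr1n ?expr0n.
rewrite (integral_scale mu mI) ?sqr_ge0//.
rewrite [X in (_ * X)%E](_ : _ = (b - a)%:E) ?EFinM//.
rewrite integral_indic//= setIT lebesgue_measure_itv/= lte_fin.
move: ab; rewrite le_eqVlt => /predU1P[->|->]; last by rewrite EFinB.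
by rewrite ltxx subrr.
Qed.

Lemma compactly_supported_sub (V : topologicalType) (f : V -> R) (K : set V) :
  compact K -> closed K -> (forall z, ~ K z -> f z = 0) -> compactly_supported f.
Proof.
move=> cK clK f0; apply: (subclosed_compact _ cK); first exact: closed_closure.
rewrite [X in _ `<=` X]((closure_id K).1 clK); apply: closure_subset => z /= /eqP fz.
by apply: contrapT => nKz; apply: fz; exact: f0.
Qed.

Lemma test_functionP (phi : test_functions R) : exists Phi : R * R -> R,
     [/\ smooth Phi, compactly_supported Phi &
         forall t x, val phi t x = if 0 <= t then Phi (t, x) else 0].
Proof. exact: set_valP phi. Qed.

Lemma test_functionE (f : R -> R -> R) :
  (exists Phi : R * R -> R, [/\ smooth Phi, compactly_supported Phi &
     forall t x, f t x = if 0 <= t then Phi (t, x) else 0]) ->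
  exists phi : test_functions R, val phi = f.
Proof.
move=> fP; have ff : test_functions R f by exact: fP.
by exists (exist _ f (mem_set ff)).
Qed.

Lemma test_lin (a : R) (phi psi : test_functions R) :
  exists chi : test_functions R, forall t x, val chi t x = a * val phi t x + val psi t x.
Proof.
have [F [sF cF eF]] := test_functionP phi.
have [G [sG cG eG]] := test_functionP psi.
have [|chi e] := @test_functionE (fun t x => a * val phi t x + val psi t x).
  exists (fun z => a * F z + G z); split.
  - by apply: smoothD => //; exact: smoothZ.
  - apply: (@compactly_supported_sub _ _ (closure [set z | F z != 0] `|` closure [set z | G z != 0])).
    + exact: compactU.
    + by apply: closedU; exact: closed_closure.
    + move=> z nz; have -> : F z = 0.
        apply/eqP; apply/negP => /negP Fz; apply: nz; left; exact: subset_closure.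
      have -> : G z = 0.
        apply/eqP; apply/negP => /negP Fz; apply: nz; right; exact: subset_closure.
      by rewrite mulr0 addr0.
  - by move=> t x; rewrite eF eG; case: ifP => // _; rewrite mulr0 addr0.
by exists chi => t x; rewrite e.
Qed.

Lemma test_bounds (phi : test_functions R) : exists N C : R,
  [/\ 0 <= N, 0 <= C, forall t x, N < t -> val phi t x = 0,
     forall t, (\int[mu]_x `|val phi t x|%:E <= C%:E)%E &
     forall t h, (\int[mu]_x `|val phi t (x + h)%R - val phi t x|%:E <= (C * `|h|)%:E)%E] /\
  mRR (fun z => val phi z.1 z.2).
Proof.
have [F [sF cF eF]] := test_functionP phi.
have [N [M [L [N0 L0 FM FN FL]]]] := test_function_bounds sF cF.
have M0 : 0 <= M by exact: le_trans (FM 0).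
have [C0 _ _ _] := support_const_ge N0 M0 L0.
have [contF _] := sF [::].
have mF : mRR F by exact: continuous2_measurable.
have mphi : mRR (fun z => val phi z.1 z.2).
  rewrite (_ : (fun z => val phi z.1 z.2) = (fun z => if 0 <= z.1 then F (z.1, z.2) else 0)).
    apply: measurable_fun_ifT => //.
      by apply: measurable_fun_ler.
    apply: (measurableT_comp mF).
    exact: measurable_fun_pair.
  by apply/funext => z; rewrite eF.
have sl t : mR (val phi t) by exact: (measurable_fun_pair2 t mphi).
exists N, (support_const N M L); split => //.
have b t : (\int[mu]_x `|val phi t x|%:E <= (support_const N M L)%:E)%E /\
  (forall h, (\int[mu]_x `|val phi t (x + h)%R - val phi t x|%:E <= (support_const N M L * `|h|)%:E)%E).
  apply: compact_support_bounds => //.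
  - by move=> x; rewrite eF; case: ifP => // _; rewrite normr0.
  - by move=> x xN; rewrite eF; case: ifP => // _; apply: FN; right.
  - move=> x h; rewrite !eF; case: ifP => // _.
    by rewrite subrr normr0 mulr_ge0.
split => //.
- move=> t x tN; rewrite eF; case: ifP => // t0; apply: FN; left.
  by rewrite ger0_norm.
- by move=> t; case: (b t).
- by move=> t h; case: (b t) => _; apply.
Qed.

Lemma test_admissible (phi : test_functions R) : admissible (val phi).
Proof.
have [N [C [[N0 C0 _ phiC _] mphi]]] := test_bounds phi; split => // t t0.
apply/integrableP; split; last by apply: le_lt_trans (phiC t) _; exact: ltry.
by apply/measurable_EFinP; exact: (measurable_fun_pair2 t mphi).
Qed.

Definition slice_norm (g : R -> R -> R) (t : R) : \bar R :=
  (\int[mu]_xi (fourier_sq (g t) xi * noise_weight H xi)%:E)%E.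

Lemma test_slice_lty (phi : test_functions R) t : 0 <= t -> (slice_norm (val phi) t < +oo)%E.
Proof.
move=> t0; have [N [C [[N0 C0 _ phiC phih] mphi]]] := test_bounds phi.
have [_ ia] := test_admissible phi.
apply: le_lt_trans (ltry _).
by apply: (slice_norm_le H0 H1 (ia t t0) C0 (lexx C)).
Qed.

Lemma test_noise_lty (phi : test_functions R) : (noise_sqnorm H (val phi) < +oo)%E.
Proof.
have [N [C [[N0 C0 phiN phiC phih] mphi]]] := test_bounds phi.
apply: le_lt_trans (ltry _).
apply: (@noise_sqnorm_window _ C 0 N) => //; first exact: test_admissible.
by move=> t x tN t0; apply: phiN; rewrite ltNge; apply/negP => tN'; apply: tN; rewrite t0.
Qed.

(** The real part of the integrand of [noise_inner], written with cosine and sine transforms. *)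
Definition cross_density (phi psi : R -> R -> R) (t xi : R) : R :=
  (trig_transform cos (phi t) xi * trig_transform cos (psi t) xi +
   trig_transform (fun x => - sin x) (phi t) xi *
   trig_transform (fun x => - sin x) (psi t) xi) * noise_weight H xi.

Definition noise_ip (phi psi : R -> R -> R) : R :=
  \int[mu]_(t in `[0, +oo[) \int[mu]_xi cross_density phi psi t xi.

Let Re_mul_conj (z1 z2 : R[i]) (w : R) :
  complex.Re (z1 * (z2^*)%C * (w%:C)%C) =
  (complex.Re z1 * complex.Re z2 + complex.Im z1 * complex.Im z2) * w.
Proof. by case: z1 => a b; case: z2 => c e /=; ring. Qed.

Lemma Re_noise_inner (phi psi : R -> R -> R) :
  complex.Re (noise_inner H phi psi) = noise_ip phi psi.
Proof.
transitivity (\int[mu]_(t in `[0, +oo[) \int[mu]_xi complex.Re (fourier (phi t) xi *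
  ((fourier (psi t) xi)^*)%C * ((c_ H * `|xi| `^ (1 - 2 * H))%:C)%C)); first by [].
apply: eq_Rintegral => t _; apply: eq_Rintegral => xi _.
by rewrite Re_mul_conj !fourier_Re !fourier_Im.
Qed.

Lemma measurable_cross_density phi psi : mRR (fun z => phi z.1 z.2) ->
  mRR (fun z => psi z.1 z.2) -> mRR (fun z => cross_density phi psi z.1 z.2).
Proof.
move=> m1 m2; apply: measurable_funM.
  by apply: measurable_funD; apply: measurable_funM; apply: measurable_trig_transform => //;
    (exact: trig_wave_cos || exact: trig_wave_Nsin).
by apply: measurableT_comp => //; exact: measurable_noise_weight.
Qed.

Lemma cross_density_le phi psi t xi : `|cross_density phi psi t xi| <=
  fourier_sq (phi t) xi * noise_weight H xi + fourier_sq (psi t) xi * noise_weight H xi.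
Proof.
rewrite /cross_density /fourier_sq normrM (ger0_norm (noise_weight_ge0 H0 H1 xi)) -mulrDl.
apply: ler_wpM2r; first exact: noise_weight_ge0.
set a := trig_transform _ _ _; set b := trig_transform _ _ _.
set c := trig_transform _ _ _; set e := trig_transform _ _ _.
have h1 := sqr_ge0 (a - b); have h2 := sqr_ge0 (a + b).
have h3 := sqr_ge0 (c - e); have h4 := sqr_ge0 (c + e).
have h5 := sqr_ge0 a; have h6 := sqr_ge0 b; have h7 := sqr_ge0 c; have h8 := sqr_ge0 e.
have e1 : (a - b) ^+ 2 = a ^+ 2 + b ^+ 2 - 2 * (a * b) by ring.
have e2 : (a + b) ^+ 2 = a ^+ 2 + b ^+ 2 + 2 * (a * b) by ring.
have e3 : (c - e) ^+ 2 = c ^+ 2 + e ^+ 2 - 2 * (c * e) by ring.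
have e4 : (c + e) ^+ 2 = c ^+ 2 + e ^+ 2 + 2 * (c * e) by ring.
rewrite e1 in h1; rewrite e2 in h2; rewrite e3 in h3; rewrite e4 in h4.
by rewrite ler_norml; apply/andP; split; lra.
Qed.

Lemma cross_slice_integrable (phi psi : test_functions R) t : 0 <= t ->
  intR (EFin \o cross_density (val phi) (val psi) t).
Proof.
move=> t0; have [m1 _] := test_admissible phi; have [m2 _] := test_admissible psi.
apply/integrableP; split.
  apply/measurable_EFinP.
  exact: (measurable_fun_pair2 t (measurable_cross_density m1 m2)).
apply: (@le_lt_trans _ _ (slice_norm (val phi) t + slice_norm (val psi) t)%E); last first.
  by rewrite lte_add_pinfty// test_slice_lty.
rewrite /slice_norm -integral_add => [|||xi|xi]; last 4 first.
- exact: (measurable_fourier_sq_weight2 H t m1).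
- exact: (measurable_fourier_sq_weight2 H t m2).
- by rewrite mulr_ge0 ?fourier_sq_ge0 ?noise_weight_ge0.
- by rewrite mulr_ge0 ?fourier_sq_ge0 ?noise_weight_ge0.
apply: integral_mono => [||xi|xi].
- apply: measurableT_comp => //.
  exact: (measurable_fun_pair2 t (measurable_cross_density m1 m2)).
- apply: measurable_funD.
    exact: (measurable_fourier_sq_weight2 H t m1).
  exact: (measurable_fourier_sq_weight2 H t m2).
- by [].
- exact: cross_density_le.
Qed.

Lemma cross_slice_le (phi psi : test_functions R) t :
  (`|\int[mu]_xi cross_density (val phi) (val psi) t xi|%:E <=
   slice_norm (val phi) t + slice_norm (val psi) t)%E.
Proof.
have [m1 _] := test_admissible phi; have [m2 _] := test_admissible psi.
have mc := measurable_fun_pair2 t (measurable_cross_density m1 m2).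
apply: le_trans; first exact: (le_abs_Rintegral mu measurableT mc).
rewrite /slice_norm -integral_add => [|||xi|xi]; last 4 first.
- exact: (measurable_fourier_sq_weight2 H t m1).
- exact: (measurable_fourier_sq_weight2 H t m2).
- by rewrite mulr_ge0 ?fourier_sq_ge0 ?noise_weight_ge0.
- by rewrite mulr_ge0 ?fourier_sq_ge0 ?noise_weight_ge0.
apply: integral_mono => [||xi|xi].
- by apply: measurableT_comp => //.
- apply: measurable_funD.
    exact: (measurable_fourier_sq_weight2 H t m1).
  exact: (measurable_fourier_sq_weight2 H t m2).
- by [].
- exact: cross_density_le.
Qed.

Lemma measurable_cross_slice (phi psi : test_functions R) :
  mR (fun t => \int[mu]_xi cross_density (val phi) (val psi) t xi).
Proof.
have [m1 _] := test_admissible phi; have [m2 _] := test_admissible psi.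
apply: (measurable_Rintegral_param mu
  (f := fun z : measurableTypeR R * measurableTypeR R => cross_density (val phi) (val psi) z.1 z.2)).
exact: measurable_cross_density.
Qed.

Lemma slice_norm_ge0 g t : (0 <= slice_norm g t)%E.
Proof. by apply: integral_ge0 => xi _; rewrite lee_fin mulr_ge0 ?fourier_sq_ge0 ?noise_weight_ge0. Qed.

Lemma cross_integrable (phi psi : test_functions R) :
  mu.-integrable (`[0%R, +oo[%classic : set R)
   (EFin \o (fun t => \int[mu]_xi cross_density (val phi) (val psi) t xi)).
Proof.
have [m1 _] := test_admissible phi; have [m2 _] := test_admissible psi.
have mcs := measurable_cross_slice phi psi.
apply/integrableP; split.
  by apply: measurable_funTS; apply/measurable_EFinP.
apply: (@le_lt_trans _ _ (noise_sqnorm H (val phi) + noise_sqnorm H (val psi))%E); last first.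
  by rewrite lte_add_pinfty// test_noise_lty.
rewrite !noise_sqnormE -ge0_integralD//; last 4 first.
- by move=> t _; exact: slice_norm_ge0.
- by apply: measurable_funTS; exact: measurable_slice_norm.
- by move=> t _; exact: slice_norm_ge0.
- by apply: measurable_funTS; exact: measurable_slice_norm.
apply: ge0_le_integral => //.
- by apply: measurable_funTS; apply/measurable_EFinP; exact: measurableT_comp.
- by apply: measurable_funTS; apply: emeasurable_funD; exact: measurable_slice_norm.
- by move=> t _; exact: cross_slice_le.
Qed.

(** Bilinearity of the covariance, from which the linearity of the noise is deduced in [W_lin].
    Integrability at both levels is what allows the real-valued integrals to be split. *)
Lemma noise_ip_lin (a : R) (phi psi chi : test_functions R) (eta : test_functions R) :
  (forall t x, val chi t x = a * val phi t x + val psi t x) ->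
  noise_ip (val chi) (val eta) = a * noise_ip (val phi) (val eta) + noise_ip (val psi) (val eta).
Proof.
move=> chiE; rewrite /noise_ip -RintegralZl//; last exact: cross_integrable.
rewrite -RintegralD//; last 2 first.
- have mD : measurable (`[0%R, +oo[%classic : set (measurableTypeR R)) by exact: measurable_itv.
  by have := integrableZl mD a (cross_integrable phi eta).
- exact: cross_integrable.
apply: eq_Rintegral => t; rewrite inE/= in_itv/= andbT => t0.
rewrite -RintegralZl//; last exact: cross_slice_integrable.
rewrite -RintegralD//; last 2 first.
- by have := integrableZl measurableT a (cross_slice_integrable phi eta t0).
- exact: cross_slice_integrable.
apply: eq_Rintegral => xi _; rewrite /cross_density.
have -> : val chi t = (fun x => a * val phi t x + val psi t x) by apply/funext.
have [_ i1] := test_admissible phi; have [_ i2] := test_admissible psi.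
have i1' := integrableZl measurableT a (i1 t t0).
rewrite !trig_transformD//; try exact: i2; try exact: i1'; try exact: trig_wave_cos; try exact: trig_wave_Nsin.
rewrite !trig_transformZ; [by ring| | | |]; try exact: i1; try exact: trig_wave_cos; exact: trig_wave_Nsin.
Qed.

Lemma noise_ip_sqnorm (phi : test_functions R) :
  ((noise_ip (val phi) (val phi))%:E = noise_sqnorm H (val phi))%E.
Proof.
have e t xi : cross_density (val phi) (val phi) t xi = fourier_sq (val phi t) xi * noise_weight H xi.
  by rewrite /cross_density /fourier_sq !expr2.
rewrite noise_sqnormE /noise_ip /Rintegral fineK; last first.
  by apply: integrable_fin_num => //; exact: cross_integrable.
apply: eq_integral => t; rewrite inE/= in_itv/= andbT => t0.
rewrite fineK; last by apply: integrable_fin_num => //; exact: cross_slice_integrable.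
by apply: eq_integral => xi _; rewrite e.
Qed.

End test_functions.

(** * Approximation of time indicators by test functions *)

Section time_cutoff.
Context {R : realType}.
Local Notation mu := (@lebesgue_measure R).
Local Notation mR := (measurable_fun [set: measurableTypeR R]).
Local Notation intR := (mu.-integrable [set: measurableTypeR R]).
Local Notation mRR := (measurable_fun [set: measurableTypeR R * measurableTypeR R]).
Variable H : R.
Hypothesis H0 : 0 < H.
Hypothesis H1 : H < 1.

(** Equal to 1 on [0, s] and to 0 beyond s + e. The first step rises between -2 and -1; it serves to
    make the support compact on the negative side, since a test function must extend smoothly to the
    whole plane. *)
Definition time_cutoff (s e t : R) : R :=
  smooth_step (1 * t + 2) - smooth_step (e^-1 * t + - (e^-1 * s)).

Lemma elem_smooth_time_cutoff (s e : R) : elem_smooth (time_cutoff s e).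
Proof.
have -> : time_cutoff s e = (fun t => smooth_step (1 * t + 2) + (-1) * smooth_step (e^-1 * t + - (e^-1 * s))).
  by apply/funext => t; rewrite mulN1r.
apply: es_add; first exact: (es_affine _ _ elem_smooth_step).
by apply: es_mul; [exact: es_cst|exact: (es_affine _ _ elem_smooth_step)].
Qed.

Lemma time_cutoff1 (s e t : R) : 0 < e -> 0 <= t -> t <= s -> time_cutoff s e t = 1.
Proof.
move=> e0 t0 ts; rewrite /time_cutoff smooth_step1; last lra.
rewrite smooth_step0 ?subr0// -mulrBr mulr_ge0_le0 ?invr_ge0 ?subr_le0//.
exact: ltW.
Qed.

Lemma time_cutoff0 (s e t : R) : 0 < e -> 0 <= s -> t < -2 \/ s + e < t ->
  time_cutoff s e t = 0.
Proof.
move=> e0 s0 [t2|tse]; rewrite /time_cutoff.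
  rewrite !smooth_step0 ?subrr//; first by rewrite -mulrBr mulr_ge0_le0 ?invr_ge0 ?(ltW e0)//; lra.
  by rewrite mul1r; lra.
rewrite !smooth_step1 ?subrr//; last by lra.
by rewrite -mulrBr mulrC ler_pdivlMr// mul1r; lra.
Qed.

Lemma time_cutoff_le1 (s e t : R) : 0 < e -> 0 <= t -> `|time_cutoff s e t| <= 1.
Proof.
move=> e0 t0; rewrite /time_cutoff smooth_step1; last lra.
have := smooth_step_ge0 (e^-1 * t - e^-1 * s); have := smooth_step_le1 (e^-1 * t - e^-1 * s).
by move=> h1 h2; rewrite ger0_norm; lra.
Qed.

Section cutoff_times.
Variables (phi : R -> R) (N s : R).
Hypothesis s0 : 0 <= s.
Hypothesis N0 : 0 <= N.
Hypothesis sphi : elem_smooth phi.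
Hypothesis phiN : forall x, N < `|x| -> phi x = 0.

Lemma cutoff_test (e : R) : 0 < e -> exists psi : test_functions R,
  forall t x, val psi t x = if 0 <= t then time_cutoff s e t * phi x else 0.
Proof.
move=> e0.
have [|psi e1] := @test_functionE R (fun t x => if 0 <= t then time_cutoff s e t * phi x else 0).
  exists (fun z => time_cutoff s e z.1 * phi z.2); split => //.
    apply: smooth_of_elem2; apply: es2_prod => //; exact: elem_smooth_time_cutoff.
  apply: (@compactly_supported_sub _ _ _ (`[-2, s + e]%classic `*` `[- N, N]%classic)).
  - by apply: compact_setX; exact: segment_compact.
  - by apply: compact_closed; [exact: norm_hausdorff|apply: compact_setX; exact: segment_compact].
  - move=> [t x] /= ntx; have [/andP[h1 h2]|h1] := boolP (-2 <= t <= s + e).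
      rewrite phiN ?mulr0// ltNge ler_norml; apply/negP => h3; apply: ntx.
      by rewrite /= !in_itv/= h1 h2.
    rewrite time_cutoff0 ?mul0r//; move: h1; rewrite negb_and -!ltNge => /orP[]; [by left|by right].
by exists psi => t x; rewrite e1.
Qed.

(** phi is the slice at time 0 of one of the cutoff test functions, so [test_bounds] applies to
    it. *)
Lemma space_bounds : exists2 C, 0 <= C &
  (\int[mu]_x `|phi x|%:E <= C%:E)%E /\
  (forall h, (\int[mu]_x `|phi (x + h)%R - phi x|%:E <= (C * `|h|)%:E)%E).
Proof.
have [psi e] := @cutoff_test 1 ltr01.
have [M [C [[M0 C0 _ psiC psih] _]]] := test_bounds psi.
have -> : phi = val psi 0.
  by apply/funext => x; rewrite e lexx time_cutoff1 ?mul1r.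
by exists C.
Qed.

Lemma measurable_space : mR phi.
Proof. by apply: continuous_measurable_fun; exact: elem_smooth_continuous. Qed.

Lemma admissible_indic_prod : admissible (fun t x => \1_(`[0, s]) t * phi x).
Proof.
have [C C0 [phiC _]] := space_bounds.
have mphi := measurable_space.
split.
  apply: measurable_funM; last exact: (measurableT_comp mphi).
  apply: (measurableT_comp (f := \1_(`[0, s]%classic : set (measurableTypeR R)) : measurableTypeR R -> R)) => //.
have iphi : intR (EFin \o phi).
  apply/integrableP; split; first exact/measurable_EFinP.
  by apply: le_lt_trans phiC _; exact: ltry.
by move=> t t0; have := integrableZl measurableT (\1_(`[0, s]) t) iphi.
Qed.

(** The smooth cutoff and the indicator differ, for positive times, only on the window ]s, s + e],
    where the difference is at most |phi|; [noise_sqnorm_window] makes its norm proportional to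
    e. *)
Lemma indic_test_approx (dl : R) : 0 < dl -> exists psi : test_functions R,
  (noise_sqnorm H (fun t x => (val psi t x - \1_(`[0, s]) t * phi x)%R) <= dl%:E)%E.
Proof.
move=> dl0; have [C C0 [phiC phih]] := space_bounds.
have K0 : 0 <= slice_const H * C ^+ 2 by rewrite mulr_ge0 ?sqr_ge0 ?slice_const_ge0.
pose e := dl / (slice_const H * C ^+ 2 + 1).
have e0 : 0 < e by rewrite divr_gt0// ltr_wpDl.
have [psi psiE] := cutoff_test e0; exists psi.
have adm := admissibleB (test_admissible psi) admissible_indic_prod.
have dE t : s < t -> (fun x => val psi t x - \1_(`[0, s]) t * phi x) = (fun x => time_cutoff s e t * phi x).
  move=> st; apply/funext => x; rewrite psiE (le_trans s0 (ltW st)) indicE memNset ?mul0r ?subr0//=.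
  by rewrite in_itv/= => /andP[_]; rewrite leNgt st.
have mphi := measurable_space.
have scale t (f : R -> R) b : 0 <= t -> mR f -> (\int[mu]_x `|f x|%:E <= b%:E)%E ->
    (\int[mu]_x `|time_cutoff s e t * f x|%:E <= b%:E)%E.
  move=> t0 mf; apply: le_trans; apply: integral_mono => [||x|x].
  - by apply: measurableT_comp => //; exact: measurable_funM.
  - exact: measurableT_comp.
  - by [].
  - by rewrite normrM ler_piMl// time_cutoff_le1.
apply: (@le_trans _ _ (slice_const H * (C ^+ 2 * (s + e - s)))%:E).
  apply: (@noise_sqnorm_window R H H0 H1 _ C s (s + e) adm C0 s0).
  - by rewrite lerDl ltW.
  - move=> t x tse t0; rewrite psiE (ltW t0); have [ts|ts] := leP t s.
      by rewrite time_cutoff1 ?(ltW t0)// indicE mem_set ?subrr//= in_itv/= (ltW t0).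
    rewrite time_cutoff0 ?mul0r ?sub0r//; last first.
      by right; rewrite ltNge; apply/negP => ts2; apply: tse; rewrite ts ts2.
    by rewrite indicE memNset ?mul0r ?oppr0//= in_itv/= => /andP[_]; rewrite leNgt ts.
  - move=> t /andP[st _]; have := scale t phi C (le_trans s0 (ltW st)) mphi phiC.
    by have := dE t st => /(congr1 (fun f => \int[mu]_x `|f x|%:E)%E) /= ->.
  - move=> t h /andP[st _].
    have := scale t (fun x => phi (x + h) - phi x) (C * `|h|) (le_trans s0 (ltW st)) _ (phih h).
    have := dE t st => /(congr1 (fun f => \int[mu]_x `|f (x + h)%R - f x|%:E)%E) /= -> h2.
    under eq_integral do rewrite -mulrBr.
    apply: h2; apply: measurable_funB => //.
    by apply: (measurableT_comp mphi); exact: (@measurable_funD _ (measurableTypeR R) R).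
have -> : s + e - s = e by ring.
rewrite lee_fin mulrA /e mulrCA ger_pMr// ler_pdivrMr ?ltr_wpDl//.
by rewrite mul1r lerDl.
Qed.

End cutoff_times.
End time_cutoff.

(** * Gaussian moments and the Wiener integral *)

Section normal_moments.
Context {R : realType}.
Local Notation mu := (@lebesgue_measure R).
Local Notation mR := (measurable_fun [set: measurableTypeR R]).

Lemma normal_Radon_Nikodym (s : R) :
  ae_eq mu setT (Radon_Nikodym (charge_of_finite_measure (normal_prob 0 s)) mu)
    (fun x => (normal_pdf 0 s x)%:E).
Proof.
have dom := normal_prob_dominates (0 : R) s.
rewrite Radon_NikodymE//=.
case: cid => /= h [h1 h2 h3].
apply: integral_ae_eq => //=.
- by apply/measurableT_comp =>//; exact: measurable_normal_pdf.
- by move=> E _ mE; rewrite -h3.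
Qed.

(** The change of density is available for integrable functions; h is therefore truncated at height
    n and the truncation removed by Fatou's lemma. *)
Lemma normal_integral_le (s : R) (h : R -> R) (c : \bar R) : mR h -> (forall x, 0 <= h x) ->
  (\int[mu]_x (h x * normal_pdf 0 s x)%:E <= c)%E ->
  (\int[normal_prob 0 s]_x (h x)%:E <= c)%E.
Proof.
move=> mh h0 hc.
have mpdf : mR (normal_pdf 0 s) by exact: measurable_normal_pdf.
pose hM (n : nat) x := Num.min (h x) n%:R.
have mhM n : mR (hM n) by exact: measurable_minr.
have hM0 n x : 0 <= hM n x by rewrite le_min h0 ler0n.
apply: (@fatou_ae R _ _ (normal_prob 0 s) hM) => //.
- apply: aeW => x; apply: cvg_near_cst; near=> n.
  by rewrite /hM; apply/min_idPl; near: n; exact: nbhs_infty_ger.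
- apply: nearW => n; apply: le_trans hc.
  have iM : (normal_prob 0 s).-integrable [set: measurableTypeR R] (EFin \o hM n).
    apply/integrableP; split; first exact/measurable_EFinP.
    apply: (@le_lt_trans _ _ (\int[normal_prob 0 s]_x (cst n%:R%:E x))%E).
      apply: ge0_le_integral => //.
      + by apply/measurable_EFinP; exact: measurableT_comp.
      + by move=> x _; rewrite /= lee_fin ger0_norm// ge_min lexx orbT.
    by rewrite integral_cst//= probability_setT mule1 ltry.
  rewrite -(Radon_Nikodym_change_of_variables (normal_prob_dominates 0 s) measurableT iM).
  have -> : (\int[mu]_x ((EFin \o hM n) x * (Radon_Nikodym (charge_of_finite_measure (normal_prob 0 s)) mu) x) =
      \int[mu]_x ((hM n x * normal_pdf 0 s x)%:E))%E.
    apply: ae_eq_integral => //.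
    + apply: emeasurable_funM; first exact/measurable_EFinP.
      apply: (measurable_int mu).
      by apply: Radon_Nikodym_integrable; exact: normal_prob_dominates.
    + by apply/measurable_EFinP; exact: measurable_funM.
    + by move: (normal_Radon_Nikodym s); apply: filterS => x /(_ Logic.I) /= ->.
  apply: integral_mono => [||x|x].
  + exact: measurable_funM.
  + exact: measurable_funM.
  + by rewrite mulr_ge0// normal_pdf_ge0.
  + by rewrite ler_wpM2r ?normal_pdf_ge0// ge_min lexx.
Unshelve. all: by end_near. Qed.

Lemma normal_peakE (s : R) : 0 < s -> normal_peak s = (Num.sqrt (2 * pi) * s)^-1.
Proof.
move=> s0; rewrite /normal_peak; congr (_^-1).
have -> : s ^+ 2 * pi *+ 2 = (2 * pi) * s ^+ 2 by rewrite -mulr_natl; ring.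
by rewrite sqrtrM ?mulr_ge0 ?pi_ge0// sqrtr_sqr gtr0_norm.
Qed.

Lemma normal_pdf_opp (s x : R) : normal_pdf 0 (- s) x = normal_pdf 0 s x \/ s = 0.
Proof.
have [->|s0] := eqVneq s 0; first by right.
by left; rewrite !normal_pdfE ?oppr_eq0// /normal_peak /normal_fun sqrrN.
Qed.

(* The Gaussian density of variance [2 s^2] absorbs any power of [x / s]. *)
Lemma normal_pdf_power (n : nat) (s x : R) : 0 < s ->
  x ^+ (2 * n) * normal_pdf 0 s x <=
  2 * n`!%:R * (4 * s ^+ 2) ^+ n * normal_pdf 0 (Num.sqrt 2 * s) x.
Proof.
move=> s0; have q0 : 0 < Num.sqrt 2 :> R by rewrite sqrtr_gt0.
have qs0 : 0 < Num.sqrt 2 * s by rewrite mulr_gt0.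
have q2 : Num.sqrt 2 ^+ 2 = 2 :> R by rewrite sqr_sqrtr.
rewrite !normal_pdfE ?gt_eqF// !normal_peakE//.
rewrite /normal_fun !subr0 [(Num.sqrt 2 * s) ^+ 2]exprMn q2.
set u := x ^+ 2 / (4 * s ^+ 2).
have s20 : 0 < s ^+ 2 by rewrite exprn_gt0.
have u0 : 0 <= u by rewrite divr_ge0 ?sqr_ge0// mulr_ge0// ltW.
have e1 : - x ^+ 2 / (s ^+ 2 *+ 2) = - u - u.
  by rewrite /u -mulr_natr; field; rewrite gt_eqF.
have e2 : - x ^+ 2 / (2 * s ^+ 2 *+ 2) = - u.
  by rewrite /u -mulr_natr; field; rewrite gt_eqF.
rewrite e1 e2 expRD.
have xu : x ^+ (2 * n) = (4 * s ^+ 2) ^+ n * u ^+ n.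
  by rewrite exprM -exprMn /u; congr (_ ^+ _); field; rewrite gt_eqF.
have := exprn_le_expR n u0; rewrite -ler_pdivrMr ?expR_gt0// -expRN => h.
set p := Num.sqrt (2 * pi).
have p0 : 0 < p by rewrite sqrtr_gt0 mulr_gt0// pi_gt0.
have k0 : 0 <= (4 * s ^+ 2) ^+ n by rewrite exprn_ge0// mulr_ge0// ltW.
have q2' : Num.sqrt 2 <= 2 :> R.
  by rewrite -[leRHS]ger0_norm// -sqrtr_sqr ler_sqrt//; lra.
have eq1 : (p * (Num.sqrt 2 * s))^-1 = (Num.sqrt 2)^-1 * (p * s)^-1.
  by rewrite mulrCA invfM.
have le1 : (p * s)^-1 <= 2 * (p * (Num.sqrt 2 * s))^-1.
  rewrite eq1 mulrA -[leLHS]mul1r ler_wpM2r//; first by rewrite invr_ge0 mulr_ge0// ltW.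
  by rewrite ler_pdivlMr// mul1r.
rewrite xu.
have -> : (4 * s ^+ 2) ^+ n * u ^+ n * ((p * s)^-1 * (expR (- u) * expR (- u))) =
   (4 * s ^+ 2) ^+ n * expR (- u) * ((u ^+ n * expR (- u)) * (p * s)^-1) by ring.
have -> : 2 * n`!%:R * (4 * s ^+ 2) ^+ n * ((p * (Num.sqrt 2 * s))^-1 * expR (- u)) =
   (4 * s ^+ 2) ^+ n * expR (- u) * (n`!%:R * (2 * (p * (Num.sqrt 2 * s))^-1)) by ring.
apply: ler_wpM2l; first by rewrite mulr_ge0 ?expR_ge0.
apply: ler_pM => //.
- by rewrite mulr_ge0 ?exprn_ge0 ?expR_ge0.
- by rewrite invr_ge0 mulr_ge0 ?ltW.
Qed.

Lemma normal_moment_le (n : nat) (s : R) : 0 < s ->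
  (\int[normal_prob 0 s]_x (x ^+ (2 * n))%:E <= (2 * n`!%:R * (4 * s ^+ 2) ^+ n)%:E)%E.
Proof.
move=> s0; apply: normal_integral_le.
- exact: measurable_funX.
- by move=> x; rewrite exprM exprn_ge0// sqr_ge0.
have k0 : 0 <= 2 * n`!%:R * (4 * s ^+ 2) ^+ n.
  by rewrite !mulr_ge0// exprn_ge0// mulr_ge0// sqr_ge0.
apply: (@le_trans _ _ (\int[mu]_x (2 * n`!%:R * (4 * s ^+ 2) ^+ n *
   normal_pdf 0 (Num.sqrt 2 * s) x)%:E)%E).
  apply: integral_mono => [||x|x].
  - by apply: measurable_funM; [exact: measurable_funX|exact: measurable_normal_pdf].
  - by apply: measurable_funM => //; exact: measurable_normal_pdf.
  - by rewrite mulr_ge0 ?normal_pdf_ge0// exprM exprn_ge0// sqr_ge0.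
  - exact: normal_pdf_power.
rewrite (integral_scale mu (@measurable_normal_pdf R 0 (Num.sqrt 2 * s))) => [|x|//]; last first.
  exact: normal_pdf_ge0.
by rewrite integral_normal_pdf mule1.
Qed.

(** A lower bound on the second moment without computing it. The segment of length s around 0 has
    mass at most 1/sqrt(2 pi) <= 1/2, so mass at least 1/2 sits where x^2 >= s^2/4. *)
Lemma normal_variance_ge (s v : R) : 0 < s ->
  (\int[normal_prob 0 s]_x (x ^+ 2)%:E <= v%:E)%E -> s ^+ 2 <= 8 * v.
Proof.
move=> s0 sv; pose I : set R := `[- (s / 2), s / 2]%classic.
have mI : measurable (I : set (measurableTypeR R)) by exact: measurable_itv.
have half : (normal_prob 0 s I <= (2^-1)%:E)%E.
  rewrite /normal_prob.
  apply: (@le_trans _ _ (\int[mu]_(x in I) (normal_peak s)%:E)%E).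
    apply: ge0_le_integral => //.
    - by move=> x _; rewrite lee_fin normal_pdf_ge0.
    - by apply: measurable_funTS; apply/measurable_EFinP; exact: measurable_normal_pdf.
    - by move=> x _; rewrite lee_fin normal_pdf_ub// gt_eqF.
  rewrite integral_cst//.
  rewrite [X in (_ * X)%E](_ : _ = (s / 2 - - (s / 2))%:E); last first.
    by apply: lebesgue_measure_segment; lra.
  rewrite -EFinM lee_fin normal_peakE// opprK.
  have -> : s / 2 + s / 2 = s by lra.
  rewrite invfM -mulrA mulVf ?gt_eqF// mulr1.
  rewrite lef_pV2 ?posrE ?sqrtr_gt0 ?mulr_gt0 ?pi_gt0//.
  rewrite -[leLHS]ger0_norm// -sqrtr_sqr ler_sqrt ?mulr_ge0 ?pi_ge0//.
  by have := pi_ge2 R; lra.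
have mc : (normal_prob 0 s (~` I) >= (2^-1)%:E)%E.
  rewrite probability_setC//.
  apply: (@le_trans _ _ (1 - (2^-1)%:E)%E); last by apply: leeB => //; exact: half.
  by rewrite -EFinB lee_fin; lra.
have : (((s / 2) ^+ 2 * 2^-1)%:E <= v%:E)%E.
  apply: le_trans sv.
  apply: (@le_trans _ _ (\int[normal_prob 0 s]_x ((s / 2) ^+ 2 * \1_(~` I) x)%:E)%E).
    rewrite (integral_scale (normal_prob 0 s) (f := \1_(~` I)))//; last first.
    - exact: sqr_ge0.
    - by apply: measurable_indic; exact: measurableC.
    rewrite integral_indic//; last exact: measurableC.
    by rewrite setIT EFinM lee_wpmul2l// lee_fin sqr_ge0.
  apply: integral_mono => [||x|x].
  - by apply: measurable_funM => //; apply: measurable_indic; exact: measurableC.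
  - exact: measurable_funX.
  - by rewrite mulr_ge0// sqr_ge0.
  - rewrite indicE; have [/set_mem xI|_] := boolP (x \in _); last by rewrite mulr0 sqr_ge0.
    rewrite mulr1 -(@real_normK _ x) ?num_real// lerXn2r ?nnegrE ?divr_ge0// ?ltW//.
    rewrite ltNge ler_norml; apply/negP => h; apply: xI.
    by rewrite /I /= in_itv/=.
by rewrite lee_fin expr_div_n; lra.
Qed.

End normal_moments.

Section mean_square.
Context {R : realType} d (Omega : measurableType d) (P : probability Omega R).
Local Notation mO := (measurable_fun [set: Omega]).

Definition mean_sq (Y : Omega -> R) : \bar R := (\int[P]_w (Y w ^+ 2)%:E)%E.

Lemma mean_sqD_le (X Y : Omega -> R) : mO X -> mO Y ->
  (mean_sq (fun w => (X w + Y w)%R) <= 2%:E * mean_sq X + 2%:E * mean_sq Y)%E.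
Proof.
move=> mX mY; apply: integral_le_combination => //.
- by apply/measurable_EFinP; apply: measurable_funX; exact: measurable_funD.
- by apply/measurable_EFinP; exact: measurable_funX.
- by apply/measurable_EFinP; exact: measurable_funX.
- by move=> w; rewrite lee_fin sqr_ge0.
- by move=> w; rewrite lee_fin sqr_ge0.
- by move=> w; rewrite lee_fin sqr_ge0.
move=> w _; rewrite -!EFinM -EFinD lee_fin -subr_ge0.
rewrite [leRHS](_ : _ = (X w - Y w) ^+ 2) ?sqr_ge0//; by ring.
Qed.

Lemma mean_sqZ (a : R) (X : Omega -> R) : mO X ->
  (mean_sq (fun w => (a * X w)%R) = (a ^+ 2)%:E * mean_sq X)%E.
Proof.
move=> mX; rewrite /mean_sq -integral_scale; [|exact: measurable_funX|by move=> w; exact: sqr_ge0|exact: sqr_ge0].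
by apply: eq_integral => w _; rewrite exprMn.
Qed.

Lemma mean_sqB_le (X Y Z : Omega -> R) : mO X -> mO Y -> mO Z ->
  (mean_sq (fun w => (X w - Z w)%R) <=
   2%:E * mean_sq (fun w => (X w - Y w)%R) + 2%:E * mean_sq (fun w => (Y w - Z w)%R))%E.
Proof.
move=> mX mY mZ.
have := @mean_sqD_le (fun w => X w - Y w) (fun w => Y w - Z w).
move=> /(_ (measurable_funB mX mY) (measurable_funB mY mZ)); apply: le_trans.
by rewrite le_eqVlt; apply/orP; left; apply/eqP; apply: eq_integral => w _; rewrite addrA subrK.
Qed.

Lemma mean_sqBC (X Y : Omega -> R) :
  mean_sq (fun w => X w - Y w) = mean_sq (fun w => Y w - X w).
Proof. by apply: eq_integral => w _; rewrite -[in RHS]sqrrN opprB. Qed.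

Lemma mean_sq_le_L2 (Y : Omega -> R) (e : R) : 0 <= e ->
  ('N[P]_2%:E[EFin \o Y] <= e%:E)%E = (mean_sq Y <= (e ^+ 2)%:E)%E.
Proof.
move=> e0.
have h : ('N[P]_2%:E[EFin \o Y] `^ 2 = mean_sq Y)%E.
  rewrite poweR_Lnorm//; apply: eq_integral => w _ /=.
  by rewrite (powR_mulrn 2 (normr_ge0 _)) real_normK ?num_real.
rewrite -h; have N0 := Lnorm_ge0 P 2%:E (EFin \o Y).
move: N0; case: ('N[P]_2%:E[EFin \o Y])%E => [r| |]//=.
  rewrite !lee_fin => r0; rewrite powR_mulrn//.
  by rewrite ler_pXn2r.
by move=> _; rewrite (negbTE (_ : 2 != 0)) ?pnatr_eq0// !leye_eq.
Qed.

Lemma mk_RV (f : Omega -> R) : mO f -> exists X : {RV P >-> R}, X = f :> (Omega -> R).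
Proof.
move=> mf; pose mp := isMeasurableFun.Build _ _ _ _ f mf.
pose X : {mfun Omega >-> R} := HB.pack f mp; by exists X.
Qed.

End mean_square.

Section ereal_small.
Context {R : realType}.

Lemma ge0_cvge0P (u : nat -> \bar R) : (forall n, 0 <= u n)%E ->
  (u n @[n --> \oo] --> 0%E) <->
  (forall e : R, 0 < e -> \forall n \near \oo, (u n <= e%:E)%E).
Proof.
move=> u0; split.
  move=> /fine_cvgP[uf ul] e e0.
  have k := cvgr_le _ ul e e0.
  apply: filterS2 uf (k _) => n un /= ke.
  by rewrite -(fineK un) lee_fin.
move=> ue; apply/fine_cvgP; split.
  have := ue 1 ltr01; apply: filterS => n un.
  by rewrite ge0_fin_numE// (le_lt_trans un)// ltry.
apply/cvgr0Pnorm_le => e e0; have := ue e e0; apply: filterS => n un /=.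
rewrite ger0_norm ?fine_ge0// -lee_fin fineK//.
by rewrite ge0_fin_numE// (le_lt_trans un)// ltry.
Unshelve. all: by end_near. Qed.

Lemma lee_addgt0_lin (x y : \bar R) (k : R) : 0 <= k ->
  (forall e : R, 0 < e -> (x <= y + (k * e)%:E)%E) -> (x <= y)%E.
Proof.
move=> k0 h; apply/lee_addgt0Pr => e e0.
have k1 : 0 < k + 1 by rewrite ltr_wpDl.
apply: le_trans (h (e / (k + 1)) (divr_gt0 e0 k1)) _.
rewrite leeD2l// lee_fin mulrCA ger_pMr// ler_pdivrMr// mul1r lerDl//.
Qed.

Lemma lee_combination (k l : R) (x y : \bar R) (a b : R) : 0 <= k -> 0 <= l ->
  (x <= a%:E)%E -> (y <= b%:E)%E -> (k%:E * x + l%:E * y <= (k * a + l * b)%:E)%E.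
Proof. by move=> k0 l0 xa yb; rewrite EFinD (EFinM k) (EFinM l) leeD// lee_wpmul2l ?lee_fin. Qed.

Lemma lee_combination2 (x y : \bar R) (a b : R) :
  (x <= a%:E)%E -> (y <= b%:E)%E -> (2%:E * x + 2%:E * y <= (2 * a + 2 * b)%:E)%E.
Proof. by apply: lee_combination. Qed.

End ereal_small.

Section wiener.
Context {R : realType} d (Omega : measurableType d) (P : probability Omega R).
Variable H : R.
Hypothesis H0 : 0 < H.
Hypothesis H1 : H < 1.
Variable W : test_functions R -> {RV P >-> R}.
Hypothesis W_noise : fractional_noise H W.
Local Notation mO := (measurable_fun [set: Omega]).
Local Notation intO := (P.-integrable [set: Omega]).
Local Notation ns := (noise_sqnorm H).
Local Notation msq := (mean_sq P).

Let mW phi : mO (W phi). Proof. by []. Qed.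

Lemma W_cov (phi psi : test_functions R) :
  (\int[P]_w (W phi w * W psi w)%:E = (noise_ip H (val phi) (val psi))%:E)%E.
Proof.
have [_ h] := W_noise; have := h phi psi.
by rewrite unlock Re_noise_inner.
Qed.

Lemma W_mean_sq (phi : test_functions R) : msq (W phi) = ns (val phi).
Proof.
rewrite -(noise_ip_sqnorm H0 H1) -W_cov.
by apply: eq_integral => w _; rewrite expr2.
Qed.

Lemma W_mean_sq_lty (phi : test_functions R) : (msq (W phi) < +oo)%E.
Proof. by rewrite W_mean_sq test_noise_lty. Qed.

Lemma W_prod_integrable (phi psi : test_functions R) :
  intO (EFin \o (fun w => W phi w * W psi w)).
Proof.
apply/integrableP; split.
  by apply/measurable_EFinP; exact: measurable_funM.
apply: (@le_lt_trans _ _ (msq (W phi) + msq (W psi))%E); last first.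
  by rewrite lte_add_pinfty// W_mean_sq_lty.
rewrite /mean_sq -integral_add; [|exact: measurable_funX|exact: measurable_funX|
  by move=> w; exact: sqr_ge0|by move=> w; exact: sqr_ge0].
apply: integral_mono => [||w|w].
- by apply: measurableT_comp => //; exact: measurable_funM.
- by apply: measurable_funD; exact: measurable_funX.
- by [].
- set a := W phi w; set b := W psi w.
  have h1 := sqr_ge0 (a - b); have h2 := sqr_ge0 (a + b).
  have h3 := sqr_ge0 a; have h4 := sqr_ge0 b.
  have e1 : (a - b) ^+ 2 = a ^+ 2 + b ^+ 2 - 2 * (a * b) by ring.
  have e2 : (a + b) ^+ 2 = a ^+ 2 + b ^+ 2 + 2 * (a * b) by ring.
  rewrite e1 in h1; rewrite e2 in h2.
  by rewrite ler_norml; apply/andP; split; lra.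
Qed.

Lemma integrable_combination (a : R) (X1 X2 X3 : Omega -> R) :
  intO (EFin \o X1) -> intO (EFin \o X2) -> intO (EFin \o X3) ->
  intO (EFin \o (fun w => X1 w - (a * X2 w + X3 w))) /\
  \int[P]_w (X1 w - (a * X2 w + X3 w)) =
    \int[P]_w X1 w - (a * \int[P]_w X2 w + \int[P]_w X3 w).
Proof.
move=> i1 i2 i3.
have i2' : intO (EFin \o (fun w => a * X2 w)) by have := integrableZl measurableT a i2.
have i23 : intO (EFin \o (fun w => a * X2 w + X3 w)).
  by have := integrableD measurableT i2' i3.
split; first by have := integrableB measurableT i1 i23.
by rewrite RintegralB// RintegralD// RintegralZl.
Qed.

(** W is not assumed linear. With Y the defect of linearity, bilinearity of the covariance gives
    E[Y W(eta)] = 0 for every eta, and Y^2 is a linear combination of such products. *)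
Lemma W_lin (a : R) (phi psi chi : test_functions R) :
  (forall t x, val chi t x = a * val phi t x + val psi t x) ->
  msq (fun w => W chi w - (a * W phi w + W psi w)) = 0%E.
Proof.
move=> chiE.
pose Y w := W chi w - (a * W phi w + W psi w).
have YW eta : intO (EFin \o (fun w => Y w * W eta w)) /\ \int[P]_w (Y w * W eta w) = 0.
  have [h1 h2] := integrable_combination a (W_prod_integrable chi eta)
    (W_prod_integrable phi eta) (W_prod_integrable psi eta).
  have e : (fun w => Y w * W eta w) =
      (fun w => W chi w * W eta w - (a * (W phi w * W eta w) + W psi w * W eta w)).
    by apply/funext => w; rewrite /Y; ring.
  rewrite e; split => //; rewrite h2 /Rintegral !W_cov /=.
  by rewrite (noise_ip_lin H0 H1 eta chiE) subrr.
have [i1 e1] := YW chi; have [i2 e2] := YW phi; have [i3 e3] := YW psi.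
have [h1 h2] := integrable_combination a i1 i2 i3.
have e : (fun w => Y w ^+ 2) = (fun w => Y w * W chi w - (a * (Y w * W phi w) + Y w * W psi w)).
  by apply/funext => w; rewrite /Y; ring.
have fin : msq Y \is a fin_num.
  rewrite /mean_sq; have := integrable_fin_num measurableT h1.
  by congr (_ \is a fin_num); apply: eq_integral => w _; rewrite /= -(congr1 (@^~ w) e).
rewrite -/(msq Y) -(fineK fin); congr (_%:E).
transitivity (\int[P]_w (Y w ^+ 2)); first by [].
by rewrite e h2 e1 e2 e3; ring.
Qed.

(** W(phi) - W(psi) agrees with W(phi - psi) up to a defect of mean square 0 by [W_lin]; the factor
    2 is the price of removing that defect by [mean_sqD_le]. *)
Lemma W_isometry (phi psi : test_functions R) :
  (msq (fun w => (W phi w - W psi w)%R) <=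
   2%:E * ns (fun t x => (val phi t x - val psi t x)%R))%E.
Proof.
have [chi chiE] := test_lin (-1) psi phi.
have h := W_lin chiE.
have -> : ns (fun t x => val phi t x - val psi t x) = ns (val chi).
  by apply: eq_noise_sqnorm => t x _; rewrite chiE; ring.
rewrite -W_mean_sq.
have mL : mO (fun w => W phi w - W psi w) by exact: measurable_funB.
have := mean_sqD_le P (measurable_funB mL (mW chi)) (mW chi).
have -> : msq (fun w => W phi w - W psi w - W chi w) = 0%E.
  rewrite mean_sqBC -h; apply: eq_integral => w _; congr (_ ^+ 2)%:E; ring.
rewrite mule0 add0e; apply: le_trans.
by rewrite le_eqVlt; apply/orP; left; apply/eqP; apply: eq_integral => w _; rewrite subrK.
Qed.

(** One test function per accuracy, instead of a converging sequence: the form in which sums and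
    limits of Wiener integrals are easiest to handle. *)
Definition wiener_approx (g : R -> R -> R) (X : Omega -> R) : Prop :=
  forall e : R, 0 < e -> exists phi : test_functions R,
    (ns (fun t x => (val phi t x - g t x)%R) <= e%:E)%E /\
    (msq (fun w => (W phi w - X w)%R) <= e%:E)%E.

Lemma wiener_integralP (g : R -> R -> R) (X : {RV P >-> R}) :
  wiener_integral H W g X <->
  [/\ admissible g, (ns g < +oo)%E & wiener_approx g X].
Proof.
split.
- move=> [mg ig fg [phi [h1 h2]]]; split => // e e0.
  have /ge0_cvge0P := h1; move=> /(_ (fun n => noise_sqnorm_ge0 H0 H1 _)) /(_ e e0) k1.
  have se0 : 0 < Num.sqrt e by rewrite sqrtr_gt0.
  have /ge0_cvge0P := h2; move=> /(_ (fun n => Lnorm_ge0 _ _ _)) /(_ _ se0) k2.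
  have [n [n1 n2]] := filter_ex (filterI k1 k2).
  exists (phi n); split => //.
  move: n2; rewrite mean_sq_le_L2; last exact: ltW.
  by rewrite sqr_sqrtr; last exact: ltW.
- move=> [[mg ig] fg ap]; split => //.
  have pos n : 0 < n.+1%:R^-1 :> R by rewrite invr_gt0.
  have [phi hphi] : exists phi : nat -> test_functions R, forall n,
     (ns (fun t x => (val (phi n) t x - g t x)%R) <= (n.+1%:R^-1)%:E)%E /\
     (msq (fun w => (W (phi n) w - X w)%R) <= (n.+1%:R^-1)%:E)%E.
    by have /boolp.choice[f hf] := fun n => ap _ (pos n); exists f.
  exists phi; split.
  + apply/ge0_cvge0P => [n|e e0]; first exact: noise_sqnorm_ge0.
    near=> n; have [h _] := hphi n; apply: le_trans h _.
    rewrite lee_fin invf_ple ?posrE//.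
    have : e^-1 <= n%:R by near: n; exact: nbhs_infty_ger.
    by move=> /le_trans; apply; rewrite ler_nat.
  + apply/ge0_cvge0P => [n|e e0]; first exact: Lnorm_ge0.
    near=> n; have [_ h] := hphi n; rewrite mean_sq_le_L2; last exact: ltW.
    apply: le_trans h _.
    rewrite lee_fin invf_ple ?posrE ?exprn_gt0//.
    have : (e ^+ 2)^-1 <= n%:R by near: n; exact: nbhs_infty_ger.
    by move=> /le_trans; apply; rewrite ler_nat.
Unshelve. all: by end_near. Qed.

Lemma wiener_test (phi : test_functions R) : wiener_integral H W (val phi) (W phi).
Proof.
apply/wiener_integralP; split; [exact: test_admissible|exact: test_noise_lty|].
move=> e e0; exists phi; split.
  rewrite (@eq_noise_sqnorm _ _ _ (fun t x => 0 * val phi t x)) => [|t x _]; last by rewrite subrr mul0r.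
  rewrite noise_sqnormZ//; last exact: test_admissible.
  by rewrite expr0n/= mul0e lee_fin ltW.
rewrite /mean_sq (eq_integral (cst 0%E)) ?integral0 ?lee_fin ?ltW// => w _.
by rewrite subrr expr0n.
Qed.

(** Passing from X to X' through W(phi) and W(psi), and back from phi, psi to g, g', uses five
    doublings: hence 32. This suffices because the lemma only serves to turn convergence of
    integrands into convergence of integrals. *)
Lemma wiener_isometry (g g' : R -> R -> R) (X X' : {RV P >-> R}) :
  wiener_integral H W g X -> wiener_integral H W g' X' ->
  (msq (fun w => (X w - X' w)%R) <= 32%:E * ns (fun t x => (g t x - g' t x)%R))%E.
Proof.
move=> /wiener_integralP[ag _ apg] /wiener_integralP[ag' _ apg'].
(* 54 collects the four approximation errors after the doublings: 2, 6, 12, 26, then 54 times e in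
   the chain below. *)
apply: (@lee_addgt0_lin _ _ _ 54) => // e e0.
have [phi [p1 p2]] := apg e e0; have [psi [q1 q2]] := apg' e e0.
have ap := test_admissible phi; have aq := test_admissible psi.
rewrite mean_sqBC in p2; rewrite (noise_sqnormBC H0 H1 aq ag') in q1.
have s1 := mean_sqB_le P (measurable_funPT X) (mW phi) (measurable_funPT X').
have s2 := mean_sqB_le P (mW phi) (mW psi) (measurable_funPT X').
have s3 := W_isometry phi psi.
have s4 := noise_sqnormB_le H0 H1 ap ag aq.
have s5 := noise_sqnormB_le H0 H1 ag ag' aq.
have n0 := noise_sqnorm_ge0 H0 H1 (fun t x => g t x - g' t x).
move: n0 s1 s2 s3 s4 s5 p1 p2 q1 q2.
move: (ns (fun t x => g t x - g' t x)) => A.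
move: (ns (fun t x => g t x - val psi t x)) => B.
move: (ns (fun t x => g' t x - val psi t x)) => C.
move: (ns (fun t x => val phi t x - g t x)) => D.
move: (ns (fun t x => val phi t x - val psi t x)) => E.
move: (msq (fun w => X w - X' w)) => a; move: (msq (fun w => X w - W phi w)) => b.
move: (msq (fun w => W phi w - X' w)) => c; move: (msq (fun w => W phi w - W psi w)) => f.
move: (msq (fun w => W psi w - X' w)) => h.
move=> A0 s1 s2 s3 s4 s5 p1 p2 q1 q2.
case: A A0 s5 => [A| |] // A0 s5; last by rewrite gt0_muley ?lte_fin// addye ?leey.
have k5 : (B <= (2 * A + 2 * e)%:E)%E by apply: le_trans s5 _; exact: lee_combination.
have k4 : (E <= (2 * e + 2 * (2 * A + 2 * e))%:E)%E.
  by apply: le_trans s4 _; exact: lee_combination.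
have k3 : (f <= (2 * (2 * e + 2 * (2 * A + 2 * e)))%:E)%E.
  by apply: le_trans s3 _; rewrite [leRHS]EFinM lee_wpmul2l.
have k2 : (c <= (2 * (2 * (2 * e + 2 * (2 * A + 2 * e))) + 2 * e)%:E)%E.
  by apply: le_trans s2 _; exact: lee_combination.
apply: le_trans s1 _.
apply: (@le_trans _ _ (2 * e + 2 * (2 * (2 * (2 * e + 2 * (2 * A + 2 * e))) + 2 * e))%:E).
  exact: lee_combination.
by rewrite -EFinM -EFinD lee_fin; lra.
Qed.

Lemma wiener_unique (g : R -> R -> R) (X X' : {RV P >-> R}) :
  wiener_integral H W g X -> wiener_integral H W g X' ->
  {ae P, forall w, X w = X' w}.
Proof.
move=> wX wX'; have := wiener_isometry wX wX'.
rewrite (@eq_noise_sqnorm _ _ _ (fun t x => 0 * g t x)) => [|t x _]; last by rewrite subrr mul0r.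
have /wiener_integralP[ag fg _] := wX.
rewrite noise_sqnormZ// expr0n/= mul0e mule0 => h.
have mXX : mO (fun w => (X w - X' w) ^+ 2) by apply: measurable_funX; exact: measurable_funB.
have e0 : (\int[P]_w `|((X w - X' w) ^+ 2)%:E| = 0)%E.
  apply/eqP; rewrite eq_le integral_ge0// andbT; apply: le_trans h.
  by rewrite le_eqVlt; apply/orP; left; apply/eqP; apply: eq_integral => w _;
    rewrite gee0_abs// lee_fin sqr_ge0.
have mE : measurable_fun [set: Omega] (fun w => ((X w - X' w) ^+ 2)%:E) by apply/measurable_EFinP.
have := (ae_eq_integral_abs P measurableT mE).1 e0.
apply: filterS => w /(_ I) /= [] /eqP; rewrite sqrf_eq0 subr_eq0 => /eqP//.
Qed.

End wiener.

Section wiener_closure.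
Context {R : realType} d (Omega : measurableType d) (P : probability Omega R).
Variable H : R.
Hypothesis H0 : 0 < H.
Hypothesis H1 : H < 1.
Variable W : test_functions R -> {RV P >-> R}.
Hypothesis W_noise : fractional_noise H W.
Local Notation mO := (measurable_fun [set: Omega]).
Local Notation ns := (noise_sqnorm H).
Local Notation msq := (mean_sq P).
Local Notation wi := (wiener_integral H W).

Lemma wiener_lin (a : R) (g g' : R -> R -> R) (X X' : {RV P >-> R}) :
  wi g X -> wi g' X' ->
  exists2 Y : {RV P >-> R}, wi (fun t x => a * g t x + g' t x) Y &
    Y = (fun w => a * X w + X' w) :> (Omega -> R).
Proof.
move=> /(wiener_integralP H0 H1)[ag fg apg] /(wiener_integralP H0 H1)[ag' fg' apg'].
have maX : mO (fun w => a * X w) by exact: measurable_funM.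
have [Y YE] := mk_RV P (measurable_funD maX (measurable_funPT X')).
have aag := admissibleZ a ag.
exists Y; last exact: YE.
apply/(wiener_integralP H0 H1); split; first exact: admissibleD.
  apply: le_lt_trans (noise_sqnormD_le H0 H1 aag ag') _.
  rewrite noise_sqnormZ//; move: fg fg'.
  have := noise_sqnorm_ge0 H0 H1 g; have := noise_sqnorm_ge0 H0 H1 g'.
  by case: (ns g) => [r| |]//; case: (ns g') => [r'| |]//= _ _ _ _; rewrite -!EFinM -EFinD ltry.
move=> e e0; have k0 : 0 < 4 * a ^+ 2 + 4 by rewrite ltr_wpDl// mulr_ge0 ?sqr_ge0.
(* Two doublings turn errors e1 for both integrals into (4 a^2 + 4) e1 for the combination. *)
pose e1 := e / (4 * a ^+ 2 + 4); have e10 : 0 < e1 by rewrite divr_gt0.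
have ee : e = (4 * a ^+ 2 + 4) * e1 by rewrite /e1 mulrC divfK// gt_eqF.
have [phi [p1 p2]] := apg e1 e10; have [psi [q1 q2]] := apg' e1 e10.
have [chi chiE] := test_lin a phi psi; exists chi.
have ap := test_admissible phi; have aq := test_admissible psi.
have a2 : (0 <= (a ^+ 2)%:E)%E by rewrite lee_fin sqr_ge0.
split.
  rewrite (@eq_noise_sqnorm _ _ _ (fun t x =>
    a * (val phi t x - g t x) + (val psi t x - g' t x))); last first.
    by move=> t x _; rewrite chiE; ring.
  have apg1 := admissibleB ap ag.
  have h := noise_sqnormD_le H0 H1 (admissibleZ a apg1) (admissibleB aq ag').
  apply: le_trans h _; rewrite noise_sqnormZ//.
  apply: (@le_trans _ _ (2 * (a ^+ 2 * e1) + 2 * e1)%:E).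
    apply: lee_combination2; last exact: q1.
    by rewrite (EFinM (a ^+ 2)); exact: (lee_wpmul2l a2 p1).
  rewrite lee_fin ee mulrDl; have : 0 <= a ^+ 2 * e1 by rewrite mulr_ge0 ?sqr_ge0// ltW.
  by move=> ?; lra.
have m1 : mO (fun w => W phi w - X w) by exact: measurable_funB.
have m2 : mO (fun w => W psi w - X' w) by exact: measurable_funB.
have m1a : mO (fun w => a * (W phi w - X w)) by exact: measurable_funM.
have mL : mO (fun w => a * W phi w + W psi w).
  by apply: measurable_funD => //; exact: measurable_funM.
have h1 := mean_sqB_le P (measurable_funPT (W chi)) mL (measurable_funPT Y).
apply: le_trans h1 _; rewrite (W_lin H0 H1 W_noise chiE) mule0 add0e.
have -> : msq (fun w => a * W phi w + W psi w - Y w) =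
    msq (fun w => a * (W phi w - X w) + (W psi w - X' w)).
  by apply: eq_integral => w _; rewrite YE/=; congr (_ ^+ 2)%:E; ring.
have h2 := mean_sqD_le P m1a m2; rewrite mean_sqZ// in h2.
apply: (@le_trans _ _ (2 * (2 * (a ^+ 2 * e1) + 2 * e1))%:E).
  rewrite [leRHS]EFinM lee_wpmul2l//; apply: le_trans h2 _.
  apply: lee_combination2; last exact: q2.
    by rewrite (EFinM (a ^+ 2)); exact: (lee_wpmul2l a2 p2).
by rewrite lee_fin ee le_eqVlt; apply/orP; left; apply/eqP; ring.
Qed.

Lemma mean_sq_cvg_cauchy (X : nat -> Omega -> R) (n : nat) (c : R) :
  (forall k, mO (X k)) -> {ae P, forall w, X k w @[k --> \oo] --> limit_fun X w} ->
  (forall m, (n <= m)%N -> (msq (fun w => (X n w - X m w)%R) <= c%:E)%E) ->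
  (msq (fun w => (X n w - limit_fun X w)%R) <= c%:E)%E.
Proof.
move=> mX cX h.
have mL : mO (limit_fun X) by exact: measurable_limit_fun.
apply: (@fatou_ae _ _ _ P (fun m w => (X n w - X m w) ^+ 2)).
- by move=> m; apply: measurable_funX; exact: measurable_funB.
- by apply: measurable_funX; exact: measurable_funB.
- by move=> *; exact: sqr_ge0.
- by move=> *; exact: sqr_ge0.
- apply: filterS cX => w cw; rewrite expr2; under eq_fun do rewrite expr2.
  by apply: cvgM; (apply: cvgB; [exact: cvg_cst|]).
- by near=> m; apply: h; near: m; exact: nbhs_infty_ge.
Unshelve. all: by end_near. Qed.

(** Completeness of the space of Wiener integrals. The predicate S records a property of the
    approximants, such as measurability for a smaller sigma-algebra; since X is the function
    [limit_fun Xn] itself and not merely an almost sure limit, such measurability is inherited by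
    X. *)
Lemma wiener_limit (S : {RV P >-> R} -> Prop) (g : R -> R -> R) : admissible g ->
  (forall e : R, 0 < e -> exists g' X',
     [/\ wi g' X', S X' & (ns (fun t x => (g' t x - g t x)%R) <= e%:E)%E]) ->
  exists (X : {RV P >-> R}) (Xn : nat -> {RV P >-> R}),
    [/\ wi g X, forall n, S (Xn n) & X = limit_fun Xn :> (Omega -> R)].
Proof.
move=> ag h.
have e0 n : 0 < (4 ^+ n)^-1 :> R by rewrite invr_gt0 exprn_gt0.
have /boolp.choice[f hf] : forall n, exists gX : (R -> R -> R) * {RV P >-> R},
    [/\ wi gX.1 gX.2, S gX.2 & (ns (fun t x => (gX.1 t x - g t x)%R) <= ((4 ^+ n)^-1)%:E)%E].
  by move=> n; have [g' [X' h']] := h _ (e0 n); exists (g', X').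
pose gn n := (f n).1; pose Xn n := (f n).2.
have wn n : wi (gn n) (Xn n) by have [] := hf n.
have an n : admissible (gn n) by have /(wiener_integralP H0 H1)[] := wn n.
have nn n : (ns (fun t x => (gn n t x - g t x)%R) <= ((4 ^+ n)^-1)%:E)%E by have [] := hf n.
have mXn n : mO (Xn n) by [].
have cau n m : (n <= m)%N -> (msq (fun w => (Xn n w - Xn m w)%R) <= (128 * (4 ^+ n)^-1)%:E)%E.
  move=> nm; apply: le_trans (wiener_isometry H0 H1 W_noise (wn n) (wn m)) _.
  have k := noise_sqnormB_le H0 H1 (an n) ag (an m).
  rewrite (noise_sqnormBC H0 H1 ag (an m)) in k.
  apply: (@le_trans _ _ (32 * (2 * (4 ^+ n)^-1 + 2 * (4 ^+ n)^-1))%:E); last first.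
    by rewrite lee_fin; lra.
  rewrite [leRHS]EFinM lee_wpmul2l//; apply: le_trans k _.
  apply: lee_combination2; first exact: nn.
  apply: le_trans (nn m) _.
  by rewrite lee_fin lef_pV2 ?posrE ?exprn_gt0// ler_weXn2l// ler1n.
have cX : {ae P, forall w, Xn k w @[k --> \oo] --> limit_fun Xn w}.
  (* 12^2 = 144 dominates the constant 128 of the mean-square bound, and 4^(-n) becomes 2^(-n) in
     L1. *)
  apply: (@ae_cauchy_fast _ _ _ P (fun n => Xn n : Omega -> R) 12) => // n.
  apply: L1_le_L2; [exact: measurable_funB|by rewrite divr_gt0 ?exprn_gt0|].
  have := cau n n.+1 (leqnSn n); rewrite /mean_sq -/(mean_sq P _).
  rewrite mean_sqBC => k; apply: le_trans k _.
  have -> : (12 / 2 ^+ n) ^+ 2 = 144 / 4 ^+ n :> R.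
    by rewrite expr_div_n -exprM mulnC exprM; congr (_ / _ ^+ _); lra.
  by rewrite lee_fin ler_pM2r ?invr_gt0 ?exprn_gt0//; lra.
have mL : mO (limit_fun (fun n => Xn n : Omega -> R)) by exact: measurable_limit_fun.
have [X XE] := mk_RV P mL.
exists X, Xn; split => //; last by move=> n; have [] := hf n.
have lim n : (msq (fun w => (Xn n w - X w)%R) <= (128 * (4 ^+ n)^-1)%:E)%E.
  by rewrite XE; apply: mean_sq_cvg_cauchy => // m; exact: cau.
have small (e : R) : 0 < e -> exists n, 128 * (4 ^+ n)^-1 <= e :> R.
  move=> ep; have [N /ltW hN] : exists N : nat, 128 / e < N%:R.
    by exists (Num.truncn (128 / e)).+1; exact: truncnS_gt.
  exists N; rewrite ler_pdivrMr ?exprn_gt0// mulrC -ler_pdivrMr//.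
  apply: le_trans hN _; rewrite -natrX ler_nat ltnW//; exact: ltn_expl.
apply/(wiener_integralP H0 H1); split => //.
  have /(wiener_integralP H0 H1)[_ fin0 _] := wn 0%N.
  have a0 := an 0%N.
  have := noise_sqnormD_le H0 H1 (admissibleB ag a0) a0.
  rewrite (@eq_noise_sqnorm _ _ _ g) => [|t x _]; last by rewrite subrK.
  move=> k; apply: le_lt_trans k _; rewrite (noise_sqnormBC H0 H1 ag a0).
  have := nn 0%N; have := noise_sqnorm_ge0 H0 H1 (fun t x => gn 0%N t x - g t x).
  have := noise_sqnorm_ge0 H0 H1 (gn 0%N); move: fin0; rewrite -/(gn 0%N).
  by case: (ns _) => [r| |]//; case: (ns _) => [r'| |]//= _ _ _ _; rewrite -!EFinM -EFinD ltry.
move=> e ep; have [n hn] := small (e / 4) (divr_gt0 ep (ltr0n _ 4)).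
have /(wiener_integralP H0 H1)[_ _ apn] := wn n.
have [phi [p1 p2]] := apn (e / 4) (divr_gt0 ep (ltr0n _ 4)).
have ap := test_admissible phi; exists phi; split.
  apply: le_trans (noise_sqnormB_le H0 H1 ap (an n) ag) _.
  apply: (@le_trans _ _ (2 * (e / 4) + 2 * (e / 4))%:E); last by rewrite lee_fin; lra.
  apply: lee_combination2; first exact: p1.
  apply: le_trans (nn n) _; rewrite lee_fin.
  have := e0 n; lra.
apply: le_trans (mean_sqB_le P (measurable_funPT (W phi)) (mXn n) (measurable_funPT X)) _.
apply: (@le_trans _ _ (2 * (e / 4) + 2 * (e / 4))%:E); last by rewrite lee_fin; lra.
by apply: lee_combination2; [exact: p2|apply: le_trans (lim n) _].
Qed.

Lemma even_moment_law (X : {RV P >-> R}) (nu : {measure set (measurableTypeR R) -> \bar R}) (k : nat) :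
  (forall B : set (measurableTypeR R), measurable B -> pushforward P X B = nu B) ->
  (\int[P]_w (X w ^+ (2 * k))%:E = \int[nu]_x (x ^+ (2 * k))%:E)%E.
Proof.
move=> XE.
have mX : measurable_fun [set: Omega] (X : Omega -> measurableTypeR R) by exact: (measurable_funPT X).
pose mp := isMeasurableFun.Build _ _ Omega (measurableTypeR R) X mX.
pose Y : {mfun Omega >-> measurableTypeR R} := HB.pack (X : Omega -> measurableTypeR R) mp.
have -> : (\int[P]_w (X w ^+ (2 * k))%:E = \int[pushforward P Y]_x (x ^+ (2 * k))%:E)%E.
  rewrite ge0_integral_pushforward// => [|x _]; last by rewrite lee_fin exprM exprn_ge0 ?sqr_ge0.
  by apply/measurable_EFinP; exact: measurable_funX.
by apply: eq_measure_integral => A mA _; exact: XE.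
Qed.

(** The moment bound 4 s^2 of [normal_moment_le] with s^2 <= 8v from [normal_variance_ge] gives
    32v. *)
Lemma gaussian_moment_le (n : nat) (X : {RV P >-> R}) (v : R) : 0 <= v ->
  centered_gaussian P X -> (msq X <= v%:E)%E ->
  (\int[P]_w (X w ^+ (2 * n))%:E <= (2 * n`!%:R * (32 * v) ^+ n)%:E)%E.
Proof.
move=> v0 gX vX.
have c1 : 1 <= 2 * n`!%:R :> R.
  by rewrite -natrM ler1n muln_gt0 fact_gt0.
case: gX => [[s s0 sE]|dE].
  (* The law depends on s only through s^2. *)
  wlog s1 : s s0 sE / 0 < s.
    move=> wl; have [sp|sn] := ltP 0 s; first exact: (wl s).
    apply: (wl (- s)); rewrite ?oppr_eq0 ?oppr_gt0 ?lt_neqAle ?s0//.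
    move=> B mB; rewrite sE//; apply: eq_integral => x _.
    by have [->//|e] := normal_pdf_opp s x; rewrite e eqxx in s0.
  have pE k : (\int[P]_w (X w ^+ (2 * k))%:E = \int[normal_prob 0 s]_x (x ^+ (2 * k))%:E)%E.
    exact: even_moment_law.
  have sv : s ^+ 2 <= 8 * v.
    apply: normal_variance_ge => //; apply: le_trans vX; rewrite /mean_sq.
    by have := pE 1%N; rewrite muln1 => ->.
  rewrite pE; apply: le_trans (normal_moment_le n s1) _.
  rewrite lee_fin ler_wpM2l ?(le_trans _ c1)//; have s2 := sqr_ge0 s.
  by apply: lerXn2r; rewrite ?nnegrE; lra.
rewrite (even_moment_law (nu := @dirac _ (measurableTypeR R) 0 R))//.
rewrite integral_dirac// ?diracT ?mul1e; last by apply/measurable_EFinP; exact: measurable_funX.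
rewrite lee_fin; case: n c1 => [|n] c1; first by rewrite muln0 !expr0 mulr1.
by rewrite mulnS/= expr0n mulr_ge0 ?exprn_ge0 ?mulr_ge0.
Qed.

(** Gaussianity is used at the approximating test functions, whose norm is at most 2v + 2v; Fatou's
    lemma carries the bound to X. Hence 128 = 32 times 4. *)
Lemma wiener_moment_le (n : nat) (g : R -> R -> R) (X : {RV P >-> R}) (v : R) : 0 < v ->
  wi g X -> (ns g <= v%:E)%E ->
  (\int[P]_w (X w ^+ (2 * n))%:E <= (2 * n`!%:R * (128 * v) ^+ n)%:E)%E.
Proof.
move=> v0 /(wiener_integralP H0 H1)[ag _ apg] gv.
have e0 k : 0 < (4 ^+ k)^-1 :> R by rewrite invr_gt0 exprn_gt0.
(* The accuracy v controls the norms of the test functions, the accuracy 4^(-k) gives almost sure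
   convergence. *)
have m0 k : 0 < Num.min v (4 ^+ k)^-1 by rewrite lt_min v0/=.
have /boolp.choice[phi hphi] := fun k => apg _ (m0 k).
have c1 : 0 <= 2 * n`!%:R :> R by rewrite mulr_ge0.
have h k : (\int[P]_w (W (phi k) w ^+ (2 * n))%:E <= (2 * n`!%:R * (128 * v) ^+ n)%:E)%E.
  have [p1 _] := hphi k; have ap := test_admissible (phi k).
  have q : (msq (W (phi k)) <= (4 * v)%:E)%E.
    rewrite (W_mean_sq H0 H1 W_noise).
    have := noise_sqnormD_le H0 H1 (admissibleB ap ag) ag.
    rewrite (@eq_noise_sqnorm _ _ _ (val (phi k))) => [|t x _]; last by rewrite subrK.
    move=> k1; apply: le_trans k1 _.
    apply: (@le_trans _ _ (2 * v + 2 * v)%:E); last by rewrite lee_fin; lra.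
    apply: lee_combination2; last exact: gv.
    by apply: le_trans p1 _; rewrite lee_fin ge_min lexx.
  have gs : centered_gaussian P (W (phi k)).
    have [gf _] := W_noise; have := gf 1%N (fun=> 1) (fun=> phi k).
    by under eq_fun do rewrite big_ord1 mul1r.
  have v4 : 0 <= 4 * v by rewrite mulr_ge0// ltW.
  apply: le_trans (gaussian_moment_le n v4 gs q) _.
  by rewrite lee_fin ler_wpM2l// (_ : 32 * (4 * v) = 128 * v)//; ring.
apply: (@fatou_ae _ _ _ P (fun k w => W (phi k) w ^+ (2 * n))).
- by move=> k; exact: measurable_funX.
- exact: measurable_funX.
- by move=> *; rewrite exprM exprn_ge0 ?sqr_ge0.
- by move=> *; rewrite exprM exprn_ge0 ?sqr_ge0.
- have cX : {ae P, forall w, W (phi k) w @[k --> \oo] --> X w}.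
    apply: (@ae_cvg_fast _ _ _ P (fun k => W (phi k) : Omega -> R) X 1) => // k.
    apply: L1_le_L2; [exact: measurable_funB|by rewrite divr_gt0 ?exprn_gt0|].
    have [_ q] := hphi k; apply: le_trans q _.
    have -> : (1 / 2 ^+ k) ^+ 2 = (4 ^+ k)^-1 :> R.
      by rewrite expr_div_n expr1n -exprM mulnC exprM mul1r; congr (_ ^+ _)^-1; lra.
    by rewrite lee_fin ge_min lexx orbT.
  apply: filterS cX => w cw.
  elim: (2 * n)%N => [|m IH]; first by under eq_fun do rewrite expr0; exact: cvg_cst.
  by rewrite exprS; under eq_fun do rewrite exprS; exact: cvgM.
- exact: nearW.
Qed.

End wiener_closure.

(** * The filtration of the noise *)

Section filtration.
Context {R : realType} d (Omega : measurableType d) (P : probability Omega R).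
Hypothesis P_complete : measure_is_complete P.
Variable H : R.
Hypothesis H0 : 0 < H.
Hypothesis H1 : H < 1.
Variable W : test_functions R -> {RV P >-> R}.
Hypothesis W_noise : fractional_noise H W.
Local Notation ns := (noise_sqnorm H).
Local Notation msq := (mean_sq P).
Local Notation wi := (wiener_integral H W).

(** The generating family of [noise_filtration], named so that measurability at time t becomes
    measurability of functions on the space [noise_space t]. *)
Definition noise_generators (t : R) : set (set Omega) :=
  [set A | exists (s : R) (phi : R -> R) (X : {RV P >-> R}),
     [/\ 0 <= s <= t, smooth phi, compactly_supported phi,
         wi (fun r x => \1_(`[0, s]) r * phi x) X &
         exists2 B : set R, measurable B & A = X @^-1` B]]
  `|` P.-negligible.

Definition noise_space (t : R) := g_sigma_algebraType (noise_generators t).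

Lemma noise_space_sub (s t : R) : s <= t ->
  measurable_fun [set: noise_space t] (id : noise_space t -> noise_space s).
Proof.
move=> st _ B mB; rewrite setTI preimage_id.
apply: (sub_sigma_algebra2 _ (M := noise_generators s)) mB => A [[r [phi [X [/andP[r0 rs] ? ? ? ?]]]]|]; last by right.
by left; exists r, phi, X; split => //; rewrite r0 (le_trans rs).
Qed.

(** Completeness of P enters here: the negligible generators have to be measurable sets. *)
Lemma measurable_noise_space (t : R) :
  measurable_fun [set: Omega] (id : Omega -> noise_space t).
Proof.
move=> _ B mB; rewrite setTI preimage_id; move: B mB.
apply: smallest_sub; first exact: sigma_algebra_measurable.
move=> A [[r [phi [X [_ _ _ _ [B mB ->]]]]]|nA].
  by rewrite -[X in measurable X]setTI; exact: (measurable_funPT X).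
exact: P_complete.
Qed.

Definition noise_adapted (t : R) (g : R -> R -> R) : Prop :=
  exists2 X : {RV P >-> R}, wi g X & measurable_fun [set: noise_space t] X.

Lemma noise_adapted_lin (t a : R) (g g' : R -> R -> R) :
  noise_adapted t g -> noise_adapted t g' -> noise_adapted t (fun s x => a * g s x + g' s x).
Proof.
move=> [X wX mX] [X' wX' mX']; have [Y wY YE] := wiener_lin H0 H1 W_noise a wX wX'.
exists Y => //; rewrite YE.
by apply: measurable_funD => //; apply: measurable_funM.
Qed.

Lemma noise_adapted_admissible t g : noise_adapted t g -> admissible g.
Proof. by move=> [X /(wiener_integralP H0 H1)[]]. Qed.

Lemma noise_adapted_limit (t : R) (g : R -> R -> R) : admissible g ->
  (forall e : R, 0 < e -> exists2 g', noise_adapted t g' &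
     (ns (fun s x => (g' s x - g s x)%R) <= e%:E)%E) ->
  noise_adapted t g.
Proof.
move=> ag h.
have [|X [Xn [wX mX XE]]] := wiener_limit H0 H1 W_noise
  (S := fun X => measurable_fun [set: noise_space t] X) ag.
  by move=> e /h[g' [X' wX' mX']] ns'; exists g', X'.
by exists X => //; rewrite XE; exact: measurable_limit_fun.
Qed.

Lemma eq_noise_adapted t g g' : (forall s x, g s x = g' s x) ->
  noise_adapted t g -> noise_adapted t g'.
Proof. by move=> gg; have -> : g' = g by apply/funext => s; apply/funext => x. Qed.

(** Once some version X of the integral exists, its preimages are themselves generators of the
    sigma-algebra at time t. *)
Lemma noise_adapted_indic (t s N : R) (phi : R -> R) : 0 <= s <= t ->
  elem_smooth phi -> (forall x, N < `|x| -> phi x = 0) ->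
  noise_adapted t (fun r x => \1_(`[0, s]) r * phi x).
Proof.
move=> /andP[s0 st] sphi phiN.
have ad := admissible_indic_prod s0 sphi phiN.
have [|X [_ [wX _ _]]] := wiener_limit H0 H1 W_noise (S := fun=> True) ad.
  move=> e e0; have [psi h] := indic_test_approx H0 H1 s0 sphi phiN e0.
  by exists (val psi), (W psi); split => //; exact: wiener_test.
exists X => // _ B mB; rewrite setTI; apply: sub_sigma_algebra; left.
exists s, phi, X; split; rewrite ?s0//; [exact: smooth_of_elem| |by exists B].
apply: (@compactly_supported_sub _ _ phi `[- N, N]%classic).
- exact: segment_compact.
- exact: interval_closed.
- by move=> x /=; rewrite in_itv/= -ler_norml => /negP; rewrite -ltNge; exact: phiN.
Qed.

End filtration.

(** * Regular kernels *)

Section power_slices.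
Context {R : realType}.
Local Notation mu := (@lebesgue_measure R).
Local Notation mR := (measurable_fun [set: measurableTypeR R]).
Local Notation intR := (mu.-integrable [set: measurableTypeR R]).
Local Notation mRR := (measurable_fun [set: measurableTypeR R * measurableTypeR R]).
Variables H T : R.
Hypothesis H0 : 0 < H.
Hypothesis H1 : H < 1.
Hypothesis T0 : 0 < T.
Local Notation ns := (noise_sqnorm H).

Definition open_time (t0 : R) : set R := `]0, t0[%classic.

Lemma measurable_open_time (t0 : R) : mR (\1_(open_time t0) : R -> R).
Proof. by apply: measurable_indic; exact: measurable_itv. Qed.

Lemma open_timeE (t0 s : R) : \1_(open_time t0) s = (if 0 < s < t0 then 1 else 0) :> R.
Proof.
rewrite indicE; case: ifPn => h; first by rewrite mem_set//= /open_time/= in_itv.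
by rewrite memNset//= /open_time/= in_itv/=; exact/negP.
Qed.

Lemma measurable_powR_rev (t0 c : R) : mR (fun s => (t0 - s) `^ c).
Proof. by apply: measurable_powR_comp; apply: measurable_funB. Qed.

Lemma integral_power_rev (t0 c : R) : 0 < c -> 0 < t0 ->
  (\int[mu]_s (\1_(open_time t0) s * (t0 - s) `^ (c - 1))%:E <= (t0 `^ c / c)%:E)%E.
Proof.
move=> c0 t00; apply: le_trans (integral_powR_0T c0 t00).
have mp : mR (fun s => s `^ (c - 1)) by apply: measurable_powR_comp.
rewrite [leRHS]integral_indicr.
pose f s := \1_(open_time t0) (t0 - s) * s `^ (c - 1).
have mf : mR f.
  apply: measurable_funM => //; apply: (measurableT_comp (measurable_open_time t0)).
  exact: measurable_funB.
have f0 s : 0 <= f s by rewrite mulr_ge0 ?powR_ge0 // open_timeE; case: ifP.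
have <- : (\int[mu]_s (f (t0 - s))%:E =
    \int[mu]_s (\1_(open_time t0) s * (t0 - s) `^ (c - 1))%:E)%E.
  by apply: eq_integral => s _; rewrite /f opprB addrC subrK.
rewrite (ge0_integral_reflect t0 (f := EFin \o f)).
- apply: integral_mono => // [|s].
    by apply: measurable_funM => //; apply: measurable_indic; exact: measurable_itv.
  rewrite /f mulrC ler_wpM2l ?powR_ge0// open_timeE; case: ifPn => //.
  move=> h; rewrite indicE mem_set//= in_itv/=; lra.
- exact/measurable_EFinP.
- by move=> s; rewrite lee_fin.
Qed.

(** Slice bounds with al = C e (t0-s)^(-1/4) and be = C (t0-s)^(-1/2), singular at the final time
    t0. The parameter e is the size of an increment; it appears in the L1 bound only, since
    translation moduli do not shrink with the increment. *)
Definition power_slices (C e t0 : R) (g : R -> R -> R) : Prop :=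
  [/\ admissible g,
   forall s, 0 < s < t0 ->
     (\int[mu]_x `|g s x|%:E <= (C * e * (t0 - s) `^ (- 4^-1))%:E)%E,
   forall s h, 0 < s < t0 ->
     (\int[mu]_x `|g s (x + h)%R - g s x|%:E <= (C * (t0 - s) `^ (- 2^-1) * `|h|)%:E)%E &
   forall s x, t0 < s -> g s x = 0].

(** Ensures al <= be on [0, T], as [noise_sqnorm_le] demands. *)
Lemma powR4_le (t : R) : 0 < t <= T -> t `^ (- 4^-1) <= (1 + T) * t `^ (- 2^-1).
Proof.
move=> /andP[t0 tT]; have -> : - 4^-1 = 4^-1 + - 2^-1 :> R by lra.
rewrite powRD; last by rewrite (gt_eqF t0) implybT.
rewrite ler_wpM2r ?powR_ge0//.
have [t1|t1] := leP t 1.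
  apply: (@le_trans _ _ 1); last by have := T0; lra.
  have := @ge0_ler_powR R 4^-1 _ t 1; rewrite powR1; apply => //; rewrite ?nnegrE ?ltW//.
apply: (@le_trans _ _ (t `^ 1)); last by rewrite powRr1 ?ltW//; lra.
by apply: ler_powR; [exact: ltW|lra].
Qed.

Definition noise_power_const (C : R) : R :=
  slice_const H * (C `^ H * (C * (1 + T)) `^ (2 - H)) * (T `^ (H / 4) / (H / 4)).

(** [power_slices] says nothing about the slice at t0, where the bounds are singular; that slice is
    erased at no cost. *)
Lemma noise_sqnorm_off (g : R -> R -> R) (t0 : R) : admissible g ->
  ns g = ns (fun s x => (s != t0)%:R * g s x).
Proof.
move=> [mg ig]; rewrite !noise_sqnormE.
have mne : mR (fun s => (s != t0)%:R : R).
  have -> : (fun s => (s != t0)%:R : R) = \1_(~` [set t0]).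
    apply/funext => s; rewrite indicE; case: eqP => [->|h].
      by rewrite memNset//=; apply.
    by rewrite mem_set.
  by apply: measurable_indic; apply: measurableC.
apply: ae_eq_integral => //.
- by apply: measurable_funTS; exact: measurable_slice_norm.
- apply: measurable_funTS; apply: measurable_slice_norm.
  by apply: measurable_funM => //; exact: (measurableT_comp mne).
- exists [set t0]; split => //; first exact: lebesgue_measure_set1.
  move=> s /= h; apply: contrapT => /eqP st; apply: h => _.
  by apply: eq_integral => xi _; under [in RHS]eq_fun do rewrite st mul1r.
Qed.

(** The time exponent is -H/4 - (2-H)/2 = H/4 - 1 > -1, so the time integral converges for every H
    in (0, 1), and e survives with power H. *)
Lemma noise_power_slices (C e t0 : R) (g : R -> R -> R) : 0 <= C -> 0 <= e <= 1 ->
  0 < t0 <= T -> power_slices C e t0 g ->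
  (ns g <= (noise_power_const C * e `^ H)%:E)%E.
Proof.
move=> C0 /andP[e0 e1] /andP[t00 t0T] [ag ga gb g0].
rewrite (noise_sqnorm_off t0 ag).
pose al s := \1_(open_time t0) s * (C * e * (t0 - s) `^ (- 4^-1)).
pose be s := \1_(open_time t0) s * (C * (1 + T) * (t0 - s) `^ (- 2^-1)).
have mal : mR al.
  apply: measurable_funM; first exact: measurable_open_time.
  by apply: measurable_funM => //; exact: measurable_powR_rev.
have mbe : mR be.
  apply: measurable_funM; first exact: measurable_open_time.
  by apply: measurable_funM => //; exact: measurable_powR_rev.
have mne : mR (fun s => (s != t0)%:R : R).
  have -> : (fun s => (s != t0)%:R : R) = \1_(~` [set t0]).
    apply/funext => s; rewrite indicE; case: eqP => [->|h].
      by rewrite memNset//=; apply.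
    by rewrite mem_set.
  by apply: measurable_indic; apply: measurableC.
have C1 : 0 <= C * (1 + T) by rewrite mulr_ge0//; have := T0; lra.
have i0 : (\int[mu]__ (0 : R)%:E = 0)%E by rewrite integral0.
have h : (ns (fun s x => ((s != t0)%:R * g s x)%R) <= (slice_const H)%:E *
    \int[mu]_(t in `]0%R, +oo[) (al t `^ H * be t `^ (2 - H))%:E)%E.
  have [mg ig] := ag.
  apply: noise_sqnorm_le => //.
  - by apply: measurable_funM => //; exact: (measurableT_comp mne).
  - move=> t t1; case: (t != t0) => /=.
      by under eq_fun do rewrite mul1r; exact: ig.
    by under eq_fun do rewrite mul0r; exact: integrable0.
  - move=> s s0; rewrite /al /be open_timeE s0/=; case: ifPn => [st|_]; last by rewrite !mul0r lexx.
    rewrite !mul1r mulr_ge0 ?powR_ge0 ?mulr_ge0//=.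
    have p : 0 < t0 - s <= T by lra.
    have k := powR4_le p; rewrite -!mulrA ler_wpM2l//; apply: le_trans k.
    by rewrite ler_piMl ?powR_ge0.
  - move=> s s0; rewrite /al open_timeE s0/=; case: ltgtP => st /=.
    + by rewrite mul1r; under eq_integral do rewrite mul1r; apply: ga; rewrite s0.
    + by rewrite mul0r (eq_integral (cst 0%E)) ?integral0// => x _; rewrite g0// mulr0 normr0.
    + by rewrite mul0r (eq_integral (cst 0%E)) ?integral0// => x _; rewrite mul0r normr0.
  - move=> s k s0; rewrite /be open_timeE s0/=; case: ltgtP => st /=.
    + rewrite mul1r; under eq_integral do rewrite !mul1r.
      have := gb s k; rewrite s0 st => /(_ isT) q; apply: le_trans q _.
      rewrite lee_fin ler_wpM2r// ler_wpM2r ?powR_ge0// ler_peMr//; have := T0; lra.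
    + by rewrite !mul0r (eq_integral (cst 0%E)) ?integral0// => x _; rewrite !g0// mulr0 subrr normr0.
    + by rewrite !mul0r (eq_integral (cst 0%E)) ?integral0// => x _; rewrite !mul0r subrr normr0.
apply: le_trans h _.
have sc := slice_const_ge0 H0 H1.
pose K := C `^ H * (C * (1 + T)) `^ (2 - H).
have K0 : 0 <= K by rewrite mulr_ge0 ?powR_ge0.
have -> : noise_power_const C * e `^ H = slice_const H * (K * e `^ H * (T `^ (H / 4) / (H / 4))).
  by rewrite /noise_power_const -/K; ring.
rewrite (EFinM (slice_const H)) lee_wpmul2l ?lee_fin//.
have H4 : 0 < H / 4 by have := H0; lra.
apply: (@le_trans _ _ (\int[mu]_s (K * e `^ H * (\1_(open_time t0) s * (t0 - s) `^ (H / 4 - 1)))%:E)%E).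
  rewrite integral_indicr; apply: integral_mono.
  - apply: measurable_funM; last by apply: measurable_indic; exact: measurable_itv.
    by apply: measurable_funM; exact: measurable_powR_comp.
  - apply: measurable_funM => //; apply: measurable_funM; first exact: measurable_open_time.
    exact: measurable_powR_rev.
  - by move=> s; rewrite !mulr_ge0 ?powR_ge0.
  - move=> s; rewrite /al /be open_timeE; case: ifPn => [/andP[s0 st]|_]; last first.
      by rewrite !mul0r powR0 ?mul0r ?mulr0// gt_eqF.
    rewrite !mul1r; have p : 0 < t0 - s by lra.
    rewrite (powRM H (mulr_ge0 C0 e0) (powR_ge0 _ _)) (powRM H C0 e0).
    rewrite (powRM (2 - H) C1 (powR_ge0 _ _)) -!powRrM.
    have -> : H / 4 - 1 = - 4^-1 * H + - 2^-1 * (2 - H) by field.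
    rewrite (@powRD _ (t0 - s) (- 4^-1 * H)); last by apply/implyP => _; rewrite gt_eqF.
    rewrite le_eqVlt; apply/orP; left; apply/eqP; rewrite /K.
    have -> : \1_(`]0, +oo[%classic : set R) s = 1 :> R by rewrite indicE mem_set//= in_itv/= s0.
    by ring.
rewrite (integral_scale mu (f := fun s => \1_(open_time t0) s * (t0 - s) `^ (H / 4 - 1))); last first.
- by rewrite mulr_ge0 ?powR_ge0.
- by move=> s; rewrite mulr_ge0 ?powR_ge0// open_timeE; case: ifP.
- by apply: measurable_funM; [exact: measurable_open_time|exact: measurable_powR_rev].
rewrite (EFinM (K * e `^ H)) lee_wpmul2l ?lee_fin ?mulr_ge0 ?powR_ge0//.
apply: le_trans (integral_power_rev H4 t00) _.
rewrite lee_fin ler_wpM2r ?invr_ge0 ?(ltW H4)//.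
by apply: ge0_ler_powR => //; rewrite ?nnegrE; have := T0; lra.
Qed.

(** The drift sees only the L1 bound: integrating (t0-s)^(-1/4) gives T^(3/4) / (3/4), and the
    dependence on e is linear. *)
Lemma drift_power_slices (C e t0 : R) (g : R -> R -> R) : 0 <= C -> 0 <= e ->
  0 < t0 <= T -> power_slices C e t0 g ->
  (\int[mu]_(s in `[0%R, T]) \int[mu]_x `|g s x|%:E <=
    (C * (T `^ (3 / 4) / (3 / 4)) * e)%:E)%E.
Proof.
move=> C0 e0 /andP[t00 t0T] [[mg ig] ga _ g0].
have mf : mR (fun s => \int[mu]_x `|g s x|%:E)%E.
  apply: (@measurable_integral_param _ _ _ _ _ mu (fun z => `|g z.1 z.2|%:E)).
  by apply/measurable_EFinP; exact: (measurableT_comp (@normr_measurable _ _) mg).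
pose h s := C * e * (\1_(open_time t0) s * (t0 - s) `^ (- 4^-1)).
have mh1 : mR (fun s => \1_(open_time t0) s * (t0 - s) `^ (- 4^-1)).
  by apply: measurable_funM; [exact: measurable_open_time|exact: measurable_powR_rev].
have h0 s : 0 <= \1_(open_time t0) s * (t0 - s) `^ (- 4^-1).
  by rewrite mulr_ge0 ?powR_ge0// open_timeE; case: ifP.
have mh : mR h by exact: measurable_funM.
apply: (@le_trans _ _ (\int[mu]_s (h s)%:E)%E); last first.
  rewrite /h (integral_scale mu mh1 h0) ?mulr_ge0//.
  have -> : C * (T `^ (3 / 4) / (3 / 4)) * e = C * e * (T `^ (3 / 4) / (3 / 4)) by ring.
  rewrite (EFinM (C * e)) lee_wpmul2l ?lee_fin ?mulr_ge0//.
  have -> : - 4^-1 = 3 / 4 - 1 :> R by field.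
  have p : 0 < 3 / 4 :> R by lra.
  apply: le_trans (integral_power_rev p t00) _.
  rewrite lee_fin ler_wpM2r ?invr_ge0 ?(ltW p)//.
  by apply: ge0_ler_powR => //; rewrite ?nnegrE; have := T0; lra.
apply: (@le_trans _ _ (\int[mu]_(s in `]0%R, T]) \int[mu]_x `|g s x|%:E)%E).
  by rewrite integral_itv_obnd_cbnd//; exact: measurable_funTS.
have hs s : 0 <= h s by rewrite mulr_ge0// mulr_ge0.
apply: (@le_trans _ _ (\int[mu]_(s in `]0%R, T]) (h s)%:E)%E); last first.
  apply: ge0_subset_integral => //; first exact/measurable_EFinP.
  by move=> s _; rewrite lee_fin.
apply: ae_ge0_le_integral => //.
- by move=> s _; apply: integral_ge0 => x _; rewrite lee_fin.
- exact: measurable_funTS.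
- by move=> s _; rewrite lee_fin.
- by apply: measurable_funTS; exact/measurable_EFinP.
exists [set t0]; split => //; first exact: lebesgue_measure_set1.
move=> s /= hn; apply: contrapT => /eqP st; apply: hn.
rewrite in_itv/= => /andP[s0 sT]; rewrite /h open_timeE s0/=.
move: st; case: ltgtP => // st _.
  by rewrite mul1r; apply: ga; rewrite s0.
by rewrite mul0r mulr0 (eq_integral (cst 0%E)) ?integral0// => x _; rewrite g0// normr0.
Qed.

End power_slices.

(** The common properties of the two kernels. The rates t^(-1/2) in [rk_shift] and (t'-t)/t in
    [rk_time] are those of the heat kernel. In [rk_smooth] the translation constant L must not
    depend on the accuracy e: the approximation is small in L1 with a fixed translation modulus,
    which by interpolation makes it small in the noise norm. *)
Record regular_kernel (R : realType) (T C : R) (G : R -> R -> R) : Prop := RegularKernel {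
  rk_measurable : measurable_fun [set: measurableTypeR R * measurableTypeR R] (fun z => G z.1 z.2);
  rk_ge0 : forall t x, 0 <= G t x;
  rk_le0 : forall t x, t <= 0 -> G t x = 0;
  rk_mass : forall t, t <= T -> (\int[@lebesgue_measure R]_x (G t x)%:E <= C%:E)%E;
  rk_shift : forall t h, 0 < t <= T ->
    (\int[@lebesgue_measure R]_x `|G t (x + h)%R - G t x|%:E <= (C * t `^ (- 2^-1) * `|h|)%:E)%E;
  rk_time : forall t t', 0 < t <= t' -> t' <= T ->
    (\int[@lebesgue_measure R]_x `|G t' x - G t x|%:E <= (C * ((t' - t) / t))%:E)%E;
  rk_smooth : forall t, 0 < t <= T -> exists2 L, 0 <= L & forall e : R, 0 < e ->
    exists (phi : R -> R) (N : R), [/\ elem_smooth phi, forall x, N < `|x| -> phi x = 0,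
      (\int[@lebesgue_measure R]_x `|phi x - G t x|%:E <= e%:E)%E &
      forall h, (\int[@lebesgue_measure R]_x `|phi (x + h)%R - phi x|%:E <= (L * `|h|)%:E)%E] }.

(** * Increments of the Green function in time and space *)

Section green.
Context {R : realType}.
Local Notation mu := (@lebesgue_measure R).
Local Notation mR := (measurable_fun [set: measurableTypeR R]).
Local Notation intR := (mu.-integrable [set: measurableTypeR R]).
Local Notation mRR := (measurable_fun [set: measurableTypeR R * measurableTypeR R]).
Variables T C : R.
Hypothesis T0 : 0 < T.
Hypothesis C0 : 0 <= C.
Variable G : R -> R -> R.
Hypothesis Greg : regular_kernel T C G.

Lemma measurable_kernel_slice (t : R) : mR (G t).
Proof. exact: (measurableT_comp (rk_measurable Greg) (@pair1_measurable _ _ (measurableTypeR R) (measurableTypeR R) t)). Qed.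

Lemma measurable_kernel_reflect (t x : R) : mR (fun y => G t (x - y)).
Proof.
apply: (measurableT_comp (measurable_kernel_slice t)); exact: measurable_funB.
Qed.

Lemma integral_reflect_fun (f g : R -> R) (x : R) : mR f -> (forall u, 0 <= f u) ->
  (forall y, g y = f (x - y)) -> (\int[mu]_y (g y)%:E = \int[mu]_y (f y)%:E)%E.
Proof.
move=> mf f0 gf; rewrite -(ge0_integral_reflect x (f := EFin \o f)).
- by apply: eq_integral => y _; rewrite gf.
- exact/measurable_EFinP.
- by move=> u; rewrite lee_fin.
Qed.

Lemma measurable_shift_diff (f : R -> R) (h : R) : mR f -> mR (fun u => `|f (u + h) - f u|).
Proof.
move=> mf; apply: (measurableT_comp (@normr_measurable _ _)); apply: measurable_funB => //.
by apply: (measurableT_comp mf); exact: (@measurable_funD _ (measurableTypeR R) R).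
Qed.

Lemma kernel_mass (t x : R) : t <= T -> (\int[mu]_y (G t (x - y))%:E <= C%:E)%E.
Proof.
move=> tT; rewrite (@integral_reflect_fun (G t) _ x)//; first exact: (rk_mass Greg).
- exact: measurable_kernel_slice.
- exact: (rk_ge0 Greg).
Qed.

Lemma kernel_shift (t x h : R) : 0 < t <= T ->
  (\int[mu]_y `|G t (x - (y + h)) - G t (x - y)|%:E <= (C * t `^ (- 2^-1) * `|h|)%:E)%E.
Proof.
move=> tT; rewrite (@integral_reflect_fun (fun u => `|G t (u + - h) - G t u|) _ x)//.
- by rewrite -normrN; exact: (rk_shift Greg).
- by apply: measurable_shift_diff; exact: measurable_kernel_slice.
- by move=> y; congr (`|G t _ - _|); ring.
Qed.

Lemma integral_abs_diff_le (f g : R -> R) (a b : R) : mR f -> mR g ->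
  (\int[mu]_y `|f y|%:E <= a%:E)%E -> (\int[mu]_y `|g y|%:E <= b%:E)%E ->
  (\int[mu]_y `|f y - g y|%:E <= (a + b)%:E)%E.
Proof.
move=> mf mg fa gb.
have mf' : mR (fun y => `|f y|) by exact: (measurableT_comp (@normr_measurable _ _)).
have mg' : mR (fun y => `|g y|) by exact: (measurableT_comp (@normr_measurable _ _)).
apply: (@le_trans _ _ (\int[mu]_y (`|f y| + `|g y|)%:E)%E).
  apply: integral_mono => // [||y]; last exact: ler_normB.
    by apply: (measurableT_comp (@normr_measurable _ _)); exact: measurable_funB.
  exact: measurable_funD.
by rewrite integral_add// EFinD leeD.
Qed.

Lemma integral_diff_shift (f g : R -> R) (h a b : R) : mR f -> mR g ->
  (\int[mu]_y `|f (y + h)%R - f y|%:E <= a%:E)%E ->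
  (\int[mu]_y `|g (y + h)%R - g y|%:E <= b%:E)%E ->
  (\int[mu]_y `|(f (y + h)%R - g (y + h)%R) - (f y - g y)|%:E <= (a + b)%:E)%E.
Proof.
move=> mf mg fa gb.
have msh (k : R -> R) : mR k -> mR (fun y => k (y + h) - k y).
  move=> mk; apply: measurable_funB => //.
  by apply: (measurableT_comp mk); exact: (@measurable_funD _ (measurableTypeR R) R).
rewrite (eq_integral (fun y : measurableTypeR R => `|(f (y + h) - f y) - (g (y + h) - g y)|%:E)).
  by apply: integral_abs_diff_le => //; exact: msh.
by move=> y _; congr (`|_|%:E); ring.
Qed.

Lemma kernel_abs_mass (t x : R) : t <= T -> (\int[mu]_y `|G t (x - y)|%:E <= C%:E)%E.
Proof.
move=> tT; under eq_integral do rewrite (ger0_norm (rk_ge0 Greg _ _)).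
exact: kernel_mass.
Qed.

(** For a <= 1 the powers a^2 and a^4 are below a; for a > 1 the trivial bound 2C is below 2Ca.
    Applied with a = e t^(-1/4), where a^2 = e^2 t^(-1/2) and a^4 = e^4 / t match the space and time
    moduli of the kernel. *)
Lemma interpolation_le (v : \bar R) (a : R) : 0 <= a ->
  (v <= (C + C)%:E)%E -> (v <= (C * a ^+ 2)%:E)%E \/ (v <= (C * a ^+ 4)%:E)%E ->
  (v <= (2 * C * a)%:E)%E.
Proof.
move=> a0 v1 v2; have [a1|a1] := leP a 1; last first.
  apply: le_trans v1 _; rewrite lee_fin -mulr2n -[C *+ 2]mulr_natl.
  by rewrite ler_peMr ?mulr_ge0// ltW.
have Ca : 0 <= C * a by rewrite mulr_ge0.
have Ca2 : C * a <= 2 * C * a by lra.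
case: v2 => v2; apply: le_trans v2 _; rewrite lee_fin; apply: le_trans Ca2.
  by rewrite ler_wpM2l// expr2 ler_piMr.
by rewrite ler_wpM2l// exprS ler_piMr ?exprn_ile1.
Qed.

Lemma powR_quarter (t : R) : 0 < t ->
  (t `^ (- 4^-1)) ^+ 2 = t `^ (- 2^-1) /\ (t `^ (- 4^-1)) ^+ 4 = t^-1.
Proof.
move=> t0; rewrite -!powR_mulrn ?powR_ge0// -!powRrM; split; first by congr (_ `^ _); field.
by rewrite (_ : - 4^-1 * 4%:R = - 1) ?powRN ?powRr1 ?ltW//; field.
Qed.

Lemma kernel_space_dist (t x x' e : R) : 0 < t <= T -> 0 <= e -> `|x' - x| <= e ^+ 2 ->
  (\int[mu]_y `|G t (x' - y) - G t (x - y)|%:E <= (2 * C * e * t `^ (- 4^-1))%:E)%E.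
Proof.
move=> tT e0 xe; have [t0 tT'] := andP tT.
rewrite -[_ * e * _]mulrA; apply: interpolation_le.
- by rewrite mulr_ge0 ?powR_ge0.
- by apply: integral_abs_diff_le; rewrite ?kernel_abs_mass//; exact: measurable_kernel_reflect.
left; rewrite (@integral_reflect_fun (fun u => `|G t (u + (x' - x)) - G t u|) _ x)//.
- apply: le_trans (rk_shift Greg _ tT) _.
  rewrite lee_fin exprMn (powR_quarter t0).1 -mulrA ler_wpM2l// mulrC.
  by rewrite ler_wpM2r ?powR_ge0.
- by apply: measurable_shift_diff; exact: measurable_kernel_slice.
- by move=> y; congr (`|G t _ - _|); ring.
Qed.

Lemma kernel_time_dist (t t' x e : R) : 0 < t <= t' -> t' <= T -> 0 <= e -> t' - t <= e ^+ 4 ->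
  (\int[mu]_y `|G t' (x - y) - G t (x - y)|%:E <= (2 * C * e * t `^ (- 4^-1))%:E)%E.
Proof.
move=> tt tT e0 te; have [t0 tt'] := andP tt.
rewrite -[_ * e * _]mulrA; apply: interpolation_le.
- by rewrite mulr_ge0 ?powR_ge0.
- apply: integral_abs_diff_le; rewrite ?kernel_abs_mass ?(le_trans tt')//; exact: measurable_kernel_reflect.
right; rewrite (@integral_reflect_fun (fun u => `|G t' u - G t u|) _ x)//.
- apply: le_trans (rk_time Greg tt tT) _.
  rewrite lee_fin exprMn (powR_quarter t0).2 ler_wpM2l//.
  by rewrite ler_wpM2r// invr_ge0 ltW.
- apply: (measurableT_comp (@normr_measurable _ _)).
  by apply: measurable_funB; exact: measurable_kernel_slice.
Qed.

Definition green (t x s y : R) : R := \1_(`[0, t]) s * G (t - s) (x - y).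

Lemma time_indicE (t s : R) : \1_(`[0, t]) s = (if 0 <= s <= t then 1 else 0) :> R.
Proof.
rewrite indicE; case: ifPn => h; first by rewrite mem_set//= in_itv.
by rewrite memNset//= in_itv/=; exact/negP.
Qed.

Lemma measurable_time_indic (t : R) : mR (\1_(`[0, t]%classic : set R) : R -> R).
Proof. by apply: measurable_indic; exact: measurable_itv. Qed.

Lemma measurable_green_param d (X : measurableType d) (t x s y : X -> measurableTypeR R) :
  measurable_fun setT t -> measurable_fun setT x -> measurable_fun setT s -> measurable_fun setT y ->
  measurable_fun setT (fun z => G (t z - s z) (x z - y z)).
Proof.
move=> mt mx ms my.
have m1 : measurable_fun setT (fun z => t z - s z : measurableTypeR R).
  exact: (@measurable_funB _ X R setT).
have m2 : measurable_fun setT (fun z => x z - y z : measurableTypeR R).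
  exact: (@measurable_funB _ X R setT).
exact: (measurableT_comp (rk_measurable Greg) (measurable_fun_pair m1 m2)).
Qed.

Lemma kernel_admissible (a : R -> R) (t x : R) : mR a -> t <= T ->
  admissible (fun s y => a s * G (t - s) (x - y)).
Proof.
move=> ma tT; split.
  apply: measurable_funM; first exact: (measurableT_comp ma).
  exact: measurable_green_param.
move=> s s0; have i : intR (EFin \o (fun y => G (t - s) (x - y))).
  apply/integrableP; split; first by apply/measurable_EFinP; exact: measurable_kernel_reflect.
  apply: (@le_lt_trans _ _ C%:E); last exact: ltry.
  by apply: kernel_abs_mass; lra.
by have := integrableZl measurableT (a s) i.
Qed.

Lemma green_admissible (t x : R) : t <= T -> admissible (green t x).
Proof. by apply: kernel_admissible; exact: measurable_time_indic. Qed.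

Lemma powR_half_le (t t' : R) : 0 < t <= t' -> t' `^ (- 2^-1) <= t `^ (- 2^-1).
Proof.
move=> /andP[t0 tt]; rewrite !powRN lef_pV2 ?posrE ?powR_gt0//; last by lra.
by apply: ge0_ler_powR => //; rewrite nnegrE; lra.
Qed.

Lemma green_power_slices_space (t x x' e : R) : t <= T -> 0 <= e -> `|x' - x| <= e ^+ 2 ->
  power_slices (2 * C) e t (fun s y => green t x' s y - green t x s y).
Proof.
move=> tT e0 xe; split.
- by apply: admissibleB; exact: green_admissible.
- move=> s /andP[s0 st]; rewrite /green time_indicE (ltW s0) (ltW st)/=.
  under eq_integral do rewrite !mul1r.
  by apply: kernel_space_dist => //; lra.
- move=> s h /andP[s0 st]; rewrite /green time_indicE (ltW s0) (ltW st)/=.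
  have p : 0 < t - s <= T by lra.
  under eq_integral do rewrite !mul1r.
  have -> : 2 * C * (t - s) `^ (- 2^-1) * `|h| =
    C * (t - s) `^ (- 2^-1) * `|h| + C * (t - s) `^ (- 2^-1) * `|h| by ring.
  have := @integral_diff_shift (fun y => G (t - s) (x' - y)) (fun y => G (t - s) (x - y)) h.
  move=> /(_ _ _ (measurable_kernel_reflect _ _) (measurable_kernel_reflect _ _)
    (kernel_shift x' h p) (kernel_shift x h p)).
  exact.
- by move=> s y ts; rewrite /green time_indicE (leNgt s) ts/= andbF !mul0r subrr.
Qed.

Lemma green_power_slices_time (t t' x e : R) : t <= t' -> t' <= T -> 0 <= e -> t' - t <= e ^+ 4 ->
  power_slices (2 * C) e t
    (fun s y => \1_(`[0, t]) s * (G (t' - s) (x - y) - G (t - s) (x - y))).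
Proof.
move=> tt tT e0 te; split.
- have mt := measurable_time_indic t.
  have := admissibleB (kernel_admissible x mt tT) (kernel_admissible x mt (le_trans tt tT)).
  by congr (admissible _); apply/funext => s; apply/funext => y; rewrite mulrBr.
- move=> s /andP[s0 st]; rewrite time_indicE (ltW s0) (ltW st)/=.
  under eq_integral do rewrite mul1r.
  by apply: kernel_time_dist => //; lra.
- move=> s h /andP[s0 st]; rewrite time_indicE (ltW s0) (ltW st)/=.
  have p : 0 < t - s <= T by lra.
  have p' : 0 < t' - s <= T by lra.
  under eq_integral do rewrite !mul1r.
  have := @integral_diff_shift (fun y => G (t' - s) (x - y)) (fun y => G (t - s) (x - y)) h.
  move=> /(_ _ _ (measurable_kernel_reflect _ _) (measurable_kernel_reflect _ _)
    (kernel_shift x h p') (kernel_shift x h p)) => q; apply: le_trans q _.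
  have k : (t' - s) `^ (- 2^-1) <= (t - s) `^ (- 2^-1) by apply: powR_half_le; lra.
  have := ler_wpM2r (normr_ge0 h) (ler_wpM2l C0 k).
  by rewrite lee_fin => ?; lra.
- by move=> s y ts; rewrite time_indicE (leNgt s) ts/= andbF mul0r.
Qed.

(** On the added slab t < s < t' one has t' - s <= e^4, hence e (t'-s)^(-1/4) >= 1 and the plain
    mass bound C is already of the required form. *)
Lemma green_power_slices_last (t t' x e : R) : 0 <= t -> t <= t' -> t' <= T -> 0 <= e -> t' - t <= e ^+ 4 ->
  power_slices (2 * C) e t'
    (fun s y => (\1_(`[0, t']) s - \1_(`[0, t]) s) * G (t' - s) (x - y)).
Proof.
move=> t0 tt tT e0 te.
have tE s : 0 < s < t' -> \1_(`[0, t']) s - \1_(`[0, t]) s = (if t < s then 1 else 0) :> R.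
  move=> /andP[s0 st]; rewrite !time_indicE (ltW s0) (ltW st)/= leNgt.
  by case: (t < s) => /=; rewrite ?subr0 ?subrr.
split.
- apply: kernel_admissible => //; apply: measurable_funB; exact: measurable_time_indic.
- move=> s /[dup] s0 /tE ->; case: ifPn => ts; last first.
    under eq_integral do rewrite mul0r normr0.
    by rewrite integral0 lee_fin !mulr_ge0 ?powR_ge0.
  under eq_integral do rewrite mul1r.
  have p : 0 < t' - s by lra.
  apply: le_trans (kernel_abs_mass x (_ : t' - s <= T)) _; first by lra.
  rewrite lee_fin -[_ * e * _]mulrA.
  suff a1 : 1 <= e * (t' - s) `^ (- 4^-1).
    have := ler_wpM2l C0 a1; have := C0; lra.
  rewrite leNgt; apply/negP => a1.
  have a0 : 0 <= e * (t' - s) `^ (- 4^-1) by rewrite mulr_ge0 ?powR_ge0.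
  have : (e * (t' - s) `^ (- 4^-1)) ^+ 4 < 1 by rewrite exprn_ilt1.
  rewrite exprMn (powR_quarter p).2 ltr_pdivrMr//; lra.
- move=> s h /[dup] /andP[s0 st] /tE ->; case: ifPn => ts; last first.
    under eq_integral do rewrite !mul0r subrr normr0.
    by rewrite integral0 lee_fin !mulr_ge0 ?powR_ge0.
  have p : 0 < t' - s <= T by lra.
  under eq_integral do rewrite !mul1r.
  apply: le_trans (kernel_shift x h p) _; rewrite lee_fin.
  have : 0 <= C * (t' - s) `^ (- 2^-1) * `|h| by rewrite !mulr_ge0 ?powR_ge0.
  by move=> ?; lra.
- move=> s y ts; rewrite !time_indicE !(leNgt s) ts (le_lt_trans tt ts)/= !andbF subrr mul0r//.
Qed.

(** Lets bounded quantities take the singular form of [power_slices] at the cost of a factor 1 +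
    T. *)
Lemma powR_ge1_const (t r : R) : 0 <= r <= 1 -> 0 < t <= T -> 1 <= (1 + T) * t `^ (- r).
Proof.
move=> /andP[r0 r1] /andP[t0 tT]; rewrite powRN ler_pdivlMr ?powR_gt0// mul1r.
have [t1|t1] := leP t 1.
  apply: (@le_trans _ _ 1); last by have := T0; lra.
  by have := @ge0_ler_powR R r r0 t 1; rewrite powR1; apply => //; rewrite nnegrE ltW.
apply: (@le_trans _ _ (t `^ 1)); last by rewrite powRr1 ?ltW//; lra.
by apply: ler_powR => //; exact: ltW.
Qed.

Lemma green_power_slices (t x : R) : t <= T ->
  power_slices (C * (1 + T)) 1 t (green t x).
Proof.
move=> tT; split; first exact: green_admissible.
- move=> s /andP[s0 st]; rewrite /green time_indicE (ltW s0) (ltW st)/=.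
  under eq_integral do rewrite mul1r.
  apply: le_trans (kernel_abs_mass x (_ : t - s <= T)) _; first by lra.
  rewrite lee_fin mulr1 -mulrA ler_peMr//.
  by apply: powR_ge1_const; apply/andP; split; lra.
- move=> s h /andP[s0 st]; rewrite /green time_indicE (ltW s0) (ltW st)/=.
  have p : 0 < t - s <= T by lra.
  under eq_integral do rewrite !mul1r.
  apply: le_trans (kernel_shift x h p) _; rewrite lee_fin.
  rewrite ler_wpM2r// ler_wpM2r ?powR_ge0// ler_peMr//; have := T0; lra.
- by move=> s y ts; rewrite /green time_indicE (leNgt s) ts/= andbF mul0r.
Qed.

End green.

Section green_noise.
Context {R : realType}.
Local Notation mu := (@lebesgue_measure R).
Local Notation mR := (measurable_fun [set: measurableTypeR R]).
Variables H T C : R.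
Hypothesis H0 : 0 < H.
Hypothesis H1 : H < 1.
Hypothesis T0 : 0 < T.
Hypothesis C0 : 0 <= C.
Variable G : R -> R -> R.
Hypothesis Greg : regular_kernel T C G.
Local Notation ns := (noise_sqnorm H).
Local Notation green := (green G).

(** For t0 = 0 the function vanishes at all positive times, so the final time may be replaced by T,
    where the estimates for t0 > 0 apply. *)
Lemma power_slices_zero (K e : R) (g : R -> R -> R) : 0 <= K -> 0 <= e ->
  power_slices K e 0 g -> power_slices K e T g.
Proof.
move=> K0 e0 [ag _ _ g0]; split => //.
- move=> s /andP[s0 _]; rewrite (eq_integral (cst 0%E)); last by move=> y _; rewrite g0// normr0.
  by rewrite integral0 lee_fin !mulr_ge0 ?powR_ge0.
- move=> s h /andP[s0 _]; rewrite (eq_integral (cst 0%E)); last by move=> y _; rewrite !g0// subrr normr0.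
  by rewrite integral0 lee_fin !mulr_ge0 ?powR_ge0.
- by move=> s y Ts; apply: g0; have := T0; lra.
Qed.

Lemma noise_power_slices0 (K e t0 : R) (g : R -> R -> R) : 0 <= K -> 0 <= e <= 1 ->
  0 <= t0 <= T -> power_slices K e t0 g -> (ns g <= (noise_power_const H T K * e `^ H)%:E)%E.
Proof.
move=> K0 e01 /andP[]; rewrite le_eqVlt => /predU1P[<- _ g0|t00 tT gt0].
  apply: (noise_power_slices H0 H1 T0 K0 e01 (t0 := T)); first by rewrite T0 lexx.
  by apply: power_slices_zero => //; case/andP: e01.
by apply: (noise_power_slices H0 H1 T0 K0 e01 (t0 := t0)) => //; rewrite t00.
Qed.

Lemma drift_power_slices0 (K e t0 : R) (g : R -> R -> R) : 0 <= K -> 0 <= e ->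
  0 <= t0 <= T -> power_slices K e t0 g ->
  (\int[mu]_(s in `[0%R, T]) \int[mu]_x `|g s x|%:E <= (K * (T `^ (3 / 4) / (3 / 4)) * e)%:E)%E.
Proof.
move=> K0 e0 /andP[]; rewrite le_eqVlt => /predU1P[<- _ g0|t00 tT gt0].
  apply: (drift_power_slices T0 K0 e0 (t0 := T)); first by rewrite T0 lexx.
  exact: power_slices_zero.
by apply: (drift_power_slices T0 K0 e0 (t0 := t0)) => //; rewrite t00.
Qed.

(** An increment of the Green function is split into a move in space at time t', a change of kernel
    time on [0, t], and the slab ]t, t']. *)
Definition green_part1 (t' x' x s y : R) : R := green t' x' s y - green t' x s y.
Definition green_part2 (t t' x s y : R) : R :=
  \1_(`[0, t]) s * (G (t' - s) (x - y) - G (t - s) (x - y)).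
Definition green_part3 (t t' x s y : R) : R :=
  (\1_(`[0, t']) s - \1_(`[0, t]) s) * G (t' - s) (x - y).

Lemma green_decomp (t t' x x' s y : R) : green t' x' s y - green t x s y =
  green_part1 t' x' x s y + (green_part2 t t' x s y + green_part3 t t' x s y).
Proof. by rewrite /green_part1 /green_part2 /green_part3 /green; ring. Qed.

Lemma green_noise_dist (t t' x x' e : R) : 0 <= e <= 1 -> 0 <= t <= T -> 0 <= t' <= T ->
  `|t' - t| <= e ^+ 4 -> `|x' - x| <= e ^+ 2 ->
  (ns (fun s y => (green t' x' s y - green t x s y)%R) <=
   (10 * noise_power_const H T (2 * C) * e `^ H)%:E)%E.
Proof.
wlog tt : t t' x x' / t <= t'.
  move=> wl e01 tT tT' te xe; have [tt|/ltW tt] := leP t t'; first exact: wl.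
  rewrite (noise_sqnormBC H0 H1); last 2 first.
  - by apply: (green_admissible Greg); case/andP: tT'.
  - by apply: (green_admissible Greg); case/andP: tT.
  by apply: wl => //; rewrite distrC.
move=> e01 tT tT' te xe; have [e0 _] := andP e01; have [t0 tT2] := andP tT; have [t0' tT2'] := andP tT'.
have te' : t' - t <= e ^+ 4 by apply: le_trans te; exact: ler_norm.
have C2 : 0 <= 2 * C by rewrite mulr_ge0.
have p1 := green_power_slices_space C0 Greg tT2' e0 xe.
have p2 := green_power_slices_time C0 Greg x tt tT2' e0 te'.
have p3 := green_power_slices_last C0 Greg x t0 tt tT2' e0 te'.
have n1 := noise_power_slices0 C2 e01 tT' p1.
have n2 := noise_power_slices0 C2 e01 tT p2.
have n3 := noise_power_slices0 C2 e01 tT' p3.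
have [a1 _ _ _] := p1; have [a2 _ _ _] := p2; have [a3 _ _ _] := p3.
rewrite (@eq_noise_sqnorm _ _ _ (fun s y => green_part1 t' x' x s y +
   (green_part2 t t' x s y + green_part3 t t' x s y))) => [|s y _]; last exact: green_decomp.
apply: le_trans (noise_sqnormD_le H0 H1 a1 (admissibleD a2 a3)) _.
pose N := noise_power_const H T (2 * C) * e `^ H.
(* The three parts have the same bound N; two nested doublings give 2 + 4 + 4 = 10. *)
apply: (@le_trans _ _ (2 * N + 2 * (2 * N + 2 * N))%:E); last first.
  by rewrite lee_fin /N le_eqVlt; apply/orP; left; apply/eqP; ring.
apply: lee_combination2; first exact: n1.
apply: le_trans (noise_sqnormD_le H0 H1 a2 a3) _.
apply: lee_combination2; [exact: n2|exact: n3].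
Qed.

Lemma green_noise_le (t x : R) : 0 <= t <= T ->
  (ns (green t x) <= (noise_power_const H T (C * (1 + T)))%:E)%E.
Proof.
move=> tT; have [t0 tT'] := andP tT.
have := noise_power_slices0 (e := 1) _ _ tT (green_power_slices T0 C0 Greg x tT').
rewrite powR1 mulr1; apply; last by rewrite ler01 lexx.
by rewrite mulr_ge0//; have := T0; lra.
Qed.

Lemma measurable_slice_mass (g : R -> R -> R) : admissible g ->
  mR (fun s => \int[mu]_y `|g s y|%:E)%E.
Proof.
move=> [mg _]; apply: (@measurable_integral_param _ _ _ _ _ mu (fun z => `|g z.1 z.2|%:E)).
by apply/measurable_EFinP; exact: (measurableT_comp (@normr_measurable _ _) mg).
Qed.

Lemma slice_massD (g1 g2 : R -> R -> R) (D : set (measurableTypeR R)) : measurable D ->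
  (forall s, D s -> 0 <= s) -> admissible g1 -> admissible g2 ->
  (\int[mu]_(s in D) \int[mu]_y `|g1 s y + g2 s y|%:E <=
   \int[mu]_(s in D) \int[mu]_y `|g1 s y|%:E + \int[mu]_(s in D) \int[mu]_y `|g2 s y|%:E)%E.
Proof.
move=> mD D0 a1 a2.
have pos (g : R -> R -> R) s : (0 <= \int[mu]_y `|g s y|%:E)%E.
  by apply: integral_ge0 => y _; rewrite lee_fin.
have ms (g : R -> R -> R) s : 0 <= s -> admissible g -> mR (fun y => `|g s y|).
  move=> s0 [_ /(_ s s0) /measurable_int/measurable_EFinP mg].
  exact: (measurableT_comp (@normr_measurable _ _) mg).
rewrite -ge0_integralD//; last 2 first.
- by apply: measurable_funTS; exact: measurable_slice_mass.
- by apply: measurable_funTS; exact: measurable_slice_mass.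
apply: ge0_le_integral => //.
- by move=> s _; apply: integral_ge0 => y _; rewrite lee_fin.
- by apply: measurable_funTS; apply: measurable_slice_mass; exact: admissibleD.
- by apply: emeasurable_funD; apply: measurable_funTS; exact: measurable_slice_mass.
- move=> s Ds; have s0 := D0 s Ds.
  rewrite -integral_add//; try exact: ms.
  apply: integral_mono => // [||y]; last exact: ler_normD.
    exact: (ms (fun s y => g1 s y + g2 s y) s s0 (admissibleD a1 a2)).
  by apply: measurable_funD; exact: ms.
Qed.

Lemma green_drift_dist (t t' x x' e : R) : 0 <= e -> 0 <= t <= T -> 0 <= t' <= T ->
  `|t' - t| <= e ^+ 4 -> `|x' - x| <= e ^+ 2 ->
  (\int[mu]_(s in `[0%R, T]) \int[mu]_y `|green t' x' s y - green t x s y|%:E <=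
   (3 * (2 * C * (T `^ (3 / 4) / (3 / 4)) * e))%:E)%E.
Proof.
wlog tt : t t' x x' / t <= t'.
  move=> wl e01 tT tT' te xe; have [tt|/ltW tt] := leP t t'; first exact: wl.
  under eq_integral do under eq_integral do rewrite distrC.
  by apply: wl => //; rewrite distrC.
move=> e0 tT tT' te xe; have [t0 tT2] := andP tT; have [t0' tT2'] := andP tT'.
have te' : t' - t <= e ^+ 4 by apply: le_trans te; exact: ler_norm.
have C2 : 0 <= 2 * C by rewrite mulr_ge0.
have p1 := green_power_slices_space C0 Greg tT2' e0 xe.
have p2 := green_power_slices_time C0 Greg x tt tT2' e0 te'.
have p3 := green_power_slices_last C0 Greg x t0 tt tT2' e0 te'.
have n1 := drift_power_slices0 C2 e0 tT' p1.
have n2 := drift_power_slices0 C2 e0 tT p2.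
have n3 := drift_power_slices0 C2 e0 tT' p3.
have [a1 _ _ _] := p1; have [a2 _ _ _] := p2; have [a3 _ _ _] := p3.
under eq_integral do under eq_integral do rewrite green_decomp.
have D0 s : (`[0, T]%classic : set R) s -> 0 <= s by rewrite /= in_itv/= => /andP[].
have mD : measurable (`[0, T]%classic : set (measurableTypeR R)) by exact: measurable_itv.
apply: le_trans (slice_massD mD D0 a1 (admissibleD a2 a3)) _.
have -> : 3 * (2 * C * (T `^ (3 / 4) / (3 / 4)) * e) = 2 * C * (T `^ (3 / 4) / (3 / 4)) * e +
  (2 * C * (T `^ (3 / 4) / (3 / 4)) * e + 2 * C * (T `^ (3 / 4) / (3 / 4)) * e) by ring.
rewrite EFinD leeD ?n1//.
apply: le_trans (slice_massD mD D0 a2 a3) _.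
by rewrite EFinD leeD.
Qed.

Lemma small_power (K e : R) : 0 <= K -> 0 < e -> exists2 r, 0 < r <= 1 & K * r `^ H <= e.
Proof.
move=> K0 e0; have q0 : 0 < e / (K + 1) by rewrite divr_gt0// ltr_wpDl.
exists (Num.min 1 ((e / (K + 1)) `^ H^-1)).
  by rewrite lt_min ltr01 powR_gt0//= ge_min lexx.
have h : Num.min 1 ((e / (K + 1)) `^ H^-1) `^ H <= e / (K + 1).
  apply: (@le_trans _ _ ((e / (K + 1)) `^ H^-1 `^ H)).
    apply: ge0_ler_powR; rewrite ?nnegrE ?powR_ge0 ?(ltW H0)//.
      by rewrite le_min ler01 powR_ge0.
    by rewrite ge_min lexx orbT.
  by rewrite -powRrM mulVf ?gt_eqF// powRr1// ltW.
apply: le_trans (ler_wpM2l K0 h) _.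
by rewrite mulrCA ger_pMr// ler_pdivrMr ?ltr_wpDl// mul1r lerDl.
Qed.

End green_noise.

(** * Adaptedness of the stochastic convolution at a fixed point *)

Section green_adapted.
Context {R : realType} d (Omega : measurableType d) (P : probability Omega R).
Local Notation mu := (@lebesgue_measure R).
Local Notation mR := (measurable_fun [set: measurableTypeR R]).
Variables H T C : R.
Hypothesis H0 : 0 < H.
Hypothesis H1 : H < 1.
Hypothesis T0 : 0 < T.
Hypothesis C0 : 0 <= C.
Variable G : R -> R -> R.
Hypothesis Greg : regular_kernel T C G.
Variable W : test_functions R -> {RV P >-> R}.
Hypothesis W_noise : fractional_noise H W.
Local Notation ns := (noise_sqnorm H).
Local Notation green := (green G).
Local Notation noise_adapted := (noise_adapted H W).

Lemma noise_adapted_power_limit (r t0 K : R) (g : R -> R -> R) : 0 <= K -> 0 <= t0 <= T ->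
  admissible g ->
  (forall e, 0 < e <= 1 -> exists2 g', noise_adapted r g' &
    power_slices K e t0 (fun s y => g' s y - g s y)) -> noise_adapted r g.
Proof.
move=> K0 t0T ag h; apply: (noise_adapted_limit H0 H1 W_noise) => // e e0.
have N0 : 0 <= noise_power_const H T K.
  have H4 : 0 <= H / 4 by have := H0; lra.
  apply: mulr_ge0; last by rewrite divr_ge0 ?powR_ge0.
  by apply: mulr_ge0; [exact: slice_const_ge0|rewrite mulr_ge0 ?powR_ge0].
have [q q01 qe] := small_power H0 N0 e0.
have [g' ag' ps] := h q q01; exists g' => //.
have q01' : 0 <= q <= 1 by have /andP[/ltW -> ->] := q01.
by apply: le_trans (noise_power_slices0 H0 H1 T0 K0 q01' t0T ps) _; rewrite lee_fin.
Qed.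

(** A kernel frozen at a positive time t is approximated by smooth compactly supported phi. The
    error is at most e in L1, while its translation modulus stays below L + C t^(-1/2), uniformly in
    e. *)
Lemma step_kernel_adapted (r s t x : R) : 0 <= s <= r -> s <= T -> 0 < t <= T ->
  noise_adapted r (fun u y => \1_(`[0, s]) u * G t (x - y)).
Proof.
move=> sr sT tT; have [s0 _] := andP sr; have [t0 _] := andP tT.
have [L L0 hL] := rk_smooth Greg tT.
have mG := measurable_kernel_reflect Greg t x.
have mI := measurable_time_indic s.
have i : mu.-integrable [set: measurableTypeR R] (EFin \o (fun y => G t (x - y))).
  apply/integrableP; split; first by apply/measurable_EFinP.
  apply: (@le_lt_trans _ _ C%:E); last exact: ltry.
  by apply: (kernel_abs_mass Greg); case/andP: tT.
(* The factor 1 + T absorbs the powers of s - u in [power_slices]; the other factor covers both the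
   L1 error and the fixed translation modulus. *)
pose K := (1 + T) * (1 + (L + C * t `^ (- 2^-1))).
have T1 : 0 <= 1 + T by have := T0; lra.
have P0 : 0 <= C * t `^ (- 2^-1) by rewrite mulr_ge0 ?powR_ge0.
have K0 : 0 <= K by rewrite mulr_ge0// !addr_ge0.
apply: (@noise_adapted_power_limit r s K) => //; first by rewrite s0.
  split; first by apply: measurable_funM; [exact: (measurableT_comp mI)|exact: (measurableT_comp mG)].
  by move=> u _; have := integrableZl measurableT (\1_(`[0, s]%classic : set R) u) i.
move=> e /andP[e0 e1]; have [phi [N [sphi phiN phie phih]]] := hL e e0.
have mphi : mR phi by apply: continuous_measurable_fun; exact: elem_smooth_continuous.
pose psi y := phi ((-1) * y + x).
have psiE y : psi y = phi (x - y) by rewrite /psi mulN1r addrC.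
have mpsi : mR psi.
  apply: continuous_measurable_fun; apply: elem_smooth_continuous.
  exact: es_affine.
have apsi : noise_adapted r (fun u y => \1_(`[0, s]) u * psi y).
  apply: (noise_adapted_indic H0 H1 W_noise (N := N + `|x|)) => //; first exact: es_affine.
  move=> y Ny; rewrite psiE phiN//.
  by have := lerB_dist y x; rewrite distrC; lra.
exists (fun u y => \1_(`[0, s]) u * psi y) => //.
have uE u : 0 < u < s -> \1_(`[0, s]) u = 1 :> R.
  by move=> /andP[u0 us]; rewrite time_indicE (ltW u0) (ltW us).
split.
- apply: admissibleB; first exact: (noise_adapted_admissible H0 H1 apsi).
  split; first by apply: measurable_funM; [exact: (measurableT_comp mI)|exact: (measurableT_comp mG)].
  by move=> u _; have := integrableZl measurableT (\1_(`[0, s]%classic : set R) u) i.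
- move=> u us; rewrite (uE u us); under eq_integral do rewrite !mul1r psiE.
  rewrite (@integral_reflect_fun _ (fun v => `|phi v - G t v|) _ x)//; last first.
    apply: (measurableT_comp (@normr_measurable _ _)); apply: measurable_funB => //.
    exact: measurable_kernel_slice Greg t.
  apply: le_trans phie _; rewrite lee_fin.
  have p : 0 < s - u <= T by lra.
  have k : 1 <= (1 + T) * (s - u) `^ (- 4^-1).
    by apply: powR_ge1_const => //; apply/andP; split; lra.
  rewrite /K (_ : _ * _ = ((1 + T) * (s - u) `^ (- 4^-1)) * (1 + (L + C * t `^ (- 2^-1))) * e); last by ring.
  rewrite ler_peMl ?(ltW e0)//; apply: mulr_ege1 => //; lra.
- move=> u h us; rewrite (uE u us); under eq_integral do rewrite !mul1r.
  have a : (\int[mu]_y `|psi (y + h) - psi y|%:E <= (L * `|h|)%:E)%E.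
    rewrite (@integral_reflect_fun _ (fun v => `|phi (v + - h) - phi v|) _ x)//.
    - by rewrite -normrN; exact: phih.
    - exact: measurable_shift_diff.
    - by move=> y; rewrite !psiE; congr (`|phi _ - _|); ring.
  have b := kernel_shift Greg x h tT.
  have := integral_diff_shift mpsi mG a b; move=> q; apply: le_trans q _.
  rewrite -mulrDl lee_fin ler_wpM2r//.
  have p : 0 < s - u <= T by lra.
  have k : 1 <= (1 + T) * (s - u) `^ (- 2^-1).
    by apply: powR_ge1_const => //; apply/andP; split; lra.
  apply: (@le_trans _ _ (1 * (1 + (L + C * t `^ (- 2^-1))))); first lra.
  rewrite /K [leRHS](_ : _ = ((1 + T) * (s - u) `^ (- 2^-1)) * (1 + (L + C * t `^ (- 2^-1)))); last by ring.
  by rewrite ler_wpM2r// !addr_ge0.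
- move=> u y su; rewrite time_indicE (leNgt u) su/= andbF !mul0r subrr//.
Qed.

(** On each time slice the kernel is frozen at the left end q of the slice, so its age t - q is at
    least t - s and stays away from 0. The slices are added one at a time as differences of
    indicators of [0, (k+1)h] and [0, kh]. *)
Lemma sliced_kernel_adapted (t x h : R) (k : nat) : 0 < t <= T -> 0 < h -> k%:R * h <= t ->
  exists2 g', noise_adapted t g' &
   (forall s, 0 < s <= k%:R * h -> exists2 q, 0 <= q < s /\ s <= q + h &
      forall y, g' s y = G (t - q) (x - y)) /\
   (forall s y, k%:R * h < s -> g' s y = 0).
Proof.
move=> tT h0; have [t0 tT'] := andP tT; elim: k => [_|k IH kt].
  exists (fun u y => \1_(`[0, 0]) u * G t (x - y)).
    by apply: step_kernel_adapted => //; have := T0; lra.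
  split => [s|s y]; rewrite mul0r => hs; first by have /andP[a b] := hs; have := lt_le_trans a b; rewrite ltxx.
  by rewrite time_indicE (leNgt s) hs andbF mul0r.
have kk : k.+1%:R * h = k%:R * h + h by rewrite -natr1 mulrDl mul1r.
have kh0 : 0 <= k%:R * h by rewrite mulr_ge0// ltW.
have kt' : k%:R * h <= t by lra.
have [g' ag' [g1 g2]] := IH kt'.
have a1 := @step_kernel_adapted t (k.+1%:R * h) (t - k%:R * h) x.
have a2 := @step_kernel_adapted t (k%:R * h) (t - k%:R * h) x.
have {}a1 : noise_adapted t (fun u y => \1_(`[0, k.+1%:R * h]) u * G (t - k%:R * h) (x - y)).
  by apply: a1; lra.
have {}a2 : noise_adapted t (fun u y => \1_(`[0, k%:R * h]) u * G (t - k%:R * h) (x - y)).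
  by apply: a2; lra.
have a12 := noise_adapted_lin H0 H1 W_noise (-1) a2 a1.
have a := noise_adapted_lin H0 H1 W_noise 1 ag' a12.
eexists; first exact: a.
split => [s /andP[s0 sk]|s y ks] /=.
  rewrite !(time_indicE _ s) (ltW s0) sk /=; have [ks|ks] := leP s (k%:R * h).
    have [|q hq gq] := g1 s; first by rewrite s0.
    by exists q => // y; rewrite gq; ring.
  exists (k%:R * h); first by split; lra.
  by move=> y; rewrite g2//; ring.
rewrite !(time_indicE _ s) !(leNgt s) ks (_ : k%:R * h < s) ?g2; [|lra|lra].
by rewrite !andbF; ring.
Qed.

Lemma green_adapted (t x : R) : 0 <= t <= T -> noise_adapted t (green t x).
Proof.
move=> tT; have [t0 tT'] := andP tT; move: t0; rewrite le_eqVlt => /predU1P[<-|t0].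
  (* At t = 0 the Green function vanishes identically; the zero function is obtained as the
     difference of a frozen kernel with itself. *)
  have a : noise_adapted 0 (fun u y => \1_(`[0, 0]) u * G T (x - y)).
    by apply: step_kernel_adapted => //; have := T0; lra.
  have := noise_adapted_lin H0 H1 W_noise (-1) a a; apply: eq_noise_adapted => s y.
  rewrite /green time_indicE mulN1r addNr; case: ifP => [/andP[s0 s1]|_]; last by rewrite mul0r.
  by rewrite (rk_le0 Greg) ?mulr0//; lra.
have C2 : 0 <= 2 * C by rewrite mulr_ge0.
apply: (@noise_adapted_power_limit t t (2 * C)) => //; first exact: (green_admissible Greg).
(* A mesh of at most e^4 is the time step for which [kernel_time_dist] bounds the slicing error by e
   (t-s)^(-1/4). *)
move=> e /andP[e0 e1]; have [N hN] : exists N : nat, t / e ^+ 4 < N%:R.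
  by exists (Num.truncn (t / e ^+ 4)).+1; exact: truncnS_gt.
have N0 : 0 < N%:R :> R by apply: le_lt_trans hN; rewrite divr_ge0 ?exprn_ge0 ?ltW.
pose h := t / N%:R; have h0 : 0 < h by rewrite divr_gt0.
have Nh : N%:R * h = t by rewrite /h mulrC divfK// gt_eqF.
have he : h <= e ^+ 4.
  by rewrite /h ler_pdivrMr// mulrC -ler_pdivrMr ?exprn_gt0// ltW.
have tT0 : 0 < t <= T by rewrite t0.
have NhT : N%:R * h <= t by rewrite Nh.
have [g' ag' [g1 g2]] := sliced_kernel_adapted x tT0 h0 NhT.
rewrite Nh in g1 g2.
exists g' => //; split.
- apply: admissibleB; [exact: (noise_adapted_admissible H0 H1 ag')|exact: (green_admissible Greg)].
- move=> s /andP[s0 st]; have [|q [/andP[q0 qs] sq] gq] := g1 s; first by rewrite s0 ltW.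
  rewrite /green time_indicE (ltW s0) (ltW st)/=.
  under eq_integral do rewrite gq mul1r.
  by apply: (kernel_time_dist C0 Greg) => //; lra.
- move=> s k /andP[s0 st]; have [|q [/andP[q0 qs] sq] gq] := g1 s; first by rewrite s0 ltW.
  rewrite /green time_indicE (ltW s0) (ltW st)/=.
  under eq_integral do rewrite !gq !mul1r.
  have p : 0 < t - s <= T by lra.
  have p' : 0 < t - q <= T by lra.
  have := @integral_diff_shift _ (fun y => G (t - q) (x - y)) (fun y => G (t - s) (x - y)) k.
  move=> /(_ _ _ (measurable_kernel_reflect Greg _ _) (measurable_kernel_reflect Greg _ _)
    (kernel_shift Greg x k p') (kernel_shift Greg x k p)) => r; apply: le_trans r _.
  have kk : (t - q) `^ (- 2^-1) <= (t - s) `^ (- 2^-1) by apply: powR_half_le; lra.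
  have := ler_wpM2r (normr_ge0 k) (ler_wpM2l C0 kk).
  by rewrite lee_fin => ?; lra.
- by move=> s y ts; rewrite g2// /green time_indicE (leNgt s) ts/= andbF mul0r subrr.
Qed.

End green_adapted.

(** * The wave and heat kernels *)

Section unimodal.
Context {R : realType}.
Local Notation mu := (@lebesgue_measure R).
Local Notation mR := (measurable_fun [set: measurableTypeR R]).
Local Notation mRR := (measurable_fun [set: measurableTypeR R * measurableTypeR R]).

(** f(x) = f(min(x, 0)) + f(max(x, 0)) - f(0) is a sum of a nondecreasing and a nonincreasing
    function, each with L1 modulus M |h|. *)
Lemma unimodal_shift (f : R -> R) (M h : R) : mR f -> (forall x, 0 <= f x <= M) ->
  (forall x y, x <= y -> y <= 0 -> f x <= f y) -> (forall x y, 0 <= x -> x <= y -> f y <= f x) ->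
  (\int[mu]_x `|f (x + h)%R - f x|%:E <= (2 * M * `|h|)%:E)%E.
Proof.
move=> mf fM fi fd; have M0 : 0 <= M by have /andP[a b] := fM 0; exact: le_trans b.
pose f1 x := f (Num.min x 0); pose f2 x := f (Num.max x 0).
have fE x : f x = f1 x + f2 x - f 0.
  rewrite /f1 /f2; have [x0|/ltW x0] := leP x 0; first by rewrite addrK.
  by rewrite addrAC subrr add0r.
have ndf1 : {homo f1 : x y / x <= y}.
  move=> x y xy; apply: fi; first by rewrite le_min !ge_min xy lexx orbT.
  by rewrite ge_min lexx orbT.
have nif2 : {homo f2 : x y /~ x <= y}.
  move=> x y xy; apply: fd; first by rewrite le_max lexx orbT.
  by rewrite ge_max !le_max xy lexx orbT.
have k1 := monotone_shift h ndf1 (fun x => fM _).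
have k2 := monotone_shift_dec h nif2 (fun x => fM _).
have mf1 : mR f1 by apply: nondecreasing_measurable => // x y _ _; exact: ndf1.
have mf2 : mR f2.
  by apply: nonincreasing_measurable => // x y xy; exact: nif2.
apply: (@le_trans _ _ (\int[mu]_x (`|f1 (x + h) - f1 x| + `|f2 (x + h) - f2 x|)%:E)%E).
  apply: integral_mono => // [||x].
  - exact: measurable_shift_diff.
  - by apply: measurable_funD; exact: measurable_shift_diff.
  - rewrite [X in `|X|](_ : _ = (f1 (x + h) - f1 x) + (f2 (x + h) - f2 x)); first exact: ler_normD.
    by rewrite (fE x) (fE (x + h)); ring.
rewrite integral_add//; [|exact: measurable_shift_diff|exact: measurable_shift_diff].
apply: le_trans (leeD k1 k2) _.
by rewrite -EFinD lee_fin le_eqVlt; apply/orP; left; apply/eqP; ring.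
Qed.

(** A smooth even bump, 1 on [-a, a] and 0 where |x| >= a + e. *)
Definition plateau (a e x : R) : R :=
  smooth_step (e^-1 * x + e^-1 * (a + e)) * smooth_step (- e^-1 * x + e^-1 * (a + e)).

Lemma elem_smooth_plateau (a e : R) : elem_smooth (plateau a e).
Proof. by apply: es_mul; apply: es_affine; exact: elem_smooth_step. Qed.

Lemma plateau_ge0 a e x : 0 <= plateau a e x.
Proof. by rewrite mulr_ge0 ?smooth_step_ge0. Qed.

Lemma plateau_le1 a e x : plateau a e x <= 1.
Proof. by rewrite mulr_ile1 ?smooth_step_ge0 ?smooth_step_le1. Qed.

Lemma plateau1 a e x : 0 < e -> `|x| <= a -> plateau a e x = 1.
Proof.
move=> e0; rewrite ler_norml => /andP[ax xa]; rewrite /plateau !smooth_step1 ?mulr1//.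
- by rewrite mulNr -mulrN -mulrDr ler_pdivlMl//; lra.
- by rewrite -mulrDr ler_pdivlMl//; lra.
Qed.

Lemma plateau0 a e x : 0 < e -> a + e <= `|x| -> plateau a e x = 0.
Proof.
move=> e0; rewrite ler_normr => /orP[ax|ax].
  rewrite /plateau [X in _ * X]smooth_step0 ?mulr0// mulNr -mulrN -mulrDr.
  by rewrite mulr_ge0_le0 ?invr_ge0 ?(ltW e0)//; lra.
rewrite /plateau smooth_step0 ?mul0r// -mulrDr.
by rewrite mulr_ge0_le0 ?invr_ge0 ?(ltW e0)//; lra.
Qed.

Lemma plateau_incr a e x y : 0 < e -> 0 <= a -> x <= y -> y <= 0 -> plateau a e x <= plateau a e y.
Proof.
move=> e0 a0 xy y0; rewrite /plateau.
have h z : z <= 0 -> smooth_step (- e^-1 * z + e^-1 * (a + e)) = 1.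
  by move=> z0; rewrite smooth_step1// mulNr -mulrN -mulrDr ler_pdivlMl//; lra.
rewrite !h ?(le_trans xy)// !mulr1; apply: smooth_step_nd.
by rewrite lerD2r ler_pM2l ?invr_gt0.
Qed.

Lemma plateau_opp a e x : plateau a e (- x) = plateau a e x.
Proof. by rewrite /plateau mulrC mulrNN mulrN mulNr. Qed.

Lemma plateau_decr a e x y : 0 < e -> 0 <= a -> 0 <= x -> x <= y -> plateau a e y <= plateau a e x.
Proof.
move=> e0 a0 x0 xy; rewrite -(plateau_opp _ _ y) -(plateau_opp _ _ x).
by apply: plateau_incr => //; rewrite ?lerN2 ?oppr_le0.
Qed.

End unimodal.

Section wave.
Context {R : realType}.
Local Notation mu := (@lebesgue_measure R).
Local Notation mR := (measurable_fun [set: measurableTypeR R]).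
Local Notation mRR := (measurable_fun [set: measurableTypeR R * measurableTypeR R]).
Local Notation G := (@wave_kernel R).

Lemma wave_kernel_ge0 t x : 0 <= G t x.
Proof. by rewrite /wave_kernel; case: ifP. Qed.

Lemma wave_kernel_le t x : G t x <= 2^-1.
Proof. by rewrite /wave_kernel; case: ifP. Qed.

Lemma wave_kernel0 t x : t <= 0 -> G t x = 0.
Proof. by move=> t0; rewrite /wave_kernel ltNge (le_trans t0). Qed.

Lemma measurable_wave_kernel : mRR (fun z => G z.1 z.2).
Proof.
apply: measurable_fun_ifT => //; apply: measurable_fun_ltr; last exact: measurable_fst.
exact: (measurableT_comp (@normr_measurable _ _) measurable_snd).
Qed.

Lemma wave_kernelE t x : G t x = 2^-1 * \1_(`]- t, t[%classic : set R) x.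
Proof.
rewrite /wave_kernel ltr_norml indicE; case: ifPn => h.
  by rewrite mem_set ?mulr1//= in_itv.
by rewrite memNset ?mulr0//= in_itv/=; exact/negP.
Qed.

Lemma measurable_wave_slice t : mR (G t).
Proof.
exact: (measurableT_comp measurable_wave_kernel (@pair1_measurable _ _ (measurableTypeR R) (measurableTypeR R) t)).
Qed.

Lemma wave_kernel_mass t : 0 <= t -> (\int[mu]_x (G t x)%:E = t%:E)%E.
Proof.
move=> t0; under eq_integral do rewrite wave_kernelE.
have mI : mR (\1_(`]- t, t[%classic : set R) : R -> R) by apply: measurable_indic; exact: measurable_itv.
rewrite (integral_scale mu mI)//.
rewrite integral_indic//= setIT lebesgue_measure_itv/= lte_fin.
case: ltP => h; first by rewrite -EFinD -EFinM; congr (_%:E); field.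
by rewrite mule0; congr (_%:E); lra.
Qed.

Lemma wave_kernel_nd t t' x : t <= t' -> G t x <= G t' x.
Proof.
move=> tt; rewrite /wave_kernel; case: (ltP `|x| t) => [xt|_]; last by case: ifP.
by rewrite (lt_le_trans xt tt).
Qed.

Lemma wave_kernel_time t t' : 0 <= t -> t <= t' ->
  (\int[mu]_x (G t' x - G t x)%:E = (t' - t)%:E)%E.
Proof.
move=> t0 tt; have : (\int[mu]_x (G t' x - G t x)%:E + \int[mu]_x (G t x)%:E = t'%:E)%E.
  rewrite -integral_add.
  - under eq_integral do rewrite subrK.
    by rewrite wave_kernel_mass// (le_trans t0).
  - by apply: measurable_funB; exact: measurable_wave_slice.
  - exact: measurable_wave_slice.
  - by move=> x; rewrite subr_ge0 wave_kernel_nd.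
  - by move=> x; exact: wave_kernel_ge0.
rewrite wave_kernel_mass//; case: (\int[mu]_x _)%E => [r| |]//=.
by rewrite -EFinD => -[<-]; rewrite addrK.
Qed.

Lemma wave_kernel_incr t x y : x <= y -> y <= 0 -> G t x <= G t y.
Proof.
move=> xy y0; rewrite /wave_kernel !ler0_norm ?(le_trans xy)//.
by case: (ltP (- x) t) => xt; [rewrite ifT//; lra|case: ifP].
Qed.

Lemma wave_kernel_decr t x y : 0 <= x -> x <= y -> G t y <= G t x.
Proof.
move=> x0 xy; rewrite /wave_kernel !ger0_norm ?(le_trans x0)//.
by case: (ltP y t) => xt; [rewrite ifT//; lra|case: ifP].
Qed.

(** The kernel has mass t <= T, jumps of height 1/2 and a time increment of mass t' - t; the factor
    1 + T brings these into the form required for small and large t alike. *)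
Lemma wave_kernel_regular (T : R) : 0 < T -> regular_kernel T (1 + T) G.
Proof.
move=> T0; split.
- exact: measurable_wave_kernel.
- exact: wave_kernel_ge0.
- exact: wave_kernel0.
- move=> t tT; have [t0|t0] := leP 0 t; first by rewrite wave_kernel_mass// lee_fin; lra.
  rewrite (eq_integral (cst 0%E)); first by rewrite integral0 lee_fin; lra.
  by move=> x _; rewrite wave_kernel0// ltW.
- move=> t h tT; apply: (le_trans (@unimodal_shift _ (G t) 2^-1 h _ _ _ _)).
  + exact: measurable_wave_slice.
  + by move=> x; rewrite wave_kernel_ge0 wave_kernel_le.
  + exact: wave_kernel_incr.
  + exact: wave_kernel_decr.
  + rewrite lee_fin ler_wpM2r// divff ?pnatr_eq0//.
    by apply: powR_ge1_const => //; apply/andP; split; lra.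
- move=> t t' /andP[t0 tt] tT.
  under eq_integral => x _ do rewrite ger0_norm ?subr_ge0 ?wave_kernel_nd//.
  rewrite (wave_kernel_time (ltW t0) tt) lee_fin mulrCA ler_peMr ?subr_ge0//.
  by rewrite ler_pdivlMr//; lra.
- move=> t /andP[t0 tT]; exists 1 => // e e0.
  pose phi x := 2^-1 * plateau t e x.
  have sphi : elem_smooth phi by apply: es_mul; [exact: es_cst|exact: elem_smooth_plateau].
  have mphi : mR phi by apply: continuous_measurable_fun; exact: elem_smooth_continuous.
  exists phi, (t + e); split => //.
  + by move=> x tx; rewrite /phi plateau0 ?mulr0// ltW.
  (* The approximant lies between the kernels of ages t and t + e, whose masses differ by e. *)
  + have te : t <= t + e by lra.
    have eE : e%:E = (t + e - t)%:E by congr (_%:E); ring.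
    rewrite eE -(wave_kernel_time (ltW t0) te); apply: integral_mono => // [||x].
    * apply: (measurableT_comp (@normr_measurable _ _)); apply: measurable_funB => //.
      exact: measurable_wave_slice.
    * by apply: measurable_funB; exact: measurable_wave_slice.
    * have p0 := plateau_ge0 t e x; have p1 := plateau_le1 t e x.
      rewrite /phi /wave_kernel; case: ltP => xt.
        by rewrite plateau1 ?(ltW xt)// mulr1 subrr normr0 ifT ?subrr//; lra.
      have q0 : 0 <= 2^-1 * plateau t e x by apply: mulr_ge0.
      rewrite !subr0 (ger0_norm q0); case: (ltP `|x| (t + e)) => xte; first lra.
      by rewrite plateau0// mulr0.
  + move=> h; apply: (le_trans (@unimodal_shift _ phi 2^-1 h mphi _ _ _)).
    * by move=> x; rewrite /phi; have := plateau_ge0 t e x; have := plateau_le1 t e x; lra.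
    * by move=> x y xy y0; rewrite ler_pM2l ?invr_gt0//; apply: plateau_incr => //; exact: ltW.
    * by move=> x y x0 xy; rewrite ler_pM2l ?invr_gt0//; apply: plateau_decr => //; exact: ltW.
    * by rewrite lee_fin divff ?pnatr_eq0.
Qed.

End wave.

Section heat.
Context {R : realType}.
Local Notation mu := (@lebesgue_measure R).
Local Notation mR := (measurable_fun [set: measurableTypeR R]).
Local Notation mRR := (measurable_fun [set: measurableTypeR R * measurableTypeR R]).
Local Notation G := (@heat_kernel R).

Lemma heat_kernelE t x : 0 < t -> G t x = normal_pdf 0 (Num.sqrt t) x.
Proof.
move=> t0; have st0 : 0 < Num.sqrt t by rewrite sqrtr_gt0.
rewrite /heat_kernel t0 normal_pdfE ?gt_eqF// /normal_peak /normal_fun.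
rewrite (sqr_sqrtr (ltW t0)) subr0 real_normK ?num_real//; congr (_ * expR _).
  by congr (Num.sqrt _)^-1; rewrite -mulr_natl; ring.
by rewrite mulNr -(mulr_natl t 2).
Qed.

Lemma heat_kernel0 t x : t <= 0 -> G t x = 0.
Proof. by move=> t0; rewrite /heat_kernel ltNge t0. Qed.

Lemma heat_kernel_ge0 t x : 0 <= G t x.
Proof.
have [t0|t0] := ltP 0 t; first by rewrite heat_kernelE// normal_pdf_ge0.
by rewrite heat_kernel0.
Qed.

Lemma measurable_heat_kernel : mRR (fun z => G z.1 z.2).
Proof.
have -> : (fun z => G z.1 z.2) = (fun z : R * R => if 0 < z.1 then
    (2 * pi * z.1) `^ (- 2^-1) * expR (- (`|z.2| ^+ 2 * (2 * z.1) `^ (- 1))) else 0).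
  apply/funext => z; rewrite /heat_kernel; case: ltP => // z0.
  have p0 : 0 <= 2 * pi * z.1 by rewrite !mulr_ge0 ?pi_ge0 ?ltW.
  have q0 : 0 <= 2 * z.1 by rewrite mulr_ge0 ?ltW.
  by rewrite !powRN powR12_sqrt// powRr1.
apply: measurable_fun_ifT => //.
  by apply: measurable_fun_ltr => //; exact: measurable_fst.
have m1 (c : R) : mRR (fun z : R * R => c * z.1).
  by apply: measurable_funM => //; exact: measurable_fst.
apply: measurable_funM; first by apply: measurable_powR_comp; exact: m1.
apply: (measurableT_comp (@measurable_expR R)).
apply: (measurableT_comp (@oppr_measurable R setT)).
apply: measurable_funM; last by apply: measurable_powR_comp; exact: m1.
by apply: measurable_funX; exact: (measurableT_comp (@normr_measurable _ _) measurable_snd).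
Qed.

Lemma measurable_heat_slice t : mR (G t).
Proof.
exact: (measurableT_comp measurable_heat_kernel (@pair1_measurable _ _ (measurableTypeR R) (measurableTypeR R) t)).
Qed.

Lemma heat_kernel_mass t : 0 < t -> (\int[mu]_x (G t x)%:E = 1%E)%E.
Proof. by move=> t0; under eq_integral do rewrite heat_kernelE//; rewrite integral_normal_pdf. Qed.

Lemma heat_kernel_le t x : 0 < t -> G t x <= t `^ (- 2^-1).
Proof.
move=> t0; rewrite powRN (powR12_sqrt (ltW t0)) /heat_kernel t0.
have s0 : 0 < Num.sqrt t by rewrite sqrtr_gt0.
have tp : t <= 2 * pi * t.
  by rewrite ler_peMl ?(ltW t0)//; have := @pi_ge2 R; lra.
have sp : Num.sqrt t <= Num.sqrt (2 * pi * t) by rewrite ler_sqrt// (le_trans (ltW t0)).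
apply: (@le_trans _ _ (Num.sqrt (2 * pi * t))^-1).
  rewrite ler_piMr ?invr_ge0 ?sqrtr_ge0// -[leRHS]expR0 ler_expR oppr_le0 divr_ge0//.
  by rewrite mulr_ge0// ltW.
by rewrite lef_pV2 ?posrE// (lt_le_trans s0).
Qed.

Lemma heat_kernel_decr t x y : `|x| <= `|y| -> G t y <= G t x.
Proof.
move=> xy; rewrite /heat_kernel; case: ltP => // t0.
rewrite ler_wpM2l ?invr_ge0 ?sqrtr_ge0// ler_expR lerN2 ler_pM2r ?invr_gt0 ?mulr_gt0//.
by rewrite lerXn2r ?nnegrE.
Qed.

(** The prefactors have ratio sqrt(t/t') >= t/t', and the exponential increases with age. This
    pointwise comparison yields the L1 time modulus. *)
Lemma heat_kernel_ratio t t' x : 0 < t <= t' -> t / t' * G t x <= G t' x.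
Proof.
move=> /andP[t0 tt]; have t0' : 0 < t' by exact: lt_le_trans tt.
rewrite /heat_kernel t0 t0' mulrA.
have pp : 0 < 2 * pi :> R by rewrite mulr_gt0// pi_gt0.
have st := sqrtr_gt0 t; have st' := sqrtr_gt0 t'; rewrite t0 in st; rewrite t0' in st'.
have sp : 0 < Num.sqrt (2 * pi) :> R by rewrite sqrtr_gt0.
apply: ler_pM; rewrite ?expR_ge0//.
- by rewrite mulr_ge0 ?invr_ge0 ?sqrtr_ge0// divr_ge0 ?ltW.
- rewrite !(sqrtrM _ (ltW pp)) !(invfM (Num.sqrt (2 * pi))) mulrCA ler_pM2l ?invr_gt0//.
  have e1 : t = Num.sqrt t ^+ 2 by rewrite sqr_sqrtr ?ltW.
  have e2 : t' = Num.sqrt t' ^+ 2 by rewrite sqr_sqrtr ?ltW.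
  have -> : t / t' / Num.sqrt t = (Num.sqrt t / Num.sqrt t') * (Num.sqrt t')^-1.
    rewrite {1}e1 {1}e2; field; by rewrite !gt_eqF.
  rewrite ler_piMl ?invr_ge0 ?(ltW st')// ler_pdivrMr// mul1r ler_sqrt// ltW//.
- rewrite ler_expR lerN2 ler_wpM2l ?sqr_ge0// lef_pV2 ?posrE ?mulr_gt0//.
  by rewrite ler_pM2l.
Qed.

Lemma heat_kernel_second_moment t : 0 < t -> (\int[mu]_x (x ^+ 2 * G t x)%:E <= (8 * t)%:E)%E.
Proof.
move=> t0; have st0 : 0 < Num.sqrt t by rewrite sqrtr_gt0.
apply: (@le_trans _ _ (\int[mu]_x (8 * t * normal_pdf 0 (Num.sqrt 2 * Num.sqrt t) x)%:E)%E).
  apply: integral_mono => [||x|x].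
  - by apply: measurable_funM; [exact: measurable_funX|exact: measurable_heat_slice].
  - by apply: measurable_funM => //; exact: measurable_normal_pdf.
  - by rewrite mulr_ge0 ?sqr_ge0 ?heat_kernel_ge0.
  - rewrite heat_kernelE//; have := @normal_pdf_power R 1 (Num.sqrt t) x st0.
    rewrite muln1 expr1 (sqr_sqrtr (ltW t0)) => /le_trans; apply.
    by rewrite le_eqVlt; apply/orP; left; apply/eqP; rewrite (_ : 1`! = 1)%N//; ring.
rewrite (integral_scale mu (@measurable_normal_pdf R 0 (Num.sqrt 2 * Num.sqrt t))).
- by rewrite integral_normal_pdf mule1.
- by move=> x; exact: normal_pdf_ge0.
- by rewrite mulr_ge0// ltW.
Qed.

(** With c = t/t', the difference is the nonnegative G t' - c G t minus (1-c) G t, both of mass 1 -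
    c; and 2(1 - t/t') <= 2(t'-t)/t. *)
Lemma heat_kernel_time t t' : 0 < t <= t' ->
  (\int[mu]_x `|G t' x - G t x|%:E <= (2 * ((t' - t) / t))%:E)%E.
Proof.
move=> tt; have [t0 tt'] := andP tt; have t0' : 0 < t' by exact: lt_le_trans tt'.
pose c := t / t'.
have c0 : 0 <= c by rewrite divr_ge0 ?ltW.
have c1 : c <= 1 by rewrite ler_pdivrMr// mul1r.
have m1 : mR (fun x => G t' x - c * G t x).
  by apply: measurable_funB; [exact: measurable_heat_slice|apply: measurable_funM => //; exact: measurable_heat_slice].
have m2 : mR (fun x => (1 - c) * G t x).
  by apply: measurable_funM => //; exact: measurable_heat_slice.
have m3 : mR (fun x => c * G t x) by apply: measurable_funM => //; exact: measurable_heat_slice.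
have i1 : (\int[mu]_x (G t' x - c * G t x)%:E = (1 - c)%:E)%E.
  have : (\int[mu]_x (G t' x - c * G t x)%:E + \int[mu]_x (c * G t x)%:E = 1%:E)%E.
    rewrite -integral_add//.
    - by under eq_integral do rewrite subrK; rewrite heat_kernel_mass.
    - by move=> x; rewrite subr_ge0; exact: heat_kernel_ratio.
    - by move=> x; rewrite mulr_ge0// heat_kernel_ge0.
  rewrite (integral_scale mu (measurable_heat_slice t) (heat_kernel_ge0 t) c0) heat_kernel_mass// mule1.
  by case: (\int[mu]_x _)%E => [r| |]//=; rewrite -EFinD => -[<-]; rewrite addrK.
apply: (@le_trans _ _ (\int[mu]_x ((G t' x - c * G t x) + (1 - c) * G t x)%:E)%E).
  apply: integral_mono => // [||x].
  - apply: (measurableT_comp (@normr_measurable _ _)).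
    by apply: measurable_funB; exact: measurable_heat_slice.
  - exact: measurable_funD.
  - have g := heat_kernel_ge0 t x; have r := heat_kernel_ratio x tt; rewrite -/c in r.
    have cg : 0 <= (1 - c) * G t x by rewrite mulr_ge0// subr_ge0.
    have e : (1 - c) * G t x = G t x - c * G t x by ring.
    by rewrite e in cg *; rewrite ler_norml; apply/andP; split; lra.
rewrite integral_add//.
- rewrite i1 (integral_scale mu (measurable_heat_slice t) (heat_kernel_ge0 t)) ?subr_ge0//.
  rewrite heat_kernel_mass// mule1 -EFinD lee_fin -mulr2n -[leLHS]mulr_natl ler_pM2l//.
  rewrite /c -{1}(divff (lt0r_neq0 t0')) -mulrBl ler_wpM2l ?subr_ge0//.
  by rewrite lef_pV2.
- by move=> x; rewrite subr_ge0; exact: heat_kernel_ratio.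
- by move=> x; rewrite mulr_ge0 ?heat_kernel_ge0// subr_ge0.
Qed.

Lemma elem_smooth_heat t : 0 < t -> elem_smooth (G t).
Proof.
move=> t0; have -> : G t = (fun x => (Num.sqrt (2 * pi * t))^-1 * expR (- (2 * t)^-1 * (x * x))).
  apply/funext => x; rewrite /heat_kernel t0; congr (_ * expR _).
  by rewrite real_normK ?num_real// expr2 mulNr mulrC.
apply: es_mul; first exact: es_cst.
by apply: es_exp; apply: es_mul; [exact: es_cst|apply: es_mul; exact: es_id].
Qed.

Lemma heat_kernel_regular (T : R) : 0 < T -> regular_kernel T 2 G.
Proof.
move=> T0; split.
- exact: measurable_heat_kernel.
- exact: heat_kernel_ge0.
- exact: heat_kernel0.
- move=> t tT; have [t0|t0] := ltP 0 t; first by rewrite heat_kernel_mass// lee_fin ler1n.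
  rewrite (eq_integral (cst 0%E)); first by rewrite integral0 lee_fin.
  by move=> x _; rewrite heat_kernel0.
- move=> t h /andP[t0 tT]; apply: (unimodal_shift (f := G t) (M := t `^ (- 2^-1))).
  + exact: measurable_heat_slice.
  + by move=> x; rewrite heat_kernel_ge0 heat_kernel_le.
  + by move=> x y xy y0; apply: heat_kernel_decr; rewrite !ler0_norm ?lerN2// (le_trans xy).
  + by move=> x y x0 xy; apply: heat_kernel_decr; rewrite !ger0_norm// (le_trans x0).
- by move=> t t' tt _; exact: heat_kernel_time.
- move=> t /andP[t0 tT]; exists (2 * t `^ (- 2^-1)); first by rewrite mulr_ge0 ?powR_ge0.
  move=> e e0; have [N hN] : exists N : nat, 8 * t / e < N%:R.
    by exists (Num.truncn (8 * t / e)).+1; exact: truncnS_gt.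
  have N0 : 0 < N%:R :> R by apply: le_lt_trans hN; rewrite divr_ge0 ?mulr_ge0 ?ltW.
  have N1 : 1 <= N%:R :> R by move: N0; rewrite ltr0n ler1n.
  (* A product of two nonnegative functions unimodal at 0 is again unimodal, so phi inherits the
     translation bound of the kernel. The lost tail is at most 8t/N by the second moment, since 1 <=
     x^2/N for |x| > N >= 1. *)
  pose phi x := G t x * plateau N%:R 1 x.
  have sphi : elem_smooth phi by apply: es_mul; [exact: elem_smooth_heat|exact: elem_smooth_plateau].
  have mphi : mR phi by apply: continuous_measurable_fun; exact: elem_smooth_continuous.
  exists phi, (N%:R + 1); split => //.
  + by move=> x tx; rewrite /phi plateau0 ?mulr0// ltW.
  + apply: (@le_trans _ _ (\int[mu]_x (N%:R^-1 * (x ^+ 2 * G t x))%:E)%E).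
      apply: integral_mono => // [||x].
      * apply: (measurableT_comp (@normr_measurable _ _)); apply: measurable_funB => //.
        exact: measurable_heat_slice.
      * apply: measurable_funM => //; apply: measurable_funM; last exact: measurable_heat_slice.
        exact: measurable_funX.
      * have g := heat_kernel_ge0 t x.
        have p0 := plateau_ge0 N%:R 1 x; have p1 := plateau_le1 N%:R 1 x.
        have -> : `|phi x - G t x| = (1 - plateau N%:R 1 x) * G t x.
          rewrite /phi distrC ger0_norm; first by ring.
          by rewrite subr_ge0 ler_piMr.
        rewrite mulrA ler_wpM2r//; have [xN|xN] := leP `|x| N%:R.
          by rewrite plateau1// subrr mulr_ge0 ?invr_ge0 ?sqr_ge0.
        apply: (@le_trans _ _ 1); first lra.
        rewrite ler_pdivlMl// mulr1 -real_normK ?num_real// expr2.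
        by rewrite -[leLHS]mul1r ler_pM// ?(le_trans N1)// ltW.
    rewrite (@integral_scale _ _ _ mu _ (fun x => x ^+ 2 * G t x)); last 3 first.
    * by apply: measurable_funM; [exact: measurable_funX|exact: measurable_heat_slice].
    * by move=> x; rewrite mulr_ge0 ?sqr_ge0 ?heat_kernel_ge0.
    * by rewrite invr_ge0.
    apply: (@le_trans _ _ (N%:R^-1%:E * (8 * t)%:E)%E).
      by rewrite lee_wpmul2l ?lee_fin ?invr_ge0// heat_kernel_second_moment.
    move: hN; rewrite ltr_pdivrMr// => hN; rewrite -EFinM lee_fin ler_pdivrMl//.
    exact: ltW.
  + move=> h; apply: (unimodal_shift (f := phi) (M := t `^ (- 2^-1))) => //.
    * move=> x; rewrite /phi mulr_ge0 ?heat_kernel_ge0 ?plateau_ge0//=.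
      apply: (@le_trans _ _ (G t x)); last exact: heat_kernel_le.
      by rewrite ler_piMr ?heat_kernel_ge0 ?plateau_le1.
    * move=> x y xy y0; rewrite /phi ler_pM ?heat_kernel_ge0 ?plateau_ge0//.
        by apply: heat_kernel_decr; rewrite !ler0_norm ?lerN2// (le_trans xy).
      exact: plateau_incr.
    * move=> x y x0 xy; rewrite /phi ler_pM ?heat_kernel_ge0 ?plateau_ge0//.
        by apply: heat_kernel_decr; rewrite !ger0_norm// (le_trans x0).
      exact: plateau_decr.
Qed.

End heat.

(** * The stochastic convolution *)

Section area.
Context {R : realType}.
Local Notation R2 := (measurableTypeR R * measurableTypeR R)%type.

(* The library's sigma-finiteness instance on products is only found for subprobabilities. *)
Definition area : set R2 -> \bar R := ((@lebesgue_measure R) \x (@lebesgue_measure R))%E.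

HB.instance Definition _ := Measure.on area.

Lemma area_sigma_finite : sigma_finite setT area.
Proof.
pose I n : set (measurableTypeR R) := `[- n%:R, n%:R]%classic.
have mI n : measurable (I n) by exact: measurable_itv.
exists (fun n => I n `*` I n) => [|n].
  apply/seteqP; split => // -[x y] _.
  have [n /ltW hn] : exists n : nat, Num.max `|x| `|y| < n%:R.
    by exists (Num.truncn (Num.max `|x| `|y|)).+1; exact: truncnS_gt.
  move: hn; rewrite ge_max => /andP[xn yn].
  by exists n => //; split; rewrite /I /= in_itv/= -ler_norml.
split; first exact: measurableX.
rewrite /area product_measure1E//.
have Ioo : (lebesgue_measure (I n) < +oo)%E.
  by rewrite /I lebesgue_measure_itv/=; case: ifP => _; rewrite ?ltry// -EFinB ltry.
by rewrite lte_mul_pinfty// ge0_fin_numE.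
Qed.

HB.instance Definition _ := Measure_isSigmaFinite.Build _ _ _ area area_sigma_finite.

End area.
Arguments area R : clear implicits.

Section space_time_kernel.
Context {R : realType}.
Local Notation mu := (@lebesgue_measure R).
Local Notation mR := (measurable_fun [set: measurableTypeR R]).
Local Notation R2 := (measurableTypeR R * measurableTypeR R)%type.
Local Notation M2 := (area R).
Variables T C : R.
Hypothesis T0 : 0 < T.
Hypothesis C0 : 0 <= C.
Variable G : R -> R -> R.
Hypothesis Greg : regular_kernel T C G.

Definition kern (p z : R * R) : R := green G p.1 p.2 z.1 z.2.

Lemma kern_ge0 p z : 0 <= kern p z.
Proof. by rewrite mulr_ge0 ?(rk_ge0 Greg)// time_indicE; case: ifP. Qed.

Lemma measurable_kern : measurable_fun [set: R2 * R2] (fun q => kern q.1 q.2).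
Proof.
have m1 : measurable_fun [set: R2 * R2] (fun q => q.1.1) by exact: (measurableT_comp measurable_fst measurable_fst).
have m2 : measurable_fun [set: R2 * R2] (fun q => q.1.2) by exact: (measurableT_comp measurable_snd measurable_fst).
have m3 : measurable_fun [set: R2 * R2] (fun q => q.2.1) by exact: (measurableT_comp measurable_fst measurable_snd).
have m4 : measurable_fun [set: R2 * R2] (fun q => q.2.2) by exact: (measurableT_comp measurable_snd measurable_snd).
apply: measurable_funM; last exact: (measurable_green_param Greg m1 m2 m3 m4).
under eq_fun do rewrite time_indicE.
apply: measurable_fun_ifT => //; apply: measurable_and.
  exact: measurable_fun_ler.
exact: measurable_fun_ler.
Qed.

Lemma measurable_kern_slice p : measurable_fun [set: R2] (kern p).
Proof.
exact: (measurableT_comp measurable_kern (@pair1_measurable _ _ R2 R2 p)).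
Qed.

Lemma space_time_tonelli (f : R * R -> R) : measurable_fun [set: R2] f -> (forall z, 0 <= f z) ->
  (\int[M2]_z (f z)%:E = \int[mu]_s \int[mu]_y (f (s, y))%:E)%E.
Proof.
move=> mf f0; transitivity (\int[mu \x mu]_z (f z)%:E)%E; first by [].
rewrite fubini_tonelli1//; exact/measurable_EFinP.
Qed.

Lemma kern_weight_le (f : R -> R) (t x : R) : mR f -> (forall s, 0 <= f s) -> t <= T ->
  (\int[M2]_z (f z.1 * kern (t, x) z)%:E <= C%:E * \int[mu]_(s in `[0%R, t]) (f s)%:E)%E.
Proof.
move=> mf f0 tT; have mk := measurable_kern_slice (t, x).
have mfs : measurable_fun [set: R2] (fun z : R2 => f z.1) by exact: (measurableT_comp mf measurable_fst).
have mI := measurable_time_indic t.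
have mfI : mR (fun s => f s * \1_(`[0, t]%classic : set R) s) by exact: measurable_funM.
have fI0 s : 0 <= f s * \1_(`[0, t]%classic : set R) s.
  by rewrite mulr_ge0// time_indicE; case: ifP.
rewrite space_time_tonelli.
- rewrite integral_indicr -(integral_scale mu mfI fI0 C0).
  apply: ge0_le_integral => //.
  + by move=> s _; apply: integral_ge0 => y _; rewrite lee_fin mulr_ge0 ?kern_ge0.
  + apply: (@measurable_integral_param _ _ _ _ _ mu (fun z => (f z.1 * kern (t, x) z)%:E)).
    by apply/measurable_EFinP; exact: measurable_funM.
  + by apply/measurable_EFinP; exact: measurable_funM.
  + move=> s _; rewrite /kern/= /green.
    under eq_integral do rewrite mulrA.
    rewrite (@integral_scale _ _ _ mu _ (fun y => G (t - s) (x - y)))//; last 2 first.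
    * exact: (measurable_kernel_reflect Greg).
    * by move=> y; exact: (rk_ge0 Greg).
    rewrite [C * _]mulrC (EFinM (f s * _)).
    have [->|] := eqVneq (f s * \1_(`[0, t]%classic : set R) s) 0; first by rewrite !mul0e.
    rewrite mulf_eq0 negb_or time_indicE => /andP[_]; case: ifPn => // [/andP[s0 st] _|]; last by rewrite eqxx.
    rewrite lee_wpmul2l ?lee_fin ?mulr1//.
    by apply: (kernel_mass Greg); lra.
- exact: measurable_funM.
- by move=> z; rewrite mulr_ge0 ?kern_ge0.
Qed.

Lemma kern_mass (t x : R) : 0 <= t <= T -> (\int[M2]_z (kern (t, x) z)%:E <= (C * T)%:E)%E.
Proof.
move=> /andP[t0 tT]; have := @kern_weight_le (fun=> 1) t x (measurable_cst _) (fun=> ler01) tT.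
under eq_integral do rewrite mul1r; move=> h; apply: le_trans h _.
rewrite (EFinM C) lee_wpmul2l ?lee_fin//.
rewrite integral_cst//= mul1e lebesgue_measure_itv/= lte_fin.
by case: ifP => _; rewrite -?EFinD ?subr0 lee_fin// ltW.
Qed.

Lemma integral_expR_le (B t : R) : 0 < B -> 0 <= t ->
  (\int[mu]_(s in `[0%R, t]) (expR (B * s))%:E <= (expR (B * t) / B)%:E)%E.
Proof.
move=> B0; rewrite le_eqVlt => /predU1P[<-|t0].
  rewrite set_itv1 integral_set1 lee_fin divr_ge0 ?expR_ge0// ltW//.
pose F (s : R) := B^-1 * expR (B * s).
have dE (s : R) : is_derive s 1 (fun s : R => expR (B * s)) (B * expR (B * s)).
  have h1 : is_derive s 1 (fun s : R => B * s) B.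
    have : is_derive s 1 (fun s : R => B * s) (B *: 1) by apply: is_deriveZ.
    by rewrite -[B *: 1]/(B * 1) mulr1.
  by have := is_derive1_comp (f := expR) (is_derive_expR (B * s)) h1; rewrite /= mulrC.
have dF (s : R) : is_derive s 1 F (expR (B * s)).
  have -> : expR (B * s) = B^-1 *: (B * expR (B * s)) by rewrite scalerA mulVf ?scale1r// gt_eqF.
  exact: is_deriveZ.
have cF (s : R) : {for s, continuous F}.
  by apply/differentiable_continuous/derivable1_diffP; case: (dF s).
rewrite (@continuous_FTC2 _ (fun s => expR (B * s)) F 0 t t0).
- rewrite -EFinB lee_fin /F mulrC lerBlDr lerDl mulr_ge0 ?expR_ge0// invr_ge0 ltW//.
- apply: continuous_in_subspaceT => s _.
  by apply/differentiable_continuous/derivable1_diffP; case: (dE s).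
- split.
  + by move=> s _; case: (dF s).
  + by apply: cvg_at_right_filter; apply: cF.
  + by apply: cvg_at_left_filter; apply: cF.
- by move=> s _; rewrite derive1E; case: (dF s).
Qed.

(** The weight e^(Bs) gains a factor 1/B against e^(Bt): for large B the drift becomes a
    contraction, on an interval of any length. *)
Lemma kern_exp (B t x : R) : 0 < B -> 0 <= t <= T ->
  (\int[M2]_z (expR (B * z.1) * kern (t, x) z)%:E <= (C * (expR (B * t) / B))%:E)%E.
Proof.
move=> B0 /andP[t0 tT].
have mE : mR (fun s => expR (B * s)).
  by apply: (measurableT_comp (@measurable_expR R)); exact: measurable_funM.
apply: le_trans (kern_weight_le x mE (fun s => expR_ge0 _) tT) _.
by rewrite (EFinM C) lee_wpmul2l ?lee_fin// integral_expR_le.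
Qed.

Lemma kern_dist (t t' x x' e : R) : 0 <= e -> 0 <= t <= T -> 0 <= t' <= T ->
  `|t' - t| <= e ^+ 4 -> `|x' - x| <= e ^+ 2 ->
  (\int[M2]_z `|kern (t', x') z - kern (t, x) z|%:E <=
   (3 * (2 * C * (T `^ (3 / 4) / (3 / 4)) * e))%:E)%E.
Proof.
move=> e0 tT tT' te xe.
have h := green_drift_dist T0 C0 Greg e0 tT tT' te xe; apply: le_trans h.
have mk := measurable_kern_slice (t, x); have mk' := measurable_kern_slice (t', x').
have md : measurable_fun [set: R2] (fun z => `|kern (t', x') z - kern (t, x) z|).
  by apply: (measurableT_comp (@normr_measurable _ _)); exact: measurable_funB.
rewrite space_time_tonelli//.
have md' : mR (fun s => \int[mu]_y `|kern (t', x') (s, y) - kern (t, x) (s, y)|%:E)%E.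
  apply: (@measurable_integral_param _ _ _ _ _ mu (fun z => `|kern (t', x') z - kern (t, x) z|%:E)).
  exact/measurable_EFinP.
have mD : measurable (`[0, T]%classic : set (measurableTypeR R)) by exact: measurable_itv.
rewrite [leRHS]integral_mkcond; apply: ge0_le_integral => //.
- by move=> s _; apply: integral_ge0 => y _; rewrite lee_fin.
- have h1 : measurable_fun (`[0, T]%classic : set (measurableTypeR R)) (fun s => \int[mu]_y `|kern (t', x') (s, y) - kern (t, x) (s, y)|%:E)%E.
    by apply: measurable_funTS; exact: md'.
  exact: ((measurable_restrictT _ mD).1 h1).
- move=> s _; rewrite patchE; case: ifPn => // sT.
  rewrite (eq_integral (cst 0%E)) ?integral0// => y _.
  rewrite /kern /green/= !time_indicE.
  have [/andP[t0 tT2] /andP[t0' tT2']] := (tT, tT').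
  have ns r : r <= T -> (0 <= s <= r) = false.
    move=> rT; apply/negbTE/negP => /andP[s0 sr]; move: sT; rewrite notin_setE/= in_itv/= s0/=.
    by apply; exact: le_trans rT.
  by rewrite !ns// !mul0r subrr normr0.
Qed.

End space_time_kernel.

Section progressive.
Context {R : realType} d (Omega : measurableType d) (P : probability Omega R).
Hypothesis P_complete : measure_is_complete P.
Variables H T : R.
Variable W : test_functions R -> {RV P >-> R}.
Local Notation R2 := (measurableTypeR R * measurableTypeR R)%type.
Local Notation noise_space := (noise_space H W).

(** Progressive measurability on [0, T]; the restriction to times in [0, r] is written with an
    indicator so that the domain is a full product space. *)
Definition progressive (U : R * R -> Omega -> R) : Prop :=
  forall r : R, 0 <= r <= T ->
  measurable_fun [set: R2 * noise_space r] (fun q => \1_(`[0, r]) q.1.1 * U q.1 q.2).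

Lemma progressive_limit (U : nat -> R * R -> Omega -> R) : (forall n, progressive (U n)) ->
  progressive (fun z => limit_fun (U ^~ z)).
Proof.
move=> pU r rT.
have -> : (fun q : R2 * noise_space r => \1_(`[0, r]) q.1.1 * limit_fun (U ^~ q.1) q.2) =
    limit_fun (fun n q => \1_(`[0, r]) q.1.1 * U n q.1 q.2).
  apply/funext => q; rewrite time_indicE; case: ifP => q1.
    rewrite mul1r /limit_fun; congr (fine (limn_esup _)); apply/funext => n.
    by rewrite time_indicE q1 mul1r.
  rewrite mul0r; symmetry; apply: limit_funE.
  by under eq_fun do rewrite time_indicE q1 mul0r; exact: cvg_cst.
by apply: measurable_limit_fun => n; exact: pU.
Qed.

Lemma progressiveD (U V : R * R -> Omega -> R) : progressive U -> progressive V ->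
  progressive (fun z w => U z w + V z w).
Proof.
move=> pU pV r rT; under eq_fun do rewrite mulrDr.
by apply: measurable_funD; [exact: pU|exact: pV].
Qed.

Lemma progressive_const (f : R * R -> R) : measurable_fun [set: R2] f ->
  progressive (fun z _ => f z).
Proof.
move=> mf r rT; apply: measurable_funM; last exact: (measurableT_comp mf measurable_fst).
apply: (measurableT_comp (measurable_time_indic r)).
exact: (measurableT_comp measurable_fst measurable_fst).
Qed.

(** By [measurable_noise_space], which rests on the completeness of P, the sigma-algebras of the
    filtration are contained in that of Omega. *)
Lemma progressive_measurable (U : R * R -> Omega -> R) (r : R) : progressive U -> 0 <= r <= T ->
  measurable_fun [set: R2 * Omega] (fun q => \1_(`[0, r]) q.1.1 * U q.1 q.2).
Proof.
move=> pU rT.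
have mi : measurable_fun [set: R2 * Omega] (fun q => (q.1, (q.2 : noise_space r))).
  apply: measurable_fun_pair => //.
  move=> _ B mB; rewrite setTI.
  have := measurable_noise_space P_complete measurableT mB; rewrite setTI => mB'.
  by rewrite -[X in measurable X]setTI; exact: measurable_snd.
exact: (measurableT_comp (pU r rT) mi).
Qed.

Lemma progressive_adapted (U : R * R -> Omega -> R) (t x : R) : progressive U -> 0 <= t <= T ->
  measurable_fun [set: noise_space t] (U (t, x)).
Proof.
move=> pU tT; have [t0 _] := andP tT.
have := measurableT_comp (pU t tT) (@pair1_measurable _ _ R2 (noise_space t) (t, x)).
have -> : (fun q : R2 * noise_space t => \1_(`[0, t]) q.1.1 * U q.1 q.2) \o pair (t, x) = U (t, x).
  by apply/funext => w /=; rewrite time_indicE t0 lexx mul1r.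
by [].
Qed.

End progressive.

Section noise_field.
Context {R : realType} d (Omega : measurableType d) (P : probability Omega R).
Hypothesis P_complete : measure_is_complete P.
Variables H T C : R.
Hypothesis H0 : 0 < H.
Hypothesis H1 : H < 1.
Hypothesis T0 : 0 < T.
Hypothesis C0 : 0 <= C.
Variable G : R -> R -> R.
Hypothesis Greg : regular_kernel T C G.
Variable W : test_functions R -> {RV P >-> R}.
Hypothesis W_noise : fractional_noise H W.
Local Notation R2 := (measurableTypeR R * measurableTypeR R)%type.
Local Notation wi := (wiener_integral H W).
Local Notation msq := (mean_sq P).

Lemma grid_scale (e : R) : 0 < e -> exists2 r, 0 < r <= 1 &
  32 * (10 * noise_power_const H T (2 * C) * r `^ H) <= e.
Proof.
move=> e0; have N0 : 0 <= 32 * (10 * noise_power_const H T (2 * C)).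
  have H4 : 0 <= H / 4 by have := H0; lra.
  rewrite mulr_ge0// mulr_ge0//; apply: mulr_ge0; last by rewrite divr_ge0 ?powR_ge0.
  by apply: mulr_ge0; [exact: slice_const_ge0|rewrite mulr_ge0 ?powR_ge0].
by have [r r01 re] := small_power H0 N0 e0; exists r => //; rewrite mulrA.
Qed.

(** Arbitrary adapted versions X(t, x), chosen point by point, have no joint regularity. Their
    values on finer and finer grids do, and at each point they converge almost surely to X(t, x)
    because the mean-square errors are at most 4^(-n). *)
Lemma noise_field : exists2 V : R * R -> Omega -> R, progressive H T W V &
  forall t x, 0 <= t <= T -> exists2 X : {RV P >-> R}, wi (green G t x) X &
    {ae P, forall w, V (t, x) w = X w}.
Proof.
have /boolp.choice[X hX] : forall z : R * R, exists X : {RV P >-> R}, 0 <= z.1 <= T ->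
    wi (green G z.1 z.2) X /\ measurable_fun [set: noise_space H W z.1] X.
  move=> z; have [zT|zT] := boolP (0 <= z.1 <= T).
    by have [X wX mX] := green_adapted H0 H1 T0 C0 Greg W_noise z.2 zT; exists X.
  have mc : measurable_fun [set: Omega] (fun=> 0 : R) by exact: measurable_cst.
  by have [X _] := mk_RV P mc; exists X.
have e0 n : 0 < (4 ^+ n)^-1 :> R by rewrite invr_gt0 exprn_gt0.
have /boolp.choice[e he] : forall n, exists r, 0 < r <= 1 /\
    32 * (10 * noise_power_const H T (2 * C) * r `^ H) <= (4 ^+ n)^-1.
  by move=> n; have [r r01 rn] := grid_scale (e0 n); exists r.
pose k n := (e n ^+ 4)^-1.
have k0 n : 0 < k n by rewrite invr_gt0 exprn_gt0//; have [/andP[]] := he n.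
pose U n (z : R * R) := X (grid_point (k n) z.1, grid_point (k n) z.2) : Omega -> R.
exists (fun z => limit_fun (U ^~ z)).
  apply: progressive_limit => n r /andP[r0 rT].
  pose cell (q : R2 * noise_space H W r) : int * int := (Num.floor (q.1.1 * k n), Num.floor (q.1.2 * k n)).
  (* On a cell the field is a single random variable, measurable at the grid time of the cell.
     Putting 0 when that time is outside [0, r] changes nothing: times in [0, r] round down into
     [0, r], and the indicator kills the others. *)
  pose F (j : int * int) (q : R2 * noise_space H W r) : R :=
    if 0 <= j.1%:~R / k n <= r then \1_(`[0, r]) q.1.1 * X (j.1%:~R / k n, j.2%:~R / k n) q.2 else 0.
  have -> : (fun q : R2 * noise_space H W r => \1_(`[0, r]) q.1.1 * U n q.1 q.2) = (fun q => F (cell q) q).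
    apply/funext => q; rewrite /F /cell /U /grid_point/=; case: ifPn => // h.
    rewrite time_indicE; case: ifPn => [/andP[q0 qr]|]; last by rewrite mul0r.
    exfalso; move/negP: h; apply; rewrite (grid_point_ge0 (k0 n) q0).
    by apply: le_trans qr; exact: grid_point_le.
  apply: measurable_fun_glue => j.
    rewrite setTI.
    have -> : cell @^-1` [set j] =
       ((fun q : R2 * noise_space H W r => q.1.1) @^-1` [set x | Num.floor (x * k n) = j.1]) `&`
       ((fun q : R2 * noise_space H W r => q.1.2) @^-1` [set x | Num.floor (x * k n) = j.2]).
      by case: j => j1 j2; apply/seteqP; split => q; [case=> <- <-|move=> [/= h1 h2]; congr pair].
    have m1 : measurable_fun [set: R2 * noise_space H W r] (fun q => q.1.1).
      exact: (measurableT_comp measurable_fst measurable_fst).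
    have m2 : measurable_fun [set: R2 * noise_space H W r] (fun q => q.1.2).
      exact: (measurableT_comp measurable_snd measurable_fst).
    apply: measurableI.
      by rewrite -[X in measurable X]setTI; apply: m1 => //; exact: measurable_floor_fiber.
    by rewrite -[X in measurable X]setTI; apply: m2 => //; exact: measurable_floor_fiber.
  apply: measurable_funTS.
  have [/andP[j0 jr]|jn] := boolP (0 <= j.1%:~R / k n <= r); last first.
    have -> : F j = (fun=> 0) by apply/funext => q; rewrite /F (negbTE jn).
    exact: measurable_cst.
  have -> : F j = (fun q => \1_(`[0, r]) q.1.1 * X (j.1%:~R / k n, j.2%:~R / k n) q.2).
    by apply/funext => q; rewrite /F j0 jr.
  apply: measurable_funM.
    apply: (measurableT_comp (measurable_time_indic r)).
    exact: (measurableT_comp measurable_fst measurable_fst).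
  have [|_ mX] := hX (j.1%:~R / k n, j.2%:~R / k n); first by rewrite /= j0 (le_trans jr).
  have mX' : measurable_fun [set: noise_space H W r] (X (j.1%:~R / k n, j.2%:~R / k n)).
    move=> _ B mB; rewrite setTI; have := mX measurableT B mB; rewrite setTI => h.
    by have := noise_space_sub jr measurableT h; rewrite setTI.
  exact: (measurableT_comp mX' measurable_snd).
move=> t x tT; have [t0 tT'] := andP tT.
have [wX _] := hX (t, x) tT; exists (X (t, x)) => //.
have cX : {ae P, forall w, U n (t, x) w @[n --> \oo] --> X (t, x) w}.
  apply: (@ae_cvg_fast _ _ _ P (fun n => U n (t, x)) (X (t, x)) 1) => // n.
  apply: L1_le_L2; [exact: measurable_funB|by rewrite divr_gt0 ?exprn_gt0|].
  have gt0 := grid_point_ge0 (k0 n) t0; have gtt := grid_point_le t (k0 n).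
  have gT : 0 <= grid_point (k n) t <= T by rewrite gt0 (le_trans gtt).
  have [wg _] := hX (grid_point (k n) t, grid_point (k n) x) gT.
  have [/andP[en0 en1] hen] := he n.
  apply: le_trans (wiener_isometry H0 H1 W_noise wg wX) _.
  have td : `|grid_point (k n) t - t| <= e n ^+ 4.
    by rewrite distrC -[leRHS]invrK; exact: grid_point_dist.
  have xd : `|grid_point (k n) x - x| <= e n ^+ 2.
    apply: (@le_trans _ _ (e n ^+ 4)).
      by rewrite distrC -[leRHS]invrK; exact: grid_point_dist.
    by rewrite ler_wiXn2l// ltW.
  have e01 : 0 <= e n <= 1 by rewrite ltW.
  have nd := green_noise_dist H0 H1 T0 C0 Greg e01 tT gT td xd.
  apply: (@le_trans _ _ (32 * (10 * noise_power_const H T (2 * C) * e n `^ H))%:E).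
    by rewrite (EFinM 32) lee_wpmul2l.
  have -> : (1 / 2 ^+ n) ^+ 2 = (4 ^+ n)^-1 :> R.
    by rewrite expr_div_n expr1n -exprM mulnC exprM mul1r; congr (_ ^+ _)^-1; lra.
  by rewrite lee_fin.
by apply: filterS cX => w; exact: limit_funE.
Qed.

End noise_field.

(** * The drift operator and Picard iteration *)

Section drift_operator.
Context {R : realType} d (Omega : measurableType d) (P : probability Omega R).
Local Notation mu := (@lebesgue_measure R).
Local Notation mR := (measurable_fun [set: measurableTypeR R]).
Local Notation R2 := (measurableTypeR R * measurableTypeR R)%type.
Local Notation M2 := (area R).
Local Notation mO := (measurable_fun [set: Omega]).

Definition measurable_process (Y : R * R -> Omega -> R) : Prop :=
  measurable_fun [set: R2 * Omega] (fun q => Y q.1 q.2).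

Lemma measurable_process_path (Y : R * R -> Omega -> R) (w : Omega) :
  measurable_process Y -> measurable_fun [set: R2] (fun z => Y z w).
Proof. by move=> mY; exact: (measurableT_comp mY (@pair2_measurable _ _ R2 Omega w)). Qed.

Lemma measurable_process_at (Y : R * R -> Omega -> R) (z : R * R) :
  measurable_process Y -> mO (Y z).
Proof. by move=> mY; exact: (measurableT_comp mY (@pair1_measurable _ _ R2 Omega z)). Qed.

Lemma measurable_process_comp (f : R -> R) (Y : R * R -> Omega -> R) : mR f ->
  measurable_process Y -> measurable_process (fun z w => f (Y z w)).
Proof. by move=> mf mY; exact: (measurableT_comp mf mY). Qed.

Lemma measurable_process_abs (Y : R * R -> Omega -> R) :
  measurable_process Y -> measurable_process (fun z w => `|Y z w|).
Proof. by move=> mY; exact: (measurableT_comp (@normr_measurable _ _) mY). Qed.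

Lemma measurable_processB (Y Z : R * R -> Omega -> R) :
  measurable_process Y -> measurable_process Z -> measurable_process (fun z w => Y z w - Z z w).
Proof. by move=> mY mZ; exact: measurable_funB. Qed.

Lemma measurable_weighted (Y : R * R -> Omega -> R) (k : R * R -> R) :
  measurable_process Y -> measurable_fun [set: R2] k ->
  measurable_fun [set: R2 * Omega] (fun q => Y q.1 q.2 * k q.1).
Proof. by move=> mY mk; apply: measurable_funM => //; exact: (measurableT_comp mk measurable_fst). Qed.

Lemma measurable_path_integral (Y : R * R -> Omega -> R) (k : R * R -> R) :
  measurable_process Y -> measurable_fun [set: R2] k ->
  measurable_fun [set: Omega] (fun w => \int[M2]_z (Y z w * k z)%:E)%E.
Proof.
move=> mY mk; have ms : measurable_fun [set: Omega * R2] (fun q => (q.2, q.1)).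
  exact: measurable_fun_pair.
apply: (@measurable_integral_param _ _ _ Omega R2 M2 (fun q => (Y q.2 q.1 * k q.2)%:E)).
by apply/measurable_EFinP; exact: (measurableT_comp (measurable_weighted mY mk) ms).
Qed.

(** Tonelli's theorem on Omega times the plane. The moment bound is asked only where the weight k is
    nonzero: kernel weights vanish outside the strip, where nothing is known of the process. *)
Lemma expectation_weighted_le (Y : R * R -> Omega -> R) (k h : R * R -> R) :
  measurable_process Y -> (forall z w, 0 <= Y z w) ->
  measurable_fun [set: R2] k -> (forall z, 0 <= k z) ->
  measurable_fun [set: R2] h -> (forall z, 0 <= h z) ->
  (forall z, k z != 0 -> (\int[P]_w (Y z w)%:E <= (h z)%:E)%E) ->
  (\int[P]_w \int[M2]_z (Y z w * k z)%:E <= \int[M2]_z (h z * k z)%:E)%E.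
Proof.
move=> mY Y0 mk k0 mh h0 Yh; have mYk := measurable_weighted mY mk.
have mf : measurable_fun [set: R2 * Omega] (fun q => (Y q.1 q.2 * k q.1)%:E) by exact/measurable_EFinP.
have f0 (q : R2 * Omega) : (0 <= (Y q.1 q.2 * k q.1)%:E)%E by rewrite lee_fin mulr_ge0.
rewrite -(@fubini_tonelli _ _ R2 Omega R M2 P _ mf f0) /=.
apply: ge0_le_integral => //.
- by move=> z _; apply: integral_ge0 => w _; rewrite lee_fin mulr_ge0.
- by apply: (measurable_integral_param P mf).
- by apply/measurable_EFinP; exact: measurable_funM.
move=> z _; under eq_integral do rewrite mulrC.
rewrite (integral_scale P (measurable_process_at z mY))// [h z * _]mulrC (EFinM (k z)).
have [->|kz] := eqVneq (k z) 0; first by rewrite !mul0e.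
by rewrite lee_wpmul2l ?lee_fin// Yh.
Qed.

Variables T C : R.
Hypothesis T0 : 0 < T.
Hypothesis C0 : 0 <= C.
Variable G : R -> R -> R.
Hypothesis Greg : regular_kernel T C G.
Variables (b : R -> R) (L : R).
Hypothesis L0 : 0 <= L.
Hypothesis bL : forall x y, `|b x - b y| <= L * `|x - y|.
Local Notation kern := (kern G).

Lemma measurable_lipschitz : mR b.
Proof.
apply: continuous_measurable_fun => x; apply/cvgrPdist_le => e e0.
have k0 : 0 < e / (L + 1) by rewrite divr_gt0// ltr_wpDl.
near=> y; apply: le_trans (bL _ _) _.
have xy : `|x - y| <= e / (L + 1) by near: y; exact: cvgr_dist_le.
apply: le_trans (ler_wpM2l L0 xy) _.
by rewrite mulrCA ger_pMr// ler_pdivrMr ?ltr_wpDl// mul1r lerDl.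
Unshelve. all: by end_near. Qed.

Lemma lipschitz_growth x : `|b x| <= L * `|x| + `|b 0|.
Proof.
have := bL x 0; rewrite subr0 => h.
have := ler_normD (b x - b 0) (b 0); rewrite subrK => h2.
by apply: le_trans h2 _; rewrite lerD2r.
Qed.

Definition drift_op (Y : R * R -> Omega -> R) (p : R * R) (w : Omega) : R :=
  \int[M2]_z (b (Y z w) * kern p z).

Lemma kern_support p z : kern p z != 0 -> 0 <= z.1 <= p.1.
Proof.
rewrite /(kern _ _) /green time_indicE; case: ifP => // _; by rewrite mul0r eqxx.
Qed.

Definition in_strip (p : R * R) : Prop := 0 <= p.1 <= T.

Lemma expectation_kern_le (Y : R * R -> Omega -> R) (A : R) p : in_strip p ->
  measurable_process Y -> (forall z w, 0 <= Y z w) -> 0 <= A ->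
  (forall z, in_strip z -> (\int[P]_w (Y z w)%:E <= A%:E)%E) ->
  (\int[P]_w \int[M2]_z (Y z w * kern p z)%:E <= (A * (C * T))%:E)%E.
Proof.
move=> pT mY Y0 A0 YA; have [p0 pT'] := andP pT.
have mk := measurable_kern_slice Greg p; have k0 := kern_ge0 Greg p.
apply: le_trans (expectation_weighted_le mY Y0 mk k0 (measurable_cst A) (fun=> A0) _) _.
  by move=> z /kern_support /andP[z0 zp]; apply: YA; rewrite /in_strip z0 (le_trans zp).
rewrite (integral_scale M2 mk k0 A0) (EFinM A) lee_wpmul2l ?lee_fin//.
by case: p pT {mk k0 p0 pT'} => t x pT; exact: (kern_mass T0 C0 Greg).
Qed.

Lemma expectation_kern_exp (Y : R * R -> Omega -> R) (A B : R) p : in_strip p ->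
  measurable_process Y -> (forall z w, 0 <= Y z w) -> 0 <= A -> 0 < B ->
  (forall z, in_strip z -> (\int[P]_w (Y z w)%:E <= (A * expR (B * z.1))%:E)%E) ->
  (\int[P]_w \int[M2]_z (Y z w * kern p z)%:E <= (A * (C * (expR (B * p.1) / B)))%:E)%E.
Proof.
move=> pT mY Y0 A0 B0 YA; have [p0 pT'] := andP pT.
have mk := measurable_kern_slice Greg p; have k0 := kern_ge0 Greg p.
have mE : mR (fun s => expR (B * s)).
  by apply: (measurableT_comp (@measurable_expR R)); exact: measurable_funM.
have mE2 : measurable_fun [set: R2] (fun z : R2 => expR (B * z.1)) by exact: (measurableT_comp mE measurable_fst).
have mh : measurable_fun [set: R2] (fun z : R2 => A * expR (B * z.1)) by exact: measurable_funM.
apply: le_trans (expectation_weighted_le mY Y0 mk k0 mh _ _) _.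
- by move=> z; rewrite mulr_ge0 ?expR_ge0.
- by move=> z /kern_support /andP[z0 zp]; apply: YA; rewrite /in_strip z0 (le_trans zp).
under eq_integral do rewrite -mulrA.
rewrite (@integral_scale _ _ _ M2 A (fun z => expR (B * z.1) * kern p z))//; last 2 first.
- exact: measurable_funM.
- by move=> z; rewrite mulr_ge0 ?expR_ge0 ?k0.
rewrite (EFinM A) lee_wpmul2l ?lee_fin//.
by case: p pT {mk k0 p0 pT'} => t x pT; exact: (kern_exp C0 Greg).
Qed.

Lemma kern_path_integrable (Y : R * R -> Omega -> R) (A : R) p : in_strip p ->
  measurable_process Y -> 0 <= A ->
  (forall z, in_strip z -> (\int[P]_w `|Y z w|%:E <= A%:E)%E) ->
  {ae P, forall w, M2.-integrable [set: R2] (EFin \o (fun z => Y z w * kern p z))}.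
Proof.
move=> pT mY A0 YA; have mk := measurable_kern_slice Greg p; have k0 := kern_ge0 Greg p.
have maY := measurable_process_abs mY.
have h := expectation_kern_le pT maY (fun z w => normr_ge0 _) A0 YA.
have := ge0_integral_lty_ae (measurable_path_integral maY mk) _ (le_lt_trans h (ltry _)).
have pos w : (0 <= \int[M2]_z (`|Y z w| * kern p z)%:E)%E.
  by apply: integral_ge0 => z _; rewrite lee_fin mulr_ge0 ?k0.
move=> /(_ pos); apply: filterS => w fw; apply/integrableP; split.
  by apply/measurable_EFinP; apply: measurable_funM => //; exact: measurable_process_path.
apply: le_lt_trans fw; rewrite le_eqVlt; apply/orP; left; apply/eqP.
by apply: eq_integral => z _; rewrite /= normrM (ger0_norm (k0 z)).
Qed.

Lemma expectation_lipschitz (Y : Omega -> R) (A : R) : mO Y -> 0 <= A ->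
  (\int[P]_w `|Y w|%:E <= A%:E)%E -> (\int[P]_w `|b (Y w)|%:E <= (L * A + `|b 0|)%:E)%E.
Proof.
move=> mY A0 YA.
have maY : mO (fun w => `|Y w|) by exact: (measurableT_comp (@normr_measurable _ _) mY).
apply: (@le_trans _ _ (\int[P]_w (L * `|Y w| + `|b 0|)%:E)%E).
  apply: integral_mono => // [||w]; last exact: lipschitz_growth.
    apply: (measurableT_comp (@normr_measurable _ _)).
    exact: (measurableT_comp measurable_lipschitz mY).
  by apply: measurable_funD => //; exact: measurable_funM.
rewrite (@integral_add _ _ _ P (fun w => L * `|Y w|) (fun=> `|b 0|))//; last 2 first.
- exact: measurable_funM.
- by move=> w; rewrite mulr_ge0.
rewrite EFinD leeD//.
  by rewrite (integral_scale P maY)// (EFinM L) lee_wpmul2l ?lee_fin.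
by rewrite integral_cst//= probability_setT mule1.
Qed.

Lemma drift_integrable (Y : R * R -> Omega -> R) (A : R) p : in_strip p ->
  measurable_process Y -> 0 <= A ->
  (forall z, in_strip z -> (\int[P]_w `|Y z w|%:E <= A%:E)%E) ->
  {ae P, forall w, M2.-integrable [set: R2] (EFin \o (fun z => b (Y z w) * kern p z))}.
Proof.
move=> pT mY A0 YA.
have mbY := measurable_process_comp measurable_lipschitz mY.
apply: (@kern_path_integrable (fun z w => b (Y z w)) (L * A + `|b 0|)) => //.
  by rewrite addr_ge0// mulr_ge0.
by move=> z zT; apply: expectation_lipschitz => //; [exact: measurable_process_at|exact: YA].
Qed.

Lemma measurable_drift_op (Y : R * R -> Omega -> R) p : measurable_process Y -> mO (drift_op Y p).
Proof.
move=> mY; have mbY := measurable_process_comp measurable_lipschitz mY.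
have ms : measurable_fun [set: Omega * R2] (fun q => (q.2, q.1)) by exact: measurable_fun_pair.
apply: (@measurable_Rintegral_param _ _ _ Omega R2 M2 (fun q => b (Y q.2 q.1) * kern p q.2)).
exact: (measurableT_comp (measurable_weighted mbY (measurable_kern_slice Greg p)) ms).
Qed.

Lemma drift_op_lipschitz (Y Z : R * R -> Omega -> R) p (w : Omega) :
  measurable_process Y -> measurable_process Z ->
  M2.-integrable [set: R2] (EFin \o (fun z => b (Y z w) * kern p z)) ->
  M2.-integrable [set: R2] (EFin \o (fun z => b (Z z w) * kern p z)) ->
  (`|drift_op Y p w - drift_op Z p w|%:E <= L%:E * \int[M2]_z (`|Y z w - Z z w| * kern p z)%:E)%E.
Proof.
move=> mY mZ iY iZ; have mk := measurable_kern_slice Greg p; have k0 := kern_ge0 Greg p.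
have mYw := measurable_process_path w mY; have mZw := measurable_process_path w mZ.
have mbY : measurable_fun [set: R2] (fun z => b (Y z w)) by exact: (measurableT_comp measurable_lipschitz mYw).
have mbZ : measurable_fun [set: R2] (fun z => b (Z z w)) by exact: (measurableT_comp measurable_lipschitz mZw).
have mD : measurable_fun [set: R2] (fun z => `|Y z w - Z z w|).
  by apply: (measurableT_comp (@normr_measurable _ _)); exact: measurable_funB.
have mf : measurable_fun [set: R2] (fun z => b (Y z w) * kern p z - b (Z z w) * kern p z).
  by apply: measurable_funB; exact: measurable_funM.
rewrite /drift_op -RintegralB//.
apply: le_trans (le_abs_Rintegral M2 measurableT mf) _.
rewrite -(@integral_scale _ _ _ M2 L (fun z => `|Y z w - Z z w| * kern p z))//; last 2 first.
- exact: measurable_funM.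
- by move=> z; rewrite mulr_ge0 ?k0.
apply: integral_mono => // [||z].
- exact: (measurableT_comp (@normr_measurable _ _) mf).
- by apply: measurable_funM => //; exact: measurable_funM.
- have -> : b (Y z w) * kern p z - b (Z z w) * kern p z = (b (Y z w) - b (Z z w)) * kern p z by ring.
  by rewrite normrM (ger0_norm (k0 z)) (mulrA L) ler_wpM2r.
Qed.

(** The value of A does not enter the conclusion: it guarantees almost sure integrability, so that
    the difference of the two drifts is the integral of the difference. *)
Lemma expectation_drift_diff (Y Z : R * R -> Omega -> R) (A : R) p : in_strip p ->
  measurable_process Y -> measurable_process Z -> 0 <= A ->
  (forall z, in_strip z -> (\int[P]_w `|Y z w|%:E <= A%:E)%E) ->
  (forall z, in_strip z -> (\int[P]_w `|Z z w|%:E <= A%:E)%E) ->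
  (\int[P]_w `|drift_op Y p w - drift_op Z p w|%:E <=
   L%:E * \int[P]_w \int[M2]_z (`|Y z w - Z z w| * kern p z)%:E)%E.
Proof.
move=> pT mY mZ A0 YA ZA.
have iY := drift_integrable pT mY A0 YA; have iZ := drift_integrable pT mZ A0 ZA.
have mk := measurable_kern_slice Greg p; have k0 := kern_ge0 Greg p.
have maD := measurable_process_abs (measurable_processB mY mZ).
have mI := measurable_path_integral maD mk.
have pos w : (0 <= \int[M2]_z (`|Y z w - Z z w| * kern p z)%:E)%E.
  by apply: integral_ge0 => z _; rewrite lee_fin mulr_ge0 ?k0.
rewrite -ge0_integralZl_EFin//.
apply: ae_ge0_le_integral => //.
- apply/measurable_EFinP; apply: (measurableT_comp (@normr_measurable _ _)).
  by apply: measurable_funB; exact: measurable_drift_op.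
- by move=> w _; rewrite mule_ge0 ?lee_fin.
- exact: measurable_funeM.
- by apply: filterS2 iY iZ => w iYw iZw _; exact: drift_op_lipschitz.
Qed.

End drift_operator.

Section drift_moments.
Context {R : realType} d (Omega : measurableType d) (P : probability Omega R).
Local Notation mu := (@lebesgue_measure R).
Local Notation mR := (measurable_fun [set: measurableTypeR R]).
Local Notation R2 := (measurableTypeR R * measurableTypeR R)%type.
Local Notation M2 := (area R).
Local Notation mO := (measurable_fun [set: Omega]).
Variables T C : R.
Hypothesis T0 : 0 < T.
Hypothesis C0 : 0 <= C.
Variable G : R -> R -> R.
Hypothesis Greg : regular_kernel T C G.
Variables (b : R -> R) (L : R).
Hypothesis L0 : 0 <= L.
Hypothesis bL : forall x y, `|b x - b y| <= L * `|x - y|.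
Local Notation kern := (kern G).
Local Notation drift_op := (drift_op G b).
Local Notation in_strip := (in_strip T).

Lemma exprD_le (n : nat) (x y : R) : 0 <= x -> 0 <= y ->
  (x + y) ^+ n <= 2 ^+ n * (x ^+ n + y ^+ n).
Proof.
move=> x0 y0; wlog xy : x y x0 y0 / x <= y.
  by move=> h; have [xy|/ltW yx] := leP x y; [exact: h|rewrite addrC [_ ^+ n + _]addrC h].
apply: (@le_trans _ _ ((2 * y) ^+ n)).
  by rewrite lerXn2r ?nnegrE ?addr_ge0 ?mulr_ge0//; lra.
by rewrite exprMn ler_wpM2l ?exprn_ge0// lerDr exprn_ge0.
Qed.

(* Jensen's inequality for the kernel, up to constants. *)
Lemma drift_power_le (Y : R * R -> Omega -> R) (n : nat) p (w : Omega) : in_strip p ->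
  measurable_process Y ->
  ((`|drift_op Y p w| ^+ n.+1)%:E <= (2 ^+ n.+1 * (C * T + 1) ^+ n)%:E *
    \int[M2]_z (`|b (Y z w)| ^+ n.+1 * kern p z)%:E)%E.
Proof.
move=> pT mY; have mk := measurable_kern_slice Greg p; have k0 := kern_ge0 Greg p.
have mb := measurable_lipschitz L0 bL.
have mbY : measurable_fun [set: R2] (fun z => b (Y z w)).
  exact: (measurableT_comp mb (measurable_process_path w mY)).
apply: integral_power_le => //.
- exact: (measurableT_comp (@normr_measurable _ _) mbY).
- by rewrite ltr_wpDl// mulr_ge0// ltW.
- apply: (@le_trans _ _ (C * T)%:E); last by rewrite lee_fin lerDl.
  by case: p pT {mk k0} => t x pT; exact: (kern_mass T0 C0 Greg).
- apply: le_trans (le_abs_Rintegral M2 measurableT (measurable_funM mbY mk)) _.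
  rewrite le_eqVlt; apply/orP; left; apply/eqP; apply: eq_integral => z _.
  by rewrite normrM (ger0_norm (k0 z)).
Qed.

Definition growth_const (n : nat) : R := 2 ^+ n * L ^+ n.

Lemma lipschitz_power_le (n : nat) (x : R) :
  `|b x| ^+ n <= growth_const n * `|x| ^+ n + 2 ^+ n * `|b 0| ^+ n.
Proof.
apply: (@le_trans _ _ ((L * `|x| + `|b 0|) ^+ n)).
  by rewrite lerXn2r ?nnegrE ?addr_ge0 ?mulr_ge0//; exact: lipschitz_growth.
apply: le_trans (exprD_le n _ _) _; rewrite ?mulr_ge0//.
by rewrite mulrDr exprMn /growth_const mulrA.
Qed.

Lemma expectation_lipschitz_power (n : nat) (Y : Omega -> R) (A : R) : mO Y -> 0 <= A ->
  (\int[P]_w (`|Y w| ^+ n)%:E <= A%:E)%E ->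
  (\int[P]_w (`|b (Y w)| ^+ n)%:E <= (growth_const n * A + 2 ^+ n * `|b 0| ^+ n)%:E)%E.
Proof.
move=> mY A0 YA; have mb := measurable_lipschitz L0 bL.
have maY : mO (fun w => `|Y w| ^+ n).
  by apply: measurable_funX; exact: (measurableT_comp (@normr_measurable _ _) mY).
have g0 : 0 <= growth_const n by rewrite mulr_ge0 ?exprn_ge0.
apply: (@le_trans _ _ (\int[P]_w (growth_const n * `|Y w| ^+ n + 2 ^+ n * `|b 0| ^+ n)%:E)%E).
  apply: integral_mono => // [||w].
  - apply: measurable_funX; apply: (measurableT_comp (@normr_measurable _ _)).
    exact: (measurableT_comp mb mY).
  - by apply: measurable_funD => //; exact: measurable_funM.
  - exact: lipschitz_power_le.
have mg : mO (fun w => growth_const n * `|Y w| ^+ n) by exact: measurable_funM.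
have gp w : 0 <= growth_const n * `|Y w| ^+ n by rewrite mulr_ge0 ?exprn_ge0.
have cp : 0 <= 2 ^+ n * `|b 0| ^+ n by rewrite mulr_ge0 ?exprn_ge0.
rewrite (integral_add P mg (measurable_cst (2 ^+ n * `|b 0| ^+ n)))//.
rewrite EFinD leeD//.
  rewrite (integral_scale P maY)//.
  by rewrite (EFinM (growth_const n)) lee_wpmul2l ?lee_fin.
by rewrite /= integral_cst//= probability_setT mule1.
Qed.

Definition drift_moment_const (n : nat) : R := 2 ^+ n.+1 * (C * T + 1) ^+ n.

Lemma drift_moment_const_ge0 n : 0 <= drift_moment_const n.
Proof. by rewrite mulr_ge0 ?exprn_ge0// addr_ge0// mulr_ge0// ltW. Qed.

(* The first part carries the exponential weight of the Picard estimate, the second the constant term. *)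
Lemma expectation_drift_power (n : nat) (Y : R * R -> Omega -> R) (A B : R) p : in_strip p ->
  measurable_process Y -> 0 <= A -> 0 < B ->
  (forall z, in_strip z -> (\int[P]_w (`|Y z w| ^+ n.+1)%:E <= (A * expR (B * z.1))%:E)%E) ->
  (\int[P]_w (`|drift_op Y p w| ^+ n.+1)%:E <=
   (drift_moment_const n * (growth_const n.+1 * A * (C * (expR (B * p.1) / B)) +
      2 ^+ n.+1 * `|b 0| ^+ n.+1 * (C * T)))%:E)%E.
Proof.
move=> pT mY A0 B0 YA; have mb := measurable_lipschitz L0 bL.
have mk := measurable_kern_slice Greg p; have k0 := kern_ge0 Greg p.
have D0 := drift_moment_const_ge0 n.
have mbY : measurable_process (fun z w => b (Y z w)) by exact: measurable_process_comp.
have mbn : measurable_process (fun z w => `|b (Y z w)| ^+ n.+1).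
  by apply: measurable_funX; exact: (measurable_process_abs mbY).
have mI := measurable_path_integral mbn mk.
have pos w : (0 <= \int[M2]_z (`|b (Y z w)| ^+ n.+1 * kern p z)%:E)%E.
  by apply: integral_ge0 => z _; rewrite lee_fin mulr_ge0 ?k0 ?exprn_ge0.
have mD : mO (fun w => `|drift_op Y p w| ^+ n.+1).
  apply: measurable_funX; apply: (measurableT_comp (@normr_measurable _ _)).
  exact: (measurable_drift_op Greg L0 bL).
apply: (@le_trans _ _ (\int[P]_w ((drift_moment_const n)%:E *
    \int[M2]_z (`|b (Y z w)| ^+ n.+1 * kern p z)%:E))%E).
  apply: ge0_le_integral => //.
  - exact/measurable_EFinP.
  - exact: measurable_funeM.
  - by move=> w _; exact: drift_power_le.
rewrite ge0_integralZl_EFin// (EFinM (drift_moment_const n)) lee_wpmul2l ?lee_fin//.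
have g0 : 0 <= growth_const n.+1 by rewrite mulr_ge0 ?exprn_ge0.
have mE : mR (fun s => expR (B * s)).
  by apply: (measurableT_comp (@measurable_expR R)); exact: measurable_funM.
have mE2 : measurable_fun [set: R2] (fun z : R2 => expR (B * z.1)) by exact: (measurableT_comp mE measurable_fst).
pose c := 2 ^+ n.+1 * `|b 0| ^+ n.+1; have c0 : 0 <= c by rewrite mulr_ge0 ?exprn_ge0.
pose h (z : R * R) := growth_const n.+1 * A * expR (B * z.1) + c.
have gA0 : 0 <= growth_const n.+1 * A by rewrite mulr_ge0.
have mh1 : measurable_fun [set: R2] (fun z : R2 => growth_const n.+1 * A * expR (B * z.1)) by exact: measurable_funM.
have mh : measurable_fun [set: R2] h by exact: measurable_funD.
have h0 z : 0 <= h z by rewrite addr_ge0// mulr_ge0 ?expR_ge0.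
apply: le_trans (expectation_weighted_le mbn _ mk k0 mh h0 _) _.
- by move=> z w; rewrite exprn_ge0.
- move=> z /kern_support /andP[z0 zp]; have [p0 pT'] := andP pT.
  rewrite /h -mulrA; apply: expectation_lipschitz_power.
  + exact: measurable_process_at.
  + by rewrite mulr_ge0 ?expR_ge0.
  + by apply: YA; rewrite /(in_strip _) z0 (le_trans zp).
rewrite (eq_integral (fun z : R2 => (growth_const n.+1 * A * (expR (B * z.1) * kern p z) + c * kern p z)%:E)); last first.
  by move=> z _; rewrite /h; congr (_%:E); ring.
have mEk : measurable_fun [set: R2] (fun z => expR (B * z.1) * kern p z) by exact: measurable_funM.
have Ek0 z : 0 <= expR (B * z.1) * kern p z by rewrite mulr_ge0 ?expR_ge0 ?k0.
have m1 : measurable_fun [set: R2] (fun z => growth_const n.+1 * A * (expR (B * z.1) * kern p z)).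
  exact: measurable_funM.
have m2 : measurable_fun [set: R2] (fun z => c * kern p z) by exact: measurable_funM.
have p1 z : 0 <= growth_const n.+1 * A * (expR (B * z.1) * kern p z) by exact: mulr_ge0.
have p2 z : 0 <= c * kern p z by rewrite mulr_ge0 ?k0.
rewrite (integral_add M2 m1 m2 p1 p2) (integral_scale M2 mEk Ek0 gA0).
rewrite (integral_scale M2 mk k0 c0) EFinD leeD//.
  rewrite (EFinM (growth_const n.+1 * A)) lee_wpmul2l ?lee_fin//.
  by have := kern_exp C0 Greg p.2 B0 pT; rewrite -surjective_pairing.
rewrite (EFinM c) lee_wpmul2l ?lee_fin//.
by have := kern_mass T0 C0 Greg p.2 pT; rewrite -surjective_pairing.
Qed.

(** The power mean inequality with weight |kern p' - kern p| of mass M; one factor M comes from the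
    inequality and one from integrating the second moment. *)
Lemma drift_modulus (Y : R * R -> Omega -> R) (A M : R) p p' : in_strip p -> in_strip p' ->
  measurable_process Y -> 0 <= A -> 0 < M ->
  (forall z, in_strip z -> (\int[P]_w (Y z w ^+ 2)%:E <= A%:E)%E) ->
  (forall z, in_strip z -> (\int[P]_w `|Y z w|%:E <= A%:E)%E) ->
  (\int[M2]_z `|kern p' z - kern p z|%:E <= M%:E)%E ->
  (mean_sq P (fun w => (drift_op Y p' w - drift_op Y p w)%R) <=
   (4 * M * ((growth_const 2 * A + 4 * `|b 0| ^+ 2) * M))%:E)%E.
Proof.
move=> pT pT' mY A0 M0 YA2 YA1 kM; have mb := measurable_lipschitz L0 bL.
have mk := measurable_kern_slice Greg p; have mk' := measurable_kern_slice Greg p'.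
pose k z := `|kern p' z - kern p z|.
have mkd : measurable_fun [set: R2] k.
  by apply: (measurableT_comp (@normr_measurable _ _)); exact: measurable_funB.
have kd0 z : 0 <= k z by exact: normr_ge0.
have mbY : measurable_process (fun z w => b (Y z w)) by exact: measurable_process_comp.
have mb2 : measurable_process (fun z w => `|b (Y z w)| ^+ 2).
  by apply: measurable_funX; exact: (measurable_process_abs mbY).
have i1 := drift_integrable T0 C0 Greg L0 bL pT mY A0 YA1.
have i2 := drift_integrable T0 C0 Greg L0 bL pT' mY A0 YA1.
have pos w : (0 <= \int[M2]_z (`|b (Y z w)| ^+ 2 * k z)%:E)%E.
  by apply: integral_ge0 => z _; rewrite lee_fin mulr_ge0 ?exprn_ge0.
have mI := measurable_path_integral mb2 mkd.
have M4 : 0 <= 2 ^+ 2 * M ^+ 1 by rewrite mulr_ge0 ?exprn_ge0// ltW.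
apply: (@le_trans _ _ (\int[P]_w ((2 ^+ 2 * M ^+ 1)%:E * \int[M2]_z (`|b (Y z w)| ^+ 2 * k z)%:E))%E).
  apply: ae_ge0_le_integral => //.
  - by move=> w _; rewrite lee_fin sqr_ge0.
  - apply/measurable_EFinP; apply: measurable_funX; apply: measurable_funB.
      exact: (measurable_drift_op Greg L0 bL).
    exact: (measurable_drift_op Greg L0 bL).
  - by move=> w _; rewrite mule_ge0// lee_fin.
  - exact: measurable_funeM.
  apply: filterS2 i1 i2 => w iw iw' _.
  have mYw := measurable_process_path w mY.
  have mbw : measurable_fun [set: R2] (fun z => b (Y z w)) by exact: (measurableT_comp mb mYw).
  have mf : measurable_fun [set: R2] (fun z => b (Y z w) * kern p' z - b (Y z w) * kern p z).
    by apply: measurable_funB; exact: measurable_funM.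
  rewrite -real_normK ?num_real//.
  apply: (@integral_power_le _ _ _ M2 1 M (fun z => `|b (Y z w)|) k) => //.
  - exact: (measurableT_comp (@normr_measurable _ _) mbw).
  - rewrite /(drift_op _ _ _) -RintegralB//.
    apply: le_trans (le_abs_Rintegral M2 measurableT mf) _.
    rewrite le_eqVlt; apply/orP; left; apply/eqP; apply: eq_integral => z _.
    by rewrite -normrM mulrBr.
rewrite ge0_integralZl_EFin//.
have -> : 4 * M * ((growth_const 2 * A + 4 * `|b 0| ^+ 2) * M) =
  2 ^+ 2 * M ^+ 1 * ((growth_const 2 * A + 2 ^+ 2 * `|b 0| ^+ 2) * M) by ring.
rewrite (EFinM (2 ^+ 2 * M ^+ 1)) lee_wpmul2l ?lee_fin//.
pose c := growth_const 2 * A + 2 ^+ 2 * `|b 0| ^+ 2.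
have c0 : 0 <= c by rewrite addr_ge0 ?mulr_ge0 ?exprn_ge0.
apply: le_trans (expectation_weighted_le mb2 _ mkd kd0 (measurable_cst c) (fun=> c0) _) _.
- by move=> z w; rewrite exprn_ge0.
- move=> z kz; apply: expectation_lipschitz_power => //; first exact: measurable_process_at.
  under eq_integral do rewrite real_normK ?num_real//.
  apply: YA2; have [/andP[p0 pT2] /andP[p0' pT2']] := (pT, pT').
  have : kern p z != 0 \/ kern p' z != 0.
    have [kp|] := eqVneq (kern p z) 0; last by left.
    right; apply/eqP => kp'; move: kz; rewrite /k kp kp' subrr normr0 eqxx//.
  by move=> [] /kern_support /andP[z0 zp]; rewrite /(in_strip _) z0 (le_trans zp).
by rewrite (integral_scale M2 mkd kd0 c0) (EFinM c) lee_wpmul2l ?lee_fin.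
Qed.

End drift_moments.

Section L1_limits.
Context {R : realType} d (Omega : measurableType d) (P : probability Omega R).
Local Notation mO := (measurable_fun [set: Omega]).

Lemma L1_dist_triangle (X Y Z : Omega -> R) (a b : R) : mO X -> mO Y -> mO Z ->
  (\int[P]_w `|X w - Y w|%:E <= a%:E)%E -> (\int[P]_w `|Y w - Z w|%:E <= b%:E)%E ->
  (\int[P]_w `|X w - Z w|%:E <= (a + b)%:E)%E.
Proof.
move=> mX mY mZ XY YZ.
have m1 : mO (fun w => `|X w - Y w|).
  by apply: (measurableT_comp (@normr_measurable _ _)); exact: measurable_funB.
have m2 : mO (fun w => `|Y w - Z w|).
  by apply: (measurableT_comp (@normr_measurable _ _)); exact: measurable_funB.
apply: (@le_trans _ _ (\int[P]_w (`|X w - Y w| + `|Y w - Z w|)%:E)%E).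
  apply: integral_mono => // [||w]; last exact: ler_distD.
    by apply: (measurableT_comp (@normr_measurable _ _)); exact: measurable_funB.
  exact: measurable_funD.
by rewrite integral_add// EFinD leeD.
Qed.

Lemma L1_fast_limit (X : nat -> Omega -> R) (C : R) : 0 <= C -> (forall n, mO (X n)) ->
  (forall n, (\int[P]_w `|X n.+1 w - X n w|%:E <= (C / 2 ^+ n)%:E)%E) ->
  {ae P, forall w, X n w @[n --> \oo] --> limit_fun X w} /\
  forall n, (\int[P]_w `|X n w - limit_fun X w|%:E <= (2 * C / 2 ^+ n)%:E)%E.
Proof.
move=> C0 mX h; have cX := @ae_cauchy_fast _ _ _ P X C mX h; split => // n.
(* The subtracted term records what remains of the geometric series, so that the induction on j
   closes. *)
have tail j : (\int[P]_w `|X n w - X (n + j)%N w|%:E <= (2 * C / 2 ^+ n - 2 * C / 2 ^+ (n + j))%:E)%E.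
  elim: j => [|j IH].
    rewrite addn0 subrr (eq_integral (cst 0%E)) ?integral0// => w _.
    by rewrite subrr normr0.
  have hj := h (n + j)%N.
  have hj' : (\int[P]_w `|X (n + j)%N w - X (n + j.+1)%N w|%:E <= (C / 2 ^+ (n + j))%:E)%E.
    by rewrite addnS; under eq_integral do rewrite distrC.
  have := L1_dist_triangle (mX n) (mX (n + j)%N) (mX (n + j.+1)%N) IH hj'.
  move=> k; apply: le_trans k _; rewrite lee_fin addnS exprS.
  have p : 0 < 2 ^+ (n + j) :> R by rewrite exprn_gt0.
  by rewrite le_eqVlt; apply/orP; left; apply/eqP; field; rewrite !gt_eqF// exprn_gt0.
apply: (@fatou_ae _ _ _ P (fun m w => `|X n w - X m w|)).
- move=> m; apply: (measurableT_comp (@normr_measurable _ _)); exact: measurable_funB.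
- apply: (measurableT_comp (@normr_measurable _ _)); apply: measurable_funB => //.
  exact: measurable_limit_fun.
- by [].
- by [].
- apply: filterS cX => w cw; apply: cvg_norm; apply: cvgB => //; exact: cvg_cst.
- near=> m; have nm : (n <= m)%N by near: m; exact: nbhs_infty_ge.
  rewrite -(subnKC nm); apply: le_trans (tail _) _.
  by rewrite lee_fin gerBl divr_ge0 ?mulr_ge0 ?exprn_ge0.
Unshelve. all: by end_near. Qed.

Lemma expectation_abs_le_power (X : Omega -> R) (N : nat) (A : R) : mO X -> (0 < N)%N ->
  (\int[P]_w (`|X w| ^+ N)%:E <= A%:E)%E -> (\int[P]_w `|X w|%:E <= (1 + A)%:E)%E.
Proof.
move=> mX N0 XA; have maX : mO (fun w => `|X w|) by exact: (measurableT_comp (@normr_measurable _ _)).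
have mN : mO (fun w => `|X w| ^+ N) by exact: measurable_funX.
apply: (@le_trans _ _ (\int[P]_w (1 + `|X w| ^+ N)%:E)%E).
  apply: integral_mono => // [|w]; first exact: measurable_funD.
  have [x1|/ltW x1] := leP `|X w| 1.
    by apply: le_trans x1 _; rewrite lerDl exprn_ge0.
  apply: (@le_trans _ _ (`|X w| ^+ N)); last by rewrite lerDr.
  by rewrite -[leLHS]expr1 ler_weXn2l.
rewrite (@integral_add _ _ _ P (fun=> 1) (fun w => `|X w| ^+ N))//.
by rewrite integral_cst//= probability_setT mule1 EFinD leeD.
Qed.

End L1_limits.

Section progressive_drift.
Context {R : realType} d (Omega : measurableType d) (P : probability Omega R).
Local Notation R2 := (measurableTypeR R * measurableTypeR R)%type.
Local Notation mR := (measurable_fun [set: measurableTypeR R]).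
Variables H T C : R.
Variable G : R -> R -> R.
Hypothesis Greg : regular_kernel T C G.
Variable W : test_functions R -> {RV P >-> R}.
Variable b : R -> R.
Hypothesis mb : mR b.
Local Notation progressive := (progressive H T W).

(** The kernel at (t, x) lives on times s <= t <= r, so an indicator of [0, r] can be inserted on U
    without changing the integral, which brings in the progressive measurability of U up to time
    r. *)
Lemma progressive_drift (U : R * R -> Omega -> R) : progressive U -> progressive (drift_op G b U).
Proof.
move=> pU r rT.
have -> : (fun q : R2 * noise_space H W r => \1_(`[0, r]) q.1.1 * drift_op G b U q.1 q.2) =
   (fun q => \int[area R]_z (b (\1_(`[0, r]) z.1 * U z q.2) * (\1_(`[0, r]) q.1.1 * kern G q.1 z))).
  apply/funext => q; rewrite (time_indicE r q.1.1); case: ifPn => [/andP[q0 qr]|_].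
    rewrite mul1r /drift_op; apply: eq_Rintegral => z _; rewrite mul1r.
    have [->|/kern_support/andP[z0 zq]] := eqVneq (kern G q.1 z) 0; first by rewrite !mulr0.
    by rewrite time_indicE z0 (le_trans zq)//= mul1r.
  rewrite mul0r; symmetry; under eq_Rintegral do rewrite mul0r mulr0.
  by rewrite /Rintegral integral0.
apply: (@measurable_Rintegral_param _ _ _ (R2 * noise_space H W r)%type R2 (area R)
  (fun v => b (\1_(`[0, r]) v.2.1 * U v.2 v.1.2) * (\1_(`[0, r]) v.1.1.1 * kern G v.1.1 v.2))).
have m1 : measurable_fun [set: (R2 * noise_space H W r) * R2] (fun v => (v.2, v.1.2)).
  apply: measurable_fun_pair => //; exact: (measurableT_comp measurable_snd measurable_fst).
have m2 : measurable_fun [set: (R2 * noise_space H W r) * R2] (fun v => (v.1.1, v.2)).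
  apply: measurable_fun_pair => //; exact: (measurableT_comp measurable_fst measurable_fst).
have m3 : measurable_fun [set: (R2 * noise_space H W r) * R2] (fun v => v.1.1.1).
  apply: (measurableT_comp measurable_fst); exact: (measurableT_comp measurable_fst measurable_fst).
apply: measurable_funM; first exact: (measurableT_comp mb (measurableT_comp (pU r rT) m1)).
apply: measurable_funM; first exact: (measurableT_comp (measurable_time_indic r) m3).
exact: (measurableT_comp (measurable_kern Greg) m2).
Qed.

Lemma progressive_cut (U : R * R -> Omega -> R) : progressive U ->
  progressive (fun z w => \1_(`[0, T]) z.1 * U z w).
Proof.
move=> pU r rT.
have -> : (fun q : R2 * noise_space H W r => \1_(`[0, r]) q.1.1 * (\1_(`[0, T]) q.1.1 * U q.1 q.2)) =
   (fun q => \1_(`[0, r]) q.1.1 * U q.1 q.2).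
  apply/funext => q; rewrite !time_indicE; case: ifPn => [/andP[q0 qr]|_]; last by rewrite !mul0r.
  have /andP[_ rT'] := rT.
  by rewrite q0 (le_trans qr)//= !mul1r.
exact: pU.
Qed.

End progressive_drift.

Section picard.
Context {R : realType} d (Omega : measurableType d) (P : probability Omega R).
Hypothesis P_complete : measure_is_complete P.
Local Notation R2 := (measurableTypeR R * measurableTypeR R)%type.
Local Notation mO := (measurable_fun [set: Omega]).
Variables H T C : R.
Hypothesis T0 : 0 < T.
Hypothesis C0 : 0 <= C.
Variable G : R -> R -> R.
Hypothesis Greg : regular_kernel T C G.
Variable W : test_functions R -> {RV P >-> R}.
Variables (b : R -> R) (L : R).
Hypothesis L0 : 0 <= L.
Hypothesis bL : forall x y, `|b x - b y| <= L * `|x - y|.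
Variables (V : R * R -> Omega -> R) (I0 : R * R -> R) (M : R).
Hypothesis pV : progressive H T W V.
Hypothesis mI0 : measurable_fun [set: R2] (fun z => \1_(`[0, T]) z.1 * I0 z).
Hypothesis M0 : 0 <= M.
Hypothesis I0M : forall z, in_strip T z -> `|I0 z| <= M.
Local Notation in_strip := (in_strip T).
Local Notation drift_op := (drift_op G b).

(** The indicators make every iterate vanish outside the strip, hence measurable on the whole plane
    although V and I0 are controlled only for times in [0, T]. *)
Definition picard_step (U : R * R -> Omega -> R) (z : R * R) (w : Omega) : R :=
  \1_(`[0, T]) z.1 * (V z w + \1_(`[0, T]) z.1 * I0 z + drift_op U z w).

Fixpoint picard (n : nat) : R * R -> Omega -> R :=
  if n is n'.+1 then picard_step (picard n') else fun _ _ => 0.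

Lemma picard_stepE U z w : in_strip z -> picard_step U z w = V z w + I0 z + drift_op U z w.
Proof. by move=> zT; rewrite /picard_step !time_indicE zT !mul1r. Qed.

Lemma progressive_picard n : progressive H T W (picard n).
Proof.
have mb := measurable_lipschitz L0 bL.
elim: n => [|n IH] /=.
  by move=> r rT; under eq_fun do rewrite mulr0; exact: measurable_cst.
apply: progressive_cut; apply: progressiveD; last exact: (progressive_drift Greg mb).
by apply: progressiveD => //; exact: progressive_const.
Qed.

Lemma picard_off n z w : ~ in_strip z -> picard n z w = 0.
Proof.
case: n => //= n /negP zT; rewrite /picard_step time_indicE.
by rewrite (negbTE zT) mul0r.
Qed.

Lemma measurable_picard n : measurable_process (picard n).
Proof.
have TT : 0 <= T <= T by rewrite lexx ltW.
have := progressive_measurable P_complete (@progressive_picard n) TT.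
congr (measurable_fun _ _); apply/funext => q; rewrite time_indicE.
case: ifPn => [_|/negP h]; first by rewrite mul1r.
by rewrite mul0r picard_off.
Qed.

Lemma measurable_field z : in_strip z -> mO (V z).
Proof.
move=> zT; have TT : 0 <= T <= T by rewrite lexx ltW.
have := progressive_measurable P_complete pV TT => m.
have := measurableT_comp m (@pair1_measurable _ _ R2 Omega z).
congr (measurable_fun _ _); apply/funext => w /=.
by rewrite time_indicE zT mul1r.
Qed.

(** With the next constant, the coefficients of the affine recursion for moments: weighted by
    e^(Bt), a bound A becomes c0 + c1 A / B after one step. *)
Definition power_const0 (N : nat) (v : R) : R :=
  2 ^+ N.+1 * (2 ^+ N.+1 * (v + M ^+ N.+1) +
    drift_moment_const T C N * (2 ^+ N.+1 * `|b 0| ^+ N.+1 * (C * T))).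
Definition power_const1 (N : nat) : R :=
  2 ^+ N.+1 * (drift_moment_const T C N * growth_const L N.+1 * C).

Lemma power_const1_ge0 N : 0 <= power_const1 N.
Proof.
rewrite mulr_ge0 ?exprn_ge0// mulr_ge0// mulr_ge0 ?drift_moment_const_ge0//.
by rewrite mulr_ge0 ?exprn_ge0.
Qed.

Lemma power_const0_ge0 N v : 0 <= v -> 0 <= power_const0 N v.
Proof.
move=> v0; rewrite mulr_ge0 ?exprn_ge0// addr_ge0//.
  by rewrite mulr_ge0 ?exprn_ge0// addr_ge0 ?exprn_ge0.
rewrite mulr_ge0 ?drift_moment_const_ge0// mulr_ge0 ?mulr_ge0 ?exprn_ge0//.
exact: ltW.
Qed.

Lemma picard_step_moment (N : nat) (v A B : R) (U : R * R -> Omega -> R) z : in_strip z ->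
  (\int[P]_w (`|V z w| ^+ N.+1)%:E <= v%:E)%E ->
  measurable_process U -> 0 <= A -> 0 < B ->
  (forall z, in_strip z -> (\int[P]_w (`|U z w| ^+ N.+1)%:E <= (A * expR (B * z.1))%:E)%E) ->
  (\int[P]_w (`|picard_step U z w| ^+ N.+1)%:E <=
    (power_const0 N v + power_const1 N * (A * expR (B * z.1) / B))%:E)%E.
Proof.
move=> zT Vv mU A0 B0 UA.
have DU := expectation_drift_power T0 C0 Greg L0 bL zT mU A0 B0 UA.
have mD : mO (drift_op U z) by exact: (measurable_drift_op Greg L0 bL).
have mV := measurable_field zT.
have mVN : mO (fun w => `|V z w| ^+ N.+1).
  by apply: measurable_funX; exact: (measurableT_comp (@normr_measurable _ _) mV).
have mDN : mO (fun w => `|drift_op U z w| ^+ N.+1).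
  by apply: measurable_funX; exact: (measurableT_comp (@normr_measurable _ _) mD).
pose k := 2 ^+ N.+1 : R; have k0 : 0 <= k by rewrite exprn_ge0.
have MN : 0 <= M ^+ N.+1 by rewrite exprn_ge0.
pose X1 w := k * (`|V z w| ^+ N.+1 + M ^+ N.+1).
have X10 w : 0 <= X1 w by rewrite mulr_ge0// addr_ge0// exprn_ge0.
have mX1 : mO X1 by apply: measurable_funM => //; exact: measurable_funD.
pose X w := X1 w + `|drift_op U z w| ^+ N.+1.
have mX : mO X by exact: measurable_funD.
have X0 w : 0 <= X w by rewrite addr_ge0// exprn_ge0.
apply: (@le_trans _ _ (\int[P]_w (k * X w)%:E)%E).
  apply: integral_mono => // [||w].
  - apply: measurable_funX; apply: (measurableT_comp (@normr_measurable _ _)).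
    have -> : picard_step U z = (fun w => V z w + I0 z + drift_op U z w).
      by apply/funext => w; rewrite picard_stepE.
    by apply: measurable_funD => //; exact: measurable_funD.
  - exact: measurable_funM.
  - rewrite (picard_stepE _ _ zT).
    apply: (@le_trans _ _ (((`|V z w| + M) + `|drift_op U z w|) ^+ N.+1)).
      apply: lerXn2r; rewrite ?nnegrE ?addr_ge0//.
      apply: le_trans (ler_normD _ _) _; rewrite lerD2r.
      by apply: le_trans (ler_normD _ _) _; rewrite lerD2l I0M.
    apply: le_trans (exprD_le _ _ _) _ => //; first by rewrite addr_ge0.
    rewrite -/k ler_wpM2l// /X lerD2r.
    by apply: le_trans (exprD_le _ _ _) _.
rewrite (integral_scale P mX X0 k0) (integral_add P mX1 mDN X10) => [|w]; last by rewrite exprn_ge0.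
have V1 : (\int[P]_w (X1 w)%:E <= (k * (v + M ^+ N.+1))%:E)%E.
  have mVM : mO (fun w => `|V z w| ^+ N.+1 + M ^+ N.+1) by exact: measurable_funD.
  rewrite (integral_scale P mVM)//; last by move=> w; rewrite addr_ge0// exprn_ge0.
  rewrite (EFinM k) lee_wpmul2l ?lee_fin//.
  rewrite (@integral_add _ _ _ P (fun w => `|V z w| ^+ N.+1) (fun=> M ^+ N.+1))//.
  by rewrite EFinD leeD// integral_cst//= probability_setT mule1.
apply: (@le_trans _ _ (k%:E * ((k * (v + M ^+ N.+1))%:E + (drift_moment_const T C N *
    (growth_const L N.+1 * A * (C * (expR (B * z.1) / B)) +
      2 ^+ N.+1 * `|b 0| ^+ N.+1 * (C * T)))%:E))%E).
  by rewrite lee_wpmul2l ?lee_fin// leeD.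
rewrite -EFinD -EFinM lee_fin le_eqVlt; apply/orP; left; apply/eqP.
by rewrite /power_const0 /power_const1 -/k; ring.
Qed.

Lemma picard_moment (N : nat) (v : R) : 0 <= v ->
  (forall z, in_strip z -> (\int[P]_w (`|V z w| ^+ N.+1)%:E <= v%:E)%E) ->
  exists A B : R, [/\ 0 <= A, 0 < B & forall n z, in_strip z ->
    (\int[P]_w (`|picard n z w| ^+ N.+1)%:E <= (A * expR (B * z.1))%:E)%E].
Proof.
move=> v0 Vv; have k0 := power_const0_ge0 N v0; have k1 := power_const1_ge0 N.
(* These values make the bound A stable under the recursion: the constant term is A/2, and the
   factor c1/B is at most 1/2. *)
pose A := 2 * power_const0 N v; pose B := 2 * power_const1 N + 1.
have A0 : 0 <= A by rewrite mulr_ge0.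
have B0 : 0 < B by rewrite ltr_wpDl// mulr_ge0.
exists A, B; split => //; elim => [|n IH] z zT.
  have AE : 0 <= A * expR (B * z.1) by exact: mulr_ge0 A0 (expR_ge0 _).
  rewrite (eq_integral (cst 0%E)) ?integral0 ?lee_fin// => w _.
  by rewrite /= normr0 expr0n.
apply: le_trans (picard_step_moment zT (Vv z zT) (measurable_picard n) A0 B0 IH) _.
rewrite lee_fin; have e1 : 1 <= expR (B * z.1).
  by rewrite -expR0 ler_expR mulr_ge0 ?(ltW B0)//; case/andP: zT.
have h1 : power_const0 N v <= A / 2 * expR (B * z.1).
  have -> : A / 2 = power_const0 N v by rewrite /A; field.
  by rewrite ler_peMr.
have h2 : power_const1 N * (A * expR (B * z.1) / B) <= A / 2 * expR (B * z.1).
  have -> : power_const1 N * (A * expR (B * z.1) / B) = (power_const1 N / B) * (A * expR (B * z.1)) by ring.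
  have -> : A / 2 * expR (B * z.1) = 2^-1 * (A * expR (B * z.1)) by ring.
  apply: ler_wpM2r; first exact: mulr_ge0 A0 (expR_ge0 _).
  by rewrite ler_pdivrMr// /B; lra.
lra.
Qed.

End picard.

Section picard_limit.
Context {R : realType} d (Omega : measurableType d) (P : probability Omega R).
Hypothesis P_complete : measure_is_complete P.
Local Notation R2 := (measurableTypeR R * measurableTypeR R)%type.
Local Notation mO := (measurable_fun [set: Omega]).
Variables H T C : R.
Hypothesis T0 : 0 < T.
Hypothesis C0 : 0 <= C.
Variable G : R -> R -> R.
Hypothesis Greg : regular_kernel T C G.
Variable W : test_functions R -> {RV P >-> R}.
Variables (b : R -> R) (L : R).
Hypothesis L0 : 0 <= L.
Hypothesis bL : forall x y, `|b x - b y| <= L * `|x - y|.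
Variables (V : R * R -> Omega -> R) (I0 : R * R -> R) (M : R).
Hypothesis pV : progressive H T W V.
Hypothesis mI0 : measurable_fun [set: R2] (fun z => \1_(`[0, T]) z.1 * I0 z).
Hypothesis M0 : 0 <= M.
Hypothesis I0M : forall z, in_strip T z -> `|I0 z| <= M.
Hypothesis Vmoment : forall N : nat, exists2 v : R, 0 <= v & forall z, in_strip T z ->
  (\int[P]_w (`|V z w| ^+ (2 * N.+1))%:E <= v%:E)%E.
Local Notation in_strip := (in_strip T).
Local Notation drift_op := (drift_op G b).
Local Notation kern := (kern G).
Local Notation picard := (picard T G b V I0).

Lemma picard_even_moment (N : nat) : exists2 A : R, 0 <= A & forall n z, in_strip z ->
  (\int[P]_w (`|picard n z w| ^+ (2 * N.+1))%:E <= A%:E)%E.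
Proof.
have [v v0 Vv] := Vmoment N.
have e : (2 * N.+1 = (2 * N).+1.+1)%N by rewrite mulnS.
rewrite e in Vv *.
have [A [B [A0 B0 h]]] := picard_moment P_complete T0 C0 Greg L0 bL pV mI0 M0 I0M v0 Vv.
exists (A * expR (B * T)); first by rewrite mulr_ge0 ?expR_ge0.
move=> n z zT; apply: le_trans (h n z zT) _.
by rewrite lee_fin ler_wpM2l// ler_expR ler_wpM2l ?(ltW B0)//; case/andP: zT.
Qed.

Lemma mpicard n : measurable_process (picard n).
Proof. exact: (measurable_picard P_complete T0 Greg L0 bL pV mI0). Qed.

Lemma mdrift U z : measurable_process U -> mO (drift_op U z).
Proof. exact: (measurable_drift_op Greg L0 bL). Qed.

Lemma picard_L1 : exists2 A : R, 0 <= A & forall n z, in_strip z ->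
  (\int[P]_w `|picard n z w|%:E <= A%:E)%E.
Proof.
have [A A0 h] := picard_even_moment 0; exists (1 + A); first by rewrite addr_ge0.
move=> n z zT; apply: (expectation_abs_le_power _ (N := 2 * 1)) => //; last exact: h.
exact: (measurable_process_at z (mpicard n)).
Qed.

Lemma picard_stepB (U U' : R * R -> Omega -> R) z w : in_strip z ->
  picard_step T G b V I0 U z w - picard_step T G b V I0 U' z w = drift_op U z w - drift_op U' z w.
Proof. by move=> zT; rewrite !picard_stepE//; ring. Qed.

Lemma picard_geometric : exists2 K : R, 0 <= K & forall n z, in_strip z ->
  (\int[P]_w `|picard n.+1 z w - picard n z w|%:E <= (K / 2 ^+ n)%:E)%E.
Proof.
(* This B makes the contraction factor LC/B at most 1/2. *)
have [A A0 hA] := picard_L1; pose B := 2 * (L * C) + 1.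
have LC0 : 0 <= L * C by rewrite mulr_ge0.
have B0 : 0 < B by rewrite ltr_wpDl// mulr_ge0.
exists (A * expR (B * T)); first by rewrite mulr_ge0 ?expR_ge0.
suff h n z : in_strip z ->
    (\int[P]_w `|picard n.+1 z w - picard n z w|%:E <= (A / 2 ^+ n * expR (B * z.1))%:E)%E.
  move=> n z zT; apply: le_trans (h n z zT) _.
  rewrite lee_fin mulrAC ler_wpM2r ?invr_ge0 ?exprn_ge0// ler_wpM2l// ler_expR.
  by rewrite ler_wpM2l ?(ltW B0)//; case/andP: zT.
elim: n z => [|n IH] z zT.
  under eq_integral do rewrite subr0.
  apply: le_trans (hA 1%N z zT) _.
  rewrite lee_fin expr0 divr1 ler_peMr// -expR0 ler_expR mulr_ge0 ?(ltW B0)//.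
  by case/andP: zT.
under eq_integral do rewrite picard_stepB//.
have := expectation_drift_diff T0 C0 Greg L0 bL zT (mpicard n.+1) (mpicard n) A0 (hA n.+1) (hA n).
move=> /le_trans; apply.
have mD := measurable_process_abs (measurable_processB (mpicard n.+1) (mpicard n)).
have A2 : 0 <= A / 2 ^+ n by rewrite divr_ge0 ?exprn_ge0.
apply: le_trans (lee_wpmul2l _ (expectation_kern_exp C0 Greg zT mD (fun z w => normr_ge0 _) A2 B0 IH)) _.
  by rewrite lee_fin.
rewrite -EFinM lee_fin exprS.
have -> : L * (A / 2 ^+ n * (C * (expR (B * z.1) / B))) =
  (L * C) / B * (A / 2 ^+ n * expR (B * z.1)) by ring.
have -> : A / (2 * 2 ^+ n) * expR (B * z.1) = 2^-1 * (A / 2 ^+ n * expR (B * z.1)).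
  by rewrite invfM; ring.
apply: ler_wpM2r; first exact: mulr_ge0 A2 (expR_ge0 _).
by rewrite ler_pdivrMr// /B; lra.
Qed.

Definition picard_limit (z : R * R) : Omega -> R := limit_fun (picard ^~ z).

Lemma progressive_picard_limit : progressive H T W picard_limit.
Proof.
by apply: progressive_limit => n; exact: (progressive_picard Greg L0 bL pV mI0).
Qed.

Lemma measurable_picard_limit : measurable_process picard_limit.
Proof. by apply: measurable_limit_fun => n; exact: mpicard. Qed.

Lemma picard_limit_ae z : in_strip z ->
  {ae P, forall w, picard n z w @[n --> \oo] --> picard_limit z w}.
Proof.
move=> zT; have [K K0 hK] := picard_geometric.
have mX n : mO (picard n z) by exact: measurable_process_at (mpicard n).
by have [] := L1_fast_limit K0 mX (fun n => hK n z zT).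
Qed.

Lemma picard_limit_dist : exists2 K : R, 0 <= K & forall n z, in_strip z ->
  (\int[P]_w `|picard n z w - picard_limit z w|%:E <= (K / 2 ^+ n)%:E)%E.
Proof.
have [K K0 hK] := picard_geometric; exists (2 * K); first by rewrite mulr_ge0.
move=> n z zT; have mX k : mO (picard k z) by exact: measurable_process_at (mpicard k).
by have [_] := L1_fast_limit K0 mX (fun n => hK n z zT); exact.
Qed.

Lemma picard_limit_moment (N : nat) : exists2 A : R, 0 <= A & forall z, in_strip z ->
  (\int[P]_w (`|picard_limit z w| ^+ (2 * N.+1))%:E <= A%:E)%E.
Proof.
have [A A0 hA] := picard_even_moment N; exists A => // z zT.
have mX k : mO (picard k z) by exact: measurable_process_at (mpicard k).
have mpow (X : Omega -> R) : mO X -> mO (fun w => `|X w| ^+ (2 * N.+1)).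
  by move=> mX'; apply: measurable_funX; exact: (measurableT_comp (@normr_measurable _ _) mX').
apply: (@fatou_ae _ _ _ P (fun n w => `|picard n z w| ^+ (2 * N.+1))).
- by move=> n; apply: mpow.
- by apply: mpow; exact: measurable_limit_fun.
- by move=> *; exact: exprn_ge0.
- by move=> *; exact: exprn_ge0.
- apply: filterS (picard_limit_ae zT) => w cw.
  elim: (2 * N.+1)%N => [|m IH]; first by under eq_fun do rewrite expr0; exact: cvg_cst.
  by rewrite exprS; under eq_fun do rewrite exprS; apply: cvgM => //; exact: cvg_norm.
- by apply: nearW => n; exact: hA.
Qed.

Lemma picard_limit_L1 : exists2 A : R, 0 <= A & forall z, in_strip z ->
  (\int[P]_w `|picard_limit z w|%:E <= A%:E)%E.
Proof.
have [A A0 h] := picard_limit_moment 0; exists (1 + A); first by rewrite addr_ge0.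
move=> z zT; apply: (expectation_abs_le_power _ (N := 2 * 1)) => //; last exact: h.
exact: (measurable_process_at z measurable_picard_limit).
Qed.

(** Both sides are almost sure limits of [picard n.+1 z]: the left by definition, the right because
    the drift is Lipschitz in L1 and the errors K/2^n stay geometric. *)
Lemma picard_limit_fixed z : in_strip z ->
  {ae P, forall w, picard_limit z w = V z w + I0 z + drift_op picard_limit z w}.
Proof.
move=> zT; have [K K0 hK] := picard_limit_dist.
have [A A0 hA] := picard_L1; have [A' A'0 hA'] := picard_limit_L1.
have mL := measurable_picard_limit; pose A2 := A + A'.
have A20 : 0 <= A2 by rewrite addr_ge0.
have h1 n z' : in_strip z' -> (\int[P]_w `|picard n z' w|%:E <= A2%:E)%E.
  by move=> z'T; apply: le_trans (hA n z' z'T) _; rewrite lee_fin lerDl.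
have h2 z' : in_strip z' -> (\int[P]_w `|picard_limit z' w|%:E <= A2%:E)%E.
  by move=> z'T; apply: le_trans (hA' z' z'T) _; rewrite lee_fin lerDr.
have CT0 : 0 <= C * T by rewrite mulr_ge0// ltW.
have cv : {ae P, forall w, picard n.+1 z w @[n --> \oo] --> V z w + I0 z + drift_op picard_limit z w}.
  have mV : mO (V z) by exact: (measurable_field P_complete T0 pV).
  have mR' : mO (fun w => V z w + I0 z + drift_op picard_limit z w).
    by apply: measurable_funD; [exact: measurable_funD|exact: mdrift].
  apply: (@ae_cvg_fast _ _ _ P (fun n => picard n.+1 z) _ (L * (K * (C * T)))) => // [n|n].
    exact: measurable_process_at (mpicard n.+1).
  under eq_integral => w _ do rewrite [picard n.+1 z w](picard_stepE _ _ _ _ _ _ zT) opprD addrACA subrr add0r.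
  apply: le_trans (expectation_drift_diff T0 C0 Greg L0 bL zT (mpicard n) mL A20 (h1 n) h2) _.
  have mD := measurable_process_abs (measurable_processB (mpicard n) mL).
  have K2 : 0 <= K / 2 ^+ n by rewrite divr_ge0 ?exprn_ge0.
  apply: le_trans (lee_wpmul2l _ (expectation_kern_le T0 C0 Greg zT mD (fun z w => normr_ge0 _) K2 (hK n))) _.
    by rewrite lee_fin.
  by rewrite -EFinM lee_fin le_eqVlt; apply/orP; left; apply/eqP; ring.
apply: filterS2 (picard_limit_ae zT) cv => w c1 c2.
have c1' : picard n.+1 z w @[n --> \oo] --> picard_limit z w.
  by rewrite (cvg_shiftS (fun n => picard n z w)).
exact: (cvg_unique (@norm_hausdorff _ R) c1' c2).
Qed.

End picard_limit.

(** * Existence and uniqueness *)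

Section iterated_Rintegral.
Context {R : realType}.
Local Notation mu := (@lebesgue_measure R).
Local Notation R2 := (measurableTypeR R * measurableTypeR R)%type.

(** The inner integral may be undefined for a null set of s, where its real value is 0 by
    convention; almost everywhere it is finite and Fubini's theorem applies. *)
Lemma Rintegral_area (f : R2 -> R) : (area R).-integrable [set: R2] (EFin \o f) ->
  \int[area R]_z f z = \int[mu]_s \int[mu]_y f (s, y).
Proof.
move=> fi; rewrite /Rintegral; congr fine.
have fi' : (mu \x mu)%E.-integrable [set: R2] (EFin \o f) by exact: fi.
transitivity (\int[mu \x mu]_z (f z)%:E)%E; first by [].
rewrite -(integral12_prod_meas1 fi').
have iF := integrable_fubini_F fi'.
have mF := measurable_int mu iF.
apply: ae_eq_integral => //.
  by apply/measurable_EFinP; apply: measurableT_comp.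
have := integrable_ae measurableT iF; apply: filterS => s /(_ I) fs _ /=.
by rewrite -(fineK fs).
Qed.

End iterated_Rintegral.

Section filter_small.
Context {R : realType}.

Lemma ge0_cvge0_filter (T : Type) (F : set_system T) (FF : Filter F) (u : T -> \bar R) :
  (forall z, 0 <= u z)%E -> (forall e : R, 0 < e -> \forall z \near F, (u z <= e%:E)%E) ->
  u z @[z --> F] --> 0%E.
Proof.
move=> u0 ue; apply/fine_cvgP; split.
  have := ue 1 ltr01; apply: filterS => n un.
  by rewrite ge0_fin_numE// (le_lt_trans un)// ltry.
apply/cvgr0Pnorm_le => e e0; have := ue e e0; apply: filterS => n un /=.
rewrite ger0_norm ?fine_ge0// -lee_fin fineK//.
by rewrite ge0_fin_numE// (le_lt_trans un)// ltry.
Qed.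

Lemma powR_le_1power (x p : R) (N : nat) : 0 <= x -> 0 <= p -> p <= N%:R -> x `^ p <= 1 + x ^+ N.
Proof.
move=> x0 p0 pN; have [x1|/ltW x1] := leP x 1.
  apply: (@le_trans _ _ 1); last by rewrite lerDl exprn_ge0.
  by have := @ge0_ler_powR R p p0 x 1; rewrite powR1; apply => //; rewrite nnegrE.
apply: (@le_trans _ _ (x ^+ N)); last by rewrite lerDr.
by rewrite -powR_mulrn//; apply: ler_powR.
Qed.

Lemma modulus_combination (c D N i r q : R) : 0 <= c -> 0 <= D -> q ^+ 2 <= r ->
  2 * (320 * N * r) + 2 * (2 * i ^+ 2 + 2 * (4 * (c * q) * (D * (c * q)))) <=
  (640 * N + 16 * (c * c * D)) * r + 4 * i ^+ 2.
Proof.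
move=> c0 D0 qr; have k : c * c * D * q ^+ 2 <= c * c * D * r.
  by apply: ler_wpM2l => //; rewrite mulr_ge0// mulr_ge0.
have -> : 4 * (c * q) * (D * (c * q)) = 4 * (c * c * D * q ^+ 2) by ring.
have -> : (640 * N + 16 * (c * c * D)) * r = 640 * (N * r) + 16 * (c * c * D * r) by ring.
by move: (c * c * D * q ^+ 2) (c * c * D * r) k => k1 k2 k; lra.
Qed.

Lemma modulus_const_ge0 (c D N : R) : 0 <= c -> 0 <= D -> 0 <= N ->
  0 <= 640 * N + 16 * (c * c * D).
Proof.
move=> c0 D0 N0; have h : 0 <= c * c * D by rewrite !mulr_ge0.
by move: (c * c * D) h => k; lra.
Qed.

End filter_small.

Section drift_paths.
Context {R : realType} d (Omega : measurableType d).
Local Notation mu := (@lebesgue_measure R).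
Local Notation R2 := (measurableTypeR R * measurableTypeR R)%type.
Variables (G : R -> R -> R) (b : R -> R) (u : R -> R -> Omega -> R) (Y : R * R -> Omega -> R).
Variables (t x : R) (w : Omega).
Hypothesis uY : forall z, 0 <= z.1 <= t -> Y z w = u z.1 z.2 w.

Lemma drift_indicE z : b (Y z w) * kern G (t, x) z =
  drift G b u t x w z.1 z.2 * \1_(`[0, t]%classic : set R) z.1.
Proof.
rewrite /kern /green /drift /= time_indicE; case: ifP => [z0|_]; last by rewrite mul0r !mulr0.
by rewrite uY// mul1r mulr1.
Qed.

Lemma drift_integrableE :
  (mu \x mu)%E.-integrable (`[0, t] `*` setT) (fun z : R2 => (drift G b u t x w z.1 z.2)%:E) <->
  (area R).-integrable [set: R2] (EFin \o (fun z => b (Y z w) * kern G (t, x) z)).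
Proof.
have mD : measurable (`[0, t] `*` setT : set R2).
  by apply: measurableX => //; exact: measurable_itv.
have -> : EFin \o (fun z => b (Y z w) * kern G (t, x) z) =
    ((fun z : R2 => (drift G b u t x w z.1 z.2)%:E) \_ (`[0, t] `*` setT)).
  apply/funext => z; rewrite /= drift_indicE patchE indicE.
  have -> : (z \in (`[0, t] `*` setT : set R2)) = (z.1 \in (`[0, t]%classic : set R)).
    by apply/idP/idP => /set_mem h; apply: mem_set; [case: h|split].
  by case: ifP => _; rewrite ?mulr1 ?mulr0.
exact: (integrable_mkcond _ mD).
Qed.

Lemma drift_iteratedE :
  (area R).-integrable [set: R2] (EFin \o (fun z => b (Y z w) * kern G (t, x) z)) ->
  \int[mu]_(s in `[0, t]) \int[mu]_y drift G b u t x w s y = drift_op G b Y (t, x) w.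
Proof.
move=> iw; rewrite /drift_op (Rintegral_area iw) /Rintegral; congr fine.
rewrite integral_mkcond; apply: eq_integral => s _; rewrite patchE.
case: ifPn => sD.
  congr (fine _)%:E; apply: eq_integral => y _.
  by rewrite (drift_indicE (s, y)) indicE sD mulr1.
under [in RHS]eq_integral do rewrite (drift_indicE (s, _)) indicE (negbTE sD) mulr0.
by rewrite integral0.
Qed.

End drift_paths.

Section existence.
Context {R : realType} d (Omega : measurableType d) (P : probability Omega R).
Hypothesis P_complete : measure_is_complete P.
Local Notation mu := (@lebesgue_measure R).
Local Notation R2 := (measurableTypeR R * measurableTypeR R)%type.
Local Notation mO := (measurable_fun [set: Omega]).
Local Notation msq := (mean_sq P).
Variables H T C p : R.
Hypothesis H0 : 0 < H.
Hypothesis H1 : H < 1.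
Hypothesis T0 : 0 < T.
Hypothesis p2 : 2 <= p.
Hypothesis C0 : 0 <= C.
Variable G : R -> R -> R.
Hypothesis Greg : regular_kernel T C G.
Variable W : test_functions R -> {RV P >-> R}.
Hypothesis W_noise : fractional_noise H W.
Variables (b : R -> R) (L : R).
Hypothesis L0 : 0 <= L.
Hypothesis bL : forall x y, `|b x - b y| <= L * `|x - y|.
Variables (I0 : R -> R -> R) (M : R).
Hypothesis mI0 : measurable_fun [set: R2] (fun z => \1_(`[0, T]) z.1 * I0 z.1 z.2).
Hypothesis M0 : 0 <= M.
Hypothesis I0M : forall t x, 0 <= t <= T -> `|I0 t x| <= M.
Hypothesis I0_continuous : forall t x, 0 <= t <= T -> forall e, 0 < e ->
  exists2 dl, 0 < dl & forall t' x', 0 <= t' <= T -> `|t' - t| <= dl -> `|x' - x| <= dl ->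
    `|I0 t' x' - I0 t x| <= e.
Local Notation in_strip := (in_strip T).
Local Notation drift_op := (drift_op G b).
Local Notation wi := (wiener_integral H W).
Variable V : R * R -> Omega -> R.
Hypothesis pV : progressive H T W V.
Hypothesis hV : forall t x, 0 <= t <= T -> exists2 X : {RV P >-> R}, wi (green G t x) X &
    {ae P, forall w, V (t, x) w = X w}.

Local Notation I0p := (fun z : R * R => I0 z.1 z.2).

Lemma field_moment (N : nat) : exists2 v : R, 0 <= v & forall z, in_strip z ->
  (\int[P]_w (`|V z w| ^+ (2 * N.+1))%:E <= v%:E)%E.
Proof.
pose v0 := noise_power_const H T (C * (1 + T)) + 1.
have T1 : 0 <= 1 + T by have := T0; lra.
have k0 : 0 <= noise_power_const H T (C * (1 + T)).
  have H4 : 0 <= H / 4 by have := H0; lra.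
  apply: mulr_ge0; last by rewrite divr_ge0 ?powR_ge0.
  by apply: mulr_ge0; [exact: slice_const_ge0|rewrite mulr_ge0 ?powR_ge0].
have v00 : 0 < v0 by rewrite ltr_wpDl.
exists (2 * (N.+1)`!%:R * (128 * v0) ^+ N.+1).
  by rewrite !mulr_ge0 ?exprn_ge0// mulr_ge0// ltW.
move=> [t x] zT; have [X wX VX] := hV x zT.
have nX : (noise_sqnorm H (green G t x) <= v0%:E)%E.
  apply: le_trans (green_noise_le H0 H1 T0 C0 Greg x zT) _.
  by rewrite lee_fin lerDl.
apply: le_trans (wiener_moment_le H0 H1 W_noise N.+1 v00 wX nX).
rewrite le_eqVlt; apply/orP; left; apply/eqP.
have mV := measurable_field P_complete T0 pV zT.
apply: ae_eq_integral => //.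
- apply/measurable_EFinP; apply: measurable_funX.
  exact: (measurableT_comp (@normr_measurable _ _) mV).
- by apply/measurable_EFinP; exact: measurable_funX.
- by apply: filterS VX => w e _; rewrite e exprM real_normK ?num_real// -exprM.
Qed.

Definition mild_solution (t x : R) : Omega -> R := picard_limit T G b V I0p (t, x).

Lemma I0pM z : in_strip z -> `|I0p z| <= M. Proof. exact: I0M. Qed.

Lemma mild_process : measurable_process (fun z => mild_solution z.1 z.2).
Proof.
have := measurable_picard_limit P_complete T0 Greg L0 bL pV mI0.
by congr measurable_process; apply/funext => -[t x].
Qed.

Lemma mild_moment (N : nat) : exists2 A : R, 0 <= A & forall t x, 0 <= t <= T ->
  (\int[P]_w (`|mild_solution t x w| ^+ (2 * N.+1))%:E <= A%:E)%E.
Proof.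
have [A A0 h] := picard_limit_moment P_complete T0 C0 Greg L0 bL pV mI0 M0 I0pM field_moment N.
by exists A => // t x tT; exact: h.
Qed.

Lemma mild_L1 : exists2 A : R, 0 <= A & forall z, in_strip z ->
  (\int[P]_w `|mild_solution z.1 z.2 w|%:E <= A%:E)%E.
Proof.
have [A A0 h] := picard_limit_L1 P_complete T0 C0 Greg L0 bL pV mI0 M0 I0pM field_moment.
by exists A => // -[t x] tT; exact: h.
Qed.

Lemma mild_fixed t x : 0 <= t <= T ->
  {ae P, forall w, mild_solution t x w =
     V (t, x) w + I0 t x + drift_op (fun z => mild_solution z.1 z.2) (t, x) w}.
Proof.
move=> tT; have -> : (fun z => mild_solution z.1 z.2) = picard_limit T G b V I0p.
  by apply/funext => -[].
exact: (picard_limit_fixed P_complete T0 C0 Greg L0 bL pV mI0 M0 I0pM field_moment (z := (t, x)) tT).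
Qed.

Lemma mild_adapted : adapted H W T mild_solution.
Proof.
move=> t x tT B mB.
have := progressive_adapted x (progressive_picard_limit Greg L0 bL pV mI0) tT.
by move=> /(_ measurableT B mB); rewrite setTI.
Qed.

Lemma mild_jointly_measurable : jointly_measurable T mild_solution.
Proof. by apply: measurable_funTS; exact: mild_process. Qed.

Lemma mild_bounded_moment : bounded_moment P T p mild_solution.
Proof.
(* Moments are controlled at even orders; 2(N+1) is one that dominates p. *)
pose N := Num.truncn p; have pN : p <= (2 * N.+1)%:R.
  have p0 : 0 <= p by have := p2; lra.
  apply: (@le_trans _ _ N.+1%:R); first by apply: ltW; exact: truncnS_gt.
  by rewrite ler_nat leq_pmull.
have [A A0 hA] := mild_moment N.
apply: (@le_lt_trans _ _ (1 + A)%:E); last exact: ltry.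
apply: ge_ereal_sup => _ [[t x] [/= tT _] <-].
rewrite in_itv/= in tT.
have mU : mO (mild_solution t x) by exact: (measurable_process_at (t, x) mild_process).
have maU : mO (fun w => `|mild_solution t x w|) by exact: (measurableT_comp (@normr_measurable _ _) mU).
rewrite unlock; apply: (@le_trans _ _ (\int[P]_w (1 + `|mild_solution t x w| ^+ (2 * N.+1))%:E)%E).
  apply: integral_mono => [||w|w].
  - exact: measurable_powR_comp.
  - by apply: measurable_funD => //; exact: measurable_funX.
  - exact: powR_ge0.
  - by apply: powR_le_1power => //; have := p2; lra.
rewrite (@integral_add _ _ _ P (fun=> 1) (fun w => `|mild_solution t x w| ^+ (2 * N.+1)))//.
- by rewrite integral_cst//= probability_setT mule1 EFinD leeD// hA.
- exact: measurable_funX.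
Qed.

Lemma mild_solves : mild_equation H W T b G I0 mild_solution.
Proof.
move=> t x tT; have [X wX VX] := hV x tT; exists X; first exact: wX.
have [A A0 hA] := mild_L1.
have di := drift_integrable T0 C0 Greg L0 bL (p := (t, x)) tT mild_process A0 hA.
apply: filterS3 VX (mild_fixed x tT) di => w Vw fw iw.
have e z : 0 <= z.1 <= t -> mild_solution z.1 z.2 w = mild_solution z.1 z.2 w by [].
split; first exact: (iffRL (@drift_integrableE _ _ _ G b mild_solution
  (fun z => mild_solution z.1 z.2) t x w e) iw).
rewrite (@drift_iteratedE _ _ _ G b mild_solution
  (fun z => mild_solution z.1 z.2) t x w e iw) fw Vw.
by rewrite [X w + _]addrC.
Qed.

Lemma mean_sq_ae (X Y : Omega -> R) : mO X -> mO Y -> {ae P, forall w, X w = Y w} -> msq X = msq Y.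
Proof.
move=> mX mY XY; apply: ae_eq_integral => //.
- by apply/measurable_EFinP; exact: measurable_funX.
- by apply/measurable_EFinP; exact: measurable_funX.
- by apply: filterS XY => w ->.
Qed.

Lemma field_modulus (q t t' x x' : R) : 0 <= q <= 1 -> 0 <= t <= T -> 0 <= t' <= T ->
  `|t' - t| <= q ^+ 4 -> `|x' - x| <= q ^+ 2 ->
  (msq (fun w => (V (t', x') w - V (t, x) w)%R) <=
   (320 * noise_power_const H T (2 * C) * q `^ H)%:E)%E.
Proof.
move=> q01 tT tT' tq xq.
have [X wX VX] := hV x tT; have [X' wX' VX'] := hV x' tT'.
have mV := measurable_field P_complete T0 pV (z := (t, x)) tT.
have mV' := measurable_field P_complete T0 pV (z := (t', x')) tT'.
rewrite (@mean_sq_ae _ (fun w => X' w - X w)); last first.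
- by apply: filterS2 VX VX' => w -> ->.
- exact: measurable_funB.
- exact: measurable_funB.
apply: le_trans (wiener_isometry H0 H1 W_noise wX' wX) _.
have n := green_noise_dist H0 H1 T0 C0 Greg q01 tT tT' tq xq.
have -> : 320 * noise_power_const H T (2 * C) * q `^ H =
  32 * (10 * noise_power_const H T (2 * C) * q `^ H) by ring.
by rewrite (EFinM 32) lee_wpmul2l.
Qed.

(** An increment of the solution is the sum of a noise increment of mean square of order q^H, an
    initial increment of size i, and a drift increment of mean square of order q^2 <= q^H. *)
Lemma mild_modulus : exists2 K, 0 <= K & forall q t t' x x' i, 0 < q <= 1 ->
  0 <= t <= T -> 0 <= t' <= T -> `|t' - t| <= q ^+ 4 -> `|x' - x| <= q ^+ 2 ->
  `|I0 t' x' - I0 t x| <= i ->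
  (msq (fun w => (mild_solution t' x' w - mild_solution t x w)%R) <= (K * q `^ H + 4 * i ^+ 2)%:E)%E.
Proof.
have [A1 A10 hA1] := mild_L1; have [A2 A20 hA2] := mild_moment 0.
pose A := A1 + A2; have A0 : 0 <= A by rewrite addr_ge0.
have U1 z : in_strip z -> (\int[P]_w `|mild_solution z.1 z.2 w|%:E <= A%:E)%E.
  by move=> zT; apply: le_trans (hA1 z zT) _; rewrite lee_fin lerDl.
have U2 z : in_strip z -> (\int[P]_w (mild_solution z.1 z.2 w ^+ 2)%:E <= A%:E)%E.
  move=> zT; have := hA2 z.1 z.2 zT; rewrite muln1.
  under eq_integral do rewrite real_normK ?num_real//.
  by move=> k; apply: le_trans k _; rewrite lee_fin lerDr.
(* The added 1 keeps c q strictly positive, as [drift_modulus] requires of its bound. *)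
pose c := 3 * (2 * C * (T `^ (3 / 4) / (3 / 4))) + 1.
have c0 : 0 < c by rewrite ltr_wpDl// !mulr_ge0 ?powR_ge0 ?invr_ge0.
pose D := growth_const L 2 * A + 4 * `|b 0| ^+ 2.
have D0 : 0 <= D by rewrite addr_ge0// mulr_ge0 ?exprn_ge0// mulr_ge0 ?exprn_ge0.
pose N := noise_power_const H T (2 * C).
have N0 : 0 <= N.
  have H4 : 0 <= H / 4 by have := H0; lra.
  apply: mulr_ge0; last by rewrite divr_ge0 ?powR_ge0.
  by apply: mulr_ge0; [exact: slice_const_ge0|rewrite mulr_ge0 ?powR_ge0].
have c00 := ltW c0.
exists (640 * N + 16 * (c * c * D)); first exact: (modulus_const_ge0 c00 D0 N0).
move=> q t t' x x' i /andP[q0 q1] tT tT' tq xq Ii.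
have q01 : 0 <= q <= 1 by rewrite ltW.
have cq0 : 0 < c * q by rewrite mulr_gt0.
have kd : (\int[area R]_z `|kern G (t', x') z - kern G (t, x) z|%:E <= (c * q)%:E)%E.
  apply: le_trans (kern_dist T0 C0 Greg (ltW q0) tT tT' tq xq) _.
  by rewrite lee_fin /c mulrDl mul1r; have := q0; lra.
have dm := drift_modulus T0 C0 Greg L0 bL (p := (t, x)) (p' := (t', x')) tT tT'
  mild_process A0 cq0 U2 U1 kd.
have fm := field_modulus q01 tT tT' tq xq.
pose Vd w := V (t', x') w - V (t, x) w.
pose Dd w := drift_op (fun z => mild_solution z.1 z.2) (t', x') w -
  drift_op (fun z => mild_solution z.1 z.2) (t, x) w.
pose Id := I0 t' x' - I0 t x.
have mV z : in_strip z -> mO (V z) by move=> zT; exact: (measurable_field P_complete T0 pV zT).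
have mDr z : mO (drift_op (fun z => mild_solution z.1 z.2) z).
  exact: (measurable_drift_op Greg L0 bL _ mild_process).
have mVd : mO Vd by apply: measurable_funB; exact: mV.
have mDd : mO Dd by exact: measurable_funB.
have mU z : mO (mild_solution z.1 z.2) by exact: (measurable_process_at z mild_process).
have mId : mO (fun w => Id + Dd w) by exact: measurable_funD.
rewrite (@mean_sq_ae _ (fun w => Vd w + (Id + Dd w))); last first.
- apply: filterS2 (mild_fixed x tT) (mild_fixed x' tT') => w -> ->.
  by rewrite /Vd /Dd /Id; ring.
- exact: measurable_funD.
- by apply: measurable_funB; [exact: (mU (t', x'))|exact: (mU (t, x))].
apply: le_trans (mean_sqD_le P mVd mId) _.
have mI : (msq (fun=> Id) <= (i ^+ 2)%:E)%E.
  rewrite /mean_sq integral_cst//= probability_setT mule1 lee_fin.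
  by rewrite -real_normK ?num_real// lerXn2r ?nnegrE ?(le_trans _ Ii).
have mID := mean_sqD_le P (measurable_cst Id) mDd.
apply: (@le_trans _ _ (2 * (320 * N * q `^ H) +
    2 * (2 * i ^+ 2 + 2 * (4 * (c * q) * (D * (c * q)))))%:E).
  apply: lee_combination2; first exact: fm.
  apply: le_trans mID _; apply: lee_combination2; [exact: mI|exact: dm].
have qq : q ^+ 2 <= q `^ H.
  by rewrite -powR_mulrn ?(ltW q0)//; apply: ger_powR; rewrite ?q0//; have := H1; lra.
by rewrite lee_fin; exact: (modulus_combination N i c00 D0 qq).
Qed.

Lemma mild_L2_continuous : L2_continuous P T mild_solution.
Proof.
have mU z : mO (mild_solution z.1 z.2) by exact: (measurable_process_at z mild_process).
split.
- move=> [t x] /= [tT _]; rewrite in_itv/= in tT.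
  rewrite inE; apply/andP; split; first by rewrite inE; exact: (mU (t, x)).
  rewrite inE /finLfun/= /finite_norm.
  have [A A0 hA] := mild_moment 0; have := hA t x tT; rewrite muln1 => h.
  apply: (@le_lt_trans _ _ (1 + A)%:E); last exact: ltry.
  rewrite mean_sq_le_L2 ?addr_ge0//.
  apply: (@le_trans _ _ A%:E).
    apply: le_trans h; rewrite le_eqVlt; apply/orP; left; apply/eqP.
    by apply: eq_integral => w _; rewrite real_normK ?num_real.
  by rewrite lee_fin; have := sqr_ge0 A; rewrite sqrrD; lra.
- move=> [t x] /= [tT _]; rewrite in_itv/= in tT.
  have [K K0 hK] := mild_modulus.
  apply: ge0_cvge0_filter => [z|e e0]; first exact: Lnorm_ge0.
  have e2 : 0 < e ^+ 2 / 2 by rewrite divr_gt0// exprn_gt0.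
  have [q /andP[q0 q1] qe] := small_power H0 K0 e2.
  have e4 : 0 < e / 4 by rewrite divr_gt0.
  have [dl dl0 hdl] := I0_continuous x tT e4.
  (* A move of at most q^4 satisfies the time condition and, since q <= 1, also the condition q^2 in
     space. *)
  pose m := Num.min dl (q ^+ 4).
  have m0 : 0 < m by rewrite lt_min dl0 exprn_gt0.
  have near_le (a : R) : nbhs a [set y | `|y - a| <= m].
    by apply/nbhs_ballP; exists m => //= y; rewrite /ball/= distrC => /ltW.
  have c12 : \forall z \near (t, x), `|z.1 - t| <= m /\ `|z.2 - x| <= m.
    by exists ([set y | `|y - t| <= m], [set y | `|y - x| <= m]) => /=; first by split; exact: near_le.
  rewrite near_withinE; apply: filterS c12 => -[t' x'] /= [tm xm] [tT' _].
  rewrite in_itv/= in tT'.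
  have [md mq] : m <= dl /\ m <= q ^+ 4 by split; rewrite /m ge_min lexx ?orbT.
  rewrite mean_sq_le_L2; last exact: ltW.
  have xq : `|x' - x| <= q ^+ 2.
    apply: (le_trans xm); apply: (le_trans mq); apply: ler_wiXn2l => //; exact: ltW.
  have q01 : 0 < q <= 1 by rewrite q0.
  apply: le_trans (hK q t t' x x' (e / 4) q01 tT tT' (le_trans tm mq) xq _) _.
    by apply: hdl => //; [exact: le_trans md|exact: le_trans md].
  rewrite lee_fin; have -> : 4 * (e / 4) ^+ 2 = e ^+ 2 / 4 by field.
  by have := sqr_ge0 e; lra.
Qed.

Lemma mild_solution_exists : exists u, solution H W T p b G I0 u.
Proof.
exists mild_solution; split; [exact: mild_adapted|exact: mild_jointly_measurable|
  exact: mild_L2_continuous|exact: mild_bounded_moment|exact: mild_solves].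
Qed.

End existence.

Section uniqueness.
Context {R : realType} d (Omega : measurableType d) (P : probability Omega R).
Local Notation mu := (@lebesgue_measure R).
Local Notation R2 := (measurableTypeR R * measurableTypeR R)%type.
Local Notation mO := (measurable_fun [set: Omega]).
Variables H T C p : R.
Hypothesis H0 : 0 < H.
Hypothesis H1 : H < 1.
Hypothesis T0 : 0 < T.
Hypothesis p2 : 2 <= p.
Hypothesis C0 : 0 <= C.
Variable G : R -> R -> R.
Hypothesis Greg : regular_kernel T C G.
Variable W : test_functions R -> {RV P >-> R}.
Hypothesis W_noise : fractional_noise H W.
Variables (b : R -> R) (L : R).
Hypothesis L0 : 0 <= L.
Hypothesis bL : forall x y, `|b x - b y| <= L * `|x - y|.
Variable I0 : R -> R -> R.
Local Notation in_strip := (in_strip T).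
Local Notation drift_op := (drift_op G b).

(** Extension by 0 outside [0, T]: a solution is jointly measurable on the strip only, while the
    drift operator integrates over the whole plane. *)
Definition strip_process (u : R -> R -> Omega -> R) (z : R * R) (w : Omega) : R :=
  \1_(`[0, T]) z.1 * u z.1 z.2 w.

Lemma strip_processE u z w : in_strip z -> strip_process u z w = u z.1 z.2 w.
Proof. by move=> zT; rewrite /strip_process time_indicE zT mul1r. Qed.

Lemma measurable_strip_process u : jointly_measurable T u -> measurable_process (strip_process u).
Proof.
move=> mu_; pose D : set (R2 * Omega) := (`[0, T] `*` setT) `*` setT.
have mD : measurable D.
  by apply: measurableX => //; apply: measurableX => //; exact: measurable_itv.
have h : measurable_fun D (fun q : R2 * Omega => u q.1.1 q.1.2 q.2) by exact: mu_.
have := (measurable_restrictT (fun q : R2 * Omega => u q.1.1 q.1.2 q.2) mD).1 h.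
congr (measurable_fun _ _); apply/funext => q; rewrite patchE /strip_process indicE.
have -> : (q \in D) = (q.1.1 \in (`[0, T]%classic : set R)).
  by apply/idP/idP => /set_mem k; apply: mem_set; [case: k => -[]|split].
by case: ifP => _; rewrite ?mul1r ?mul0r.
Qed.

Lemma bounded_moment_L1 u : jointly_measurable T u -> bounded_moment P T p u ->
  exists2 A : R, 0 <= A & forall z, in_strip z -> (\int[P]_w `|strip_process u z w|%:E <= A%:E)%E.
Proof.
move=> mu_ up; have mY := measurable_strip_process mu_.
have [A hA] : exists A : R, forall z, in_strip z -> (\int[P]_w (`|strip_process u z w| `^ p)%:E <= A%:E)%E.
  pose S := ereal_sup [set ('E_P[fun w => (`|u z.1 z.2 w| `^ p)%R])%E |
              z in (`[0%R, T] `*` setT : set (R * R))].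
  have SE z : in_strip z -> (\int[P]_w (`|strip_process u z w| `^ p)%:E <= S)%E.
    move=> zT; apply: ereal_sup_ubound; exists z.
      by split => //; rewrite /= in_itv.
    by rewrite unlock; apply: eq_integral => w _; rewrite strip_processE.
  have S0 : (0 <= S)%E.
    have TT : in_strip (0, 0) by rewrite /(in_strip _)/= lexx ltW.
    by apply: le_trans (SE _ TT); apply: integral_ge0 => w _; rewrite lee_fin powR_ge0.
  exists (fine S) => z zT; rewrite fineK; first exact: SE.
  by rewrite ge0_fin_numE.
have A0 : 0 <= A.
  have TT : in_strip (0, 0) by rewrite /(in_strip _)/= lexx ltW.
  rewrite -lee_fin; apply: le_trans (hA _ TT).
  by apply: integral_ge0 => w _; rewrite lee_fin powR_ge0.
exists (1 + A); first by rewrite addr_ge0.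
move=> z zT; have mYz := measurable_process_at z mY.
have maY : mO (fun w => `|strip_process u z w|) by exact: (measurableT_comp (@normr_measurable _ _) mYz).
have mpY : mO (fun w => `|strip_process u z w| `^ p) by exact: measurable_powR_comp.
apply: (@le_trans _ _ (\int[P]_w (1 + `|strip_process u z w| `^ p)%:E)%E).
  apply: integral_mono => // [|w]; first exact: measurable_funD.
  have [y1|/ltW y1] := leP `|strip_process u z w| 1.
    by apply: (le_trans y1); rewrite lerDl powR_ge0.
  apply: (@le_trans _ _ (`|strip_process u z w| `^ p)); last by rewrite lerDr.
  by apply: le1r_powR => //; have := p2; lra.
rewrite (@integral_add _ _ _ P (fun=> 1) (fun w => `|strip_process u z w| `^ p))//.
by rewrite integral_cst//= probability_setT mule1 EFinD leeD// hA.
Qed.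

(** The two equations may hold with different versions of the stochastic integral; these agree
    almost surely by [wiener_unique], so noise and initial term cancel. *)
Lemma solution_difference u v t x : 0 <= t <= T ->
  mild_equation H W T b G I0 u -> mild_equation H W T b G I0 v ->
  {ae P, forall w,
    [/\ (area R).-integrable [set: R2] (EFin \o (fun z => b (strip_process u z w) * kern G (t, x) z)),
        (area R).-integrable [set: R2] (EFin \o (fun z => b (strip_process v z w) * kern G (t, x) z)) &
    u t x w - v t x w = drift_op (strip_process u) (t, x) w - drift_op (strip_process v) (t, x) w]}.
Proof.
move=> tT hu hv; have [X wX hX] := hu t x tT; have [X' wX' hX'] := hv t x tT.
have XX := wiener_unique H0 H1 W_noise wX wX'.
apply: filterS3 XX hX hX' => w e [iu eu] [iv ev].
have tw (y : R -> R -> Omega -> R) z : 0 <= z.1 <= t -> strip_process y z w = y z.1 z.2 w.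
  move=> /andP[z0 zt]; apply: strip_processE; rewrite /(in_strip _) z0/=.
  by apply: le_trans zt _; case/andP: tT.
have iu' := iffLR (drift_integrableE G b x (tw u)) iu.
have iv' := iffLR (drift_integrableE G b x (tw v)) iv.
split => //; rewrite eu ev e (drift_iteratedE (tw u) iu') (drift_iteratedE (tw v) iv').
by ring.
Qed.

(** The difference of two solutions equals the difference of their drifts, so each application of
    the contraction estimate halves its weighted L1 bound; it is therefore 0. *)
Lemma solution_unique u v : solution H W T p b G I0 u -> solution H W T p b G I0 v ->
  modification P T u v.
Proof.
move=> [_ ju _ pu eu] [_ jv _ pv ev] t x tT.
have mY := measurable_strip_process ju; have mZ := measurable_strip_process jv.
have [A1 A10 hA1] := bounded_moment_L1 ju pu; have [A2 A20 hA2] := bounded_moment_L1 jv pv.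
pose A := A1 + A2; have A0 : 0 <= A by rewrite addr_ge0.
have YA z : in_strip z -> (\int[P]_w `|strip_process u z w|%:E <= A%:E)%E.
  by move=> zT; apply: le_trans (hA1 z zT) _; rewrite lee_fin lerDl.
have ZA z : in_strip z -> (\int[P]_w `|strip_process v z w|%:E <= A%:E)%E.
  by move=> zT; apply: le_trans (hA2 z zT) _; rewrite lee_fin lerDr.
have mD := measurable_process_abs (measurable_processB mY mZ).
pose B := 2 * (L * C) + 1.
have LC0 : 0 <= L * C by rewrite mulr_ge0.
have B0 : 0 < B by rewrite ltr_wpDl// mulr_ge0.
have h n z : in_strip z ->
    (\int[P]_w `|strip_process u z w - strip_process v z w|%:E <=
      (2 * A / 2 ^+ n * expR (B * z.1))%:E)%E.
  elim: n z => [|n IH] z zT.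
    have mYz := measurable_process_at z mY; have mZz := measurable_process_at z mZ.
    apply: (@le_trans _ _ (2 * A)%:E).
      have m0 : mO (fun=> 0 : R) by exact: measurable_cst.
      have -> : 2 * A = A + A by rewrite mulrDl mul1r.
      apply: (@L1_dist_triangle _ _ _ P (strip_process u z) (fun=> 0) (strip_process v z)) => //.
        by under eq_integral do rewrite subr0; exact: YA.
      by under eq_integral do rewrite sub0r normrN; exact: ZA.
    rewrite lee_fin expr0 divr1 ler_peMr ?mulr_ge0// -expR0 ler_expR mulr_ge0 ?(ltW B0)//.
    by case/andP: zT.
  have e : (\int[P]_w `|strip_process u z w - strip_process v z w|%:E =
     \int[P]_w `|drift_op (strip_process u) z w - drift_op (strip_process v) z w|%:E)%E.
    apply: ae_eq_integral => //.
    - by apply/measurable_EFinP; exact: (measurable_process_at z mD).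
    - apply/measurable_EFinP; apply: (measurableT_comp (@normr_measurable _ _)).
      by apply: measurable_funB; [exact: (measurable_drift_op Greg L0 bL z mY)|
        exact: (measurable_drift_op Greg L0 bL z mZ)].
    - apply: filterS (solution_difference z.2 zT eu ev) => w [_ _ k] _ /=.
      by rewrite !strip_processE// k -surjective_pairing.
  rewrite e.
  have := expectation_drift_diff T0 C0 Greg L0 bL zT mY mZ A0 YA ZA.
  move=> /le_trans; apply.
  have A2n : 0 <= 2 * A / 2 ^+ n by rewrite divr_ge0 ?exprn_ge0// mulr_ge0.
  apply: le_trans (lee_wpmul2l _ (expectation_kern_exp C0 Greg zT mD (fun z w => normr_ge0 _) A2n B0 IH)) _.
    by rewrite lee_fin.
  rewrite -EFinM lee_fin exprS.
  have -> : L * (2 * A / 2 ^+ n * (C * (expR (B * z.1) / B))) =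
    (L * C) / B * (2 * A / 2 ^+ n * expR (B * z.1)) by ring.
  have -> : 2 * A / (2 * 2 ^+ n) * expR (B * z.1) = 2^-1 * (2 * A / 2 ^+ n * expR (B * z.1)).
    by rewrite invfM; ring.
  apply: ler_wpM2r; first exact: mulr_ge0 A2n (expR_ge0 _).
  by rewrite ler_pdivrMr// /B; lra.
have tx : in_strip (t, x) by [].
have z0 : (\int[P]_w `|strip_process u (t, x) w - strip_process v (t, x) w|%:E = 0)%E.
  apply/eqP; rewrite eq_le integral_ge0 ?andbT; last by move=> w _; rewrite lee_fin.
  apply/lee_addgt0Pr => e e0; rewrite add0e.
  pose K := 2 * A * expR (B * t).
  have K0 : 0 <= K by rewrite mulr_ge0 ?expR_ge0// mulr_ge0.
  have [n hn] : exists n : nat, K / 2 ^+ n <= e.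
    exists (Num.truncn (K / e)); rewrite ler_pdivrMr ?exprn_gt0// mulrC -ler_pdivrMr//.
    apply: le_trans (ltW (truncnS_gt _)) _; rewrite -natrX ler_nat.
    exact: ltn_expl.
  apply: le_trans (h n (t, x) tx) _; rewrite lee_fin.
  by have -> : 2 * A / 2 ^+ n * expR (B * (t, x).1) = K / 2 ^+ n by rewrite /K/=; ring.
have mDt := measurable_process_at (t, x) mD.
have mE : measurable_fun [set: Omega]
    (fun w => (strip_process u (t, x) w - strip_process v (t, x) w)%:E).
  by apply/measurable_EFinP; apply: measurable_funB; exact: measurable_process_at.
have := (ae_eq_integral_abs P measurableT mE).1 z0.
apply: filterS => w /(_ I) /= []; rewrite !strip_processE//= => /eqP.
by rewrite subr_eq0 => /eqP.
Qed.

End uniqueness.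

(** * Initial terms *)

Section moduli.
Context {R : realType}.

Lemma lipschitz_const (b : R -> R) : lipschitz b ->
  exists2 L, 0 <= L & forall x y, `|b x - b y| <= L * `|x - y|.
Proof.
move=> [N [_ hN]]; exists (`|N| + 1); first by rewrite addr_ge0.
move=> x y; apply: (hN _ _ (x, y)) => //.
by apply: le_lt_trans (ler_norm N) _; rewrite ltrDl.
Qed.

Lemma bounded_const (f : R -> R) : bounded_fun f -> exists2 M, 0 <= M & forall x, `|f x| <= M.
Proof.
move=> [N [_ hN]]; exists (`|N| + 1); first by rewrite addr_ge0.
move=> x; apply: (hN _ _ x) => //.
by apply: le_lt_trans (ler_norm N) _; rewrite ltrDl.
Qed.

Definition uniform_modulus (f : R -> R) : Prop := forall e : R, 0 < e ->
  exists2 dl, 0 < dl & forall x y, `|x - y| <= dl -> `|f x - f y| <= e.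

Lemma hoelder_modulus (H : R) (f : R -> R) : 0 < H -> hoelder_continuous H f -> uniform_modulus f.
Proof.
move=> H0 [K hK] e e0; have [r /andP[r0 _] re] := small_power H0 (normr_ge0 K) e0.
exists r => // x y xy; apply: le_trans (hK x y) _; apply: le_trans re.
apply: (@le_trans _ _ (`|K| * `|x - y| `^ H)); first by rewrite ler_wpM2r ?powR_ge0 ?ler_norm.
by rewrite ler_wpM2l// ge0_ler_powR ?(ltW H0)// nnegrE ltW.
Qed.

Lemma measurable_uniform_modulus (f : R -> R) : uniform_modulus f ->
  measurable_fun [set: measurableTypeR R] f.
Proof.
move=> uf; apply: continuous_measurable_fun => x; apply/cvgrPdist_le => e e0.
have [dl dl0 h] := uf e e0.
by apply/nbhs_ballP; exists dl => //= y; rewrite /ball/= => /ltW; exact: h.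
Qed.

End moduli.

Section convolution.
Context {R : realType}.
Local Notation mu := (@lebesgue_measure R).
Local Notation mR := (measurable_fun [set: measurableTypeR R]).
Local Notation R2 := (measurableTypeR R * measurableTypeR R)%type.
Variables (f : R -> R) (M : R).
Hypothesis mf : mR f.
Hypothesis M0 : 0 <= M.
Hypothesis fM : forall x, `|f x| <= M.

Lemma weighted_bound (k : R -> R) : mR k ->
  (\int[mu]_y `|k y * f y|%:E <= M%:E * \int[mu]_y `|k y|%:E)%E.
Proof.
move=> mk; have mk' : mR (fun y => `|k y|) by exact: (measurableT_comp (@normr_measurable _ _) mk).
rewrite -(@integral_scale _ _ _ mu M (fun y => `|k y|))//.
apply: integral_mono => // [||y].
- by apply: (measurableT_comp (@normr_measurable _ _)); exact: measurable_funM.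
- exact: measurable_funM.
- by rewrite normrM mulrC ler_wpM2r.
Qed.

Lemma weighted_integrable (k : R -> R) (a : R) : mR k -> (\int[mu]_y `|k y|%:E <= a%:E)%E ->
  mu.-integrable [set: measurableTypeR R] (EFin \o (fun y => k y * f y)).
Proof.
move=> mk ka; apply/integrableP; split.
  by apply/measurable_EFinP; exact: measurable_funM.
apply: le_lt_trans (weighted_bound mk) _.
apply: (@le_lt_trans _ _ (M%:E * a%:E)%E); first by rewrite lee_wpmul2l.
by rewrite -EFinM ltry.
Qed.

Lemma weighted_Rintegral_le (k : R -> R) (a : R) : mR k -> (\int[mu]_y `|k y|%:E <= a%:E)%E ->
  `|\int[mu]_y (k y * f y)| <= M * a.
Proof.
move=> mk ka; rewrite -lee_fin.
have mkf : mR (fun y => k y * f y) by exact: measurable_funM.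
apply: le_trans (le_abs_Rintegral mu measurableT mkf) _.
apply: le_trans (weighted_bound mk) _.
by rewrite EFinM lee_wpmul2l.
Qed.

Lemma weighted_Rintegral_dist (k k' : R -> R) (a a' c : R) : mR k -> mR k' ->
  (\int[mu]_y `|k y|%:E <= a%:E)%E -> (\int[mu]_y `|k' y|%:E <= a'%:E)%E ->
  (\int[mu]_y `|k' y - k y|%:E <= c%:E)%E ->
  `|\int[mu]_y (k' y * f y) - \int[mu]_y (k y * f y)| <= M * c.
Proof.
move=> mk mk' ka ka' kc.
have i := weighted_integrable mk ka; have i' := weighted_integrable mk' ka'.
rewrite -RintegralB//.
have -> : \int[mu]_y (k' y * f y - k y * f y) = \int[mu]_y ((k' y - k y) * f y).
  by apply: eq_Rintegral => y _; rewrite mulrBl.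
by apply: weighted_Rintegral_le => //; exact: measurable_funB.
Qed.

Section kernel.
Variables T C : R.
Hypothesis T0 : 0 < T.
Hypothesis C0 : 0 <= C.
Variable G : R -> R -> R.
Hypothesis Greg : regular_kernel T C G.

Definition kernel_conv (t x : R) : R := \int[mu]_y (G t (x - y) * f y).

Lemma kernel_conv_le t x : t <= T -> `|kernel_conv t x| <= M * C.
Proof.
move=> tT; apply: weighted_Rintegral_le; first exact: (measurable_kernel_reflect Greg).
exact: (kernel_abs_mass Greg).
Qed.

Lemma measurable_kernel_conv : measurable_fun [set: R2] (fun z => kernel_conv z.1 z.2).
Proof.
apply: (@measurable_Rintegral_param _ _ _ R2 (measurableTypeR R) mu
  (fun q => G q.1.1 (q.1.2 - q.2) * f q.2)).
apply: measurable_funM; last exact: (measurableT_comp mf measurable_snd).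
have m2 : measurable_fun [set: R2 * measurableTypeR R] (fun q => q.1.2 - q.2 : measurableTypeR R).
  apply: (@measurable_funB _ _ R) => //.
  by exact: (measurableT_comp measurable_snd measurable_fst).
have m1 : measurable_fun [set: R2 * measurableTypeR R] (fun q => q.1.1).
  by exact: (measurableT_comp measurable_fst measurable_fst).
exact: (measurableT_comp (rk_measurable Greg) (measurable_fun_pair m1 m2)).
Qed.

(** Keeping t' above t/2 bounds the singular factors t^(-1/4) by the constant r; the L1 moduli of
    the kernel then act on the bounded f. *)
Lemma kernel_conv_continuous t x e : 0 < t <= T -> 0 < e ->
  exists2 dl, 0 < dl & forall t' x', 0 <= t' <= T -> `|t' - t| <= dl -> `|x' - x| <= dl ->
    `|kernel_conv t' x' - kernel_conv t x| <= e.
Proof.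
move=> /andP[t0 tT] e0; pose r := (t / 2) `^ (- 4^-1).
have r0 : 0 <= r by exact: powR_ge0.
pose K := M * (4 * C * r).
have K0 : 0 <= K by rewrite !mulr_ge0.
pose q := Num.min 1 (e / (K + 1)).
have q0 : 0 < q by rewrite lt_min ltr01 divr_gt0// ltr_wpDl.
have Kq : K * q <= e.
  apply: (@le_trans _ _ (K * (e / (K + 1)))); first by rewrite ler_wpM2l// ge_min lexx orbT.
  rewrite mulrCA ler_piMr ?(ltW e0)// ler_pdivrMr; lra.
have q1 : q <= 1 by rewrite ge_min lexx.
exists (Num.min (t / 2) (q ^+ 4)); first by rewrite lt_min divr_gt0// exprn_gt0.
move=> t' x' /andP[t'0 t'T]; rewrite !le_min => /andP[tt tq] /andP[_ xq].
have xq2 : `|x' - x| <= q ^+ 2 by apply: le_trans xq _; apply: ler_wiXn2l => //; exact: ltW.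
have th s : t / 2 <= s -> s `^ (- 4^-1) <= r.
  move=> ts; have h2 : 0 < t / 2 by rewrite divr_gt0.
  have s0 : 0 < s by exact: lt_le_trans ts.
  rewrite /r !powRN lef_pV2 ?posrE ?powR_gt0//.
  by apply: ge0_ler_powR => //; rewrite nnegrE ltW.
have t2 : t / 2 <= t' by move: tt; rewrite ler_norml => /andP[]; lra.
have t'p : 0 < t' by apply: lt_le_trans t2; rewrite divr_gt0.
have mk s z := measurable_kernel_reflect Greg s z.
have cq : 0 <= 2 * C * q by rewrite !mulr_ge0// ltW.
have d1 : `|kernel_conv t' x' - kernel_conv t' x| <= M * (2 * C * q * r).
  apply: (weighted_Rintegral_dist (mk _ _) (mk _ _) (kernel_abs_mass Greg _ t'T) (kernel_abs_mass Greg _ t'T)).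
  have t'pT : 0 < t' <= T by rewrite t'p.
  apply: le_trans (kernel_space_dist C0 Greg t'pT (ltW q0) xq2) _.
  by rewrite lee_fin; apply: ler_wpM2l => //; exact: th.
have d2 : `|kernel_conv t' x - kernel_conv t x| <= M * (2 * C * q * r).
  have [le_tt|/ltW le_tt] := leP t t'.
    apply: (weighted_Rintegral_dist (mk _ _) (mk _ _) (kernel_abs_mass Greg _ tT) (kernel_abs_mass Greg _ t'T)).
    have tt0 : 0 < t <= t' by rewrite t0.
    have tq' : t' - t <= q ^+ 4 by apply: le_trans (ler_norm _) tq.
    apply: le_trans (kernel_time_dist C0 Greg x tt0 t'T (ltW q0) tq') _.
    by rewrite lee_fin; apply: ler_wpM2l => //; apply: th; lra.
  rewrite distrC.
  apply: (weighted_Rintegral_dist (mk _ _) (mk _ _) (kernel_abs_mass Greg _ t'T) (kernel_abs_mass Greg _ tT)).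
  have tt0 : 0 < t' <= t by rewrite t'p.
  have tq' : t - t' <= q ^+ 4 by apply: le_trans (ler_norm _) _; rewrite distrC.
  apply: le_trans (kernel_time_dist C0 Greg x tt0 tT (ltW q0) tq') _.
  by rewrite lee_fin; apply: ler_wpM2l => //; exact: th.
apply: le_trans Kq.
have -> : kernel_conv t' x' - kernel_conv t x =
  (kernel_conv t' x' - kernel_conv t' x) + (kernel_conv t' x - kernel_conv t x) by rewrite addrA subrK.
apply: le_trans (ler_normD _ _) _.
have -> : K * q = M * (2 * C * q * r) + M * (2 * C * q * r) by rewrite /K; ring.
exact: lerD.
Qed.

End kernel.
End convolution.

Section wave_initial.
Context {R : realType}.
Local Notation mu := (@lebesgue_measure R).
Local Notation R2 := (measurableTypeR R * measurableTypeR R)%type.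
Variables u0 v0 : R -> R.
Variables M N T : R.
Hypothesis T0 : 0 < T.
Hypothesis uu : uniform_modulus u0.
Hypothesis uv : uniform_modulus v0.
Hypothesis M0 : 0 <= M.
Hypothesis u0M : forall x, `|u0 x| <= M.
Hypothesis N0 : 0 <= N.
Hypothesis v0N : forall x, `|v0 x| <= N.
Local Notation conv := (kernel_conv v0 (@wave_kernel R)).

Let C0 : 0 <= 1 + T. Proof. by have := T0; lra. Qed.
Let Greg := wave_kernel_regular T0.
Let mv := measurable_uniform_modulus uv.

(** The integral in d'Alembert's formula is a convolution with the wave kernel; the closed segment
    and the open support of the kernel differ by two points. *)
Lemma wave_convE t x : 0 <= t -> 2^-1 * (\int[mu]_(y in `[x - t, x + t]) v0 y) = conv t x.
Proof.
move=> t0; have mk := measurable_kernel_reflect Greg t x.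
have mI : measurable (`]x - t, x + t[%classic : set (measurableTypeR R)) by exact: measurable_itv.
have ik : mu.-integrable [set: measurableTypeR R] (EFin \o (fun y => wave_kernel t (x - y) * v0 y)).
  apply: (weighted_integrable mv N0 v0N mk (a := t)).
  under eq_integral do rewrite (ger0_norm (wave_kernel_ge0 _ _)).
  rewrite (@integral_reflect_fun _ (wave_kernel t) _ x) ?wave_kernel_mass//.
  - exact: measurable_wave_slice.
  - exact: wave_kernel_ge0.
have kE y : wave_kernel t (x - y) = 2^-1 * \1_(`]x - t, x + t[%classic : set R) y.
  rewrite wave_kernelE !indicE; congr (_ * _%:R); congr (nat_of_bool _).
  by apply/idP/idP => /set_mem h; apply: mem_set; move: h => /=; rewrite !in_itv/= => /andP[]; lra.
have iv : mu.-integrable (`]x - t, x + t[%classic : set (measurableTypeR R)) (EFin \o v0).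
  apply/(integrable_mkcond _ mI).
  have := integrableZl measurableT 2 ik.
  congr (integrable _ _ _); apply/funext => y; rewrite patchE /= kE indicE.
  case: ifP => _; last by rewrite mulr0 mul0r mule0.
  by rewrite -EFinM mulr1 mulrA divff ?mul1r.
have -> : \int[mu]_(y in `[x - t, x + t]) v0 y = \int[mu]_(y in `]x - t, x + t[) v0 y.
  have mv' (A : set (measurableTypeR R)) : measurable_fun A (EFin \o v0).
    by apply: measurable_funTS; exact/measurable_EFinP.
  rewrite /Rintegral; congr fine.
  have e1 := @integral_itv_obnd_cbnd _ (x - t) (BRight (x + t)) (EFin \o v0) (mv' _).
  have e2 := @integral_itv_bndo_bndc _ (BRight (x - t)) (x + t) (EFin \o v0) (mv' _).
  exact: esym (etrans e2 e1).
rewrite -RintegralZl// /Rintegral /kernel_conv.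
rewrite integral_mkcond; congr fine; apply: eq_integral => y _; rewrite patchE kE indicE.
by case: ifP => _; rewrite ?mulr1// mulr0 mul0r.
Qed.

Lemma wave_initialE t x : 0 <= t ->
  wave_initial u0 v0 t x = conv t x + 2^-1 * (u0 (x + t) + u0 (x - t)).
Proof. by move=> t0; rewrite /wave_initial wave_convE. Qed.

Lemma wave_initial_le t x : 0 <= t <= T -> `|wave_initial u0 v0 t x| <= N * (1 + T) + M.
Proof.
move=> /andP[t0 tT]; rewrite wave_initialE//; apply: le_trans (ler_normD _ _) _.
apply: lerD; first exact: (kernel_conv_le mv N0 v0N Greg).
rewrite normrM ger0_norm ?invr_ge0// ler_pdivrMl//.
by apply: le_trans (ler_normD _ _) _; rewrite mulr_natl mulr2n lerD.
Qed.

Lemma measurable_wave_initial :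
  measurable_fun [set: R2] (fun z => \1_(`[0, T]) z.1 * wave_initial u0 v0 z.1 z.2).
Proof.
have mu' := measurable_uniform_modulus uu.
have -> : (fun z : R2 => \1_(`[0, T]) z.1 * wave_initial u0 v0 z.1 z.2) =
  (fun z => \1_(`[0, T]) z.1 * (conv z.1 z.2 + 2^-1 * (u0 (z.2 + z.1) + u0 (z.2 - z.1)))).
  apply/funext => z; rewrite time_indicE; case: ifP => [/andP[z0 _]|_]; last by rewrite !mul0r.
  by rewrite wave_initialE.
apply: measurable_funM; first exact: (measurableT_comp (measurable_time_indic T) measurable_fst).
apply: measurable_funD; first exact: (measurable_kernel_conv mv Greg).
apply: measurable_funM => //; apply: measurable_funD.
- by apply: (measurableT_comp mu'); exact: (@measurable_funD _ R2 R).
- by apply: (measurableT_comp mu'); exact: (@measurable_funB _ R2 R).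
Qed.

(** At t = 0, which [kernel_conv_continuous] excludes, the convolution is at most N times the mass
    t' of the kernel, and so tends to 0. *)
Lemma wave_conv_continuous t x e : 0 <= t <= T -> 0 < e ->
  exists2 dl, 0 < dl & forall t' x', 0 <= t' <= T -> `|t' - t| <= dl -> `|x' - x| <= dl ->
    `|conv t' x' - conv t x| <= e.
Proof.
move=> /andP[t0 tT] e0; have [tp|t0'] := ltP 0 t.
  have tp' : 0 < t <= T by rewrite tp.
  exact: (kernel_conv_continuous mv N0 v0N C0 Greg x tp' e0).
have {t0 t0'} -> : t = 0 by apply/eqP; rewrite eq_le t0 t0'.
have conv_le s z : 0 <= s -> `|conv s z| <= N * s.
  move=> s0; apply: (weighted_Rintegral_le mv N0 v0N (measurable_kernel_reflect Greg s z)).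
  under eq_integral do rewrite (ger0_norm (wave_kernel_ge0 _ _)).
  rewrite (@integral_reflect_fun _ (wave_kernel s) _ z) ?wave_kernel_mass//.
  - exact: measurable_wave_slice.
  - exact: wave_kernel_ge0.
have N1 : 0 < N + 1 by rewrite ltr_wpDl.
exists (e / (N + 1)); first by rewrite divr_gt0.
move=> t' x' /andP[t'0 _]; rewrite subr0 ger0_norm// => te _.
have c0 : conv 0 x = 0 by apply/eqP; rewrite -normr_le0; have := conv_le 0 x; rewrite mulr0; apply.
rewrite c0 subr0; apply: le_trans (conv_le t' x' t'0) _.
apply: le_trans (ler_wpM2l N0 te) _.
by rewrite mulrCA ler_piMr ?(ltW e0)// ler_pdivrMr//; lra.
Qed.

Lemma wave_initial_continuous t x : 0 <= t <= T -> forall e, 0 < e ->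
  exists2 dl, 0 < dl & forall t' x', 0 <= t' <= T -> `|t' - t| <= dl -> `|x' - x| <= dl ->
    `|wave_initial u0 v0 t' x' - wave_initial u0 v0 t x| <= e.
Proof.
move=> tT e e0; have e2 : 0 < e / 2 by rewrite divr_gt0.
have [d1 d10 h1] := wave_conv_continuous x tT e2; have [d2 d20 h2] := uu e2.
exists (Num.min d1 (d2 / 2)); first by rewrite lt_min d10 divr_gt0.
move=> t' x' tT'; rewrite !le_min => /andP[t1 t2] /andP[x1 x2].
have [t0 _] := andP tT; have [t'0 _] := andP tT'.
rewrite !wave_initialE//.
have k := h1 t' x' tT' t1 x1.
have k1 : `|u0 (x' + t') - u0 (x + t)| <= e / 2.
  apply: h2; have -> : x' + t' - (x + t) = (x' - x) + (t' - t) by ring.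
  by apply: le_trans (ler_normD _ _) _; lra.
have k2 : `|u0 (x' - t') - u0 (x - t)| <= e / 2.
  apply: h2; have -> : x' - t' - (x - t) = (x' - x) - (t' - t) by ring.
  by apply: le_trans (ler_normB _ _) _; lra.
move: k k1 k2; rewrite !ler_norml => /andP[a1 a2] /andP[b1 b2] /andP[c1 c2].
by apply/andP; split; lra.
Qed.

End wave_initial.

Section heat_initial.
Context {R : realType}.
Local Notation mu := (@lebesgue_measure R).
Local Notation R2 := (measurableTypeR R * measurableTypeR R)%type.
Variables (u0 : R -> R) (M T : R).
Hypothesis T0 : 0 < T.
Hypothesis uu : uniform_modulus u0.
Hypothesis M0 : 0 <= M.
Hypothesis u0M : forall x, `|u0 x| <= M.
Local Notation conv := (kernel_conv u0 (@heat_kernel R)).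

Let Greg := heat_kernel_regular T0.
Let mu0 := measurable_uniform_modulus uu.

Lemma heat_initialE t x : heat_initial u0 t x = if 0 < t then conv t x else u0 x.
Proof. by []. Qed.

Lemma heat_initial_le t x : 0 <= t <= T -> `|heat_initial u0 t x| <= M * 2.
Proof.
move=> /andP[t0 tT]; rewrite heat_initialE; case: ifP => _.
  exact: (kernel_conv_le mu0 M0 u0M Greg).
by apply: le_trans (u0M x) _; rewrite ler_peMr// ler1n.
Qed.

Lemma measurable_heat_initial :
  measurable_fun [set: R2] (fun z => \1_(`[0, T]) z.1 * heat_initial u0 z.1 z.2).
Proof.
apply: measurable_funM; first exact: (measurableT_comp (measurable_time_indic T) measurable_fst).
apply: measurable_fun_ifT.
- by apply: measurable_fun_ltr => //; exact: measurable_fst.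
- exact: (measurable_kernel_conv mu0 Greg).
- exact: (measurableT_comp mu0 measurable_snd).
Qed.

(** The heat kernel is an approximate identity: uniform continuity handles |y - x| <= d, and beyond
    d the second moment, of order t, controls the mass. *)
Lemma heat_initial_near0 x e : 0 < e ->
  exists2 dl, 0 < dl & forall t' x', 0 < t' -> t' <= dl -> `|x' - x| <= dl ->
    `|conv t' x' - u0 x| <= e.
Proof.
move=> e0; have e2 : 0 < e / 2 by rewrite divr_gt0.
have [d d0 hd] := uu e2.
(* Chosen so that K (d/2)^2 = 2M, the trivial bound on the oscillation of u0. *)
pose K := 8 * M / d ^+ 2; have K0 : 0 <= K by rewrite divr_ge0 ?mulr_ge0 ?exprn_ge0 ?(ltW d0).
have K1 : 0 < 16 * K + 1 by rewrite ltr_wpDl// mulr_ge0.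
(* With |x' - x| <= d/2, any y at distance more than d from x is at distance at least d/2 from x'.
   The second bound makes the tail term 8Kt at most e/2. *)
exists (Num.min (d / 2) (e / (16 * K + 1))); first by rewrite lt_min !divr_gt0.
move=> t x'; rewrite !le_min => t0 /andP[_ te] /andP[xd _].
have mk : measurable_fun [set: measurableTypeR R] (fun y => heat_kernel t (x' - y)).
  exact: (measurable_kernel_reflect Greg).
have mass : (\int[mu]_y (heat_kernel t (x' - y))%:E = 1%:E)%E.
  rewrite (@integral_reflect_fun _ (heat_kernel t) _ x') ?heat_kernel_mass//.
  - exact: measurable_heat_slice.
  - exact: heat_kernel_ge0.
have amass : (\int[mu]_y `|heat_kernel t (x' - y)|%:E <= 1%:E)%E.
  by under eq_integral do rewrite (ger0_norm (heat_kernel_ge0 _ _)); rewrite mass.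
have iu := weighted_integrable mu0 M0 u0M mk amass.
have ic := @weighted_integrable _ (fun=> u0 x) M (measurable_cst _) M0 (fun=> u0M x) _ _ mk amass.
(* Unit mass turns the constant into an average, so that the difference becomes a single
   integral. *)
have -> : u0 x = \int[mu]_y (heat_kernel t (x' - y) * u0 x).
  rewrite RintegralZr//; first by rewrite /Rintegral mass /= mul1r.
  apply/integrableP; split; first exact/measurable_EFinP.
  by apply: le_lt_trans amass _; rewrite ltry.
rewrite /kernel_conv -RintegralB//.
have mD : measurable_fun [set: measurableTypeR R]
    (fun y => heat_kernel t (x' - y) * u0 y - heat_kernel t (x' - y) * u0 x).
  by apply: measurable_funB; exact: measurable_funM.
rewrite -lee_fin; apply: le_trans (le_abs_Rintegral mu measurableT mD) _.
have m2 : measurable_fun [set: measurableTypeR R] (fun y => (x' - y) ^+ 2 * heat_kernel t (x' - y)).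
  by apply: measurable_funM => //; apply: measurable_funX; exact: measurable_funB.
apply: (@le_trans _ _ (\int[mu]_y (e / 2 * heat_kernel t (x' - y) +
    K * ((x' - y) ^+ 2 * heat_kernel t (x' - y)))%:E)%E).
  apply: integral_mono => // [||y].
  - exact: (measurableT_comp (@normr_measurable _ _) mD).
  - by apply: measurable_funD; exact: measurable_funM.
  - have k0 := @heat_kernel_ge0 R t (x' - y).
    rewrite -mulrBr normrM (ger0_norm k0) mulrA -mulrDl mulrC ler_wpM2r//.
    have [yd|yd] := leP `|y - x| d.
      apply: le_trans (hd _ _ yd) _; rewrite lerDl mulr_ge0 ?sqr_ge0//.
    apply: (@le_trans _ _ (2 * M)).
      by apply: le_trans (ler_normB _ _) _; rewrite mulr_natl mulr2n lerD.
    have dy : (d / 2) ^+ 2 <= (x' - y) ^+ 2.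
      rewrite -(real_normK (num_real (x' - y))) lerXn2r ?nnegrE ?divr_ge0 ?(ltW d0)//.
      have := ler_normB (x' - x) (x' - y); have -> : x' - x - (x' - y) = y - x by ring.
      by lra.
    have := ler_wpM2l K0 dy.
    have -> : K * (d / 2) ^+ 2 = 2 * M by rewrite /K; field; rewrite gt_eqF.
    by lra.
have e20 := ltW e2.
have k2 y : 0 <= (x' - y) ^+ 2 * heat_kernel t (x' - y).
  by rewrite mulr_ge0 ?sqr_ge0 ?heat_kernel_ge0.
rewrite (@integral_add _ _ _ mu (fun y => e / 2 * heat_kernel t (x' - y))
  (fun y => K * ((x' - y) ^+ 2 * heat_kernel t (x' - y)))); first last.
- by move=> y; exact: mulr_ge0.
- by move=> y; rewrite mulr_ge0 ?heat_kernel_ge0.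
- exact: measurable_funM.
- exact: measurable_funM.
rewrite (integral_scale mu mk (fun y => heat_kernel_ge0 _ _) e20) (integral_scale mu m2 k2 K0) mass.
rewrite (@integral_reflect_fun _ (fun u => u ^+ 2 * heat_kernel t u) _ x')//; first last.
- by move=> u; rewrite mulr_ge0 ?sqr_ge0 ?heat_kernel_ge0.
- by apply: measurable_funM; [exact: measurable_funX|exact: measurable_heat_slice].
apply: (@le_trans _ _ ((e / 2)%:E * 1%:E + K%:E * (8 * t)%:E)%E).
  by rewrite leeD// lee_wpmul2l ?lee_fin// heat_kernel_second_moment.
rewrite -!EFinM -EFinD lee_fin mulr1.
have : (16 * K + 1) * t <= e by rewrite mulrC -ler_pdivlMr.
have -> : K * (8 * t) = 8 * (K * t) by ring.
by rewrite mulrDl mul1r -mulrA; move: (K * t) => Kt h; lra.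
Qed.

Lemma heat_initial_continuous t x : 0 <= t <= T -> forall e, 0 < e ->
  exists2 dl, 0 < dl & forall t' x', 0 <= t' <= T -> `|t' - t| <= dl -> `|x' - x| <= dl ->
    `|heat_initial u0 t' x' - heat_initial u0 t x| <= e.
Proof.
move=> /andP[t0 tT] e e0; have [tp|t0'] := ltP 0 t.
  have tp' : 0 < t <= T by rewrite tp.
  have [dl dl0 h] := kernel_conv_continuous mu0 M0 u0M (ler0n R 2) Greg x tp' e0.
  exists (Num.min dl (t / 2)); first by rewrite lt_min dl0 divr_gt0.
  move=> t' x' tT'; rewrite !le_min => /andP[t1 t2] /andP[x1 _].
  rewrite !heat_initialE tp ifT; first exact: h.
  by move: t2; rewrite ler_norml => /andP[]; lra.
have {t0 t0'} -> : t = 0 by apply/eqP; rewrite eq_le t0 t0'.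
have [d1 d10 h1] := heat_initial_near0 x e0; have [d2 d20 h2] := uu e0.
exists (Num.min d1 d2); first by rewrite lt_min d10.
move=> t' x' /andP[t'0 _]; rewrite subr0 ger0_norm// !le_min => /andP[t1 _] /andP[x1 x2].
rewrite !heat_initialE ltxx; case: (ltP 0 t') => [t'p|_]; last exact: h2.
exact: h1.
Qed.

End heat_initial.

Theorem theorem3p1 (R : realType) (d : measure_display)
    (Omega : measurableType d) (P : probability Omega R)
    (P_complete : measure_is_complete P)
    (T H p : R) (T_gt0 : 0 < T) (H_in01 : 0 < H < 1) (p_ge2 : 2 <= p)
    (W : test_functions R -> {RV P >-> R}) (W_noise : fractional_noise H W)
    (b : R -> R) (b_lipschitz : lipschitz b) :
  (forall u0 v0 : R -> R,
     hoelder_continuous H u0 -> bounded_fun u0 -> hoelder_continuous H v0 -> bounded_fun v0 ->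
     has_unique_solution H W T p b (@wave_kernel R) (wave_initial u0 v0)) /\
  (forall u0 : R -> R,
     hoelder_continuous H u0 -> bounded_fun u0 ->
     has_unique_solution H W T p b (@heat_kernel R) (heat_initial u0)).
Proof.
have [H0 H1] := andP H_in01; have [L L0 bL] := lipschitz_const b_lipschitz.
split=> [u0 v0 hu /bounded_const[M M0 uM] hv /bounded_const[N N0 vN]
        |u0 hu /bounded_const[M M0 uM]].
- have uu := hoelder_modulus H0 hu; have uv := hoelder_modulus H0 hv.
  have C0 : 0 <= 1 + T by rewrite addr_ge0// ltW.
  have Greg := wave_kernel_regular T_gt0.
  have [V pV hV] := noise_field H0 H1 T_gt0 C0 Greg W_noise.
  split; last first.
    by move=> u v su sv; exact: (solution_unique H0 H1 T_gt0 p_ge2 C0 Greg W_noise L0 bL su sv).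
  have K0 : 0 <= N * (1 + T) + M by rewrite addr_ge0// mulr_ge0.
  exact: (mild_solution_exists P_complete H0 H1 T_gt0 p_ge2 C0 Greg W_noise L0 bL
    (measurable_wave_initial T_gt0 uu uv N0 vN) K0
    (wave_initial_le T_gt0 uv uM N0 vN) (wave_initial_continuous T_gt0 uu uv N0 vN) pV hV).
- have uu := hoelder_modulus H0 hu; have C0 : 0 <= 2 :> R by [].
  have Greg := heat_kernel_regular T_gt0.
  have [V pV hV] := noise_field H0 H1 T_gt0 C0 Greg W_noise.
  split; last first.
    by move=> u v su sv; exact: (solution_unique H0 H1 T_gt0 p_ge2 C0 Greg W_noise L0 bL su sv).
  have K0 : 0 <= M * 2 by rewrite mulr_ge0.
  exact: (mild_solution_exists P_complete H0 H1 T_gt0 p_ge2 C0 Greg W_noise L0 bL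
    (measurable_heat_initial T_gt0 uu) K0
    (heat_initial_le T_gt0 uu M0 uM) (heat_initial_continuous T_gt0 uu M0 uM) pV hV).
Qed.
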